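(* Let $p\in[-d,2]$. Let $Z$ be an invariant $\mathbb R^d$-valued Gaussian random field on $\mathbb R^d$, let $\Phi$ be an invariant locally square-integrable random measure on $\mathbb R^d$, assume that $Z$ and $\Phi$ are independent, and let $\Psi(B):=\int\mathbf 1\{x+Z(x)\in B\}\,\Phi(dx)$ for Borel $B\subseteq\mathbb R^d$. Assume that $$\int\frac{\big\|\mathrm{Cov}[Z(y),Z(0)]\big\|}{1+\|y\|^{2-p}}\,\alpha_\Phi(dy)<\infty,$$ where $\mathrm{Cov}[Z(y),Z(0)]$ is the full $d\times d$ covariance matrix. Then $\Psi$ is $p$-uniform if $\Phi$ is $p$-uniform; and if $p<2$, then $\Psi$ is beyond $p$-uniform if $\Phi$ is beyond $p$-uniform.
   Context: $d\in\mathbb N$, $B_r=\{x\in\mathbb R^d:\|x\|<r\}$. $(\Omega,\mathcal A,\mathbb P)$ is a probability space with a measurable flow $\{\theta_x:x\in\mathbb R^d\}$ ($\theta_0=\mathrm{id}$, $\theta_{x+y}=\theta_x\theta_y$, $(\omega,x)\mapsto\theta_x\omega$ measurable) preserving $\mathbb P$. A random measure $\Phi$ is a random element of the space of locally finite (nonnegative) measures on $\mathbb R^d$, invariant if $\Phi(\theta_x\omega,B)=\Phi(\omega,B+x)$, and locally square-integrable if $\mathbb E[\Phi(B_1)^2]<\infty$. A random field $Z$ is invariant if $Z(\theta_z\omega,x)=Z(\omega,x+z)$; it is Gaussian if all finite collections $(Z(x_1),\dots,Z(x_n))$ are jointly Gaussian, and it is required to be a random element of the Skorokhod space (for Gaussian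 fields: continuous paths). With $\hat f(k)=\int e^{-i\langle k,x\rangle}f(x)\,dx$ and $\Phi(f)=\int f\,d\Phi$, the Bartlett spectral measure $\hat\beta_\Phi$ is the unique locally finite measure on $\mathbb R^d$ with $\mathrm{Cov}[\Phi(f),\Phi(g)]=(2\pi)^{-d}\int\hat f\,\overline{\hat g}\,d\hat\beta_\Phi$ for all bounded measurable compactly supported $f,g$. For $p\in[-d,\infty)$, $\Phi$ is $p$-uniform if $\varepsilon^{-d}\hat\beta_\Phi(B_\varepsilon)=O(\varepsilon^p)$ as $\varepsilon\to0$, and beyond $p$-uniform if this holds with $o(\varepsilon^p)$. The reduced second moment measure is $\alpha_\Phi(B)=\mathbb E\big[\iint\mathbf 1\{x\in[0,1)^d,\,x-y\in B\}\,\Phi(dx)\Phi(dy)\big]$. *)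

(* Defs.v *)
From HB Require Import structures.
From mathcomp Require Import all_boot all_order all_algebra.
From mathcomp Require Import all_classical all_reals all_analysis.
From mathcomp Require Import measurable_realfun.
From mathcomp Require Import complex.

Set Implicit Arguments.
Unset Strict Implicit.
Unset Printing Implicit Defensive.

Import Order.TTheory GRing.Theory Num.Theory.
Import numFieldNormedType.Exports.

Local Open Scope classical_set_scope.
Local Open Scope ring_scope.

(* R^d is 'rV[R]_d with its Borel sigma-algebra. *)
HB.instance Definition _ (R : realType) (d : nat) :=
  @isMeasurable.Build default_measure_display 'rV[R]_d
    <<s @open 'rV[R]_d >> (@sigma_algebra0 _ setT _)
    (@sigma_algebraC _ _) (@sigma_algebra_bigcup _ setT _).

Section Euclidean.
Context {R : realType}.

Definition dotv {d : nat} (x y : 'rV[R]_d) : R := \sum_i x 0 i * y 0 i.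

(* The library norm on matrices is the sup norm; the Euclidean norm defines
   the balls. *)
Definition enorm {d : nat} (x : 'rV[R]_d) : R := Num.sqrt (dotv x x).

Definition frobenius_norm {m n : nat} (A : 'M[R]_(m, n)) : R :=
  Num.sqrt (\sum_i \sum_j A i j ^+ 2).

Definition eball {d : nat} (r : R) : set 'rV[R]_d := [set x | enorm x < r].

Definition unit_cube {d : nat} : set 'rV[R]_d :=
  [set x | forall i, 0 <= x 0 i < 1].

Definition translate {d : nat} (B : set 'rV[R]_d) (x : 'rV[R]_d) :
  set 'rV[R]_d := [set b + x | b in B].

Definition locally_finite {d : nat} (mu : set 'rV[R]_d -> \bar R) : Prop :=
  forall r : R, (mu (@eball d r) < +oo)%E.

(* Iterated product measure: by recursion on the dimension, with the formula
   (lambda_1 \x lambda_n) A = \int[lambda_1]_t lambda_n (xsection A t).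
   It is a plain set function, which is all that the integral requires. *)
Fixpoint lebesgue_rV (d : nat) : set 'rV[R]_d -> \bar R :=
  match d return set 'rV[R]_d -> \bar R with
  | 0 => \d_(0 : 'rV[R]_0)
  | n.+1 => fun A => (\int[@lebesgue_measure R]_t
      lebesgue_rV [set y : 'rV[R]_n | A (row_mx t%:M y)])%E
  end.

End Euclidean.

Section Fourier.
Context {R : realType}.
Local Open Scope complex_scope.

Definition cintegrable {d : measure_display} {T : measurableType d}
    (mu : set T -> \bar R) (f : T -> R[i]) : Prop :=
  mu.-integrable setT (EFin \o (fun x => complex.Re (f x))) /\
  mu.-integrable setT (EFin \o (fun x => complex.Im (f x))).

Definition cintegral {d : measure_display} {T : measurableType d}
    (mu : set T -> \bar R) (f : T -> R[i]) : R[i] :=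
  fine (\int[mu]_x (complex.Re (f x))%:E)%E +i*
  fine (\int[mu]_x (complex.Im (f x))%:E)%E.

Definition expi (t : R) : R[i] := cos t +i* sin t.

Definition fourier {d : nat} (f : 'rV[R]_d -> R) (k : 'rV[R]_d) : R[i] :=
  cintegral (@lebesgue_rV R d) (fun x => expi (- dotv k x) * (f x)%:C).

Definition test_function {d : nat} (f : 'rV[R]_d -> R) : Prop :=
  [/\ measurable_fun setT f,
      exists M : R, forall x, `|f x| <= M &
      exists2 K : set 'rV[R]_d, compact K & forall x, ~ K x -> f x = 0].

End Fourier.

Section RandomElements.
Context {R : realType} {d : nat} {dO : measure_display}
  {Omega : measurableType dO} (P : probability Omega R).
Implicit Types (theta : 'rV[R]_d -> Omega -> Omega)
  (Phi : Omega -> {measure set 'rV[R]_d -> \bar R})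
  (Z : Omega -> 'rV[R]_d -> 'rV[R]_d).

Record preserving_flow theta : Prop := PreservingFlow {
  flow0 : forall w, theta 0 w = w ;
  flowD : forall x y w, theta (x + y) w = theta x (theta y w) ;
  measurable_flow :
    measurable_fun setT (fun z : Omega * 'rV[R]_d => theta z.2 z.1) ;
  flow_preserves : forall x A, measurable A -> P (theta x @^-1` A) = P A }.

Definition invariant_measure theta Phi : Prop :=
  forall x w B, measurable B -> Phi (theta x w) B = Phi w (translate B x).

Definition locally_square_integrable Phi : Prop :=
  (\int[P]_w (Phi w (eball 1) ^+ 2) < +oo)%E.

Definition invariant_field theta Z : Prop :=
  forall z w x, Z (theta z w) x = Z w (x + z).

(* Point masses are Gaussian; normal_prob m 0 is not a point mass. *)
Definition gaussian_rv (X : Omega -> R) : Prop :=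
  measurable_fun setT X /\
  exists m s : R, forall A : set R, measurable A ->
    P (X @^-1` A) = if s == 0 then \d_m A else normal_prob m s A.

Definition jointly_gaussian (n : nat) (X : 'I_n -> Omega -> 'rV[R]_d) : Prop :=
  forall a : 'I_n -> 'rV[R]_d,
    gaussian_rv (fun w => \sum_(j < n) dotv (a j) (X j w)).

Record gaussian_field Z : Prop := GaussianField {
  field_continuous : forall w, continuous (Z w) ;
  field_measurable : forall x, measurable_fun setT (Z ^~ x) ;
  field_gaussian : forall (n : nat) (x : 'I_n -> 'rV[R]_d),
    jointly_gaussian (fun j => Z ^~ (x j)) }.

Definition covariance_mx (X Y : Omega -> 'rV[R]_d) : 'M[R]_d :=
  \matrix_(i, j) fine (covariance P (fun w => X w 0 i) (fun w => Y w 0 j)).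

(* The evaluation maps generate the sigma-algebras of both path space and
   the space of locally finite measures. *)
Definition field_events Z : set (set Omega) :=
  [set A | exists x B, measurable B /\ A = Z ^~ x @^-1` B].

Definition measure_events Phi : set (set Omega) :=
  [set A | exists B (C : set (\bar R)),
    [/\ measurable B, measurable C & A = (fun w => Phi w B) @^-1` C]].

Definition field_measure_independent Z Phi : Prop :=
  forall A B, <<s field_events Z >> A -> <<s measure_events Phi >> B ->
    P (A `&` B) = (P A * P B)%E.

(* A plain set function, like lebesgue_rV. *)
Definition reduced_second_moment Phi (B : set 'rV[R]_d) : \bar R :=
  (\int[P]_w \int[Phi w]_y \int[Phi w]_x
     (\1_(unit_cube) x * \1_B (x - y))%:E)%E.

(* The identity for real-valued f and g is equivalent to the one for complex
   test functions, by sesquilinearity.  The two integrability fields keep both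
   sides of it meaningful. *)
Record bartlett_spectral_measure Phi
    (beta : {measure set 'rV[R]_d -> \bar R}) : Prop := Bartlett {
  bartlett_square_integrable : locally_square_integrable Phi ;
  bartlett_locally_finite : locally_finite beta ;
  bartlett_integrable : forall f g, test_function f -> test_function g ->
    cintegrable beta (fun k => fourier f k * (fourier g k)^*%C) ;
  bartlett_covariance : forall f g, test_function f -> test_function g ->
    (fine (covariance P (fun w => \int[Phi w]_x f x)
                        (fun w => \int[Phi w]_x g x)))%:C%C =
    ((2 * pi) ^- d)%:C%C *
      cintegral beta (fun k => fourier f k * (fourier g k)^*%C) }.

Definition p_uniform (p : R) Phi : Prop :=
  exists2 beta, bartlett_spectral_measure Phi beta &
    ((fun e : R => e ^- d * fine (beta (eball e))) : R -> R^o)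
      =O_ (0^'+) ((fun e : R => e `^ p) : R -> R^o).

Definition beyond_p_uniform (p : R) Phi : Prop :=
  exists2 beta, bartlett_spectral_measure Phi beta &
    ((fun e : R => e ^- d * fine (beta (eball e))) : R -> R^o)
      =o_ (0^'+) ((fun e : R => e `^ p) : R -> R^o).

End RandomElements.

(* Main.v *)
Require Import Defs.
From HB Require Import structures.
From mathcomp Require Import all_boot all_order all_algebra.
From mathcomp Require Import all_classical all_reals all_analysis.
From mathcomp Require Import measurable_realfun.
From mathcomp Require Import complex ring lra.

Set Implicit Arguments.
Unset Strict Implicit.
Unset Printing Implicit Defensive.

Import Order.TTheory GRing.Theory Num.Theory.
Import numFieldNormedType.Exports.

Local Open Scope classical_set_scope.
Local Open Scope ring_scope.

(** Write [lam] for the intensity of [Phi] and call [pairing f] the number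
    [\int f d alpha_Phi - lam^2 \int f].  The reduced second moment measure of
    [Psi] is that of [Phi] with [u] displaced by [Z(u) - Z(0)], and a Bartlett
    spectral measure of [Psi] is a vague limit of the densities obtained by Fourier
    transforming the Gaussian-damped second moment measure.  Up to constants,
    [beta_Psi(B_e)] is bounded by the integral of a Gaussian of width [e] against
    [beta_Psi], that is, by [s^(d/2)] times the displaced pairing of the Gaussian
    [exp(- s |u|^2 / 2)], with [s = e^2].  If [Z(u) - Z(0)] is replaced by a
    difference of independent copies, averaging only multiplies the spectral density
    of the Gaussian by a squared characteristic function, so the pairing does not
    increase; interpolating between the two Gaussian laws shows that the replacement
    costs at most a constant times [s |Cov[Z(u),Z(0)]| exp(- 2 sqrt s |u|_1)], and
    [e^2 exp(- 2 e |u|_1)] is at most a constant times [e^p / (1 + |u|^(2-p))].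
    Finally the Gaussian mass of [beta_Phi] is summed over the layers
    [n e <= |k| < (n+1) e], which turns the hypothesis on small balls into a bound
    of the same order. *)

Local Notation mcomp := measurableT_comp.
Local Notation mfunT := (measurable_fun setT).
Local Notation "mu .-intR f" := (integrable mu setT (EFin \o f))
  (at level 10, left associativity, f at next level).

(** Both uniformity notions ask for some Bartlett measure, so the two sides are asymmetric. The
    measure of [Psi] is constructed, and its Gaussian integrals are known by construction. The
    measure of [Phi] is an arbitrary given one, known only through its isometry on compactly
    supported functions; Gaussians are reached from there by truncation and Fatou, at the price of a
    factor 2. Integrals against second moment measures are controlled by a single number, the
    integral of [rho 1], an exponential of the l1 norm. It is finite for [Phi] by square
    integrability, and for [Psi] because a Gaussian field has exponential moments. By stationarity
    the difference of independent copies has a law that does not depend on [u], so comparing with it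
    means shifting the Gaussian by a fixed vector and averaging. [Phi] and [Psi] have the same
    intensity, hence the terms in [lam^2] cancel. The power in the hypothesis comes from
    [e^2 = e^p e^(2-p)]. For [p < 2] the second factor tends to 0, and dominated convergence turns a
    bound of order [e^p] into [o(e^p)]. *)

Lemma le_of_eq disp (T : porderType disp) (x y : T) : x = y -> (x <= y)%O.
Proof. by move=> ->. Qed.

(** * Integrals against plain set functions *)

Section eq_setfun_integral.
Import HBNNSimple.

(** The integral is a supremum of sums over nonnegative simple functions, which evaluate the set
    function on measurable sets only. This is the bridge from the plain set functions [lebesgue_rV]
    and [reduced_second_moment] to bundled measures. *)
Lemma eq_setfun_integral {dT} {T : measurableType dT} {R : realType}
    (mu nu : set T -> \bar R) (f : T -> \bar R) :
  (forall A, measurable A -> mu A = nu A) ->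
  (\int[mu]_x f x = \int[nu]_x f x)%E.
Proof.
move=> mn.
have H (g : {nnsfun T >-> R}) : sintegral mu g = sintegral nu g.
  rewrite /sintegral; apply: eq_fsbigr => x _; congr (_ * _)%E.
  by rewrite mn//.
rewrite /integral; congr (_ - _)%E; congr ereal_sup;
  by apply/seteqP; split => _ [g gf <-]; exists g => //; rewrite H.
Qed.

End eq_setfun_integral.

(** * Borel measurability in R^d *)

Section rV_measurable.
Context {R : realType} {d : nat}.
Local Notation V := 'rV[R]_d.

Lemma open_rV_measurable (U : set V) : open U -> measurable U.
Proof. exact: sub_sigma_algebra. Qed.

Lemma measurable_coord (i : 'I_d) : mfunT (fun x : V => x 0 i).
Proof.
apply: (measurability _ (RGenOpens.measurableE R)).
move=> _ [_ [a [b ->] <-]]; rewrite setTI.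
apply: open_rV_measurable; apply: open_comp; last exact: interval_open.
by move=> x _; apply: coord_continuous.
Qed.

(** Preimages of rational cubes are finite intersections of coordinate conditions. Covering an open
    set by countably many of them is what reduces Borel measurability of a map to that of its
    coordinates. *)
Lemma measurable_rV_cover (U : set V) : open U ->
  U = \bigcup_(p in [set p : 'rV[rat]_d * nat |
        (fun y : V => forall i, `|y 0 i - ratr (p.1 0 i)| < p.2.+1%:R^-1) `<=` U])
      [set y : V | forall i, `|y 0 i - ratr (p.1 0 i)| < p.2.+1%:R^-1].
Proof.
move=> oU; apply/seteqP; split => [x Ux|x [p]/=]; last by move=> pU /pU.
have [e /= e0 eU] : nbhs_ball x U by apply/nbhs_ballP; rewrite nbhsE; exists U.
(* The cube has diameter at most [2 / (n+1)], which this [n] keeps below [e]; as it contains [x], it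
   stays in the ball. *)
pose n := Num.truncn (2 * e^-1).
have ne : n.+1%:R^-1 * 2 < e.
  have : 2 * e^-1 < n.+1%:R by rewrite truncnS_gt.
  by rewrite ltr_pdivrMr// [_^-1 * _]mulrC ltr_pdivrMr// mulrC.
have q_ i : exists q : rat, `|x 0 i - ratr q| < n.+1%:R^-1.
  have [q] := @rat_in_itvoo R (x 0 i) (x 0 i + n.+1%:R^-1) ltac:(by rewrite ltrDl invr_gt0).
  rewrite in_itv/= => /andP[q1 q2].
  by exists q; rewrite distrC gtr0_norm ?subr_gt0// ltrBlDl.
pose q := \row_i projT1 (cid (q_ i)).
have qE i : `|x 0 i - ratr (q 0 i)| < n.+1%:R^-1.
  by rewrite mxE; case: cid.
exists (q, n) => //= y qy; apply: eU; rewrite /ball/=; split => // i j.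
rewrite ord1 /ball/=.
rewrite (_ : x 0 j - y 0 j = (x 0 j - ratr (q 0 j)) - (y 0 j - ratr (q 0 j))); last by ring.
apply: (le_lt_trans (ler_normB _ _)); apply: lt_trans ne; rewrite mulr_natr mulr2n.
exact: ltrD.
Qed.

Lemma measurable_fun_rV {dT} {T : measurableType dT} (f : T -> V) :
  (forall i, mfunT (fun t => f t 0 i)) -> mfunT f.
Proof.
move=> mf; apply: (measurability (@open V)) => // _ [U oU <-]; rewrite setTI.
rewrite (measurable_rV_cover oU) preimage_bigcup.
rewrite bigcup_mkcond; apply: countable_bigcupT_measurable => // -[q n].
case: ifP => // _.
rewrite (_ : _ @^-1` _ = \bigcap_(i in [set: 'I_d])
   ((fun t => `|f t 0 i - ratr (q 0 i)|) @^-1` `]-oo, n.+1%:R^-1[)); last first.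
  apply/seteqP; split => [t /= h i _|t /= h i]; first by rewrite /= in_itv/=; exact: h.
  by have := h i I; rewrite /= in_itv.
apply: fin_bigcap_measurable => // i _.
rewrite -[X in measurable X]setTI.
apply: (mcomp (f := (fun x : R => `|x|))) => //.
by apply: measurable_funB.
Qed.

Lemma measurable_rVP {dT} {T : measurableType dT} (f : T -> V) :
  mfunT f -> forall i, mfunT (fun t => f t 0 i).
Proof. by move=> mf i; apply: (mcomp (measurable_coord i)). Qed.

Lemma measurable_rVD {dT} {T : measurableType dT} (f g : T -> V) :
  mfunT f -> mfunT g ->
  mfunT (fun t => f t + g t).
Proof.
move=> mf mg; apply: measurable_fun_rV => i.
under [X in measurable_fun _ X]eq_fun do rewrite mxE.
by apply: measurable_funD; exact: measurable_rVP.
Qed.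

Lemma measurable_rVZ {dT} {T : measurableType dT} (c : T -> R) (f : T -> V) :
  mfunT c -> mfunT f ->
  mfunT (fun t => c t *: f t).
Proof.
move=> mc mf; apply: measurable_fun_rV => i.
under [X in measurable_fun _ X]eq_fun do rewrite mxE.
by apply: measurable_funM => //; exact: measurable_rVP.
Qed.

Lemma measurable_rVN {dT} {T : measurableType dT} (f : T -> V) :
  mfunT f -> mfunT (fun t => - f t).
Proof.
move=> mf; under [X in measurable_fun _ X]eq_fun do rewrite -scaleN1r.
exact: measurable_rVZ.
Qed.

Lemma measurable_rVB {dT} {T : measurableType dT} (f g : T -> V) :
  mfunT f -> mfunT g ->
  mfunT (fun t => f t - g t).
Proof. by move=> mf mg; apply: measurable_rVD => //; exact: measurable_rVN. Qed.

Lemma measurable_dotv {dT} {T : measurableType dT} (f g : T -> V) :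
  mfunT f -> mfunT g ->
  mfunT (fun t => dotv (f t) (g t)).
Proof.
move=> mf mg; apply: measurable_sum => i; apply: measurable_funM;
  exact: measurable_rVP.
Qed.

End rV_measurable.

(** * Images, sigma-finiteness and products of measures *)

Section measure_packing.
Context {dT} {T : measurableType dT} {R : realType}.

(** The proof of sigma-finiteness is an argument of the term, so that the structure required by the
    Fubini theorems can be attached to a measure for which it has been proved. [pushm] does the same
    with the measurability of a map. *)
Definition sfm_of (m : {measure set T -> \bar R}) (H : sigma_finite setT m)
  : set T -> \bar R := m.
HB.instance Definition _ m H := Measure.on (@sfm_of m H).
HB.instance Definition _ m H := @Measure_isSigmaFinite.Build _ _ _ (@sfm_of m H) H.

Context {dU} {U : measurableType dU}.

Definition pushm (m : {measure set T -> \bar R}) (f : T -> U)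
  (mf : mfunT f) : set U -> \bar R := pushforward m f.
HB.instance Definition _ m f mf := Measure.copy (@pushm m f mf)
  (measure_function_pushforward__canonical__measure_function_Measure m mf).

Lemma ge0_integral_pushm (m : {measure set T -> \bar R}) (f : T -> U)
    (mf : mfunT f) (g : U -> \bar R) :
  mfunT g -> (forall y, 0 <= g y)%E ->
  (\int[pushm m mf]_y g y = \int[m]_x g (f x))%E.
Proof.
by move=> mg g0; rewrite /pushm ge0_integral_pushforward// preimage_setT.
Qed.

End measure_packing.

Section product_sigma_finite.
Context {d1 d2} {T1 : measurableType d1} {T2 : measurableType d2} {R : realType}.
Variables (m1 : {sigma_finite_measure set T1 -> \bar R})
  (m2 : {sigma_finite_measure set T2 -> \bar R}).

Lemma sigma_finite_product :
  sigma_finite setT ((m1 \x m2)%E : {measure set (T1 * T2)%type -> \bar R}).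
Proof.
have /sigma_finiteP[F [FT ndF Fo]] := sigma_finiteT m1.
have /sigma_finiteP[G [GT ndG Go]] := sigma_finiteT m2.
exists (fun n => F n `*` G n) => [|n].
  apply/seteqP; split => // -[x y] _.
  have [i _ Fx] : (\bigcup_i F i) x by rewrite -FT.
  have [j _ Gy] : (\bigcup_i G i) y by rewrite -GT.
  exists (maxn i j) => //; split => /=.
    by move: Fx; apply/subsetPset/ndF/leq_maxl.
  by move: Gy; apply/subsetPset/ndG/leq_maxr.
have [[mF Fn] [mG Gn]] := (Fo n, Go n).
split; first exact: measurableX.
by rewrite /= product_measure1E// lte_mul_pinfty// ge0_fin_numE.
Qed.

Definition prodm : {sigma_finite_measure set (T1 * T2)%type -> \bar R} :=
  sfm_of sigma_finite_product.

End product_sigma_finite.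

(** * Lebesgue measure on R^d *)

Section lebesgue.
Context {R : realType}.

Definition leb1 : {sigma_finite_measure set (measurableTypeR R) -> \bar R} :=
  lebesgue_measure.

Definition cons_rV {n} (t : R) (y : 'rV[R]_n) : 'rV[R]_n.+1 := row_mx t%:M y.
Definition tail_rV {n} (x : 'rV[R]_n.+1) : 'rV[R]_n := \row_i x 0 (lift ord0 i).

Lemma cons_rV0 n t (y : 'rV[R]_n) : cons_rV t y 0 ord0 = t.
Proof.
rewrite /cons_rV (_ : ord0 = lshift n (ord0 : 'I_1)); last exact/val_inj.
by apply: etrans (row_mxEl _ _ _ _) _; rewrite mxE eqxx mulr1n.
Qed.

Lemma cons_rVS n t (y : 'rV[R]_n) i : cons_rV t y 0 (lift ord0 i) = y 0 i.
Proof.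
rewrite /cons_rV (_ : lift ord0 i = rshift 1 i); last exact/val_inj.
exact: (row_mxEr _ _ _ _).
Qed.

Lemma cons_tail_rV n (x : 'rV[R]_n.+1) : cons_rV (x 0 ord0) (tail_rV x) = x.
Proof.
apply/rowP => i; case: (unliftP ord0 i) => [j|] ->; last by rewrite cons_rV0.
by rewrite cons_rVS mxE.
Qed.

Lemma tail_cons_rV n t (y : 'rV[R]_n) : tail_rV (cons_rV t y) = y.
Proof. by apply/rowP => i; rewrite mxE cons_rVS. Qed.

Lemma measurable_cons_rV n :
  mfunT (fun p : measurableTypeR R * 'rV[R]_n => cons_rV p.1 p.2).
Proof.
apply: measurable_fun_rV => i; case: (unliftP ord0 i) => [j|] ->.
  under eq_fun do rewrite cons_rVS.
  by apply: measurable_rVP; exact: measurable_snd.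
by under eq_fun do rewrite cons_rV0; exact: measurable_fst.
Qed.

Lemma measurable_tail_rV n : mfunT (@tail_rV n).
Proof.
apply: measurable_fun_rV => i; under eq_fun do rewrite mxE.
exact: measurable_coord.
Qed.

(** By recursion [lebesgue_rV n.+1] is the image of the product of [leb1] and [lebesgue_rV n] under
    [cons_rV], hence a measure. Sigma-finiteness is pulled back along the inverse map to head and
    tail. The result is a sigma type, from which [lebm] is extracted. *)
Lemma lebesgue_rV_measure n :
  {m : {sigma_finite_measure set 'rV[R]_n -> \bar R} |
    m = @lebesgue_rV R n :> (set _ -> \bar R)}.
Proof.
elim: n => [|n [m mE]].
  have H : sigma_finite setT (\d_(0 : 'rV[R]_0) : set _ -> \bar R).
    by apply: fin_num_fun_sigma_finite => //; rewrite measure0.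
  by exists (sfm_of H).
pose mu := pushm (prodm leb1 m) (@measurable_cons_rV n).
have H : sigma_finite setT mu.
  have [F FT Ffin] := sigma_finiteT (prodm leb1 m).
  pose g := fun x : 'rV[R]_n.+1 => (x 0 ord0 : measurableTypeR R, tail_rV x).
  have mg : mfunT g.
    by apply: measurable_fun_pair; [exact: measurable_coord|exact: measurable_tail_rV].
  exists (fun i => g @^-1` F i); first by rewrite -preimage_bigcup -FT preimage_setT.
  move=> i; have [mF Fi] := Ffin i; split.
    by rewrite -[X in measurable X]setTI; exact: mg.
  apply: le_lt_trans Fi; rewrite /mu /pushm /pushforward le_measure ?inE//.
    rewrite -[X in measurable X]setTI; apply: measurable_cons_rV => //.
    by rewrite -[X in measurable X]setTI; exact: mg.
  by move=> [t y] /=; rewrite /g cons_rV0 tail_cons_rV.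
exists (sfm_of H) => /=; apply/funext => A.
rewrite /mu /pushm /pushforward /product_measure1 /=; apply: eq_integral => t _.
rewrite /= -mE; congr (m _); apply/seteqP; split => y; by rewrite /xsection /= inE.
Qed.

Definition lebm n : {sigma_finite_measure set 'rV[R]_n -> \bar R} :=
  projT1 (lebesgue_rV_measure n).

Lemma lebmE n : lebm n = @lebesgue_rV R n :> (set _ -> \bar R).
Proof. by rewrite /lebm; case: lebesgue_rV_measure. Qed.

Lemma integral_lebm0 (f : 'rV[R]_0 -> \bar R) : mfunT f ->
  (\int[lebm 0]_x f x)%E = f 0.
Proof.
move=> mf; rewrite (eq_setfun_integral (nu := \d_(0 : 'rV[R]_0))).
  by rewrite integral_dirac//= diracT mul1e.
by move=> A _; rewrite lebmE.
Qed.

Lemma lebmS n A :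
  lebm n.+1 A = pushm (prodm leb1 (lebm n)) (@measurable_cons_rV n) A.
Proof.
rewrite lebmE /pushm /pushforward /product_measure1 /=.
apply: eq_integral => t _; rewrite /= -lebmE; congr (lebm n _).
by apply/seteqP; split => y; rewrite /xsection /= inE.
Qed.

Lemma ge0_integral_lebmS n (f : 'rV[R]_n.+1 -> \bar R) :
  mfunT f -> (forall x, 0 <= f x)%E ->
  (\int[lebm n.+1]_x f x =
   \int[lebesgue_measure]_t \int[lebm n]_y f (cons_rV t y))%E.
Proof.
move=> mf f0.
rewrite (eq_setfun_integral _ (fun A _ => lebmS A)) ge0_integral_pushm// fubini_tonelli1//=.
exact: (mcomp mf (@measurable_cons_rV n)).
Qed.

End lebesgue.

(** * Real-valued integrals: domination, limits, Fubini *)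

Section Rintegral_extra.
Context {dT} {T : measurableType dT} {R : realType}.
Variable mu : {measure set T -> \bar R}.
Implicit Types f g h : T -> R.

Lemma integrable_le f g : mfunT f ->
  (forall x, `|f x| <= g x) -> mu.-intR g ->
  mu.-intR f.
Proof.
move=> mf fg ig; apply: (le_integrable _ _ _ ig) => //; first exact/measurable_EFinP.
move=> x _ /=; rewrite lee_fin; apply: le_trans (fg x) _; exact: ler_norm.
Qed.

Lemma EFin_Rintegral f : mu.-intR f ->
  (\int[mu]_x f x)%:E = (\int[mu]_x (f x)%:E)%E.
Proof. by move=> fi; rewrite fineK//; apply: integrable_fin_num. Qed.

Lemma Rintegral_dct (f_ : nat -> T -> R) f g :
  (forall n, mfunT (f_ n)) ->
  (forall x, f_ n x @[n --> \oo] --> f x) ->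
  (forall n x, `|f_ n x| <= g x) -> mu.-intR g ->
  (\int[mu]_x f_ n x) @[n --> \oo] --> \int[mu]_x f x.
Proof.
move=> mf cf fg ig.
have mlim : mfunT f.
  by apply: (measurable_fun_cvg (h := f_)) => // x _; exact: cf.
have ifn n : mu.-intR (f_ n) by exact: integrable_le ig.
have fgl x : `|f x| <= g x.
  have cfx : `|f_ n x| @[n --> \oo] --> `|f x| by apply: cvg_norm; exact: cf.
  rewrite -(cvg_lim _ cfx)//; apply: limr_le; first exact: cvgP cfx.
  exact: nearW.
have H : (\int[mu]_x (f_ n x)%:E)%E @[n --> \oo] --> (\int[mu]_x (f x)%:E)%E.
  apply: (@dominated_cvg _ _ _ mu _ measurableT _ _ (EFin \o g)) => //.
  - by move=> n; exact/measurable_EFinP.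
  - by move=> x _; apply: cvg_EFin; [exact: nearW|exact: cf].
  - by move=> n x _ /=; rewrite lee_fin.
apply: fine_cvg; rewrite EFin_Rintegral//; exact: integrable_le ig.
Qed.

Lemma integrable_ge0_lty f : mfunT f -> (forall x, 0 <= f x) ->
  (\int[mu]_x (f x)%:E < +oo)%E -> mu.-intR f.
Proof.
move=> mf f0 fi; apply/integrableP; split; first exact/measurable_EFinP.
by under eq_integral do rewrite /= ger0_norm//.
Qed.

Lemma ge0_integral_lty f g : mfunT f -> mfunT g ->
  (forall x, 0 <= f x) -> (forall x, f x <= g x) ->
  (\int[mu]_x (g x)%:E < +oo)%E -> (\int[mu]_x (f x)%:E < +oo)%E.
Proof.
move=> mf mg f0 fg; apply: le_lt_trans; apply: ge0_le_integral => //.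
- by move=> x _; rewrite lee_fin.
- exact/measurable_EFinP.
- exact/measurable_EFinP.
- by move=> x _; rewrite lee_fin.
Qed.

Lemma intgbZ (c : R) f : mu.-intR f ->
  mu.-intR (fun x => c * f x).
Proof.
move=> fi; rewrite (_ : _ \o _ = (fun x => c%:E * (EFin \o f) x)%E).
  exact: integrableZl.
by apply/funext => x; rewrite /= EFinM.
Qed.

Lemma integrable_add f g : mu.-intR f ->
  mu.-intR g ->
  mu.-intR (fun x => f x + g x).
Proof.
move=> fi gi; rewrite (_ : _ \o _ = ((EFin \o f) \+ (EFin \o g))%E).
  exact: integrableD.
by apply/funext => x; rewrite /= EFinD.
Qed.

Lemma integrable_opp f : mu.-intR f ->
  mu.-intR (fun x => - f x).
Proof.
move=> fi; under [X in _.-integrable _ (_ \o X)]eq_fun do rewrite -mulN1r.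
exact: intgbZ.
Qed.

Lemma integrable_sub f g : mu.-intR f ->
  mu.-intR g ->
  mu.-intR (fun x => f x - g x).
Proof. by move=> fi gi; apply: integrable_add => //; exact: integrable_opp. Qed.

End Rintegral_extra.

Section Fubini_extra.
Context {d1 d2} {T1 : measurableType d1} {T2 : measurableType d2} {R : realType}.
Variables (m1 : {sigma_finite_measure set T1 -> \bar R})
  (m2 : {sigma_finite_measure set T2 -> \bar R}).

(** Domination by a product [g x * h y] is the form in which real-valued double integrals are
    justified below; Tonelli integrates the two factors separately. *)
Lemma integrable_prod_dom (f : T1 * T2 -> R) (g : T1 -> R) (h : T2 -> R) :
  mfunT f -> (forall x y, `|f (x, y)| <= g x * h y) ->
  m1.-intR g -> m2.-intR h ->
  (m1 \x m2)%E.-intR f.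
Proof.
move=> mf fgh ig ih.
have mg : mfunT g by apply/measurable_EFinP; case/integrableP: ig.
have mh : mfunT h by apply/measurable_EFinP; case/integrableP: ih.
have inE x : (\int[m2]_y (`|(h y)%:E| * `|(g x)%:E|) =
    (\int[m2]_y `|(h y)%:E|) * `|(g x)%:E|)%E.
  rewrite ge0_integralZr//; last by apply: mcomp => //; exact/measurable_EFinP.
apply/integrable12ltyP; first exact/measurable_EFinP.
apply: (@le_lt_trans _ _ (\int[m1]_x (\int[m2]_y (`|(h y)%:E| * `|(g x)%:E|)))%E).
  apply: ge0_le_integral => //.
  - by move=> x _; exact: integral_ge0.
  - apply: (measurable_fun_fubini_tonelli_F (fun z => `|(f z)%:E|%E)) => //.
    by apply: mcomp => //; exact/measurable_EFinP.
  - rewrite (funext inE).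
    by apply: measurable_funeM; apply: mcomp => //; exact/measurable_EFinP.
  - move=> x _; apply: ge0_le_integral => //.
    + apply: mcomp => //; apply/measurable_EFinP.
      exact: (mcomp mf (measurable_pair1 x)).
    + by apply: emeasurable_funM => //; apply: mcomp => //; exact/measurable_EFinP.
    + move=> y _ /=; rewrite lee_fin; apply: le_trans (fgh x y) _.
      by rewrite mulrC -normrM ler_norm.
rewrite (funext inE).
rewrite ge0_integralZl//; last 2 first.
- by apply: mcomp => //; exact/measurable_EFinP.
- exact: integral_ge0.
case/integrableP: ig => _ ig; case/integrableP: ih => _ ih.
by rewrite lte_mul_pinfty// ?integral_ge0// ge0_fin_numE// integral_ge0.
Qed.

Lemma Rintegral_swap (f : T1 * T2 -> R) (g : T1 -> R) (h : T2 -> R) :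
  mfunT f -> (forall x y, `|f (x, y)| <= g x * h y) ->
  m1.-intR g -> m2.-intR h ->
  \int[m1]_x \int[m2]_y f (x, y) = \int[m2]_y \int[m1]_x f (x, y).
Proof.
move=> mf fgh ig ih.
have fi := integrable_prod_dom mf fgh ig ih.
have I1 x : m2.-intR (fun y => f (x, y)).
  apply: (integrable_le (g := fun y => g x * h y)) => //.
    exact: (mcomp mf (measurable_pair1 x)).
  exact: intgbZ.
have I2 y : m1.-intR (fun x => f (x, y)).
  apply: (integrable_le (g := fun x => h y * g x)) => //.
  - exact: (mcomp mf (measurable_pair2 y)).
  - by move=> x; rewrite mulrC.
  - exact: intgbZ.
rewrite /Rintegral; congr fine.
transitivity (\int[m1]_x \int[m2]_y (f (x, y))%:E)%E.
  by apply: eq_integral => x _; rewrite -EFin_Rintegral.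
rewrite (Fubini fi); apply: eq_integral => y _; exact/esym/EFin_Rintegral.
Qed.

End Fubini_extra.

Section measure_preserving.
Context {dT} {T : measurableType dT} {R : realType}.

Lemma integral_mpres (m : {measure set T -> \bar R}) (phi : T -> T)
    (g : T -> \bar R) : mfunT phi ->
  (forall A, measurable A -> m (phi @^-1` A) = m A) ->
  mfunT g -> (\int[m]_x g (phi x) = \int[m]_x g x)%E.
Proof.
move=> mphi mpres mg.
have H (h : T -> \bar R) : mfunT h -> (forall x, 0 <= h x)%E ->
    (\int[m]_x h (phi x) = \int[m]_x h x)%E.
  move=> mh h0; rewrite -(ge0_integral_pushm m mphi mh h0).
  by apply: eq_setfun_integral => A mA; exact: mpres.
rewrite integralE [RHS]integralE; congr (_ - _)%E.
  rewrite -(H (g^\+)%E) ?funeposE//; last exact: measurable_funepos.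
  by apply: eq_integral => x _; rewrite !funeposE.
rewrite -(H (g^\-)%E)//; last exact: measurable_funeneg.
by apply: eq_integral => x _; rewrite !funenegE.
Qed.

End measure_preserving.

(** * Translations and reflections of Lebesgue measure *)

Section lebesgue_invariance.
Context {R : realType}.

Lemma leb1_shift (a : R) (A : set (measurableTypeR R)) : measurable A ->
  leb1 ((fun t : R => t + a) @^-1` A) = leb1 A.
Proof.
move=> mA.
have ms : mfunT (fun t : measurableTypeR R => t + a : measurableTypeR R).
  exact: measurable_funD.
rewrite [RHS](@lebesgue_measure_unique _ (pushm leb1 ms))//.
move=> _ [[x y]] _ <-; rewrite /pushm /pushforward/=.
rewrite (_ : _ @^-1` _ = `]x - a, y - a]%classic); last first.
  by apply/seteqP; split => t /=; rewrite !in_itv/= ltrBlDr lerBrDr.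
rewrite /leb1/= !lebesgue_measure_itv/= !lte_fin ltrD2r.
by case: ifP => // _; rewrite -!EFinD; congr EFin; ring.
Qed.

Lemma ge0_integral_leb1_shift (a : R) (f : R -> \bar R) :
  mfunT f ->
  (\int[lebesgue_measure]_t f (t + a)%R = \int[lebesgue_measure]_t f t)%E.
Proof.
move=> mf; apply: (integral_mpres (m := leb1) (phi := fun t : measurableTypeR R => t + a : measurableTypeR R)) => //.
  exact: measurable_funD.
exact: leb1_shift.
Qed.

Lemma integral_leb1_opp (f : R -> \bar R) :
  mfunT f ->
  (\int[lebesgue_measure]_t f (- t)%R = \int[lebesgue_measure]_t f t)%E.
Proof.
move=> mf; apply: (integral_mpres (m := leb1) (phi := fun t : measurableTypeR R => - t : measurableTypeR R)) => //.
  exact: oppr_measurable.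
by move=> A mA; exact: (lebesgue_measureN mA).
Qed.

Lemma cons_rVD n t u (y z : 'rV[R]_n) :
  cons_rV t y + cons_rV u z = cons_rV (t + u) (y + z).
Proof.
apply/rowP => i; rewrite [LHS]mxE.
case: (unliftP ord0 i) => [j|] ->; last by rewrite !cons_rV0.
by rewrite !cons_rVS [RHS]mxE.
Qed.

Lemma cons_rVN n t (y : 'rV[R]_n) : - cons_rV t y = cons_rV (- t) (- y).
Proof.
apply/rowP => i; rewrite [LHS]mxE.
case: (unliftP ord0 i) => [j|] ->; last by rewrite !cons_rV0.
by rewrite !cons_rVS [RHS]mxE.
Qed.

Lemma measurable_fun_cons_rV n {dT} {T : measurableType dT} (f : T -> R)
    (g : T -> 'rV[R]_n) : mfunT f -> mfunT g ->
  mfunT (fun t => cons_rV (f t) (g t)).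
Proof.
move=> mf mg; apply: measurable_fun_rV => i; case: (unliftP ord0 i) => [j|] ->.
  by under eq_fun do rewrite cons_rVS; exact: measurable_rVP.
by under eq_fun do rewrite cons_rV0.
Qed.

Lemma measurable_cons_rV2 n (t : R) :
  mfunT (fun y : 'rV[R]_n => cons_rV t y).
Proof. exact: measurable_fun_cons_rV. Qed.

Lemma measurable_lebm_slice n (f : 'rV[R]_n.+1 -> \bar R) :
  mfunT f -> (forall x, 0 <= f x)%E ->
  mfunT (fun t : measurableTypeR R => \int[lebm n]_y f (cons_rV t y))%E.
Proof.
move=> mf f0.
apply: (measurable_fun_fubini_tonelli_F (fun p : measurableTypeR R * 'rV[R]_n => f (cons_rV p.1 p.2))) => //.
by apply: (mcomp mf); exact: measurable_cons_rV.
Qed.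

Lemma ge0_integral_lebm_shift n (a : 'rV[R]_n) (f : 'rV[R]_n -> \bar R) :
  mfunT f -> (forall x, 0 <= f x)%E ->
  (\int[lebm n]_x f (x + a)%R = \int[lebm n]_x f x)%E.
Proof.
elim: n a f => [|n IH] a f mf f0.
  rewrite !integral_lebm0//; last by apply: (mcomp mf); exact: measurable_rVD.
  by congr f; apply/rowP => -[].
rewrite ge0_integral_lebmS//; last by apply: (mcomp mf); exact: measurable_rVD.
rewrite (ge0_integral_lebmS mf f0) -[a]cons_tail_rV.
transitivity (\int[lebesgue_measure]_t \int[lebm n]_y f (cons_rV (t + a 0 ord0)%R y))%E.
  apply: eq_integral => t _; rewrite -(IH (tail_rV a) (fun y => f (cons_rV (t + a 0 ord0) y)))//.
    by apply: eq_integral => y _; rewrite cons_rVD.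
  by apply: (mcomp mf); exact: measurable_cons_rV2.
apply: (@ge0_integral_leb1_shift (a 0 ord0) ( fun t => (\int[lebm n]_y f (cons_rV t y))%E)).
exact: measurable_lebm_slice.
Qed.

Lemma ge0_integral_lebm_opp n (f : 'rV[R]_n -> \bar R) :
  mfunT f -> (forall x, 0 <= f x)%E ->
  (\int[lebm n]_x f (- x)%R = \int[lebm n]_x f x)%E.
Proof.
elim: n f => [|n IH] f mf f0.
  rewrite !integral_lebm0//; last by apply: (mcomp mf); exact: measurable_rVN.
  by congr f; apply/rowP => -[].
rewrite ge0_integral_lebmS//; last by apply: (mcomp mf); exact: measurable_rVN.
rewrite (ge0_integral_lebmS mf f0).
transitivity (\int[lebesgue_measure]_t \int[lebm n]_y f (cons_rV (- t)%R y))%E.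
  apply: eq_integral => t _; rewrite -(IH (fun y => f (cons_rV (- t) y)))//.
    by apply: eq_integral => y _; rewrite cons_rVN.
  by apply: (mcomp mf); exact: measurable_cons_rV2.
apply: (@integral_leb1_opp ( fun t => (\int[lebm n]_y f (cons_rV t y))%E)).
exact: measurable_lebm_slice.
Qed.

Section mpres.
Context {n : nat}.
Implicit Types A : set 'rV[R]_n.

(** The identity for nonnegative functions, applied to indicators, says that [phi] preserves the
    measure of sets; [integral_mpres] then covers functions of any sign. *)
Let mpres (phi : 'rV[R]_n -> 'rV[R]_n) : mfunT phi ->
  (forall f : 'rV[R]_n -> \bar R, mfunT f -> (forall x, 0 <= f x)%E ->
    \int[lebm n]_x f (phi x) = \int[lebm n]_x f x)%E ->
  forall g : 'rV[R]_n -> \bar R, mfunT g ->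
    (\int[lebm n]_x g (phi x) = \int[lebm n]_x g x)%E.
Proof.
move=> mphi H g mg; apply: integral_mpres => // A mA.
have mpA : measurable (phi @^-1` A) by rewrite -[X in measurable X]setTI; exact: mphi.
have m1 : mfunT (fun x => (\1_A x)%:E : \bar R) by exact/measurable_EFinP.
have E := H _ m1 (fun x => ltac:(by rewrite lee_fin)).
transitivity (\int[lebm n]_x (\1_(phi @^-1` A) x)%:E)%E.
  by rewrite integral_indic// setIT.
by rewrite [LHS]E integral_indic// setIT.
Qed.

Lemma integral_lebm_shift (a : 'rV[R]_n) (g : 'rV[R]_n -> \bar R) :
  mfunT g ->
  (\int[lebm n]_x g (x + a)%R = \int[lebm n]_x g x)%E.
Proof.
apply: mpres; first exact: measurable_rVD.
by move=> f mf f0; exact: ge0_integral_lebm_shift.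
Qed.

Lemma integral_lebm_opp (g : 'rV[R]_n -> \bar R) :
  mfunT g ->
  (\int[lebm n]_x g (- x)%R = \int[lebm n]_x g x)%E.
Proof.
apply: mpres; first exact: measurable_rVN.
by move=> f mf f0; exact: ge0_integral_lebm_opp.
Qed.

Lemma integral_lebm_refl (a : 'rV[R]_n) (g : 'rV[R]_n -> \bar R) :
  mfunT g ->
  (\int[lebm n]_x g (a - x)%R = \int[lebm n]_x g x)%E.
Proof.
move=> mg; rewrite -[RHS]integral_lebm_opp//.
rewrite -[RHS](integral_lebm_shift (- a)).
  by apply: eq_integral => x _; rewrite opprD opprK addrC.
by apply: (mcomp mg); exact: measurable_rVN.
Qed.

End mpres.
End lebesgue_invariance.

(** * Gaussian integrals on the line *)

Section gaussian1.
Context {R : realType}.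
Local Notation mu := (@lebesgue_measure R).

Definition gexp (a t : R) : R := expR (- (a * t ^+ 2 / 2)).

Lemma gexp_ge0 a t : 0 <= gexp a t. Proof. exact: expR_ge0. Qed.

Lemma gexpN a t : gexp a (- t) = gexp a t.
Proof. by rewrite /gexp sqrrN. Qed.

Lemma continuous_gexp a : continuous (gexp a).
Proof.
move=> t; apply: continuous_comp; last exact: continuous_expR.
apply: cvgN; apply: cvgM; last exact: cvg_cst.
apply: cvgM; first exact: cvg_cst.
exact: exprn_continuous.
Qed.

Lemma measurable_gexp a : mfunT (gexp a).
Proof. by apply: continuous_measurable_fun; exact: continuous_gexp. Qed.

Lemma integral_gexp (a : R) : 0 < a ->
  (\int[mu]_t (gexp a t)%:E = (Num.sqrt (2 * pi / a))%:E)%E.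
Proof.
move=> a0.
(* [gexp a] is the normal density with standard deviation [1 / sqrt a], without its normalising
   factor. *)
pose s := (Num.sqrt a)^-1.
have sa : 0 < Num.sqrt a by rewrite sqrtr_gt0.
have s0 : s != 0 by rewrite invr_neq0 ?gt_eqF.
have s2 : s ^+ 2 = a^-1 by rewrite /s exprVn sqr_sqrtr ?ltW.
have := integral_normal_pdf (0 : R) s.
under eq_integral do rewrite (normal_pdfE _ s0) EFinM.
rewrite ge0_integralZl//; last 3 first.
- by apply/measurable_EFinP; exact: measurable_normal_fun.
- by move=> x _; rewrite lee_fin normal_fun_ge0.
- by rewrite lee_fin normal_peak_ge0.
rewrite (_ : (fun x => _) = (fun x => (gexp a x)%:E)); last first.
  apply/funext => x; congr (expR _)%:E.
  rewrite subr0 s2 mulNr -mulr_natr invfM invrK; congr (- _); ring.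
rewrite /normal_peak s2.
have P0 : 0 < Num.sqrt (a^-1 * pi *+ 2).
  by rewrite sqrtr_gt0 pmulrn_lgt0// mulr_gt0 ?invr_gt0 ?pi_gt0.
set I := integral _ _ _ => E.
have -> : 2 * pi / a = a^-1 * pi *+ 2 by rewrite -mulr_natr; ring.
rewrite -[LHS]mul1e -(divff (lt0r_neq0 P0)) EFinM -muleA E.
by rewrite mule1.
Qed.

Lemma integrable_gexp (a : R) : 0 < a -> mu.-intR (gexp a).
Proof.
move=> a0; apply: (@integrable_ge0_lty _ _ _ leb1).
- exact: measurable_gexp.
- by move=> x; exact: gexp_ge0.
- by rewrite [X in (X < _)%E](integral_gexp a0) ltry.
Qed.

(** Half of the exponent is spent on [|t|]: with [e = a t^2 / 4] one has [|t| <= e + 1/a], and both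
    terms are at most a multiple of [exp e]. *)
Lemma normr_gexp_le (a t : R) : 0 < a -> `|t| * gexp a t <= (1 + a^-1) * gexp (a / 2) t.
Proof.
move=> a0.
have -> : gexp a t = expR (- (a * t ^+ 2 / 4)) * gexp (a / 2) t.
  by rewrite /gexp -expRD; congr expR; lra.
rewrite mulrA ler_wpM2r ?gexp_ge0//.
rewrite expRN ler_pdivrMr ?expR_gt0//.
set e := a * t ^+ 2 / 4.
have e0 : 0 <= e by rewrite /e divr_ge0// mulr_ge0 ?sqr_ge0// ltW.
have te : `|t| <= e + a^-1.
  rewrite -subr_ge0 (_ : _ - _ = a^-1 * (a / 2 * `|t| - 1) ^+ 2).
    by rewrite mulr_ge0 ?sqr_ge0// invr_ge0 ltW.
  rewrite /e -(real_normK (num_real t)); field.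
  by rewrite gt_eqF.
apply: le_trans te _; rewrite mulrDl mul1r lerD//.
  by apply: le_trans (expR_ge1Dx _); rewrite lerDr.
rewrite -[X in X <= _]mulr1 ler_wpM2l ?invr_ge0 ?(ltW a0)//.
by apply: le_trans (expR_ge1Dx _); rewrite lerDl.
Qed.

Lemma integrable_id_gexp (a : R) : 0 < a ->
  mu.-intR (fun t => t * gexp a t).
Proof.
move=> a0; apply: (@integrable_le _ _ _ leb1 _ (fun t => (1 + a^-1) * gexp (a / 2) t)).
- by apply: measurable_funM => //; exact: measurable_gexp.
- by move=> t; rewrite normrM (ger0_norm (gexp_ge0 _ _)); exact: normr_gexp_le.
- by apply: (@intgbZ _ _ _ leb1); apply: integrable_gexp; rewrite divr_gt0.
Qed.

Lemma is_derive_gexp a (t : R) : is_derive t 1 (gexp a) (- (a * t) * gexp a t).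
Proof.
rewrite /gexp; apply: is_derive_eq.
by rewrite /GRing.scale/= ; field.
Qed.

(** The fundamental theorem on [[-(n+1), n+1]], then dominated convergence in [n]. This is the
    integration by parts behind the Gaussian characteristic function. *)
Lemma Rintegral_derive_eq0 (f f' : R -> R) :
  (forall t : R, is_derive t 1 f (f' t)) -> continuous f' ->
  mu.-intR f' ->
  f n%:R @[n --> \oo] --> (0 : R) -> f (- n%:R) @[n --> \oo] --> (0 : R) ->
  \int[mu]_t f' t = 0.
Proof.
move=> df cf' if' f1 f2.
have mf' : mfunT f' by exact: continuous_measurable_fun.
have cf : continuous f.
  by move=> t; apply/differentiable_continuous/derivable1_diffP.
pose I n := `[(- n.+1%:R : R), n.+1%:R]%classic.
have E n : \int[mu]_t (f' t * \1_(I n) t) = f n.+1%:R - f (- n.+1%:R).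
  have lt_n : (- n.+1%:R : R) < n.+1%:R by rewrite gtrN.
  have := @continuous_FTC2 R f' f (- n.+1%:R) n.+1%:R lt_n.
  move=> /(_ _ _ _)H.
  rewrite /Rintegral (_ : integral _ _ _ = (f n.+1%:R)%:E - (f (- n.+1%:R))%:E)%E//.
  rewrite -H.
  - rewrite [RHS]integral_mkcond; apply: eq_integral => t _.
    by rewrite patchE indicE; case: ifP => _; rewrite ?mulr1 ?mulr0.
  - exact: continuous_subspaceT.
  - split => //.
    + by apply: cvg_at_right_filter; exact: cf.
    + by apply: cvg_at_left_filter; exact: cf.
  - by move=> t _; rewrite derive1E; apply: derive_val.
have c1 : (\int[mu]_t (f' t * \1_(I n) t)) @[n --> \oo] --> (0 : R).
  rewrite (funext E) -[X in _ --> X](subr0 (0 : R)); apply: cvgB.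
    by rewrite (cvg_shiftS (fun n => f n%:R)).
  by rewrite (cvg_shiftS (fun n => f (- n%:R))).
have c2 : (\int[mu]_t (f' t * \1_(I n) t)) @[n --> \oo] --> \int[mu]_t f' t.
  apply: (@Rintegral_dct _ _ _ leb1 _ _ (fun t => `|f' t|)).
  - move=> n; apply: measurable_funM; first exact: mf'.
    by apply: measurable_indic; exact: measurable_itv.
  - move=> t; apply: cvg_near_cst; near=> n.
    rewrite indicE mem_set ?mulr1// /I/= in_itv/= -ler_norml.
    apply: (@le_trans _ _ n%:R); last by rewrite ler_nat.
    by apply: ltW; near: n; exact: nbhs_infty_gtr.
  - by move=> n t; rewrite normrM ler_piMr// indicE; case: (_ \in _); rewrite ?normr1 ?normr0.
  - exact: (integrable_norm if').
exact: (cvg_unique _ c2 c1).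
Unshelve. all: by end_near. Qed.

Lemma gexp_cvg0 (a : R) : 0 < a -> gexp a n%:R @[n --> \oo] --> (0 : R).
Proof.
move=> a0.
have c0 : (fun n => 2 / a * harmonic n) n @[n --> \oo] --> (0 : R).
  by rewrite -[X in _ --> X](mulr0 (2 / a)); apply: cvgM; [exact: cvg_cst|exact: cvg_harmonic].
rewrite -(cvg_shiftS (fun n => gexp a n%:R)).
apply: (squeeze_cvgr _ (cvg_cst _) c0); near=> n.
rewrite gexp_ge0/= /gexp expRN /harmonic/=.
have n0 : 0 < a * n.+1%:R ^+ 2 / 2 by rewrite divr_gt0// mulr_gt0// exprn_gt0.
apply: (@le_trans _ _ (a * n.+1%:R ^+ 2 / 2)^-1).
  rewrite lef_pV2 ?posrE ?expR_gt0//.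
  by apply: le_trans (expR_ge1Dx _); rewrite lerDr.
have n1 : 0 < n.+1%:R :> R by rewrite ltr0n.
have -> : (a * n.+1%:R ^+ 2 / 2)^-1 = 2 / a * n.+1%:R^-1 * n.+1%:R^-1.
  by move: (n.+1%:R : R) n1 => x x0; field; rewrite (gt_eqF a0) (gt_eqF x0).
rewrite ler_piMr ?invf_le1 ?ler1n// mulr_ge0 ?invr_ge0 ?(ltW n1)//.
by rewrite divr_ge0// ltW.
Unshelve. all: by end_near. Qed.

Lemma normr_sin_le1 (x : R) : `|sin x| <= 1.
Proof. by rewrite ler_norml sin_geN1 sin_le1. Qed.

Lemma normr_cos_le1 (x : R) : `|cos x| <= 1.
Proof. by rewrite ler_norml cos_geN1 cos_le1. Qed.

Lemma measurable_cos_comp {dT} {T : measurableType dT} (f : T -> R) :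
  mfunT f -> mfunT (fun t => cos (f t)).
Proof.
move=> mf; apply: (mcomp (f := @cos R)) => //.
by apply: continuous_measurable_fun; exact: continuous_cos.
Qed.

Lemma measurable_sin_comp {dT} {T : measurableType dT} (f : T -> R) :
  mfunT f -> mfunT (fun t => sin (f t)).
Proof.
move=> mf; apply: (mcomp (f := @sin R)) => //.
by apply: continuous_measurable_fun; exact: continuous_sin.
Qed.

Lemma measurable_expR_comp {dT} {T : measurableType dT} (f : T -> R) :
  mfunT f -> mfunT (fun t => expR (f t)).
Proof. by move=> mf; apply: (mcomp (f := @expR R)). Qed.

Lemma integrable_cos_gexp (a z : R) : 0 < a ->
  mu.-intR (fun t => cos (z * t) * gexp a t).
Proof.
move=> a0; apply: (@integrable_le _ _ _ leb1 _ (gexp a)).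
- by apply: measurable_funM; [apply: measurable_cos_comp; exact: measurable_funM|exact: measurable_gexp].
- by move=> t; rewrite normrM (ger0_norm (gexp_ge0 _ _)) ler_piMl ?gexp_ge0 ?normr_cos_le1.
- exact: integrable_gexp.
Qed.

Lemma integrable_sin_gexp (a z : R) : 0 < a ->
  mu.-intR (fun t => sin (z * t) * (t * gexp a t)).
Proof.
move=> a0; apply: (@integrable_le _ _ _ leb1 _ (fun t => `|t * gexp a t|)).
- apply: measurable_funM; first by apply: measurable_sin_comp; exact: measurable_funM.
  by apply: measurable_funM => //; exact: measurable_gexp.
- by move=> t; rewrite normrM ler_piMl ?normr_sin_le1.
- exact: (integrable_norm (integrable_id_gexp a0)).
Qed.

(** The derivative of [sin (z t) exp (- a t^2 / 2)] integrates to 0. *)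
Lemma Rintegral_sin_id_gexp (a z : R) : 0 < a ->
  \int[mu]_t (sin (z * t) * (t * gexp a t)) = z / a * \int[mu]_t (cos (z * t) * gexp a t).
Proof.
move=> a0.
pose f' t := z * (cos (z * t) * gexp a t) - a * (sin (z * t) * (t * gexp a t)).
have ic := @intgbZ _ _ _ leb1 z _ (integrable_cos_gexp z a0).
have is_ := @intgbZ _ _ _ leb1 a _ (integrable_sin_gexp z a0).
have : \int[mu]_t f' t = 0.
  apply: (@Rintegral_derive_eq0 (fun t => sin (z * t) * gexp a t)).
  - move=> t.
    have d1 : is_derive t (1 : R) (fun t => sin (z * t)) (z * cos (z * t)).
      by apply: is_derive_eq; rewrite /GRing.scale/=; ring.
    have -> : f' t = sin (z * t) *: (- (a * t) * gexp a t) + gexp a t *: (z * cos (z * t)).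
      by rewrite /f' /GRing.scale/=; ring.
    exact: (is_deriveM d1 (is_derive_gexp a t)).
  - have cz : continuous (fun t : R => z * t) by move=> t; exact: mulrl_continuous.
    have cg := @continuous_gexp a.
    move=> t; apply: cvgB.
      apply: cvgM; first exact: cvg_cst.
      apply: cvgM; last exact: cg.
      by apply: continuous_comp; [exact: cz|exact: continuous_cos].
    apply: cvgM; first exact: cvg_cst.
    apply: cvgM; first by apply: continuous_comp; [exact: cz|exact: continuous_sin].
    by apply: cvgM; [exact: cvg_id|exact: cg].
  - exact: (@integrable_sub _ _ _ leb1).
  - apply: (squeeze_cvgr _ _ (gexp_cvg0 a0)); last first.
      by rewrite -oppr0; apply: cvgN; exact: (gexp_cvg0 a0).
    near=> n; rewrite -ler_norml normrM (ger0_norm (gexp_ge0 _ _)).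
    by rewrite ler_piMl ?gexp_ge0 ?normr_sin_le1.
  - apply: (squeeze_cvgr _ _ (gexp_cvg0 a0)); last first.
      by rewrite -oppr0; apply: cvgN; exact: (gexp_cvg0 a0).
    near=> n; rewrite -ler_norml normrM gexpN (ger0_norm (gexp_ge0 _ _)).
    by rewrite ler_piMl ?gexp_ge0 ?normr_sin_le1.
rewrite /f' (@RintegralB _ _ _ leb1)// (@RintegralZl _ _ _ leb1)//; last exact: integrable_cos_gexp.
rewrite (@RintegralZl _ _ _ leb1)//; last exact: integrable_sin_gexp.
move/eqP; rewrite subr_eq0 => /eqP E.
apply: (mulfI (lt0r_neq0 a0)); rewrite -[LHS]E; field.
by rewrite gt_eqF.
Unshelve. all: by end_near. Qed.

Lemma is_derive_cos_gexp (a z : R) : 0 < a ->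
  is_derive z 1 (fun z => \int[mu]_t (cos (z * t) * gexp a t))
    (- (z / a) * \int[mu]_t (cos (z * t) * gexp a t)).
Proof.
move=> a0.
pose f (z t : R) := cos (z * t) * gexp a t.
have d1 (x t : R) : is_derive x (1 : R) (f ^~ t) (- (sin (x * t) * (t * gexp a t))).
  by apply: is_derive_eq; rewrite /GRing.scale/=; ring.
have dE x t : partial1of2 f x t = - (sin (x * t) * (t * gexp a t)).
  by rewrite partial1of2E; apply: derive_val.
have Iz : `]z - 1, z + 1[%classic z by rewrite /= in_itv/=; lra.
have H1 x : `]z - 1, z + 1[%classic x -> leb1.-intR (f x).
  by move=> _; exact: integrable_cos_gexp.
have H2 x t : `]z - 1, z + 1[%classic x -> [set: R] t -> derivable (f ^~ t) x 1.
  by move=> _ _; exact: ex_derive.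
have H3 := integrable_norm (integrable_id_gexp a0).
have H4 x t : `]z - 1, z + 1[%classic x -> [set: R] t ->
    `|partial1of2 f x t| <= `|t * gexp a t|.
  by move=> _ _; rewrite dE normrN normrM ler_piMl ?normr_sin_le1.
have D := @derivable_under_integral _ _ _ leb1 f _ measurableT _ _ _ Iz H1 H2 _
  (fun _ => normr_ge0 _) H3 H4.
apply: DeriveDef => //; rewrite -derive1E.
rewrite (@differentiation_under_integral _ _ _ leb1 f _ measurableT _ _ _ Iz H1 H2 _
  (fun _ => normr_ge0 _) H3 H4).
have -> : partial1of2 f z = fun t => -1 * (sin (z * t) * (t * gexp a t)).
  by apply/funext => t; rewrite dE mulN1r.
rewrite (@RintegralZl _ _ _ leb1)//; last exact: integrable_sin_gexp.
by rewrite [X in -1 * X](Rintegral_sin_id_gexp _ a0) mulN1r mulNr.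
Qed.

(** As a function of [z] the left side [C] satisfies [C' = - (z / a) C], so
    [C z * exp (z^2 / (2 a))] is constant; its value at 0 is the Gaussian mass. *)
Lemma Rintegral_cos_gexp (a z : R) : 0 < a ->
  \int[mu]_t (cos (z * t) * gexp a t) = Num.sqrt (2 * pi / a) * gexp a^-1 z.
Proof.
move=> a0.
pose C z := \int[mu]_t (cos (z * t) * gexp a t).
have d0 (x : R) : is_derive x (1 : R) (fun x => C x * expR (x ^+ 2 / (2 * a))) 0.
  have := is_derive_cos_gexp x a0; rewrite -/(C x) -/(C) => dC.
  have dE : is_derive x (1 : R) (fun x => expR (x ^+ 2 / (2 * a))) (x / a * expR (x ^+ 2 / (2 * a))).
    apply: is_derive_eq; rewrite /GRing.scale/=; field.
    by rewrite gt_eqF.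
  have -> : 0 = C x *: (x / a * expR (x ^+ 2 / (2 * a))) +
      expR (x ^+ 2 / (2 * a)) *: (- (x / a) * C x).
    by rewrite /GRing.scale/=; ring.
  exact: (is_deriveM dC dE).
have := is_derive_0_is_cst z 0 d0; rewrite expr0n/= mul0r expR0 mulr1 => E.
have C0 : C 0 = Num.sqrt (2 * pi / a).
  rewrite /C /Rintegral; under eq_integral do rewrite mul0r cos0 mul1r.
  by rewrite integral_gexp.
rewrite -/(C z) -C0 -E -mulrA /gexp -expRD.
rewrite (_ : _ + _ = 0) ?expR0 ?mulr1//; field.
by rewrite gt_eqF.
Qed.

End gaussian1.

Lemma measurable_EFin {dT} {T : measurableType dT} {R : realType} (f : T -> R) :
  mfunT f -> mfunT (fun x => (f x)%:E).
Proof. by move=> mf; exact/measurable_EFinP. Qed.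

Section pushm_integral.
Context {dT dU} {T : measurableType dT} {U : measurableType dU} {R : realType}.

Lemma integral_pushm (m : {measure set T -> \bar R}) (f : T -> U)
    (mf : mfunT f) (g : U -> \bar R) : mfunT g ->
  (\int[pushm m mf]_y g y = \int[m]_x g (f x))%E.
Proof.
move=> mg; rewrite [LHS]integralE [RHS]integralE; congr (_ - _)%E.
  rewrite ge0_integral_pushm//; last exact: measurable_funepos.
  by apply: eq_integral => x _; rewrite !funeposE.
rewrite ge0_integral_pushm//; last exact: measurable_funeneg.
by apply: eq_integral => x _; rewrite !funenegE.
Qed.

End pushm_integral.

(** * Gaussians and exponential weights on R^d *)

Section gaussiann.
Context {R : realType}.

Definition l1 {n} (x : 'rV[R]_n) : R := \sum_i `|x 0 i|.
Definition gaussn {n} (a : R) (x : 'rV[R]_n) : R := expR (- (a * dotv x x / 2)).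
(** With the l1 norm in place of the Euclidean one the weight factorises over the coordinates, as
    [gaussn] does, and its integral reduces to the line. *)
Definition rho {n} (c : R) (x : 'rV[R]_n) : R := expR (- (c * l1 x)).

Lemma measurable_l1 n : mfunT (@l1 n).
Proof.
apply: measurable_sum => i; apply: mcomp => //.
exact: measurable_coord.
Qed.

Lemma measurable_dotv_id n : mfunT (fun x : 'rV[R]_n => dotv x x).
Proof. exact: measurable_dotv. Qed.

Lemma measurable_gaussn n a : mfunT (@gaussn n a).
Proof.
apply: measurable_expR_comp; apply: mcomp => //.
apply: measurable_funM => //; apply: measurable_funM => //.
exact: measurable_dotv_id.
Qed.

Lemma measurable_rho n c : mfunT (@rho n c).
Proof.
apply: measurable_expR_comp; apply: mcomp => //.
by apply: measurable_funM => //; exact: measurable_l1.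
Qed.

Lemma gaussn_ge0 n a x : 0 <= @gaussn n a x. Proof. exact: expR_ge0. Qed.
Lemma gaussn_gt0 n a x : 0 < @gaussn n a x. Proof. exact: expR_gt0. Qed.
Lemma rho_ge0 n c x : 0 <= @rho n c x. Proof. exact: expR_ge0. Qed.
Lemma rho_gt0 n c x : 0 < @rho n c x. Proof. exact: expR_gt0. Qed.

Lemma l1_ge0 n (x : 'rV[R]_n) : 0 <= l1 x.
Proof. by apply: sumr_ge0. Qed.

Lemma l1D n (x y : 'rV[R]_n) : l1 (x + y) <= l1 x + l1 y.
Proof.
by rewrite /l1 -big_split; apply: ler_sum => i _; rewrite mxE ler_normD.
Qed.

Lemma l1N n (x : 'rV[R]_n) : l1 (- x) = l1 x.
Proof. by apply: eq_bigr => i _; rewrite mxE normrN. Qed.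

Lemma l1Z n c (x : 'rV[R]_n) : l1 (c *: x) = `|c| * l1 x.
Proof. by rewrite /l1 mulr_sumr; apply: eq_bigr => i _; rewrite mxE normrM. Qed.

Lemma dotv_ge0 n (x : 'rV[R]_n) : 0 <= dotv x x.
Proof. by apply: sumr_ge0 => i _; rewrite -expr2 sqr_ge0. Qed.

Lemma dotvC n (x y : 'rV[R]_n) : dotv x y = dotv y x.
Proof. by apply: eq_bigr => i _; rewrite mulrC. Qed.

Lemma dotvDl n (x y z : 'rV[R]_n) : dotv (x + y) z = dotv x z + dotv y z.
Proof.
by rewrite /dotv -big_split; apply: eq_bigr => i _; rewrite mxE mulrDl.
Qed.

Lemma dotvDr n (x y z : 'rV[R]_n) : dotv z (x + y) = dotv z x + dotv z y.
Proof. by rewrite dotvC dotvDl !(dotvC z). Qed.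

Lemma dotvZl n c (x y : 'rV[R]_n) : dotv (c *: x) y = c * dotv x y.
Proof. by rewrite /dotv mulr_sumr; apply: eq_bigr => i _; rewrite mxE mulrA. Qed.

Lemma dotvZr n c (x y : 'rV[R]_n) : dotv x (c *: y) = c * dotv x y.
Proof. by rewrite dotvC dotvZl dotvC. Qed.

Lemma dotvNl n (x y : 'rV[R]_n) : dotv (- x) y = - dotv x y.
Proof. by rewrite -scaleN1r dotvZl mulN1r. Qed.

Lemma dotvNr n (x y : 'rV[R]_n) : dotv x (- y) = - dotv x y.
Proof. by rewrite dotvC dotvNl dotvC. Qed.

Lemma dotvBl n (x y z : 'rV[R]_n) : dotv (x - y) z = dotv x z - dotv y z.
Proof. by rewrite dotvDl dotvNl. Qed.

Lemma dotvBr n (x y z : 'rV[R]_n) : dotv z (x - y) = dotv z x - dotv z y.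
Proof. by rewrite dotvDr dotvNr. Qed.

Lemma dotv_cons n t u (y z : 'rV[R]_n) :
  dotv (cons_rV t y) (cons_rV u z) = t * u + dotv y z.
Proof.
rewrite /dotv big_ord_recl !cons_rV0; congr (_ + _).
by apply: eq_bigr => i _; rewrite !cons_rVS.
Qed.

Lemma gaussn_cons n a t (y : 'rV[R]_n) :
  gaussn a (cons_rV t y) = gexp a t * gaussn a y.
Proof.
by rewrite /gaussn dotv_cons /gexp -expRD; congr expR; rewrite expr2; field.
Qed.

Lemma gaussnN n a (x : 'rV[R]_n) : gaussn a (- x) = gaussn a x.
Proof. by rewrite /gaussn dotvNl dotvNr opprK. Qed.

Lemma ge0_integral_lebm_prod n (g : R -> R) : mfunT g ->
  (forall t, 0 <= g t) ->
  (\int[lebm n]_x (\prod_i g (x 0 i))%:E =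
   (\int[lebesgue_measure]_t (g t)%:E) ^+ n)%E.
Proof.
move=> mg g0; have p0 m (x : 'rV[R]_m) : 0 <= \prod_i g (x 0 i).
  by apply: prodr_ge0 => i _.
have mp m : mfunT (fun x : 'rV[R]_m => \prod_i g (x 0 i)).
  apply: measurable_prod => i _; apply: (mcomp mg).
  exact: measurable_coord.
elim: n => [|n IH].
  rewrite integral_lebm0; first by rewrite big_ord0 expe0.
  exact: (measurable_EFin (mp _)).
rewrite ge0_integral_lebmS; last 2 first.
- exact: (measurable_EFin (mp _)).
- by move=> x; rewrite lee_fin.
under eq_integral => t _.
  under eq_integral => y _.
    rewrite big_ord_recl cons_rV0 EFinM.
    under eq_bigr do rewrite cons_rVS.
    over.
  rewrite ge0_integralZl; [|by []|exact: (measurable_EFin (mp _))| |]; last 2 first.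
  - by move=> x _; rewrite lee_fin.
  - by rewrite lee_fin.
  rewrite IH.
  over.
rewrite ge0_integralZr//.
- by rewrite expeS.
- exact: (measurable_EFin mg).
- by move=> x _; rewrite lee_fin.
- by apply: expe_ge0; apply: integral_ge0 => x _; rewrite lee_fin.
Qed.

(** The two-sided exponential is dominated by the sum of the exponential densities at [t] and at
    [- t], each of mass 1, divided by [c]. *)
Lemma integral_rho1_lty (c : R) : 0 < c ->
  (\int[lebesgue_measure]_t (expR (- (c * `|t|)))%:E < +oo :> \bar R)%E.
Proof.
move=> c0.
have mp : mfunT (exponential_pdf c) by exact: measurable_exponential_pdf.
have p0 t : 0 <= exponential_pdf c t by exact: (exponential_pdf_ge0 (ltW c0)).
have mpN : mfunT (fun t : R => exponential_pdf c (- t)).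
  by apply: (mcomp mp); exact: oppr_measurable.
apply: (@ge0_integral_lty _ _ _ leb1 _ (fun t => c^-1 * (exponential_pdf c t + exponential_pdf c (- t)))).
- apply: measurable_expR_comp; apply: mcomp => //.
  by apply: measurable_funM => //; exact: normr_measurable.
- by apply: measurable_funM => //; exact: measurable_funD.
- by move=> t; exact: expR_ge0.
- suff H (t : R) : c * expR (- (c * `|t|)) <= exponential_pdf c t + exponential_pdf c (- t).
    by move=> t; rewrite ler_pdivlMl//; exact: H.
  case: (leP 0 t) => t0.
    rewrite [X in X <= _](_ : _ = exponential_pdf c t) ?lerDl//.
    rewrite ger0_norm// /exponential_pdf patchE ifT ?mulNr//.
    by rewrite inE/= in_itv/= t0.
  rewrite [X in X <= _](_ : _ = exponential_pdf c (- t)) ?lerDr//.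
  rewrite ltr0_norm// /exponential_pdf patchE ifT ?mulNr//.
  by rewrite inE/= in_itv/= andbT oppr_ge0 ltW.
under eq_integral do rewrite EFinM EFinD.
rewrite ge0_integralZl; [|by []| | |]; last 3 first.
- by apply: emeasurable_funD; exact/measurable_EFinP.
- by move=> x _; rewrite adde_ge0// lee_fin.
- by rewrite lee_fin invr_ge0 ltW.
rewrite ge0_integralD; [|by []| | | |]; last 4 first.
- by move=> x _; rewrite lee_fin.
- exact/measurable_EFinP.
- by move=> x _; rewrite lee_fin.
- exact/measurable_EFinP.
rewrite [X in (_ * (_ + X))%E](@integral_leb1_opp _ (fun t => (exponential_pdf c t)%:E)); last exact/measurable_EFinP.
rewrite [X in (_ * (X + _))%E](integral_exponential_pdf c0).
by rewrite [X in (_ * (_ + X))%E](integral_exponential_pdf c0) -EFinD -EFinM ltry.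
Qed.

Lemma rho_prod n c (x : 'rV[R]_n) : rho c x = \prod_i expR (- (c * `|x 0 i|)).
Proof.
by rewrite /rho /l1 mulr_sumr -sumrN expR_sum.
Qed.

Lemma gaussn_prod n a (x : 'rV[R]_n) : gaussn a x = \prod_i gexp a (x 0 i).
Proof.
rewrite /gaussn /gexp -expR_sum; congr expR; rewrite sumrN /dotv; congr (- _).
by rewrite mulr_sumr mulr_suml; apply: eq_bigr => i _; rewrite expr2.
Qed.

Lemma integral_rho_lty n (c : R) : 0 < c -> (\int[lebm n]_x (rho c x)%:E < +oo)%E.
Proof.
move=> c0; under eq_integral do rewrite rho_prod.
rewrite (@ge0_integral_lebm_prod n (fun t => expR (- (c * `|t|)))); last 2 first.
- apply: measurable_expR_comp; apply: mcomp => //.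
  by apply: measurable_funM => //; exact: normr_measurable.
- by move=> t; exact: expR_ge0.
rewrite ltey_eq fin_numX//; rewrite ge0_fin_numE.
  exact: integral_rho1_lty.
by apply: integral_ge0 => t _; rewrite lee_fin expR_ge0.
Qed.

Lemma integrable_rho n (c : R) : 0 < c -> (lebm n).-intR (rho c).
Proof.
move=> c0; apply: integrable_ge0_lty; [exact: measurable_rho|exact: rho_ge0|].
exact: integral_rho_lty.
Qed.

Lemma integral_gaussn n (a : R) : 0 < a ->
  (\int[lebm n]_x (gaussn a x)%:E = (Num.sqrt (2 * pi / a) ^+ n)%:E)%E.
Proof.
move=> a0; under eq_integral do rewrite gaussn_prod.
rewrite ge0_integral_lebm_prod; last 2 first.
- exact: measurable_gexp.
- by move=> t; exact: gexp_ge0.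
by rewrite (integral_gexp a0) EFin_expe.
Qed.

Lemma integrable_gaussn n (a : R) : 0 < a -> (lebm n).-intR (gaussn a).
Proof.
move=> a0; apply: integrable_ge0_lty; [exact: measurable_gaussn|exact: gaussn_ge0|].
by rewrite integral_gaussn// ltry.
Qed.

Lemma Rintegral_lebmS n (f : 'rV[R]_n.+1 -> R) (g : R -> R) (h : 'rV[R]_n -> R) :
  mfunT f -> (forall t y, `|f (cons_rV t y)| <= g t * h y) ->
  leb1.-intR g -> (lebm n).-intR h ->
  \int[lebm n.+1]_x f x = \int[leb1]_t \int[lebm n]_y f (cons_rV t y).
Proof.
move=> mf fgh ig ih.
have mfc : mfunT (fun p : measurableTypeR R * 'rV[R]_n => f (cons_rV p.1 p.2)).
  by apply: (mcomp mf); exact: measurable_cons_rV.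
have fi := @integrable_prod_dom _ _ _ _ _ leb1 (lebm n)
  (fun p : measurableTypeR R * 'rV[R]_n => f (cons_rV p.1 p.2)) g h mfc fgh ig ih.
have -> : \int[lebm n.+1]_x f x = \int[pushm (prodm leb1 (lebm n)) (@measurable_cons_rV _ n)]_x f x.
  by congr fine; apply: eq_setfun_integral => A mA; exact: lebmS.
rewrite /Rintegral integral_pushm; last exact/measurable_EFinP.
congr fine; rewrite -[LHS](integral12_prod_meas1 fi).
apply: eq_integral => t _; rewrite /fubini_F/=.
rewrite -EFin_Rintegral//.
apply: (@integrable_le _ _ _ _ _ (fun y => g t * h y)) => //.
- exact: (mcomp mf (measurable_cons_rV2 _)).
- exact: intgbZ.
Qed.

Lemma measurable_cos_dotv n (z : 'rV[R]_n) : mfunT (fun x => cos (dotv z x)).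
Proof. by apply: measurable_cos_comp; exact: measurable_dotv. Qed.

Lemma measurable_sin_dotv n (z : 'rV[R]_n) : mfunT (fun x => sin (dotv z x)).
Proof. by apply: measurable_sin_comp; exact: measurable_dotv. Qed.

Lemma integrable_cos_gaussn n (a : R) (z : 'rV[R]_n) : 0 < a ->
  (lebm n).-intR (fun x => cos (dotv z x) * gaussn a x).
Proof.
move=> a0; apply: (@integrable_le _ _ _ _ _ (gaussn a)).
- by apply: measurable_funM; [exact: measurable_cos_dotv|exact: measurable_gaussn].
- by move=> x; rewrite normrM (ger0_norm (gaussn_ge0 _ _)) ler_piMl ?gaussn_ge0 ?normr_cos_le1.
- exact: integrable_gaussn.
Qed.

Lemma integrable_sin_gaussn n (a : R) (z : 'rV[R]_n) : 0 < a ->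
  (lebm n).-intR (fun x => sin (dotv z x) * gaussn a x).
Proof.
move=> a0; apply: (@integrable_le _ _ _ _ _ (gaussn a)).
- by apply: measurable_funM; [exact: measurable_sin_dotv|exact: measurable_gaussn].
- by move=> x; rewrite normrM (ger0_norm (gaussn_ge0 _ _)) ler_piMl ?gaussn_ge0 ?normr_sin_le1.
- exact: integrable_gaussn.
Qed.

Lemma Rintegral_sin_gaussn n (a : R) (z : 'rV[R]_n) : 0 < a ->
  \int[lebm n]_x (sin (dotv z x) * gaussn a x) = 0.
Proof.
move=> a0; set I := Rintegral _ _ _.
suff : I = - I by move=> /eqP; rewrite -addr_eq0 -mulr2n mulrn_eq0/= => /eqP.
have ms : mfunT (fun x => sin (dotv z x) * gaussn a x).
  by apply: measurable_funM; [exact: measurable_sin_dotv|exact: measurable_gaussn].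
have E : I = \int[lebm n]_x (sin (dotv z (- x)) * gaussn a (- x)).
  rewrite /I /Rintegral -(@integral_lebm_opp _ _ (fun x => (sin (dotv z x) * gaussn a x)%:E))//.
  exact/measurable_EFinP.
rewrite [LHS]E (_ : (fun x => _) =
    (fun x => -1 * (sin (dotv z x) * gaussn a x))); last first.
  by apply/funext => x; rewrite dotvNr sinN gaussnN mulN1r mulNr.
by rewrite RintegralZl ?mulN1r//; exact: integrable_sin_gaussn.
Qed.

(** Induction on the dimension: the addition formula for the cosine separates the first coordinate,
    and the product of the sines drops out because the sine integral vanishes by oddness. *)
Lemma Rintegral_cos_gaussn n (a : R) (z : 'rV[R]_n) : 0 < a ->
  \int[lebm n]_x (cos (dotv z x) * gaussn a x) =
  Num.sqrt (2 * pi / a) ^+ n * gaussn a^-1 z.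
Proof.
move=> a0; elim: n z => [|n IH] z.
  rewrite /Rintegral integral_lebm0/=; last first.
    by apply/measurable_EFinP/measurable_funM; [exact: measurable_cos_dotv|exact: measurable_gaussn].
  by rewrite /gaussn /dotv !big_ord0 !mulr0 !mul0r cos0 oppr0 !expR0 expr0.
rewrite -[z]cons_tail_rV; set z0 := z 0 ord0; set z' := tail_rV z.
rewrite (@Rintegral_lebmS _ _ (gexp a) (gaussn a)); last 4 first.
- by apply: measurable_funM; [exact: measurable_cos_dotv|exact: measurable_gaussn].
- move=> t y; rewrite gaussn_cons normrM; set G := gexp a t * _.
  have G0 : 0 <= G by exact: mulr_ge0 (gexp_ge0 _ _) (gaussn_ge0 _ _).
  by rewrite (ger0_norm G0) ler_piMl// normr_cos_le1.
- exact: integrable_gexp.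
- exact: integrable_gaussn.
have E t : \int[lebm n]_y (cos (dotv (cons_rV z0 z') (cons_rV t y)) * gaussn a (cons_rV t y)) =
   (Num.sqrt (2 * pi / a) ^+ n * gaussn a^-1 z') * (cos (z0 * t) * gexp a t).
  rewrite (_ : (fun y => _) = (fun y => (cos (z0 * t) * gexp a t) * (cos (dotv z' y) * gaussn a y)
      - (sin (z0 * t) * gexp a t) * (sin (dotv z' y) * gaussn a y))); last first.
    by apply/funext => y; rewrite dotv_cons cosD gaussn_cons; ring.
  have ic := integrable_cos_gaussn z' a0.
  have is_ := integrable_sin_gaussn z' a0.
  rewrite RintegralB//; [|exact: intgbZ|exact: intgbZ].
  by rewrite !RintegralZl// Rintegral_sin_gaussn// IH mulr0 subr0 mulrC.
rewrite (funext E) RintegralZl//; last exact: integrable_cos_gexp.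
rewrite [X in _ * X](Rintegral_cos_gexp _ a0) gaussn_cons exprS.
ring.
Qed.

End gaussiann.

(** * Vague limits *)

(* A subsequential vague limit of densities is built without Riesz representation: the
   ultralimits of the masses of dyadic cells label a binary tree, and the limit measure
   is the image of Lebesgue measure on an interval under the tree's branch map. *)

Section words.
Implicit Types (s : seq bool) (n : nat).

Fixpoint words n : seq (seq bool) :=
  if n is m.+1 then [seq false :: s | s <- words m] ++ [seq true :: s | s <- words m]
  else [:: [::]].

Fixpoint bitword {X : Type} (b : nat -> X -> bool) n (x : X) : seq bool :=
  if n is m.+1 then b m x :: bitword b m x else [::].

Lemma size_words n s : s \in words n -> size s = n.
Proof.
elim: n s => [|n IH] s /=; first by rewrite inE => /eqP ->.
by rewrite mem_cat => /orP[] /mapP[s' /IH <- ->].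
Qed.

Lemma size_bitword {X : Type} b n (x : X) : size (bitword b n x) = n.
Proof. by elim: n => //= n ->. Qed.

Lemma nth_bitword {X : Type} b n (x : X) j : (j < n)%N ->
  nth false (rev (bitword b n x)) j = b j x.
Proof.
elim: n => // n IH; rewrite ltnS leq_eqVlt /= rev_cons nth_rcons size_rev size_bitword.
by move=> /orP[/eqP ->|jn]; [rewrite ltnn eqxx|rewrite jn IH].
Qed.

(** Exactly one word of length [n] is the bit word of [x]. A function of the first [n] bits thus
    becomes a finite combination of cell indicators, and its integral needs the masses of the cells
    only. *)
Lemma sum_words {R : realType} {X : Type} b n (x : X) (f : seq bool -> R) :
  \sum_(s <- words n) f s * (bitword b n x == s)%:R = f (bitword b n x).
Proof.
elim: n f => [|n IH] f /=; first by rewrite big_seq1 eqxx mulr1.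
rewrite big_cat !big_map/= -big_split/= -(IH (fun s => f (b n x :: s))).
apply: eq_bigr => s _; rewrite !eqseq_cons.
by case: (b n x); rewrite /= ?mulr0 ?addr0 ?add0r.
Qed.

End words.

(** * Trees of masses and their interval maps *)

Section tree.
Context {R : realType}.
Variable l : seq bool -> R.
Hypothesis l_ge0 : forall s, 0 <= l s.
Hypothesis l_split : forall s, l s = l (false :: s) + l (true :: s).

(** Left endpoint of the interval of length [l s] attached to the node [s]. Words carry their latest
    bit first, so [b :: s'] is a child of [s'], and the child [true] lies to the right of the child
    [false]. *)
Fixpoint lo (s : seq bool) : R :=
  if s is b :: s' then lo s' + (if b then l (false :: s') else 0) else 0.

Fixpoint treeword n (u : R) : seq bool :=
  if n is m.+1 then let s := treeword m u in (lo s + l (false :: s) <= u) :: s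
  else [::].

Definition treebit n (u : R) : bool :=
  let s := treeword n u in lo s + l (false :: s) <= u.

Lemma treewordE n u : treeword n u = bitword treebit n u.
Proof. by elim: n => //= n <-. Qed.

(** The children cut the interval of their parent at [lo s + l (false :: s)], the threshold that
    [treeword] tests. A node of mass 0 has an empty interval and is not visited from inside the root
    interval. *)
Lemma tree_cell s u :
  ((0 <= u < l [::]) && (treeword (size s) u == s)) = (lo s <= u < lo s + l s).
Proof.
elim: s => [|b s IH] /=; first by rewrite andbT add0r.
rewrite eqseq_cons [X in _ && X]andbC andbA IH.
have [/andP[h1 h2]|h] := boolP (lo s <= u < lo s + l s).
  have -> : treeword (size s) u = s.
    by move: IH; rewrite h1 h2 => /andP[_ /eqP].
  rewrite /=; case: b => /=.
    by rewrite eqb_id -addrA -(l_split s) h2 andbT.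
  by rewrite addr0 h1/= eqbF_neg -ltNge.
rewrite /=; symmetry; apply/negbTE; apply: contra h => /andP[].
case: b => [h1 h2|]; last rewrite addr0 => -> h2 /=.
  by rewrite (le_trans _ h1) ?lerDl//= (l_split s) addrA.
by apply: (lt_le_trans h2); rewrite lerD2l (l_split s) lerDl.
Qed.

Lemma integral_tree n (f : seq bool -> R) :
  \int[leb1]_u (\1_(`[0, l [::][%classic : set R) u * f (treeword n u)) =
  \sum_(s <- words n) f s * l s.
Proof.
pose I s := `[lo s, lo s + l s[%classic : set R.
have mI s : measurable (I s : set (measurableTypeR R)) by exact: measurable_itv.
have I0 s : (\int[leb1]_u (\1_(I s) u)%:E = (l s)%:E)%E.
  rewrite integral_indic// setIT /I /leb1/= lebesgue_measure_itv/= lte_fin.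
  case: ifP => [_|]; first by rewrite -EFinB; congr EFin; ring.
  by move=> /negbT; rewrite -leNgt gerDl => h; congr EFin; apply/eqP; rewrite eq_le l_ge0 h.
have I1 s : leb1.-intR (\1_(I s) : R -> R).
  apply: (@integrable_ge0_lty _ _ _ leb1).
  - by apply: measurable_indic; exact: mI.
  - by move=> x; rewrite indicE.
  - by rewrite I0 ltry.
have I2 s : \int[leb1]_u \1_(I s) u = l s by rewrite /Rintegral I0.
have -> : (fun u => \1_(`[0, l [::][%classic : set R) u * f (treeword n u)) =
    (fun u : R => \sum_(s <- words n) f s * \1_(I s) u).
  apply/funext => u; rewrite treewordE -(sum_words treebit n u f) mulr_sumr.
  rewrite big_seq [RHS]big_seq; apply: eq_bigr => s /size_words sn.
  rewrite mulrCA; congr (_ * _).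
  rewrite -treewordE -sn /I !indicE -natrM mulnb; congr (_ %:R).
  by rewrite !mem_setE/= !in_itv/= tree_cell.
elim: (words n) => [|s ws IH].
  by under eq_Rintegral do rewrite big_nil; rewrite /Rintegral integral0 big_nil.
rewrite big_cons -IH -{1}(I2 s) -(@RintegralZl _ _ _ leb1)//.
rewrite -(@RintegralD _ _ _ leb1)//.
- by apply: eq_Rintegral => u _; rewrite big_cons.
- exact: intgbZ.
- elim: ws {IH} => [|s' ws IH].
    by under [X in _.-integrable _ (_ \o X)]eq_fun do rewrite big_nil; exact: integrable0.
  under [X in _.-integrable _ (_ \o X)]eq_fun do rewrite big_cons.
  by apply: integrable_add => //; exact: intgbZ.
Qed.

Lemma measurable_treebit n : mfunT (fun u : R => treebit n u : bool).
Proof.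
have H m (f : seq bool -> R) : mfunT (fun u : R => f (treeword m u)).
  elim: m f => [|m IH] f /=; first exact: measurable_cst.
  rewrite (_ : (fun u => _) = fun u => if treebit m u
     then f (true :: treeword m u) else f (false :: treeword m u)); last first.
    by apply/funext => u; rewrite /treebit/=; case: ifP.
  apply: (@measurable_fun_ifT _ _ _ _ (fun u => f (true :: treeword m u))
    (fun u => f (false :: treeword m u)) (fun u => treebit m u)) => //; last 2 first.
  - exact: (IH (fun s => f (true :: s))).
  - exact: (IH (fun s => f (false :: s))).
  apply: (@measurable_fun_ler _ _ _ setT (fun u => lo (treeword m u) + l (false :: treeword m u)) id).
    exact: (IH (fun s => lo s + l (false :: s))).
  exact: measurable_id.
apply: (@measurable_fun_ler _ _ _ setT (fun u => lo (treeword n u) + l (false :: treeword n u)) id).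
  exact: (H n (fun s => lo s + l (false :: s))).
exact: measurable_id.
Qed.

End tree.

Section extra.
Context {dT} {T : measurableType dT} {R : realType}.

Lemma ge0_integral_mrestr (m : {measure set T -> \bar R}) (D : set T)
    (mD : measurable D) (f : T -> \bar R) :
  mfunT f -> (forall x, 0 <= f x)%E ->
  (\int[mrestr m mD]_x f x = \int[m]_(x in D) f x)%E.
Proof.
move=> mf f0; rewrite -(setvU D) ge0_integral_setU//; last 3 first.
- exact: measurableC.
- by rewrite setvU.
- by apply/disj_setPS => x [].
rewrite null_set_integral ?add0e//.
- by apply: eq_measure_integral => A mA AD /=; rewrite /mrestr setIidl.
- exact: measurableC.
- exact: measurable_funTS.
- by rewrite /= /mrestr setICl measure0.
Qed.

Lemma integrable_sum_seq {I : Type} (mu : {measure set T -> \bar R}) (ws : seq I) (F : I -> T -> R) :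
  (forall s, mu.-intR (F s)) ->
  mu.-intR (fun x => \sum_(s <- ws) F s x).
Proof.
move=> iF; elim: ws => [|s ws IH].
  rewrite (_ : _ \o _ = cst 0%E); first exact: integrable0.
  by apply/funext => x /=; rewrite big_nil.
rewrite (_ : _ \o _ = EFin \o (fun x => F s x + \sum_(s <- ws) F s x)).
  exact: integrable_add.
by apply/funext => x /=; rewrite big_cons.
Qed.

Lemma Rintegral_sum_seq {I : Type} (mu : {measure set T -> \bar R}) (ws : seq I) (F : I -> T -> R) :
  (forall s, mu.-intR (F s)) ->
  \int[mu]_x (\sum_(s <- ws) F s x) = \sum_(s <- ws) \int[mu]_x F s x.
Proof.
move=> iF; elim: ws => [|s ws IH].
  rewrite big_nil (_ : (fun x => _) = cst 0); first by rewrite /Rintegral integral0.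
  by apply/funext => x /=; rewrite big_nil.
rewrite big_cons -IH -RintegralD//; last exact: integrable_sum_seq.
by congr Rintegral; apply/funext => x; rewrite big_cons.
Qed.

Lemma measurable_bitword (b : nat -> T -> bool) :
  (forall j, mfunT (b j)) ->
  forall n (f : seq bool -> R), mfunT (fun x => f (bitword b n x)).
Proof.
move=> mb; elim => [|n IH] f /=; first exact: measurable_cst.
rewrite (_ : (fun x => _) = fun x => if b n x
   then f (true :: bitword b n x) else f (false :: bitword b n x)); last first.
  by apply/funext => x; case: ifP.
apply: measurable_fun_ifT => //.
- exact: (IH (fun s => f (true :: s))).
- exact: (IH (fun s => f (false :: s))).
Qed.

End extra.

Section ultralimit.
Context {R : realType}.
Variables (U : set_system nat) (uU : UltraFilter U).

(** A cluster point exists by compactness, and an ultrafilter converges to any of its cluster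
    points. One ultrafilter serves all cells at once, which replaces a diagonal extraction of
    subsequences. *)
Lemma ultra_bounded_cvg (a : nat -> R) (M : R) :
  (forall k, 0 <= a k <= M) -> exists l : R, a @ U --> l /\ 0 <= l <= M.
Proof.
move=> aM; have PU : ProperFilter U by exact: ultra_proper.
have UI : U (a @^-1` `[0, M]%classic).
  by apply: filterE => k; rewrite /= in_itv/= aM.
have [l [lM cl]] := @segment_compact R 0 M _ (fmap_proper_filter a PU) UI.
exists l; split; last by move: lM; rewrite /= in_itv.
move=> A Al; have [//|UAc] := in_ultra_setVsetC (a @^-1` A) uU.
have [x [/= h1 h2]] := cl _ _ (UAc : (a @ U) (~` A)) Al.
by [].
Qed.

End ultralimit.

(** * Binary digits *)

Section digits.
Context {R : realType}.

(** Iterates of the doubling map modulo 1: [rem2 q] is the remainder after [q] digits, and [dbit q]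
    reads the digit number [q], counted from 0. *)
Fixpoint rem2 q (t : R) : R :=
  if q is p.+1 then 2 * rem2 p t - (2^-1 <= rem2 p t)%R%:R else t.

Definition dbit q (t : R) : bool := 2^-1 <= rem2 q t.

Definition dec (beta : nat -> bool) m : R := \sum_(q < m) (beta q)%:R * 2^-1 ^+ q.+1.

Lemma rem2_itv q t : 0 <= t < 1 -> 0 <= rem2 q t < 1.
Proof.
move=> t01; elim: q => //= q; case: (leP 2^-1 (rem2 q t)) => /= h h2; lra.
Qed.

Lemma dec_dbit m t : t = dec (dbit ^~ t) m + rem2 m t * 2^-1 ^+ m.
Proof.
elim: m => [|m IH]; first by rewrite /dec big_ord0 add0r expr0 mulr1.
rewrite {1}IH /dec big_ord_recr /= -addrA; congr (_ + _).
rewrite /dbit exprS; set r := rem2 m t; set b := (_ <= r)%R%:R; set e := 2^-1 ^+ m.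
by field.
Qed.

Lemma dec_dbit_bound m t : 0 <= t < 1 -> `|dec (dbit ^~ t) m - t| <= 2^-1 ^+ m.
Proof.
move=> t01; rewrite {2}(dec_dbit m t) opprD addrA subrr add0r normrN.
have /andP[r0 r1] := rem2_itv m t01.
have e0 : 0 <= (2^-1 : R) ^+ m by apply: exprn_ge0; rewrite invr_ge0.
by rewrite ger0_norm ?mulr_ge0// ler_piMl// ltW.
Qed.

Lemma sum_pow2 m k : \sum_(m <= q < m + k) (2^-1 : R) ^+ q.+1 = 2^-1 ^+ m - 2^-1 ^+ (m + k).
Proof.
elim: k => [|k IH]; first by rewrite addn0 big_geq// subrr.
rewrite addnS big_nat_recr ?leq_addr//= IH [in RHS]exprS [in LHS]exprS.
by set e := 2^-1 ^+ (m + k); field.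
Qed.

Lemma dec_mono beta m k : dec beta m <= dec beta (m + k) <= dec beta m + 2^-1 ^+ m.
Proof.
have pe q : 0 <= (2^-1 : R) ^+ q by apply: exprn_ge0; rewrite invr_ge0.
rewrite /dec -!(big_mkord xpredT (fun q => (beta q)%:R * 2^-1 ^+ q.+1)).
rewrite (@big_cat_nat _ _ _ m _ (m + k)) ?leq_addr//= lerDl lerD2l; apply/andP; split.
  by apply: sumr_ge0 => i _; exact: mulr_ge0.
apply: (@le_trans _ _ (\sum_(m <= q < m + k) (2^-1 : R) ^+ q.+1)).
  by apply: ler_sum => i _; rewrite ler_piMl// lern1 leq_b1.
by rewrite sum_pow2 gerBl.
Qed.

(** The bits are arbitrary, and a sequence may end in ones only, so the value lies in the closed
    interval from 0 to 1. For this reason the Lipschitz bound on test functions is later required on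
    the closed box. *)
Definition declim (beta : nat -> bool) : R := limn (dec beta).

Lemma cvg_dec beta : dec beta n @[n --> \oo] --> declim beta.
Proof.
apply: nondecreasing_is_cvgn => [m n mn|].
  by rewrite -(subnKC mn); case/andP: (dec_mono beta m (n - m)).
exists 1 => _ [n _ <-]; have /andP[_] := dec_mono beta 0 n.
by rewrite add0n expr0 /dec big_ord0 add0r.
Qed.

Lemma declim_bound beta m : `|dec beta m - declim beta| <= 2^-1 ^+ m.
Proof.
have c : `|dec beta m - dec beta n| @[n --> \oo] --> `|dec beta m - declim beta|.
  by apply: cvg_norm; apply: cvgB; [exact: cvg_cst|exact: cvg_dec].
rewrite -(cvg_lim _ c)//; apply: limr_le; first exact: cvgP c.
near=> n; have mn : (m <= n)%N by near: n; exact: nbhs_infty_ge.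
have := dec_mono beta m (n - m); rewrite subnKC// => /andP[h1 h2].
by rewrite distrC ger0_norm ?subr_ge0// lerBlDl.
Unshelve. all: by end_near. Qed.

Lemma declim_itv beta : 0 <= declim beta <= 1.
Proof.
have := declim_bound beta 0; rewrite /dec big_ord0 expr0 sub0r normrN => h.
have h0 : 0 <= declim beta.
  apply: (@limr_ge _ _ _ _ _ (dec beta)); first by apply: cvgP; exact: cvg_dec.
  by apply: nearW => n; apply: sumr_ge0 => i _; apply: mulr_ge0.
by rewrite h0/=; apply: le_trans h; exact: ler_norm.
Qed.

Lemma dec_itv beta m : 0 <= dec beta m <= 1.
Proof.
have := dec_mono beta 0 m.
have -> : dec beta 0 = 0 by rewrite /dec big_ord0.
by rewrite add0n expr0 add0r.
Qed.

Lemma measurable_rem2 q : mfunT (rem2 q).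
Proof.
elim: q => //= q IH; apply: measurable_funB; first exact: measurable_funM.
rewrite (_ : (fun x => _) = fun x => if 2^-1 <= rem2 q x then 1 else 0); last first.
  by apply/funext => x; case: ifP.
apply: measurable_fun_ifT => //.
exact: (@measurable_fun_ler _ _ _ setT (cst 2^-1) (rem2 q)).
Qed.

Lemma measurable_dbit q : mfunT (dbit q).
Proof.
apply: (@measurable_fun_ler _ _ _ setT (cst 2^-1) (rem2 q)) => //.
exact: measurable_rem2.
Qed.

End digits.

Lemma normr_Rintegral_le {dT} {T : measurableType dT} {R : realType}
    (mu : {measure set T -> \bar R}) (F G : T -> R) :
  mu.-intR F -> mu.-intR G ->
  (forall x, `|F x| <= G x) -> `|\int[mu]_x F x| <= \int[mu]_x G x.
Proof.
move=> iF iG FG; apply: (le_trans (le_normr_Rintegral _ iF)) => //.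
by apply: le_Rintegral => //; exact: (integrable_norm iF).
Qed.

(** * Limits of densities carried by a box *)

Section shell.
Context {R : realType} {d : nat}.
Local Notation V := 'rV[R]_d.
Variables (U : set_system nat) (uU : UltraFilter U).
Variables (h : nat -> V -> R) (L Bd : R).
Hypothesis L_gt0 : 0 < L.
Hypothesis mh : forall k, mfunT (h k).
Hypothesis h_ge0 : forall k x, 0 <= h k x.
Hypothesis h_supp : forall k x, h k x != 0 -> forall i, `|x 0 i| < L.
Hypothesis hB : forall k, (\int[lebm d]_x (h k x)%:E <= Bd%:E)%E.

Let ih k : (lebm d).-intR (h k).
Proof.
by apply: integrable_ge0_lty => //; apply: le_lt_trans (hB k) (ltry _).
Qed.

Let ihB k : \int[lebm d]_x h k x <= Bd.
Proof. by rewrite -lee_fin EFin_Rintegral. Qed.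

Let coordn (x : V) (i : 'I_d) : R := (x 0 i + L) / (2 * L).

(** The digits of the coordinates are interleaved: bit [j] is the digit [j %/ d] of the coordinate
    [j %% d], so that [m * d] bits fix [m] digits of each coordinate. In dimension 0 there is no
    coordinate and all bits are [false]. *)
Let xbit j (x : V) : bool :=
  if (insub (j %% d)%N : option 'I_d) is Some i then dbit (j %/ d) (coordn x i)
  else false.

Let sub_bits (beta : nat -> bool) (i : 'I_d) q := beta (q * d + i)%N.

Let unscale (y : 'I_d -> R) : V := \row_i (L * (2 * y i - 1)).

Let d_gt0 (i : 'I_d) : (0 < d)%N. Proof. exact: leq_ltn_trans (ltn_ord i). Qed.

Let xbitE q (i : 'I_d) x : xbit (q * d + i) x = dbit q (coordn x i).
Proof.
rewrite /xbit modnMDl modn_small// divnMDl ?(d_gt0 i)// divn_small// addn0.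
by rewrite valK.
Qed.

Let m_xbit j : mfunT (xbit j).
Proof.
rewrite /xbit; case: insub => [i|]; last exact: measurable_cst.
apply: (mcomp (measurable_dbit _)).
by apply: measurable_funM => //; apply: measurable_funD => //; exact: measurable_coord.
Qed.

Let unscale_dist (y z : 'I_d -> R) (e : R) : (forall i, `|y i - z i| <= e) ->
  l1 (unscale y - unscale z) <= d%:R * (2 * L * e).
Proof.
move=> yz; rewrite /l1 (_ : d%:R * (2 * L * e) = \sum_(i < d) (2 * L * e)); last first.
  by rewrite sumr_const card_ord mulr_natl.
apply: ler_sum => i _; rewrite !mxE.
rewrite (_ : _ - _ = 2 * L * (y i - z i)); last by ring.
by rewrite normrM ger0_norm ?mulr_ge0 ?(ltW L_gt0)// ler_wpM2l ?mulr_ge0 ?(ltW L_gt0).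
Qed.

Let unscale_box (y : 'I_d -> R) : (forall i, 0 <= y i <= 1) ->
  forall i, `|unscale y 0 i| <= L.
Proof.
move=> y01 i; rewrite mxE normrM (ger0_norm (ltW L_gt0)) ler_piMr ?(ltW L_gt0)//.
by rewrite ler_norml; have := y01 i; lra.
Qed.

Let coordnK x : unscale (coordn x) = x.
Proof.
apply/rowP => i; rewrite mxE /coordn; field.
by rewrite gt_eqF.
Qed.

Let coordn_itv (x : V) i : `|x 0 i| < L -> 0 <= coordn x i < 1.
Proof.
rewrite ltr_norml => /andP[h1 h2]; have L2 : 0 < 2 * L by rewrite mulr_gt0.
by rewrite /coordn divr_ge0/= ?ltr_pdivrMr//; [lra|lra|exact: ltW].
Qed.

Let cell n (s : seq bool) (x : V) : R := (bitword xbit n x == s)%:R.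

Let m_cell n s : mfunT (cell n s).
Proof. exact: (measurable_bitword m_xbit n (fun w => (w == s)%:R)). Qed.

Let cell_ge0 n s x : 0 <= cell n s x. Proof. exact: ler0n. Qed.

Let cell_le1 n s x : cell n s x <= 1. Proof. by rewrite /cell lern1 leq_b1. Qed.

Let i_cell n s k : (lebm d).-intR (fun x => cell n s x * h k x).
Proof.
apply: (integrable_le _ _ (ih k)); first exact: measurable_funM.
by move=> x; rewrite ger0_norm ?mulr_ge0// ler_piMl.
Qed.

Let mass k s := \int[lebm d]_x (cell (size s) s x * h k x).

Let mass_itv s k : 0 <= mass k s <= Bd.
Proof.
rewrite /mass Rintegral_ge0//=; last by move=> x _; rewrite mulr_ge0.
apply: le_trans (ihB k); apply: le_Rintegral => // x _.
by rewrite ler_piMl.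
Qed.

Let mass_split k s : mass k s = mass k (false :: s) + mass k (true :: s).
Proof.
rewrite /mass -RintegralD//; congr Rintegral; apply/funext => x.
rewrite -mulrDl; congr (_ * _); rewrite /cell /= !eqseq_cons.
by case: (xbit _ _); rewrite /= ?addr0 ?add0r.
Qed.

Let sum_mass n (f : seq bool -> R) k : \sum_(s <- words n) f s * mass k s =
  \int[lebm d]_x (f (bitword xbit n x) * h k x).
Proof.
transitivity (\int[lebm d]_x \sum_(s <- words n) f s * (cell n s x * h k x)).
  rewrite Rintegral_sum_seq; last by move=> s; exact: intgbZ.
  rewrite big_seq [RHS]big_seq; apply: eq_bigr => s /size_words sn.
  by rewrite RintegralZl// /mass sn.
congr Rintegral; apply/funext => x; rewrite -(sum_words xbit n x f) mulr_suml.
by apply: eq_bigr => s _; rewrite mulrA.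
Qed.

Let i_word n (f : seq bool -> R) k :
  (lebm d).-intR (fun x => f (bitword xbit n x) * h k x).
Proof.
rewrite (_ : (fun x => _) = (fun x => \sum_(s <- words n) f s * (cell n s x * h k x))).
  by apply: integrable_sum_seq => s; exact: intgbZ.
apply/funext => x; rewrite -(sum_words xbit n x f) mulr_suml.
by apply: eq_bigr => s _; rewrite mulrA.
Qed.

Let PU : ProperFilter U. Proof. exact: ultra_proper. Qed.

Let ell s : R := sval (cid (ultra_bounded_cvg uU (mass_itv s))).

Let cvg_ell s : (mass ^~ s) @ U --> ell s.
Proof. by rewrite /ell; case: cid => /= l []. Qed.

Let ell_itv s : 0 <= ell s <= Bd.
Proof. by rewrite /ell; case: cid => /= l []. Qed.

Let ell_ge0 s : 0 <= ell s. Proof. by case/andP: (ell_itv s). Qed.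

(** At a fixed stage the masses split over the two children, and the identity passes to the
    ultralimit. The limits therefore label a tree, although they need not be the masses that the
    limit measure gives to the half-open cells. *)
Let ell_split s : ell s = ell (false :: s) + ell (true :: s).
Proof.
have c : (mass ^~ s) @ U --> ell (false :: s) + ell (true :: s).
  rewrite (_ : mass ^~ s = fun k => mass k (false :: s) + mass k (true :: s)).
    by apply: cvgD; exact: cvg_ell.
  by apply/funext => k; exact: mass_split.
have PF : ProperFilter ((mass ^~ s) @ U) by exact: fmap_proper_filter.
exact: (cvg_unique (@Rhausdorff R) (@cvg_ell s) c).
Qed.

Let I : set (measurableTypeR R) := `[0, ell [::][%classic.
Let mI : measurable I. Proof. exact: measurable_itv. Qed.

Let tbit := treebit ell.

Let Xl (u : measurableTypeR R) : V := unscale (fun i => declim (sub_bits (tbit ^~ u) i)).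

Let mXl : mfunT Xl.
Proof.
apply: measurable_fun_rV => i.
under eq_fun do rewrite mxE.
apply: measurable_funM => //; apply: measurable_funB => //; apply: measurable_funM => //.
apply: (@measurable_fun_cvg _ _ _ _ (fun m u => dec (sub_bits (tbit ^~ u) i) m)); last first.
  by move=> u _; exact: cvg_dec.
move=> m; apply: measurable_sum => q; apply: measurable_funM => //.
rewrite (_ : (fun x => _) = fun x => if tbit (q * d + i) x then 1 else 0); last first.
  by apply/funext => x; rewrite /sub_bits; case: ifP.
by apply: measurable_fun_ifT => //; exact: measurable_treebit.
Qed.

Definition shell_measure : {measure set V -> \bar R} := pushm (mrestr leb1 mI) mXl.

Let I_fin : leb1 I = (ell [::])%:E.
Proof.
rewrite /leb1/= /I lebesgue_measure_itv/= lte_fin.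
case: ifP => [_|]; first by rewrite -EFinB subr0.
by move=> /negbT; rewrite -leNgt => h0; congr EFin; apply/eqP; rewrite eq_le ell_ge0 h0.
Qed.

Let int_I : (\int[leb1]_u (\1_I u)%:E = (ell [::])%:E)%E.
Proof. by rewrite integral_indic// setIT; exact: I_fin. Qed.

Section test.
Variables (phi : V -> R) (M K : R).
Hypothesis mphi : mfunT phi.
Hypothesis phi_itv : forall x, 0 <= phi x <= M.
Hypothesis K_ge0 : 0 <= K.
Hypothesis phi_lip : forall x y : V, (forall i, `|x 0 i| <= L) ->
  (forall i, `|y 0 i| <= L) -> `|phi x - phi y| <= K * l1 (x - y).

(** Value of [phi] at the lower corner of the cell, read from the first [m] digits of each
    coordinate; [rev] restores the order of the bits. *)
Let fm m (s : seq bool) : R :=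
  phi (unscale (fun i => dec (sub_bits (nth false (rev s)) i) m)).

(** Bounds the oscillation of [phi] over a cell with [m] digits per coordinate, whose sides have
    length [2 L / 2^m]. *)
Let eta m : R := K * (d%:R * (2 * L * 2^-1 ^+ m)).

Let eta_ge0 m : 0 <= eta m.
Proof.
by rewrite /eta !mulr_ge0 ?(ltW L_gt0)//.
Qed.

Let fmE (X : Type) (b : nat -> X -> bool) m (x : X) :
  fm m (bitword b (m * d) x) = phi (unscale (fun i => dec (sub_bits (b ^~ x) i) m)).
Proof.
rewrite /fm; congr (phi (unscale _)); apply/funext => i; apply: eq_bigr => q _.
congr (_%:R * _); rewrite /sub_bits nth_bitword//.
have := ltn_ord i; have := ltn_ord q; move: (nat_of_ord q) (nat_of_ord i) => a c am cd.
by apply: (@leq_trans (a.+1 * d)); [rewrite mulSn addnC ltn_add2r|rewrite leq_mul2r am orbT].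
Qed.

Let i_phi k : (lebm d).-intR (fun x => phi x * h k x).
Proof.
apply: (integrable_le _ _ (intgbZ M (ih k))).
  exact: measurable_funM.
move=> x; have /andP[p0 pM] := phi_itv x.
by rewrite ger0_norm ?mulr_ge0// ler_wpM2r.
Qed.

Let err1 m k : `|\int[lebm d]_x (phi x * h k x) -
  \sum_(s <- words (m * d)) fm m s * mass k s| <= eta m * Bd.
Proof.
rewrite sum_mass -RintegralB//.
apply: (@le_trans _ _ (\int[lebm d]_x (eta m * h k x))); last first.
  by rewrite RintegralZl// ler_wpM2l.
apply: normr_Rintegral_le.
- exact: integrable_sub.
- exact: intgbZ.
move=> x; rewrite -mulrBl normrM (ger0_norm (h_ge0 _ _)).
have [->|hx] := eqVneq (h k x) 0; first by rewrite !mulr0.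
rewrite ler_wpM2r// fmE.
have xL := h_supp hx.
have xI i : 0 <= coordn x i < 1 by exact: coordn_itv.
rewrite -{1}[x]coordnK; apply: (le_trans (phi_lip _ _)).
- by apply: unscale_box => i; have /andP[-> /ltW ->] := xI i.
- by apply: unscale_box => i; exact: dec_itv.
rewrite ler_wpM2l//; apply: unscale_dist => i.
rewrite distrC (_ : dec _ _ = dec (dbit ^~ (coordn x i)) m); first exact: dec_dbit_bound.
by apply: eq_bigr => q _; rewrite /sub_bits xbitE.
Qed.

Let iI : leb1.-intR (\1_I : R -> R).
Proof.
apply: (@integrable_ge0_lty _ _ _ leb1).
- exact: measurable_indic.
- by move=> x; rewrite indicE.
- by rewrite int_I ltry.
Qed.

Let mphiX : mfunT (fun u => phi (Xl u)).
Proof. exact: (mcomp mphi mXl). Qed.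

Let i_lim : leb1.-intR (fun u => \1_I u * phi (Xl u)).
Proof.
apply: (@integrable_le _ _ _ leb1 _ (fun u => M * \1_I u)).
- by apply: measurable_funM => //; exact: measurable_indic.
- move=> u; have /andP[p0 pM] := phi_itv (Xl u).
  by rewrite mulrC ger0_norm ?mulr_ge0 ?ler_wpM2r ?indicE.
- exact: intgbZ.
Qed.

Let integral_shell_E :
  (\int[shell_measure]_x (phi x)%:E = (\int[leb1]_u (\1_I u * phi (Xl u)))%:E)%E.
Proof.
have p0 x : (0 <= (phi x)%:E)%E by rewrite lee_fin; case/andP: (phi_itv x).
rewrite /shell_measure ge0_integral_pushm//; last exact: measurable_EFin.
rewrite ge0_integral_mrestr//; last exact: (measurable_EFin mphiX).
rewrite EFin_Rintegral// integral_mkcond; apply: eq_integral => u _.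
by rewrite patchE indicE; case: ifP => _; rewrite ?mul1r ?mul0r.
Qed.

Let err2 m : `|\int[leb1]_u (\1_I u * phi (Xl u)) -
  \sum_(s <- words (m * d)) fm m s * ell s| <= eta m * Bd.
Proof.
rewrite -(integral_tree ell_ge0 ell_split).
have i_fm : leb1.-intR (fun u => \1_I u * fm m (treeword ell (m * d) u)).
  apply: (@integrable_le _ _ _ leb1 _ (fun u => M * \1_I u)).
  - apply: measurable_funM; first exact: measurable_indic.
    under eq_fun do rewrite treewordE.
    exact: (measurable_bitword (measurable_treebit ell)).
  - move=> u; have /andP[p0 pM] := phi_itv (unscale (fun i => dec (sub_bits (nth false (rev (treeword ell (m * d) u))) i) m)).
    by rewrite mulrC ger0_norm ?mulr_ge0 ?ler_wpM2r ?indicE.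
  - exact: intgbZ.
rewrite -(@RintegralB _ _ _ leb1)//.
apply: (@le_trans _ _ (\int[leb1]_u (eta m * \1_I u))); last first.
  rewrite (@RintegralZl _ _ _ leb1)// ler_wpM2l//.
  by rewrite /Rintegral int_I/=; case/andP: (ell_itv [::]).
apply: (@normr_Rintegral_le _ _ _ leb1).
- exact: (@integrable_sub _ _ _ leb1).
- exact: (@intgbZ _ _ _ leb1).
move=> u; have I0 : 0 <= \1_I u :> R by rewrite indicE.
rewrite -[X in X * fm _ _]/(\1_I u) -mulrBr normrM mulrC (ger0_norm I0) ler_wpM2r//.
rewrite treewordE fmE; apply: (le_trans (phi_lip _ _)).
- by apply: unscale_box => i; exact: declim_itv.
- by apply: unscale_box => i; exact: dec_itv.
rewrite ler_wpM2l//; apply: unscale_dist => i; rewrite distrC; exact: declim_bound.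
Qed.

(** Both integrals are within [eta m * Bd] of finite sums over cells, uniformly in [k] ([err1] and
    [err2]), and for fixed [m] these sums converge along [U] by the choice of [ell]. *)
Lemma cvg_shell : (fun k => \int[lebm d]_x (phi x * h k x)) @ U -->
   fine (\int[shell_measure]_x (phi x)%:E)%E.
Proof.
rewrite integral_shell_E /=; set J := Rintegral _ _ _.
have Bd_ge0 : 0 <= Bd by case/andP: (ell_itv [::]) => a b; exact: le_trans b.
apply/cvgrPdist_lt => e e0.
have ceta : (eta m * Bd) @[m --> \oo] --> (0 : R).
  rewrite (_ : (fun m => _) = (fun m => K * (d%:R * (2 * L)) * Bd * 2^-1 ^+ m)); last first.
    by apply/funext => m; rewrite /eta; ring.
  rewrite -[X in _ --> X](mulr0 (K * (d%:R * (2 * L)) * Bd)); apply: cvgM; first exact: cvg_cst.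
  by apply: cvg_expr; rewrite ger0_norm ?invr_ge0// invf_lt1// ltr1n.
have [m em] : exists m, eta m * Bd < e / 3.
  have /cvgrPdist_lt/(_ (e / 3)) := ceta; rewrite divr_gt0// => /(_ isT)[m _ Hm].
  exists m; have := Hm m (leqnn _); rewrite /= sub0r normrN.
  by apply: le_lt_trans; exact: ler_norm.
have cs : (fun k => \sum_(s <- words (m * d)) fm m s * mass k s) @ U -->
    \sum_(s <- words (m * d)) fm m s * ell s.
  elim: (words _) => [|s ws IH].
    by rewrite big_nil; under eq_fun do rewrite big_nil; exact: cvg_cst.
  rewrite big_cons; under eq_fun do rewrite big_cons.
  by apply: cvgD => //; apply: cvgM; [exact: cvg_cst|exact: cvg_ell].
have e3 : 0 < e / 3 by rewrite divr_gt0.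
have /cvgrPdist_lt/(_ _ e3) H := cs.
apply: filterS H => k Hk.
have := err1 m k; have := err2 m; move: Hk; rewrite -/J.
move: em; set a := \int[lebm d]_x _; set b := \sum_(s <- _) fm m s * mass k s.
set c := \sum_(s <- _) _; set E := eta m * Bd.
by rewrite !ltr_norml !ler_norml; lra.
Qed.

Lemma shell_lty : (\int[shell_measure]_x (phi x)%:E < +oo)%E.
Proof. by rewrite integral_shell_E ltry. Qed.

End test.
End shell.

Lemma expRN_cvg0 {R : realType} (c : R) : 0 < c ->
  expR (- (c * n%:R)) @[n --> \oo] --> (0 : R).
Proof.
move=> c0; rewrite (_ : (fun n => _) = (fun n => expR (- c) ^+ n)); last first.
  by apply/funext => n; rewrite -expRM_natr mulNr.
by apply: cvg_expr; rewrite ger0_norm ?expR_ge0// expR_lt1 oppr_lt0.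
Qed.

Lemma cvg_le_lim {R : realType} (F : set_system nat) (PF : ProperFilter F)
    (f g : nat -> R) (l m : R) : f @ F --> l -> g @ F --> m ->
  (forall n, f n <= g n) -> l <= m.
Proof.
move=> fl gm fg; rewrite leNgt; apply/negP => ml.
have e0 : 0 < (l - m) / 2 by rewrite divr_gt0// subr_gt0.
have /cvgrPdist_lt/(_ _ e0) H1 := fl.
have /cvgrPdist_lt/(_ _ e0) H2 := gm.
have [n []] := filter_ex (filterI H1 H2).
by have := fg n; rewrite /= !ltr_norml; lra.
Qed.

(** * Vague limits on R^d as sums over shells *)

Section vague.
Context {R : realType} {d : nat}.
Local Notation V := 'rV[R]_d.
Variable H : nat -> V -> R.
Hypothesis mH : forall n, mfunT (H n).
Hypothesis H_ge0 : forall n x, 0 <= H n x.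
Variable B : R -> R.
Hypothesis HB : forall e n, 0 < e ->
  (\int[lebm d]_x (gaussn e x * H n x)%:E <= (B e)%:E)%E.

(** On a shell in the squared norm [gaussn 1] is bounded below by a positive constant, so the
    Gaussian bound [HB] controls the mass of [H n] there; and a shell fits into a box. *)
Let A (N : nat) : set V := [set x | N%:R <= dotv x x < N.+1%:R].

Let mA N : measurable (A N).
Proof.
rewrite (_ : A N = (fun x => dotv x x) @^-1` `[N%:R, N.+1%:R[%classic); last first.
  by apply/seteqP; split => x; rewrite /A/= in_itv.
by rewrite -[X in measurable X]setTI; apply: measurable_dotv_id.
Qed.

Let h N n (x : V) : R := \1_(A N) x * H n x.

Let mh N n : mfunT (h N n).
Proof. by apply: measurable_funM => //; exact: measurable_indic. Qed.

Let h_ge0 N n x : 0 <= h N n x.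
Proof. by rewrite mulr_ge0// indicE. Qed.

Let h_supp N n x : h N n x != 0 -> forall i, `|x 0 i| < N.+1%:R.
Proof.
rewrite /h indicE; case: (boolP (x \in A N)); last by rewrite mul0r eqxx.
rewrite inE => /andP[_ xN] _ i.
rewrite -(@ltr_pXn2r _ 2)// ?nnegrE// real_normK ?num_real//.
have xi : x 0 i ^+ 2 <= dotv x x.
  rewrite /dotv (bigD1 i)//= expr2 lerDl; apply: sumr_ge0 => j _.
  by rewrite -expr2 sqr_ge0.
apply: (le_lt_trans xi); apply: (lt_le_trans xN).
by rewrite expr2 ler_peMr// ler1n.
Qed.

Let ig e n : 0 < e -> (lebm d).-intR (fun x => gaussn e x * H n x).
Proof.
move=> e0; apply: integrable_ge0_lty.
- by apply: measurable_funM => //; exact: measurable_gaussn.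
- by move=> x; rewrite mulr_ge0// gaussn_ge0.
- exact: le_lt_trans (HB n e0) (ltry _).
Qed.

Let igB e n : 0 < e -> \int[lebm d]_x (gaussn e x * H n x) <= B e.
Proof. by move=> e0; rewrite -lee_fin EFin_Rintegral ?HB//; exact: ig. Qed.

Let hB N n : (\int[lebm d]_x (h N n x)%:E <= (expR (N.+1%:R / 2) * B 1)%:E)%E.
Proof.
have N0 : 0 <= expR (N.+1%:R / 2) :> R by exact: expR_ge0.
apply: (@le_trans _ _ (\int[lebm d]_x (expR (N.+1%:R / 2) * (gaussn 1 x * H n x))%:E)%E).
  apply: ge0_le_integral => //.
  - by move=> x _; rewrite lee_fin.
  - exact/measurable_EFinP.
  - apply/measurable_EFinP/measurable_funM => //; apply: measurable_funM => //.
    exact: measurable_gaussn.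
  - move=> x _; rewrite lee_fin mulrA /h ler_wpM2r//.
    rewrite indicE; case: (boolP (x \in A N)) => /=; last first.
      by rewrite mulr_ge0 ?expR_ge0 ?gaussn_ge0.
    rewrite inE => /andP[_ xN]; rewrite /gaussn -expRD mul1r -{1}(@expR0 R) ler_expR.
    by rewrite subr_ge0 ler_wpM2r// ltW.
rewrite -EFin_Rintegral; last by apply: intgbZ; exact: ig.
by rewrite lee_fin RintegralZl// ?ler_wpM2l ?igB//; exact: ig.
Qed.

Let U_ex := ultraFilterLemma (F := \oo : set_system nat) _.
Let U := sval (cid U_ex).
Let uU : UltraFilter U. Proof. by rewrite /U; case: cid => ? []. Qed.
Let Uoo : \oo `<=` U. Proof. by rewrite /U; case: cid => ? []. Qed.
Let PU : ProperFilter U. Proof. exact: ultra_proper. Qed.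

Let betaN N : {measure set V -> \bar R} :=
  @shell_measure R d U uU (h N) N.+1%:R (expR (N.+1%:R / 2) * B 1)
    (mh N) (h_ge0 N) (hB N).

(** The limit of a shell may put mass on the boundary of the shell, and the neighbouring limit may
    charge it too. Only the sum of the integrals matters: for a test function it is the limit of the
    integrals over the whole space. *)
Definition vague_limit : {measure set V -> \bar R} := mseries betaN 0.

Section test.
Variables (phi : V -> R) (C e l : R).
Hypothesis mphi : mfunT phi.
Hypothesis phi_ge0 : forall x, 0 <= phi x.
Hypothesis e_gt0 : 0 < e.
Hypothesis phi_le : forall x, phi x <= C * gaussn e x.
Hypothesis phi_lip : forall L : R, 0 < L -> exists2 K, 0 <= K &
  forall x y : V, (forall i, `|x 0 i| <= L) -> (forall i, `|y 0 i| <= L) ->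
    `|phi x - phi y| <= K * l1 (x - y).
Hypothesis phi_cvg : (\int[lebm d]_x (phi x * H n x)) @[n --> \oo] --> l.

Let C_ge0 : 0 <= C.
Proof.
have := le_trans (phi_ge0 0) (phi_le 0).
by rewrite pmulr_lge0// gaussn_gt0.
Qed.

Let phi_itv x : 0 <= phi x <= C.
Proof.
rewrite phi_ge0/=; apply: (le_trans (phi_le x)); rewrite ler_piMr//.
by rewrite /gaussn expR_le1 oppr_le0 divr_ge0// mulr_ge0 ?dotv_ge0// ltW.
Qed.

Let i_phi n : (lebm d).-intR (fun x => phi x * H n x).
Proof.
apply: (integrable_le _ _ (intgbZ C (ig n e_gt0))).
  exact: measurable_funM.
by move=> x; rewrite ger0_norm ?mulr_ge0// mulrA ler_wpM2r.
Qed.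

Let a N n := \int[lebm d]_x (phi x * h N n x).

Let al N := fine (\int[betaN N]_x (phi x)%:E)%E.

Let cvg_a N : (a N) @ U --> al N.
Proof.
have [K K0 HK] := phi_lip (ltr0Sn R N).
exact: (@cvg_shell _ _ _ uU _ _ _ (ltr0Sn R N) (mh N) (h_ge0 N) (@h_supp N) (hB N) _ _ _ mphi phi_itv K0 HK).
Qed.

Let alE N : (\int[betaN N]_x (phi x)%:E = (al N)%:E)%E.
Proof.
rewrite fineK// ge0_fin_numE; last by apply: integral_ge0 => x _; rewrite lee_fin.
exact: (shell_lty uU _ (mh N) (h_ge0 N) (hB N) mphi phi_itv).
Qed.

Let i_a N n : (lebm d).-intR (fun x => phi x * h N n x).
Proof.
apply: (integrable_le _ _ (i_phi n)); first exact: measurable_funM.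
by move=> x; rewrite ger0_norm ?mulr_ge0// /h ler_wpM2l// ler_piMl.
Qed.

(** Uniform bound on the integral beyond [dotv x x = M]: there one half of the exponent of
    [gaussn e] gives at most [exp (- e M / 4)], and the other half is integrated by [HB] at
    [e / 2]. *)
Let eps M := C * expR (- (e / 4 * M%:R)) * B (e / 2).

Let sumA M x : \sum_(0 <= N < M) (\1_(A N) x : R) = (dotv x x < M%:R)%R%:R.
Proof.
elim: M => [|M IH]; first by rewrite big_geq// ltNge dotv_ge0.
rewrite big_nat_recr//= IH indicE.
case: (ltP (dotv x x) M%:R) => xM.
  rewrite memNset ?addr0; last by rewrite /A/= => /andP[]; rewrite leNgt xM.
  by rewrite (lt_trans xM)// ltr_nat.
rewrite add0r; case: (ltP (dotv x x) M.+1%:R) => xM1.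
  by rewrite mem_set//= /A/= xM xM1.
by rewrite memNset//= /A/= => /andP[_]; rewrite ltNge xM1.
Qed.

Let partial M n : \int[lebm d]_x (phi x * H n x) - eps M <=
  \sum_(0 <= N < M) a N n <= \int[lebm d]_x (phi x * H n x).
Proof.
have e2 : 0 < e / 2 by rewrite divr_gt0.
rewrite /a -Rintegral_sum_seq//.
have E x : \sum_(0 <= N < M) phi x * h N n x = phi x * H n x * (dotv x x < M%:R)%R%:R.
  by rewrite -sumA mulr_sumr; apply: eq_bigr => N _; rewrite /h; ring.
have iS := integrable_sum_seq (index_iota 0 M) (fun N => @i_a N n).
apply/andP; split; last first.
  apply: le_Rintegral => // x _; rewrite E ler_piMr ?mulr_ge0//.
  by rewrite lern1 leq_b1.
rewrite lerBlDr -lerBlDl -RintegralB//.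
pose g x := C * expR (- (e / 4 * M%:R)) * (gaussn (e / 2) x * H n x).
have i_g : (lebm d).-intR g by apply: intgbZ; exact: ig.
apply: (@le_trans _ _ (\int[lebm d]_x g x)); last first.
  rewrite RintegralZl//; last exact: ig.
  by rewrite /eps ler_wpM2l ?mulr_ge0 ?expR_ge0// igB.
apply: le_Rintegral => //; first exact: integrable_sub.
move=> x _; rewrite E -{1}[phi x * _]mulr1 -mulrBr.
case: ltP => xM; first by rewrite subrr mulr0 /g !mulr_ge0// ?expR_ge0 ?gaussn_ge0.
rewrite subr0 mulr1 /g mulrA ler_wpM2r//; apply: (le_trans (phi_le x)).
rewrite -mulrA ler_wpM2l// /gaussn -expRD ler_expR.
rewrite -opprD lerN2; have := ler_wpM2l (ltW e_gt0) xM; lra.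
Qed.

(** Finitely many shells can be exchanged with the limit along [U], and [eps M], independent of [n],
    controls the others. Since [U] refines the filter at infinity, the value is the ordinary limit
    [l], whatever the ultrafilter. *)
Lemma integral_vague_limit : (\int[vague_limit]_x (phi x)%:E = l%:E)%E.
Proof.
rewrite /vague_limit ge0_integral_measure_series//; last 2 first.
- by move=> x _; rewrite lee_fin.
- exact: measurable_EFin.
under eq_eseriesr do rewrite alE.
have FU : Filter U by exact: (@filter_filter _ _ PU).
have phiU : (fun n => \int[lebm d]_x (phi x * H n x)) @ U --> l.
  by move=> X /phi_cvg /Uoo.
have sal M : (fun n => \sum_(0 <= N < M) a N n) @ U --> \sum_(0 <= N < M) al N.
  elim: M => [|M IH].
    rewrite [X in _ --> X]big_geq// (_ : (fun n => _) = cst 0); first exact: (@cvg_cst R 0 nat U FU).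
    by apply/funext => n; rewrite big_geq.
  rewrite [X in _ --> X]big_nat_recr//=.
  rewrite (_ : (fun n => _) = fun n => \sum_(0 <= N < M) a N n + a M n).
    by apply: cvgD => //; exact: cvg_a.
  by apply/funext => n; rewrite big_nat_recr.
have lim_itv M : l - eps M <= \sum_(0 <= N < M) al N <= l.
  apply/andP; split.
    have c : (fun n => \int[lebm d]_x (phi x * H n x) - eps M) @ U --> l - eps M.
      by apply: cvgB => //; exact: cvg_cst.
    by apply: (cvg_le_lim PU c (@sal M)) => n; case/andP: (partial M n).
  by apply: (cvg_le_lim PU (@sal M) phiU) => n; case/andP: (partial M n).
have ceps : eps M @[M --> \oo] --> (0 : R).
  rewrite (_ : eps = fun M => C * B (e / 2) * expR (- (e / 4 * M%:R))); last first.
    by apply/funext => M; rewrite /eps; ring.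
  rewrite -[X in _ --> X](mulr0 (C * B (e / 2))); apply: cvgM; first exact: cvg_cst.
  by apply: expRN_cvg0; rewrite divr_gt0.
have cs : \sum_(0 <= N < M) al N @[M --> \oo] --> l.
  apply: (squeeze_cvgr (f := fun M => l - eps M) (h := cst l)).
  - exact: nearW.
  - by rewrite -[X in _ --> X]subr0; apply: cvgB => //; exact: cvg_cst.
  - exact: cvg_cst.
apply/cvg_lim => //.
rewrite (_ : (fun n => _) = (fun n => (\sum_(0 <= N < n) al N)%:E)).
  by apply: cvg_EFin => //; exact: nearW.
by apply/funext => n; rewrite sumEFin.
Qed.

End test.
End vague.

(** * Local Lipschitz bounds *)

Section lipschitz.
Context {R : realType}.

Lemma is_derive_bound_lip (f df : R -> R) : (forall x : R, is_derive x 1 f (df x)) ->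
  (forall x, `|df x| <= 1) -> forall a b, `|f a - f b| <= `|a - b|.
Proof.
move=> fd dfb.
suff H a b : a <= b -> `|f b - f a| <= `|b - a|.
  move=> a b; case: (leP a b) => [ab|/ltW ba]; last exact: H.
  by rewrite distrC [leRHS]distrC; exact: H.
move=> ab; have [|c _ ->] := @MVT_segment R f df a b ab (fun x _ => fd x).
  apply: continuous_subspaceT => x.
  by apply/differentiable_continuous/derivable1_diffP.
by rewrite normrM ler_piMl.
Qed.

Lemma cos_lip (a b : R) : `|cos a - cos b| <= `|a - b|.
Proof.
apply: (is_derive_bound_lip (df := fun x => - sin x)) => x.
by rewrite normrN normr_sin_le1.
Qed.

Lemma sin_lip (a b : R) : `|sin a - sin b| <= `|a - b|.
Proof.
by apply: (is_derive_bound_lip (df := fun x => cos x)) => x; exact: normr_cos_le1.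
Qed.

Lemma expRN_lip (a b : R) : 0 <= a -> 0 <= b -> `|expR (- a) - expR (- b)| <= `|a - b|.
Proof.
suff H (x y : R) : 0 <= x -> x <= y -> `|expR (- x) - expR (- y)| <= `|x - y|.
  move=> a0 b0; case: (leP a b) => [|/ltW] ab; first exact: H.
  by rewrite distrC [leRHS]distrC; exact: H.
move=> x0 xy; rewrite ger0_norm ?subr_ge0 ?ler_expR ?lerN2//.
rewrite distrC ger0_norm ?subr_ge0//.
rewrite (_ : expR (- y) = expR (- x) * expR (- (y - x))); last first.
  by rewrite -expRD; congr expR; ring.
rewrite -{1}[expR (- x)]mulr1 -mulrBr.
have h : 1 - expR (- (y - x)) <= y - x by have := expR_ge1Dx (- (y - x)); lra.
apply: (le_trans _ h); rewrite ler_piMl ?expR_le1 ?oppr_le0//.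
by rewrite subr_ge0 expR_le1 oppr_le0 subr_ge0.
Qed.

Definition loclip {d} (phi : 'rV[R]_d -> R) := forall L : R, 0 < L ->
  exists2 K, 0 <= K & forall x y : 'rV[R]_d, (forall i, `|x 0 i| <= L) ->
    (forall i, `|y 0 i| <= L) -> `|phi x - phi y| <= K * l1 (x - y).

Context {d : nat}.
Implicit Types phi psi : 'rV[R]_d -> R.

Lemma normr_dotv_le (z x : 'rV[R]_d) (c : R) : (forall i, `|z 0 i| <= c) ->
  `|dotv z x| <= c * l1 x.
Proof.
move=> zc; rewrite /dotv /l1 mulr_sumr.
apply: (le_trans (ler_norm_sum _ _ _)); apply: ler_sum => i _.
by rewrite normrM ler_wpM2r.
Qed.

Lemma normr_coord_le (x : 'rV[R]_d) i : `|x 0 i| <= l1 x.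
Proof. by rewrite /l1 (bigD1 i)//= lerDl; exact: sumr_ge0. Qed.

Lemma normr_dotv_l1 (z x : 'rV[R]_d) : `|dotv z x| <= l1 z * l1 x.
Proof. by apply: normr_dotv_le => i; exact: normr_coord_le. Qed.

Lemma loclip_comp_dotv (f : R -> R) (z : 'rV[R]_d) :
  (forall a b, `|f a - f b| <= `|a - b|) -> loclip (fun x => f (dotv z x)).
Proof.
move=> fl L L0; exists (l1 z); first exact: l1_ge0.
move=> x y _ _; apply: (le_trans (fl _ _)); rewrite -dotvBr.
exact: normr_dotv_l1.
Qed.

Lemma loclip_gaussn a : 0 <= a -> loclip (@gaussn R d a).
Proof.
move=> a0 L L0; exists (a * L); first by rewrite mulr_ge0// ltW.
move=> x y xL yL; rewrite /gaussn.
apply: (le_trans (expRN_lip _ _)).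
- by rewrite divr_ge0// mulr_ge0// dotv_ge0.
- by rewrite divr_ge0// mulr_ge0// dotv_ge0.
rewrite (_ : _ - _ = a / 2 * dotv (x + y) (x - y)); last first.
  by rewrite dotvDl !dotvBr (dotvC y x); ring.
rewrite normrM ger0_norm ?divr_ge0//.
rewrite (_ : a * L * l1 (x - y) = a / 2 * (2 * L * l1 (x - y))); last by field.
rewrite ler_wpM2l ?divr_ge0//; apply: normr_dotv_le => i.
rewrite mxE; apply: (le_trans (ler_normD _ _)).
by rewrite mulr_natl mulr2n lerD.
Qed.

Lemma loclip_mul phi psi (M : R) : loclip phi -> loclip psi ->
  (forall x, `|phi x| <= M) -> (forall x, `|psi x| <= M) ->
  loclip (fun x => phi x * psi x).
Proof.
move=> hp hq pM qM L L0; have [K K0 HK] := hp L L0; have [K' K'0 HK'] := hq L L0.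
have M0 : 0 <= M by apply: le_trans (pM 0).
exists (M * (K + K')); first by rewrite mulr_ge0// addr_ge0.
move=> x y xL yL.
rewrite (_ : _ - _ = phi x * (psi x - psi y) + (phi x - phi y) * psi y); last by ring.
apply: (le_trans (ler_normD _ _)); rewrite !normrM.
rewrite mulrDr mulrDl addrC lerD//.
  by rewrite mulrC -mulrA ler_pM// HK.
by rewrite -mulrA ler_pM// HK'.
Qed.

Lemma loclip_1D phi : loclip phi -> loclip (fun x => 1 + phi x).
Proof.
move=> hp L L0; have [K K0 HK] := hp L L0; exists K => // x y xL yL.
by rewrite opprD addrACA subrr add0r HK.
Qed.

End lipschitz.

(** * Gaussians against exponential weights *)

Section gauss_rho.
Context {R : realType} {d : nat}.
Local Notation V := 'rV[R]_d.

(** Completing the square in each coordinate: [t <= a t^2 / 2 + 1 / (2 a)], and the constants add up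
    to [d / (2 a)]. *)
Lemma gaussn_le_rho (a : R) (x : V) : 0 < a ->
  gaussn a x <= expR (d%:R / (2 * a)) * rho 1 x.
Proof.
move=> a0; rewrite /gaussn /rho -expRD ler_expR mul1r.
suff : l1 x <= a * dotv x x / 2 + d%:R / (2 * a) by lra.
rewrite (_ : d%:R / (2 * a) = \sum_(i < d) (2 * a)^-1); last first.
  by rewrite sumr_const card_ord mulr_natl.
rewrite /l1 /dotv mulr_sumr mulr_suml -big_split/=; apply: ler_sum => i _.
rewrite -expr2 -real_normK ?num_real//; set t := `|_|.
rewrite -subr_ge0 (_ : _ - _ = (2 * a)^-1 * (a * t - 1) ^+ 2); last first.
  by field; rewrite gt_eqF.
by rewrite mulr_ge0 ?sqr_ge0// invr_ge0 mulr_ge0// ltW.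
Qed.

Lemma rho_shift_le c (x z : V) : 0 <= c -> rho c (x - z) <= expR (c * l1 z) * rho c x.
Proof.
move=> c0; rewrite /rho -expRD ler_expR -mulrBr -mulrN ler_wpM2l//.
by rewrite lerBrDl addrC -lerBrDl opprK addrC; have := l1D (x - z) z; rewrite subrK.
Qed.

Lemma gaussn_shift_le (a : R) (x z : V) : 0 < a ->
  gaussn a (x - z) <= expR (d%:R / (2 * a)) * expR (l1 z) * rho 1 x.
Proof.
move=> a0; apply: (le_trans (gaussn_le_rho _ a0)); rewrite -mulrA.
rewrite ler_wpM2l ?expR_ge0//.
by apply: (le_trans (rho_shift_le _ _ _)); rewrite ?mul1r.
Qed.

Lemma gaussn_le1 (a : R) (x : V) : 0 <= a -> gaussn a x <= 1.
Proof. by move=> a0; rewrite /gaussn expR_le1 oppr_le0 divr_ge0// mulr_ge0 ?dotv_ge0. Qed.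

Lemma measurable_gaussn_shift (a : R) (z : V) :
  mfunT (fun x : V => gaussn a (x - z)).
Proof.
apply: (mcomp (@measurable_gaussn _ _ _)); exact: measurable_rVB.
Qed.

End gauss_rho.

(** The total mass of [gaussn e], that is [(2 pi / e)^(d/2)]. *)
Definition gmass {R : realType} (d : nat) (e : R) : R := Num.sqrt (2 * pi / e) ^+ d.

Lemma gmass_ge0 {R : realType} d (e : R) : 0 <= gmass d e.
Proof. by apply: exprn_ge0; rewrite sqrtr_ge0. Qed.

(** * Spectral measures *)

Section spectral.
Context {R : realType} {d : nat}.
Local Notation V := 'rV[R]_d.
Variables (alpha : {sigma_finite_measure set V -> \bar R}) (lam2 : R).
Hypothesis lam2_ge0 : 0 <= lam2.
Hypothesis alpha_rho : (\int[alpha]_x (rho 1 x)%:E < +oo)%E.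

Definition pairing (f : V -> R) : R :=
  \int[alpha]_x f x - lam2 * \int[lebm d]_x f x.

Hypothesis alpha_pd : forall (k : V) (s : R), 0 < s ->
  0 <= pairing (fun x => cos (dotv k x) * gaussn s x).
Hypothesis alpha_sym : forall (z : V) (s : R), 0 < s ->
  \int[alpha]_x gaussn s (x - z) = \int[alpha]_x gaussn s (x + z).

Lemma integrable_alpha_rho : alpha.-intR (rho 1).
Proof. exact: (integrable_ge0_lty (@measurable_rho _ _ _) (rho_ge0 _)). Qed.

Lemma integrable_alpha_dom (f : V -> R) (C : R) : mfunT f ->
  (forall x, `|f x| <= C * rho 1 x) -> alpha.-intR f.
Proof.
move=> mf fC; apply: (integrable_le mf fC).
by apply: intgbZ; exact: integrable_alpha_rho.
Qed.

Lemma integrable_lebm_dom (f : V -> R) (C : R) : mfunT f ->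
  (forall x, `|f x| <= C * rho 1 x) -> (lebm d).-intR f.
Proof.
move=> mf fC; apply: (integrable_le mf fC).
by apply: intgbZ; exact: integrable_rho.
Qed.

Lemma pairing_cvg (f_ : nat -> V -> R) (f : V -> R) (C : R) :
  (forall n, mfunT (f_ n)) ->
  (forall x, f_ n x @[n --> \oo] --> f x) ->
  (forall n x, `|f_ n x| <= C * rho 1 x) ->
  pairing (f_ n) @[n --> \oo] --> pairing f.
Proof.
move=> mf cf fC; apply: cvgB.
  apply: (Rintegral_dct mf cf fC).
  by apply: intgbZ; exact: integrable_alpha_rho.
apply: cvgM; first exact: cvg_cst.
apply: (Rintegral_dct mf cf fC).
by apply: intgbZ; exact: integrable_rho.
Qed.

Local Notation c0 := (@gmass R d).

(** Integral over [k] of [cos (z.k) cos (u.k) gaussn e k]: the product-to-sum formula splits it into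
    two shifted Gaussians of inverse width. *)
Let tc e (z u : V) : R := c0 e * 2^-1 * (gaussn e^-1 (u - z) + gaussn e^-1 (u + z)).

(** The damping factor makes the cosine transform converge and [alpha_pd] makes it nonnegative, so
    that it can serve as a density. *)
Let H n (k : V) : R := pairing (fun u => cos (dotv k u) * gaussn n.+1%:R^-1 u).

Section swap.
Variable nu : {sigma_finite_measure set V -> \bar R}.
Hypothesis nu_gauss : forall s, 0 < s -> nu.-intR (gaussn s).
Variables (e s : R) (e_gt0 : 0 < e) (s_gt0 : 0 < s).

Let m2 (z : V) (trig : R -> R) : mfunT trig ->
  mfunT (fun p : V * V =>
    trig (dotv z p.1) * gaussn e p.1 * (cos (dotv p.1 p.2) * gaussn s p.2)).
Proof.
move=> mt; apply: measurable_funM; apply: measurable_funM.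
- by apply: (mcomp mt); apply: measurable_dotv => //; exact: measurable_fst.
- by apply: (mcomp (@measurable_gaussn _ _ _)); exact: measurable_fst.
- apply: measurable_cos_comp; apply: measurable_dotv; [exact: measurable_fst|exact: measurable_snd].
- by apply: (mcomp (@measurable_gaussn _ _ _)); exact: measurable_snd.
Qed.

Let bound (z : V) (trig : R -> R) (k u : V) : (forall t, `|trig t| <= 1) ->
  `|trig (dotv z k) * gaussn e k * (cos (dotv k u) * gaussn s u)| <= gaussn e k * gaussn s u.
Proof.
move=> t1; rewrite !normrM !(ger0_norm (gaussn_ge0 _ _)).
rewrite ler_pM ?mulr_ge0 ?gaussn_ge0// ler_piMl ?gaussn_ge0// normr_cos_le1.
by [].
Qed.

Lemma integrable_cos_nu k : nu.-intR (fun u => cos (dotv k u) * gaussn s u).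
Proof.
apply: (integrable_le _ _ (nu_gauss s_gt0)).
  by apply: measurable_funM; [exact: measurable_cos_dotv|exact: measurable_gaussn].
by move=> u; rewrite normrM (ger0_norm (gaussn_ge0 _ _)) ler_piMl ?gaussn_ge0 ?normr_cos_le1.
Qed.

Let swap (z : V) (trig : R -> R) : mfunT trig -> (forall t, `|trig t| <= 1) ->
  \int[lebm d]_k (trig (dotv z k) * gaussn e k * \int[nu]_u (cos (dotv k u) * gaussn s u)) =
  \int[nu]_u (gaussn s u * \int[lebm d]_k (trig (dotv z k) * cos (dotv u k) * gaussn e k)).
Proof.
move=> mt t1.
transitivity (\int[lebm d]_k \int[nu]_u (trig (dotv z k) * gaussn e k * (cos (dotv k u) * gaussn s u))).
  congr Rintegral; apply/funext => k; rewrite RintegralZl//; exact: integrable_cos_nu.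
rewrite (@Rintegral_swap _ _ _ _ _ (lebm d) nu (fun p => trig (dotv z p.1) * gaussn e p.1 * (cos (dotv p.1 p.2) * gaussn s p.2)) (gaussn e) (gaussn s)); last 4 first.
- exact: m2.
- by move=> k u; exact: bound.
- exact: integrable_gaussn.
- exact: nu_gauss.
congr Rintegral; apply/funext => u.
transitivity (\int[lebm d]_k (gaussn s u * (trig (dotv z k) * cos (dotv u k) * gaussn e k))).
  by congr Rintegral; apply/funext => k; rewrite /= (dotvC u k); ring.
rewrite RintegralZl//; apply: (integrable_le _ _ (integrable_gaussn d e_gt0)).
  apply: measurable_funM; last exact: measurable_gaussn.
  apply: measurable_funM; last exact: measurable_cos_dotv.
  by apply: (mcomp mt); exact: measurable_dotv.
move=> k; rewrite !normrM (ger0_norm (gaussn_ge0 _ _)) ler_piMl ?gaussn_ge0//.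
by rewrite -[1]mulr1 ler_pM ?normr_cos_le1.
Qed.

Lemma swap_cos z :
  \int[lebm d]_k (cos (dotv z k) * gaussn e k * \int[nu]_u (cos (dotv k u) * gaussn s u)) =
  \int[nu]_u (gaussn s u * tc e z u).
Proof.
rewrite swap//; last 2 first.
- by apply: measurable_cos_comp; exact: measurable_id.
- exact: normr_cos_le1.
congr Rintegral; apply/funext => u; congr (_ * _).
rewrite (_ : (fun k => _) = (fun k => 2^-1 * (cos (dotv (u - z) k) * gaussn e k) +
    2^-1 * (cos (dotv (u + z) k) * gaussn e k))); last first.
  by apply/funext => k; rewrite dotvBl dotvDl cosB cosD; field.
have i1 := integrable_cos_gaussn (u - z) e_gt0.
have i2 := integrable_cos_gaussn (u + z) e_gt0.
rewrite RintegralD//; [|exact: intgbZ|exact: intgbZ].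
rewrite !RintegralZl// !Rintegral_cos_gaussn// /tc /gmass; ring.
Qed.

Lemma swap_sin z :
  \int[lebm d]_k (sin (dotv z k) * gaussn e k * \int[nu]_u (cos (dotv k u) * gaussn s u)) = 0.
Proof.
rewrite swap//; last 2 first.
- by apply: measurable_sin_comp; exact: measurable_id.
- exact: normr_sin_le1.
rewrite (_ : (fun u => _) = cst 0); first by rewrite /Rintegral integral0.
apply/funext => u.
rewrite (_ : (fun k => _) = (fun k => 2^-1 * (sin (dotv (z + u) k) * gaussn e k) +
    2^-1 * (sin (dotv (z - u) k) * gaussn e k))); last first.
  by apply/funext => k; rewrite dotvBl dotvDl sinB sinD; field.
have i1 := integrable_sin_gaussn (z + u) e_gt0.
have i2 := integrable_sin_gaussn (z - u) e_gt0.
rewrite RintegralD//; [|exact: intgbZ|exact: intgbZ].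
by rewrite !RintegralZl// !Rintegral_sin_gaussn// !mulr0 addr0 mulr0.
Qed.

(** The Fubini form of measurability asks for integrability over the pair [(k, u)], hence for decay
    in [k]. The factor [gaussn 1 k] provides it and, being positive, is divided out afterwards. *)
Lemma measurable_cos_nu : mfunT (fun k => \int[nu]_u (cos (dotv k u) * gaussn s u)).
Proof.
have m : mfunT (fun p : V * V => cos (dotv p.1 p.2) * gaussn s p.2).
  apply: measurable_funM.
    apply: measurable_cos_comp; apply: measurable_dotv; [exact: measurable_fst|exact: measurable_snd].
  by apply: (mcomp (@measurable_gaussn _ _ _)); exact: measurable_snd.
pose f := fun p : V * V => (gaussn 1 p.1 * (cos (dotv p.1 p.2) * gaussn s p.2))%:E.
have := @measurable_fubini_F _ _ _ _ R (lebm d) nu f.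
have fi : (lebm d \x nu)%E.-integrable setT f.
  apply: (@integrable_prod_dom _ _ _ _ _ (lebm d) nu (fun p => gaussn 1 p.1 * (cos (dotv p.1 p.2) * gaussn s p.2)) (gaussn 1) (gaussn s)).
  - apply: measurable_funM => //.
    by apply: (mcomp (@measurable_gaussn _ _ _)); exact: measurable_fst.
  - move=> k u; rewrite !normrM !(ger0_norm (gaussn_ge0 _ _)) ler_wpM2l ?gaussn_ge0//.
    by rewrite ler_piMl ?gaussn_ge0 ?normr_cos_le1.
  - exact: integrable_gaussn.
  - exact: nu_gauss.
move=> /(_ fi) mF.
have -> : (fun k => \int[nu]_u (cos (dotv k u) * gaussn s u)) =
    (fun k => (gaussn 1 k)^-1 * fine (\int[nu]_u f (k, u))%E).
  apply/funext => k.
  rewrite -[fine _]/(\int[nu]_u (gaussn 1 k * (cos (dotv k u) * gaussn s u))).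
  rewrite RintegralZl//; last exact: integrable_cos_nu.
  by rewrite mulrA mulVf ?mul1r// gt_eqF// gaussn_gt0.
apply: measurable_funM.
  rewrite (_ : (fun k => _) = gaussn (-1)); first exact: measurable_gaussn.
  by apply/funext => k; rewrite /gaussn -expRN; congr expR; ring.
exact: (mcomp (@fine_measurable R setT measurableT) mF).
Qed.

Let A k := \int[nu]_u (cos (dotv k u) * gaussn s u).

Let A_le k : `|A k| <= \int[nu]_u gaussn s u.
Proof.
apply: normr_Rintegral_le; [exact: integrable_cos_nu|exact: nu_gauss|].
by move=> u; rewrite normrM (ger0_norm (gaussn_ge0 _ _)) ler_piMl ?gaussn_ge0 ?normr_cos_le1.
Qed.

Lemma integrable_trig_nu (trig : V -> R) : mfunT trig ->
  (forall t, `|trig t| <= 1) ->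
  (lebm d).-intR (fun k => trig k * gaussn e k * A k).
Proof.
move=> mt t1; pose M := \int[nu]_u gaussn s u.
apply: (integrable_le _ _ (intgbZ M (integrable_gaussn d e_gt0))).
  apply: measurable_funM; last exact: measurable_cos_nu.
  by apply: measurable_funM => //; exact: measurable_gaussn.
move=> k; rewrite mulrC !normrM (ger0_norm (gaussn_ge0 _ _)).
by rewrite ler_pM ?mulr_ge0 ?gaussn_ge0// ler_piMl ?gaussn_ge0.
Qed.

End swap.

Let alpha_gauss (s : R) : 0 < s -> alpha.-intR (gaussn s).
Proof.
move=> s0; apply: (@integrable_alpha_dom _ (expR (d%:R / (2 * s)))).
  exact: measurable_gaussn.
by move=> x; rewrite ger0_norm ?gaussn_ge0//; exact: gaussn_le_rho.
Qed.

Let lebm_gauss (s : R) : 0 < s -> (lebm d).-intR (gaussn s).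
Proof. by move=> s0; exact: integrable_gaussn. Qed.

Let s_ n : R := n.+1%:R^-1.

Let s_gt0 n : 0 < s_ n. Proof. by rewrite invr_gt0. Qed.

Let H_ge0 n k : 0 <= H n k. Proof. exact: alpha_pd. Qed.

Let mH n : mfunT (H n).
Proof.
apply: measurable_funB; first exact: (measurable_cos_nu alpha_gauss).
apply: measurable_funM => //; exact: (measurable_cos_nu lebm_gauss).
Qed.

Let trig_H (trig : V -> R) (e : R) n : 0 < e -> mfunT trig ->
  (forall t, `|trig t| <= 1) ->
  (lebm d).-intR (fun k => trig k * gaussn e k * H n k) /\
  \int[lebm d]_k (trig k * gaussn e k * H n k) =
  \int[lebm d]_k (trig k * gaussn e k * \int[alpha]_u (cos (dotv k u) * gaussn (s_ n) u)) -
  lam2 * \int[lebm d]_k (trig k * gaussn e k * \int[lebm d]_u (cos (dotv k u) * gaussn (s_ n) u)).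
Proof.
move=> e0 mt t1.
have i1 := @integrable_trig_nu alpha alpha_gauss _ _ e0 (s_gt0 n) _ mt t1.
have i2 := @integrable_trig_nu (lebm d) lebm_gauss _ _ e0 (s_gt0 n) _ mt t1.
have i3 := intgbZ lam2 i2.
have -> : (fun k => trig k * gaussn e k * H n k) = (fun k =>
    trig k * gaussn e k * \int[alpha]_u (cos (dotv k u) * gaussn (s_ n) u) -
    lam2 * (trig k * gaussn e k * \int[lebm d]_u (cos (dotv k u) * gaussn (s_ n) u))).
  by apply/funext => k; rewrite /H /pairing mulrBr; congr (_ - _); rewrite mulrCA.
split; first exact: integrable_sub.
by rewrite RintegralB// RintegralZl.
Qed.

Let cos_H z (e : R) n : 0 < e ->
  \int[lebm d]_k (cos (dotv z k) * gaussn e k * H n k) =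
  pairing (fun u => gaussn (s_ n) u * tc e z u).
Proof.
move=> e0; rewrite (trig_H _ e0 _ (fun=> normr_cos_le1 _)).2; last exact: measurable_cos_dotv.
by rewrite (swap_cos alpha_gauss e0 (s_gt0 n)) (swap_cos lebm_gauss e0 (s_gt0 n)).
Qed.

Let sin_H z (e : R) n : 0 < e -> \int[lebm d]_k (sin (dotv z k) * gaussn e k * H n k) = 0.
Proof.
move=> e0; rewrite (trig_H _ e0 _ (fun=> normr_sin_le1 _)).2; last exact: measurable_sin_dotv.
by rewrite (swap_sin alpha_gauss e0 (s_gt0 n)) (swap_sin lebm_gauss e0 (s_gt0 n)) mulr0 subr0.
Qed.

Let tc_ge0 (e : R) z u : 0 <= tc e z u.
Proof. by rewrite !mulr_ge0 ?gmass_ge0// addr_ge0// gaussn_ge0. Qed.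

Let mtc (e : R) z : mfunT (tc e z).
Proof.
apply: measurable_funM => //; apply: measurable_funD; first exact: measurable_gaussn_shift.
by rewrite -[z]opprK; exact: measurable_gaussn_shift.
Qed.

Let tc_le (e : R) z u : 0 < e ->
  tc e z u <= c0 e * (expR (d%:R / (2 * e^-1)) * expR (l1 z)) * rho 1 u.
Proof.
move=> e0; have ei : 0 < e^-1 by rewrite invr_gt0.
rewrite /tc -!mulrA ler_wpM2l ?gmass_ge0// [in leRHS]mulrA.
have h1 := gaussn_shift_le u z ei.
have h2 := gaussn_shift_le u (- z) ei; rewrite opprK l1N in h2.
by rewrite mulrC ler_pdivrMr// mulr_natr mulr2n lerD.
Qed.

Let gs_le1 n (u : V) : gaussn (s_ n) u <= 1 :> R. Proof. exact: gaussn_le1 (ltW (s_gt0 n)). Qed.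

Let gaussn_cvg1 (u : V) : gaussn (s_ n) u @[n --> \oo] --> (1 : R).
Proof.
have h : s_ n * dotv u u / 2 @[n --> \oo] --> (0 : R).
  rewrite -(mul0r (dotv u u / 2)).
  rewrite (_ : (fun n => _) = (fun n => harmonic n * (dotv u u / 2))); last first.
    by apply/funext => n; rewrite /harmonic mulrA.
  by apply: cvgM; [exact: cvg_harmonic|exact: cvg_cst].
have hc : - (s_ n * dotv u u / 2) @[n --> \oo] --> (0 : R) by rewrite -oppr0; exact: cvgN.
by have := cvg_comp _ _ hc (@continuous_expR R 0); rewrite expR0; apply.
Qed.

(** Removing the damping by dominated convergence leaves the pairing with [tc e z]. By [alpha_sym],
    and by translation invariance of [lebm], its two shifted Gaussians contribute equally. *)
Let cos_H_cvg z (e : R) : 0 < e ->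
  \int[lebm d]_k (cos (dotv z k) * gaussn e k * H n k) @[n --> \oo] -->
  c0 e * pairing (fun u => gaussn e^-1 (u - z)).
Proof.
move=> e0; have ei : 0 < e^-1 by rewrite invr_gt0.
rewrite (_ : (fun n => _) = (fun n => pairing (fun u => gaussn (s_ n) u * tc e z u))); last first.
  by apply/funext => n; exact: cos_H.
have -> : c0 e * pairing (fun u => gaussn e^-1 (u - z)) = pairing (tc e z).
  have ia w : alpha.-intR (fun u => gaussn e^-1 (u - w)).
    apply: (@integrable_alpha_dom _ (expR (d%:R / (2 * e^-1)) * expR (l1 w))).
      exact: measurable_gaussn_shift.
    by move=> x; rewrite ger0_norm ?gaussn_ge0//; exact: gaussn_shift_le.
  have il w : (lebm d).-intR (fun u => gaussn e^-1 (u - w)).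
    apply: (@integrable_lebm_dom _ (expR (d%:R / (2 * e^-1)) * expR (l1 w))).
      exact: measurable_gaussn_shift.
    by move=> x; rewrite ger0_norm ?gaussn_ge0//; exact: gaussn_shift_le.
  have ia' := ia (- z); have il' := il (- z); rewrite opprK in ia' il'.
  rewrite /pairing /tc !RintegralZl//; [|exact: integrable_add|exact: integrable_add].
  rewrite !RintegralD// -(alpha_sym z)//.
  have -> : \int[lebm d]_x gaussn e^-1 (x + z) = \int[lebm d]_x gaussn e^-1 (x - z).
    have mE : mfunT (fun x : V => (gaussn e^-1 x)%:E).
      by apply: measurable_EFin; exact: measurable_gaussn.
    have h1 := integral_lebm_shift z mE; have h2 := integral_lebm_shift (- z) mE.
    exact: (congr1 fine (etrans h1 (esym h2))).
  set Ia := \int[alpha]_x _; set Il := \int[lebm d]_x _.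
  by field.
apply: (@pairing_cvg _ _ (c0 e * (expR (d%:R / (2 * e^-1)) * expR (l1 z)))).
- by move=> n; apply: measurable_funM; [exact: measurable_gaussn|exact: mtc].
- move=> x; rewrite -[X in _ --> X]mul1r; apply: cvgM; [exact: gaussn_cvg1|exact: cvg_cst].
- move=> n x; rewrite ger0_norm; last by apply: mulr_ge0; [exact: gaussn_ge0|exact: tc_ge0].
  apply: le_trans (tc_le _ _ e0); apply: ler_piMl; [exact: tc_ge0|exact: gs_le1].
Qed.

Let B (e : R) : R := c0 e * \int[alpha]_u gaussn e^-1 u.

(** This is [cos_H] at [z = 0]. The term in [lam2] is dropped because of its sign, and the damping
    factor is at most 1, so the bound does not depend on [n]. *)
Let HB (e : R) n : 0 < e -> (\int[lebm d]_x (gaussn e x * H n x)%:E <= (B e)%:E)%E.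
Proof.
move=> e0; have ei : 0 < e^-1 by rewrite invr_gt0.
have [i1 _] := @trig_H (cst 1) e n e0 (measurable_cst _) (fun=> ltac:(by rewrite normr1)).
have E1 : (fun k => cst 1 k * gaussn e k * H n k) = (fun k => gaussn e k * H n k).
  by apply/funext => k; rewrite /= mul1r.
rewrite E1 in i1; rewrite -EFin_Rintegral// lee_fin.
have := cos_H 0 n e0.
have -> : (fun k => cos (dotv 0 k) * gaussn e k * H n k) = (fun k => gaussn e k * H n k).
  by apply/funext => k; rewrite -(scale0r 0) dotvZl mul0r cos0 mul1r.
move=> ->; have E2 u : tc e 0 u = c0 e * gaussn e^-1 u.
  by rewrite /tc subr0 addr0; field.
have i2 : alpha.-intR (fun u => c0 e * gaussn e^-1 u).
  by apply: intgbZ; exact: alpha_gauss.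
have mf : mfunT (fun u => gaussn (s_ n) u * tc e 0 u).
  by apply: measurable_funM; [exact: measurable_gaussn|exact: mtc].
have i3 : alpha.-intR (fun u => gaussn (s_ n) u * tc e 0 u).
  apply: (integrable_le mf _ i2) => u.
  rewrite ger0_norm; last by apply: mulr_ge0; [exact: gaussn_ge0|exact: tc_ge0].
  by rewrite E2 ler_piMl// mulr_ge0 ?gmass_ge0 ?gaussn_ge0.
have -> : B e = \int[alpha]_u (c0 e * gaussn e^-1 u).
  by rewrite RintegralZl//; exact: alpha_gauss.
rewrite /pairing.
rewrite lerBlDr; apply: ler_wpDr.
  rewrite mulr_ge0//; apply: Rintegral_ge0 => x _; apply: mulr_ge0; [exact: gaussn_ge0|exact: tc_ge0].
apply: le_Rintegral => // u _.
by rewrite E2 ler_piMl// mulr_ge0 ?gmass_ge0 ?gaussn_ge0.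
Qed.

Let beta := vague_limit mH H_ge0 HB.

(** Vague limits are available for nonnegative test functions, hence the [1 +]; the integral of
    [trig * gaussn e] is recovered by subtraction in [spectral_measure_exists]. *)
Let integral_beta (trig : V -> R) (e : R) l : 0 < e -> mfunT trig ->
  (forall k, `|trig k| <= 1) -> loclip trig ->
  \int[lebm d]_k (trig k * gaussn e k * H n k) @[n --> \oo] --> l ->
  (\int[beta]_k ((1 + trig k) * gaussn e k)%:E)%E =
  (c0 e * pairing (fun u => gaussn e^-1 (u - 0)) + l)%:E.
Proof.
move=> e0 mt t1 lt tl.
have m1 : mfunT (fun k => 1 + trig k) by exact: measurable_funD.
have p0 k : 0 <= 1 + trig k.
  by have := t1 k; rewrite ler_norml => /andP[h _]; rewrite -lerBlDl sub0r.
have p2 k : 1 + trig k <= 2.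
  by have := t1 k; rewrite ler_norml => /andP[_ h]; rewrite -[2]/(1 + 1) lerD2l.
apply: (@integral_vague_limit _ _ _ mH H_ge0 _ HB _ 2 e).
- by apply: measurable_funM => //; exact: measurable_gaussn.
- by move=> k; rewrite mulr_ge0 ?gaussn_ge0.
- exact: e0.
- by move=> k; rewrite ler_wpM2r ?gaussn_ge0.
- apply: (loclip_mul (M := 2)); first exact: loclip_1D.
  + exact/loclip_gaussn/ltW.
  + by move=> k; rewrite ger0_norm.
  + move=> k; rewrite ger0_norm ?gaussn_ge0//; apply: (le_trans (gaussn_le1 _ (ltW e0))).
    by rewrite ler1n.
rewrite (_ : (fun n => _) = (fun n =>
    \int[lebm d]_k (cos (dotv 0 k) * gaussn e k * H n k) +
    \int[lebm d]_k (trig k * gaussn e k * H n k))).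
  by apply: cvgD => //; exact: cos_H_cvg.
apply/funext => n; rewrite -RintegralD//.
- by congr Rintegral; apply/funext => k; rewrite -(scale0r 0) dotvZl mul0r cos0; ring.
- by apply: (trig_H _ e0 _ (fun=> normr_cos_le1 _)).1; exact: measurable_cos_dotv.
- by apply: (trig_H _ e0 mt t1).1.
Qed.

Theorem spectral_measure_exists : exists beta : {measure set V -> \bar R},
  [/\ forall e : R, 0 < e -> beta.-intR (gaussn e),
      forall (e : R) z, 0 < e -> \int[beta]_k (cos (dotv z k) * gaussn e k) =
        gmass d e * pairing (fun u => gaussn e^-1 (u - z)) &
      forall (e : R) z, 0 < e -> \int[beta]_k (sin (dotv z k) * gaussn e k) = 0].
Proof.
exists beta.
have I (e : R) (trig : V -> R) (l : R) : 0 < e -> mfunT trig ->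
    (forall k, `|trig k| <= 1) -> loclip trig ->
    \int[lebm d]_k (trig k * gaussn e k * H n k) @[n --> \oo] --> l ->
    beta.-intR (fun k => (1 + trig k) * gaussn e k) /\
    \int[beta]_k ((1 + trig k) * gaussn e k) =
    c0 e * pairing (fun u => gaussn e^-1 (u - 0)) + l.
  move=> e0 mt t1 lt tl; have Eb := integral_beta e0 mt t1 lt tl.
  split; last by rewrite /Rintegral Eb.
  apply: integrable_ge0_lty.
  - by apply: measurable_funM; [exact: measurable_funD|exact: measurable_gaussn].
  - move=> k; rewrite mulr_ge0 ?gaussn_ge0//.
    by have := t1 k; rewrite ler_norml => /andP[h _]; rewrite -lerBlDl sub0r.
  - by rewrite Eb ltry.
have I0 (e : R) : 0 < e -> beta.-intR (gaussn e) /\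
    \int[beta]_k gaussn e k = c0 e * pairing (fun u => gaussn e^-1 (u - 0)).
  move=> e0; have := I e (cst 0) 0 e0 (measurable_cst _).
  case.
  - by move=> k; rewrite normr0.
  - by move=> L L0; exists 0 => // x y _ _; rewrite subrr normr0 mul0r.
  - rewrite (_ : (fun n => _) = cst 0); first exact: cvg_cst.
    apply/funext => n; rewrite (_ : (fun k => _) = cst 0); first by rewrite /Rintegral integral0.
    by apply/funext => k; rewrite /= !mul0r.
  by under eq_fun do rewrite /= addr0 mul1r; rewrite addr0.
have J (e : R) (trig : V -> R) (l : R) : 0 < e -> mfunT trig ->
    (forall k, `|trig k| <= 1) -> loclip trig ->
    \int[lebm d]_k (trig k * gaussn e k * H n k) @[n --> \oo] --> l ->
    \int[beta]_k (trig k * gaussn e k) = l.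
  move=> e0 mt t1 lt tl; have [i1 e1] := I _ _ _ e0 mt t1 lt tl; have [i2 e2] := I0 _ e0.
  rewrite (_ : (fun k => _) = (fun k => (1 + trig k) * gaussn e k - gaussn e k)); last first.
    by apply/funext => k; ring.
  by rewrite RintegralB// e1 e2 addrC addKr.
split.
- by move=> e e0; exact: (I0 e e0).1.
- move=> e z e0; apply: J => //; first exact: measurable_cos_dotv.
  + by move=> k; exact: normr_cos_le1.
  + by apply: loclip_comp_dotv; exact: cos_lip.
  + exact: cos_H_cvg.
- move=> e z e0; apply: J => //; first exact: measurable_sin_dotv.
  + by move=> k; exact: normr_sin_le1.
  + by apply: loclip_comp_dotv; exact: sin_lip.
  + rewrite (_ : (fun n => _) = cst 0); first exact: cvg_cst.
    by apply/funext => n; rewrite sin_H.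
Qed.

End spectral.

Section rV_norm.
Context {R : realType} {d : nat}.
Implicit Types x : 'rV[R]_d.

Lemma normr_le_l1 x : `|x| <= l1 x.
Proof.
rewrite /Num.norm/= mx_normrE; apply: bigmax_le; first exact: l1_ge0.
by move=> [i j] _ /=; rewrite ord1 normr_coord_le.
Qed.

Lemma coord_le_normr x i : `|x 0 i| <= `|x|.
Proof.
by rewrite {2}/Num.norm/= mx_normrE; apply: (@le_bigmax _ _ _ 0 (fun ij => `|x ij.1 ij.2|) (0, i)).
Qed.

Lemma l1_le_normr x : l1 x <= d%:R * `|x|.
Proof.
rewrite /l1 (_ : d%:R * `|x| = \sum_(i < d) `|x|); last by rewrite sumr_const card_ord mulr_natl.
by apply: ler_sum => i _; exact: coord_le_normr.
Qed.

End rV_norm.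

Lemma cvg0_norm_lt {R : realType} (u : nat -> R) (r : R) :
  u n @[n --> \oo] --> (0 : R) -> 0 < r -> \forall n \near \oo, `|u n| < r.
Proof.
move=> u0 r0; have h := (@cvgr0_norm_lt _ _ _ _ _ _ u0) r r0.
exact: h. Qed.

(** * Continuity of translations in L^1 *)

Section translation.
Context {R : realType} {d : nat}.
Local Notation V := 'rV[R]_d.
Implicit Types f g h : V -> R.

Definition modulus f (v : V) : \bar R := (\int[lebm d]_x `|f (x + v) - f x|%:E)%E.

Lemma measurable_shift f (v : V) : mfunT f ->
  mfunT (fun x : V => f (x + v)).
Proof. by move=> mf; apply: (mcomp mf); exact: measurable_rVD. Qed.

Lemma measurable_dist f g : mfunT f -> mfunT g ->
  mfunT (fun x : V => `|f x - g x|%:E).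
Proof.
move=> mf mg; apply: measurable_EFin.
by apply: mcomp => //; exact: measurable_funB.
Qed.

Lemma modulus_triangle f g (v : V) : mfunT f -> mfunT g ->
  (modulus f v <= \int[lebm d]_x `|f x - g x|%:E + \int[lebm d]_x `|f x - g x|%:E + modulus g v)%E.
Proof.
move=> mf mg.
have mfv := measurable_shift v mf; have mgv := measurable_shift v mg.
rewrite -{1}(ge0_integral_lebm_shift v (measurable_dist mf mg))//.
rewrite /modulus -ge0_integralD//; [|exact: measurable_dist|exact: measurable_dist].
rewrite -ge0_integralD//; last 3 first.
- by move=> x _; rewrite adde_ge0.
- by apply: emeasurable_funD; exact: measurable_dist.
- exact: measurable_dist.
apply: ge0_le_integral => //.
- exact: measurable_dist.
- by apply: emeasurable_funD; [apply: emeasurable_funD|]; exact: measurable_dist.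
move=> x _; rewrite -!EFinD lee_fin.
rewrite (_ : f (x + v) - f x = (f (x + v) - g (x + v)) + (g x - f x) + (g (x + v) - g x)); last by ring.
apply: (le_trans (ler_normD _ _)); rewrite lerD2r.
by apply: (le_trans (ler_normD _ _)); rewrite lerD2l distrC.
Qed.

Lemma modulusD f g (a b : R) (v : V) : mfunT f -> mfunT g ->
  (modulus (fun x => (a * f x + b * g x)%R) v <= `|a|%:E * modulus f v + `|b|%:E * modulus g v)%E.
Proof.
move=> mf mg.
have mfv := measurable_shift v mf; have mgv := measurable_shift v mg.
rewrite /modulus -!ge0_integralZl//; try exact: measurable_dist.
have mm (c : R) h : mfunT h ->
    mfunT (fun x : V => (`|c|%:E * `|h (x + v)%R - h x|%:E)%E).
  by move=> mh; apply: emeasurable_funM => //; apply: measurable_dist => //; exact: measurable_shift.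
rewrite -ge0_integralD//; [|exact: mm|exact: mm].
apply: ge0_le_integral => //.
- apply: measurable_dist; first by apply: measurable_funD; exact: measurable_funM.
  by apply: measurable_funD; exact: measurable_funM.
- by apply: emeasurable_funD; exact: mm.
move=> x _; rewrite -!EFinM -EFinD lee_fin -!normrM.
rewrite (_ : _ - _ = a * (f (x + v) - f x) + b * (g (x + v) - g x)); last by ring.
exact: ler_normD.
Qed.

Lemma integrable_indic_lty (A : set V) : measurable A -> (lebm d A < +oo)%E ->
  (lebm d).-intR (\1_A : V -> R).
Proof.
move=> mA fA; apply: integrable_ge0_lty => //.
by rewrite integral_indic// setIT.
Qed.

Variable u_ : nat -> V.
Hypothesis u_cvg0 : l1 (u_ n) @[n --> \oo] --> (0 : R).

Definition L1cont f := mfunT f /\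
  forall e : R, 0 < e -> \forall n \near \oo, (modulus f (u_ n) <= e%:E)%E.

Lemma L1cont_lim f : mfunT f ->
  (forall e : R, 0 < e -> exists2 g, L1cont g & (\int[lebm d]_x `|f x - g x|%:E <= e%:E)%E) ->
  L1cont f.
Proof.
move=> mf H; split => // e e0; have e3 : 0 < e / 3 by rewrite divr_gt0.
have [g [mg cg] fg] := H _ e3; near=> n.
apply: (le_trans (modulus_triangle _ mf mg)).
rewrite (_ : e%:E = ((e / 3)%:E + (e / 3)%:E + (e / 3)%:E)%E); last first.
  by rewrite -!EFinD; congr EFin; field.
apply: leeD; first exact: leeD.
by near: n; exact: cg.
Unshelve. all: by end_near. Qed.

Lemma L1contD f g (a b : R) : L1cont f -> L1cont g -> L1cont (fun x => a * f x + b * g x).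
Proof.
move=> [mf cf] [mg cg]; split; first by apply: measurable_funD; exact: measurable_funM.
move=> e e0; pose c := `|a| + `|b| + 1.
have c0 : 0 < c by rewrite ltr_wpDl// addr_ge0.
have ec : 0 < e / c by rewrite divr_gt0.
near=> n; apply: (le_trans (modulusD _ _ _ mf mg)).
apply: (@le_trans _ _ (`|a|%:E * (e / c)%:E + `|b|%:E * (e / c)%:E)%E).
  by apply: leeD; apply: lee_wpmul2l => //; near: n; [exact: cf|exact: cg].
rewrite -!EFinM -EFinD lee_fin -mulrDl mulrA ler_pdivrMr// mulrC ler_wpM2l ?(ltW e0)//.
by rewrite /c lerDl.
Unshelve. all: by end_near. Qed.

Lemma L1cont0 : L1cont (fun=> 0).
Proof.
split => // e e0; near=> n; rewrite /modulus integral0_eq ?lee_fin ?(ltW e0)//.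
by move=> x _; rewrite subrr normr0.
Unshelve. all: by end_near. Qed.

(* Translation invariance gives [\int |1_U(x+u) - 1_U(x)| = 2 \int 1_U (1 - 1_U(x+u))],
   where the integrand tends to 0 everywhere when [U] is open. *)
Lemma L1cont_open (U : set V) : open U -> (lebm d U < +oo)%E -> L1cont (\1_U).
Proof.
move=> oU fU; have mU := open_rV_measurable oU.
have mI : mfunT (\1_U : V -> R) by exact: measurable_indic.
have iI : (lebm d).-intR (\1_U : V -> R).
  exact: integrable_indic_lty.
split => // e e0.
have mIv v : mfunT (fun x : V => \1_U (x + v) : R) by exact: measurable_shift.
have mE : mfunT (fun x : V => (\1_U x : R)%:E) by exact: measurable_EFin.
have iIv v : (lebm d).-intR (fun x => \1_U (x + v) : R).
  apply: integrable_ge0_lty => //; rewrite (ge0_integral_lebm_shift v mE)//.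
  by rewrite integral_indic// setIT.
pose F n (x : V) : R := \1_U x * (1 - \1_U (x + u_ n)).
have I01 (x : V) : 0 <= (\1_U x : R) <= 1 by rewrite indicE; case: (_ \in _); rewrite /= ?lexx ler01.
have mF n : mfunT (F n).
  by apply: measurable_funM => //; exact: measurable_funB.
have F0 n x : 0 <= F n x.
  have /andP[a0 a1] := I01 x; have /andP[b0 b1] := I01 (x + u_ n).
  by rewrite /F mulr_ge0 ?subr_ge0.
have FI n x : `|F n x| <= \1_U x.
  have /andP[a0 a1] := I01 x; have /andP[b0 b1] := I01 (x + u_ n).
  by rewrite ger0_norm// /F ler_piMr// gerBl.
have iF n : (lebm d).-intR (F n) by exact: (integrable_le _ (FI n) iI).
have modE n : modulus (\1_U) (u_ n) = (2 * \int[lebm d]_x F n x)%:E.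
  have -> : 2 * \int[lebm d]_x F n x =
      \int[lebm d]_x (2 * F n x - (\1_U x - \1_U (x + u_ n))).
    have -> : 2 * \int[lebm d]_x F n x =
      2 * \int[lebm d]_x F n x - (\int[lebm d]_x \1_U x - \int[lebm d]_x \1_U (x + u_ n)).
      rewrite [X in _ - (X - _)](_ : _ = \int[lebm d]_x \1_U (x + u_ n)) ?subrr ?subr0//.
      exact: (congr1 fine (esym (ge0_integral_lebm_shift (u_ n) mE _))).
    rewrite RintegralB//; [|exact: intgbZ|exact: integrable_sub].
    by rewrite RintegralZl// RintegralB.
  rewrite EFin_Rintegral; last first.
    by apply: integrable_sub; [exact: intgbZ|exact: integrable_sub].
  apply: eq_integral => x _; congr EFin; rewrite /F !indicE.
  case: (x \in U); case: (x + u_ n \in U) => /=;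
    by rewrite ?subrr ?subr0 ?sub0r ?mulr0 ?mulr1 ?mul0r ?normr0 ?normrN ?normr1 ?opprK ?subr0//; lra.
have cF : \int[lebm d]_x F n x @[n --> \oo] --> \int[lebm d]_x (cst 0 : V -> R) x.
  apply: (Rintegral_dct mF _ FI iI) => x.
  have [xU|xU] := boolP (x \in U); last first.
    rewrite (_ : (fun n => _) = cst 0); first exact: cvg_cst.
    by apply/funext => n; rewrite /F indicE (negbTE xU) mul0r.
  apply: (cvg_near_cst (0 : R)).
  have [r /= r0 rU] : nbhs_ball x U by apply/nbhs_ballP; rewrite nbhsE; exists U => //; split => //; exact/set_mem.
  have := cvg0_norm_lt u_cvg0 r0.
  apply: filterS => n; rewrite ger0_norm ?l1_ge0// => un.
  rewrite /F !indicE xU (_ : x + u_ n \in U) ?subrr ?mulr0//.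
  apply/mem_set/rU; rewrite -ball_normE/= opprD addNKr normrN.
  exact: le_lt_trans (normr_le_l1 _) un.
have e2 : 0 < e / 2 by rewrite divr_gt0.
rewrite /Rintegral integral0/= in cF.
have := cvg0_norm_lt cF e2; apply: filterS => n.
rewrite modE lee_fin => h; rewrite mulrC -ler_pdivlMr//; apply: ltW.
exact: le_lt_trans (ler_norm _) h.
Qed.

Definition cube (L : R) : set V := [set x | `|x| < L].

Lemma open_cube L : open (cube L).
Proof.
rewrite (_ : cube L = (fun x : V => `|x|) @^-1` [set y | y < L])//; apply: open_comp; last exact: open_lt.
by move=> x _; exact: norm_continuous.
Qed.

Lemma measurable_cube L : measurable (cube L).
Proof. by apply: open_rV_measurable; exact: open_cube. Qed.

Lemma indic_cube_le L x : (\1_(cube L) x : R) <= expR (d%:R * L) * rho 1 x.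
Proof.
rewrite indicE; case: (boolP (x \in _)) => [/set_mem/= xL|_]; last first.
  by rewrite mulr_ge0 ?expR_ge0.
rewrite /rho -expRD mul1r -{1}(@expR0 R) ler_expR subr_ge0.
by apply: (le_trans (l1_le_normr _)); rewrite ler_wpM2l// ltW.
Qed.

Lemma lebm_cube_lty L : (lebm d (cube L) < +oo)%E.
Proof.
have mQ := measurable_cube L.
rewrite -[X in lebm d X]setIT -integral_indic//.
apply: (ge0_integral_lty (g := fun x => expR (d%:R * L) * rho 1 x)) => //.
- by apply: measurable_funM => //; exact: measurable_rho.
- exact: indic_cube_le.
- have := intgbZ (expR (d%:R * L)) (integrable_rho d (@ltr01 R)).
  by move=> /integrable_lty; apply => //; exact: measurableT.
Qed.

Lemma integrable_indic_cube (A : set V) L : measurable A -> A `<=` cube L ->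
  (lebm d).-intR (\1_A : V -> R).
Proof.
move=> mA AQ; apply: integrable_indic_lty => //; apply: le_lt_trans (lebm_cube_lty L).
by rewrite le_measure ?inE//; exact: measurable_cube.
Qed.

(** Dynkin induction from the open sets, inside a cube of finite volume: complements are differences
    with the cube, and a disjoint union is an L^1 limit of its finite parts by dominated
    convergence. *)
Lemma L1cont_indic (A : set V) L : measurable A -> L1cont (\1_(A `&` cube L)).
Proof.
move=> mA; have mQ := measurable_cube L.
pose P := [set B : set V | L1cont (\1_(B `&` cube L))].
apply: (@dynkin_induction _ _ (@open V) P) => //.
- by move=> B C; exact: openI.
- by rewrite /P/= setTI; apply: L1cont_open; [exact: open_cube|exact: lebm_cube_lty].
- move=> U oU; rewrite /P/=; apply: L1cont_open; first by apply: openI => //; exact: open_cube.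
  apply: le_lt_trans (lebm_cube_lty L).
  by rewrite le_measure ?inE//; apply: measurableI => //; exact: open_rV_measurable.
- move=> B mB PB; rewrite /P/=.
  have := L1contD 1 (-1) (L1cont_open (@open_cube L) (lebm_cube_lty L)) PB.
  congr L1cont; apply/funext => x; rewrite !indicE !in_setI in_setC.
  by case: (x \in B); case: (x \in cube L) => /=; lra.
move=> F mF tF PF; rewrite /P/=.
pose S N := \big[setU/set0]_(i < N) F i.
have mS N : measurable (S N) by apply: bigsetU_measurable.
have cS N : L1cont (\1_(S N `&` cube L)).
  elim: N => [|N IH].
    by rewrite /S big_ord0 set0I indic0; exact: L1cont0.
  have := L1contD 1 1 IH (PF N); congr L1cont; apply/funext => x.
  rewrite /S big_ord_recr/= !indicE !in_setI in_setU.
  have : ~ (x \in S N /\ x \in F N).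
    move=> [/set_mem]; rewrite /S -bigcup_mkord => -[i /= iN Fi] /set_mem FN.
    by have := tF i N I I (ex_intro _ x (conj Fi FN)) => iE; rewrite iE ltnn in iN.
  rewrite /S; case: (x \in \big[_/_]_(_ < _) _); case: (x \in F N); case: (x \in cube L) => //=; try lra;
   by move=> h; exfalso; apply: h.
apply: L1cont_lim.
  by apply: measurable_indic; apply: measurableI => //; exact: bigcupT_measurable.
move=> e e0.
have iQ := integrable_indic_cube mQ (@subset_refl _ _).
pose G N x : R := `|\1_((\bigcup_k F k) `&` cube L) x - \1_(S N `&` cube L) x|.
have mG N : mfunT (G N).
  apply: mcomp => //; apply: measurable_funB; apply: measurable_indic;
  by apply: measurableI => //; exact: bigcupT_measurable.
have SF N x : x \in S N -> x \in \bigcup_k F k.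
  by move=> /set_mem; rewrite /S -bigcup_mkord => -[i _ Fi]; apply/mem_set; exists i.
have GQ N x : `|G N x| <= \1_(cube L) x.
  rewrite /G normr_id !indicE !in_setI; have := @SF N x.
  case: (x \in \bigcup_k F k); case: (x \in S N); case: (x \in cube L) => /=;
   rewrite ?subrr ?subr0 ?normr0 ?normr1 //; by move=> h; have := h isT.
have cG : \int[lebm d]_x G N x @[N --> \oo] --> \int[lebm d]_x (cst 0 : V -> R) x.
  apply: (Rintegral_dct mG _ GQ iQ) => x.
  apply: (cvg_near_cst (0 : R)).
  have [xF|xF] := boolP (x \in \bigcup_k F k); last first.
    apply: nearW => N; rewrite /G !indicE !in_setI (negbTE xF).
    rewrite (negbTE (contra (@SF N x) xF)).
    by rewrite /= subrr normr0.
  have [k _ Fk] := set_mem xF; exists k.+1 => //= N /= kN.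
  rewrite /G !indicE !in_setI xF (_ : x \in S N) ?subrr ?normr0//.
  by apply/mem_set; rewrite /S -bigcup_mkord; exists k.
rewrite {2}/Rintegral integral0/= in cG.
have [N _ hN] := cvg0_norm_lt cG e0.
exists (\1_(S N `&` cube L)); first exact: cS.
have iG : (lebm d).-intR (G N) by exact: (integrable_le _ (GQ N) iQ).
rewrite -[leLHS](EFin_Rintegral iG) lee_fin; apply: ltW.
exact: le_lt_trans (ler_norm _) (hN N (leqnn N)).
Qed.

(** Subtracting [r] where [f] is at least [r] lowers the bound on [f] by one step [r]. After [N]
    subtractions the remainder is at most [r], and what was removed is a combination of
    indicators. *)
Lemma simple_approx L (r : R) N f : 0 < r -> mfunT f -> (forall x, 0 <= f x) ->
  (forall x, f x <= N.+1%:R * r) -> (forall x, ~ cube L x -> f x = 0) ->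
  exists2 g, L1cont g & forall x, `|f x - g x| <= r * \1_(cube L) x.
Proof.
move=> r0; elim: N f => [|N IH] f mf f0 fN fQ.
  exists (fun=> 0); first exact: L1cont0.
  move=> x; rewrite subr0 ger0_norm// indicE; case: (boolP (x \in _)) => [|/negP] xQ.
    by rewrite mulr1 -[r]mul1r.
  by rewrite mulr0 fQ// => /mem_set.
pose A := [set x | r <= f x].
have mA : measurable A.
  by rewrite -[A]setTI; apply: (measurable_fun_ler (measurable_cst r) mf measurableT).
pose f' x := f x - r * \1_(A `&` cube L) x.
have mf' : mfunT f'.
  apply: measurable_funB => //; apply: measurable_funM => //.
  by apply: measurable_indic; apply: measurableI => //; exact: measurable_cube.
have AQ x : A x -> cube L x.
  by move=> Ax; apply: contrapT => /fQ fx; move: Ax; rewrite /A/= fx leNgt r0.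
have iA x : (\1_(A `&` cube L) x : R) = (r <= f x)%R%:R.
  rewrite indicE (_ : (x \in _) = (r <= f x))//; apply/idP/idP => [/set_mem[]//|rf].
  by apply/mem_set; split => //; exact: AQ.
case: (IH f' mf').
- move=> x; have := f0 x; rewrite /f' iA; case: (leP r (f x)) => /= h; rewrite ?mulr1 ?mulr0 ?subr0 ?subr_ge0//.
- move=> x; rewrite /f' iA; have := fN x; case: (leP r (f x)) => /= h; rewrite ?mulr1 ?mulr0 ?subr0.
    by move=> h2; rewrite lerBlDr; apply: (le_trans h2); rewrite -(natr1 N.+1) mulrDl mul1r.
  by move=> _; apply: (le_trans (ltW h)); rewrite ler_peMl ?(ltW r0)// ler1n.
- move=> x xQ; rewrite /f' iA fQ// leNgt r0/= mulr0 subr0//.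
move=> g cg fg; exists (fun x => 1 * g x + r * \1_(A `&` cube L) x).
  by apply: L1contD => //; exact: L1cont_indic.
move=> x; have := fg x; rewrite /f'; congr (`|_| <= _); ring.
Qed.

Lemma L1cont_bounded f L (M : R) : mfunT f -> (forall x, `|f x| <= M) ->
  (forall x, ~ cube L x -> f x = 0) -> L1cont f.
Proof.
move=> mf fM fQ; have mQ := measurable_cube L.
have M0 : 0 <= M by exact: le_trans (fM 0).
have mI : mfunT (\1_(cube L) : V -> R) by exact: measurable_indic.
have iI := integrable_indic_cube mQ (@subset_refl _ _).
have cQ := L1cont_open (@open_cube L) (lebm_cube_lty L).
(* Adding [M] on the cube makes the function nonnegative, as [simple_approx] requires. *)
suff H : L1cont (fun x => f x + M * \1_(cube L) x).
  have := L1contD 1 (- M) H cQ; congr L1cont; apply/funext => x; ring.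
have mg : mfunT (fun x : V => f x + M * \1_(cube L) x).
  by apply: measurable_funD => //; exact: measurable_funM.
apply: L1cont_lim => // e e0.
pose l := \int[lebm d]_x \1_(cube L) x.
have l0 : 0 <= l by apply: Rintegral_ge0 => x _; rewrite indicE.
pose r := e / (l + 1).
have r0 : 0 < r by rewrite divr_gt0// ltr_wpDl.
have iQE x : (\1_(cube L) x : R) = (x \in cube L)%:R by rewrite indicE.
have g0 x : 0 <= f x + M * \1_(cube L) x.
  have := fM x; rewrite ler_norml => /andP[h _]; rewrite iQE.
  have [xQ|xQ] := boolP (x \in cube L); first by rewrite mulr1; lra.
  by rewrite mulr0 addr0 fQ// => /mem_set; apply/negP.
have gN x : f x + M * \1_(cube L) x <= (Num.truncn (2 * M / r)).+1%:R * r.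
  rewrite -ler_pdivrMr//; apply: (@le_trans _ _ (2 * M / r)); last first.
    by apply: ltW; rewrite truncnS_gt.
  rewrite ler_pM2r ?invr_gt0//; apply: (le_trans (ler_norm _)); apply: (le_trans (ler_normD _ _)).
  rewrite mulr_natl mulr2n lerD// normrM ger0_norm// ler_piMr// iQE.
  by case: (_ \in _); rewrite /= ?normr1 ?normr0.
have gQ x : ~ cube L x -> f x + M * \1_(cube L) x = 0.
  move=> xQ; rewrite fQ// add0r iQE; case: (boolP (x \in cube L)) => [/set_mem//|_].
  by rewrite mulr0.
have [g cg fg] := simple_approx r0 mg g0 gN gQ.
exists g => //; have [mmg _] := cg.
apply: (@le_trans _ _ (\int[lebm d]_x (r * \1_(cube L) x)%:E)%E).
  apply: ge0_le_integral => //.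
  - exact: measurable_dist.
  - by apply: measurable_EFin; exact: measurable_funM.
  - by move=> x _; rewrite lee_fin fg.
rewrite -EFin_Rintegral; last exact: intgbZ.
rewrite RintegralZl// lee_fin -/l /r mulrAC ler_pdivrMr ?ltr_wpDl//.
by rewrite ler_wpM2l ?(ltW e0)// lerDl.
Qed.

Lemma test_function_cube f : test_function f ->
  exists (L M : R), [/\ mfunT f, 0 <= M, (forall x, `|f x| <= M) &
    forall x, ~ cube L x -> f x = 0].
Proof.
move=> [mf [M fM] [K cK fK]].
have [B [Br HB]] := compact_bounded cK.
exists (B + 2), M; split => //; first exact: le_trans (fM 0).
move=> x xB; apply: fK => Kx; apply: xB; rewrite /cube/=.
have : `|x| <= B + 1 by apply: (HB (B + 1)) => //; rewrite ltrDl.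
by move=> /le_lt_trans; apply; rewrite ltrD2l ltr1n.
Qed.

Lemma test_function_le f : test_function f ->
  exists2 C : R, 0 <= C & forall x, `|f x| <= C * rho 1 x.
Proof.
move=> /test_function_cube[L [M [mf M0 fM fL]]].
exists (M * expR (d%:R * L)); first by rewrite mulr_ge0 ?expR_ge0.
move=> x; have [xQ|xQ] := pselect (cube L x); last first.
  by rewrite fL// normr0 !mulr_ge0 ?expR_ge0 ?rho_ge0.
rewrite -mulrA -[leLHS]mulr1 ler_pM//.
by apply: le_trans (indic_cube_le L x); rewrite indicE mem_set.
Qed.

Lemma L1cont_test f : test_function f -> L1cont f.
Proof. by move=> /test_function_cube[L [M [mf M0 fM fL]]]; exact: L1cont_bounded fM fL. Qed.

End translation.

(** * Dilations of Lebesgue measure *)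

Section scaling.
Context {R : realType}.

Lemma ge0_integral_leb1_scale (c : R) (f : R -> \bar R) : 0 < c ->
  mfunT f -> (forall t, 0 <= f t)%E ->
  (\int[lebesgue_measure]_t f t = c%:E * \int[lebesgue_measure]_t f (c * t)%R)%E.
Proof.
move=> c0 mf f0.
have ms : mfunT (fun t : measurableTypeR R => c * t : measurableTypeR R).
  exact: measurable_funM.
have c0' : 0 <= c by exact: ltW.
pose k : {nonneg R} := NngNum c0'.
have E A : measurable A -> leb1 A = mscale k (pushm leb1 ms) A.
  move=> mA; apply: (@lebesgue_measure_unique _ (mscale k (pushm leb1 ms))) => //.
  move=> _ [[x y]] _ <-.
  transitivity (c%:E * lebesgue_measure ((fun t : R => (c * t)%R) @^-1` `]x, y]%classic))%E; last by [].
  rewrite (_ : _ @^-1` _ = `]x / c, y / c]%classic); last first.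
    by apply/seteqP; split => t /=; rewrite !in_itv/= ltr_pdivrMr// ler_pdivlMr// mulrC.
  rewrite !lebesgue_measure_itv/= !lte_fin ltr_pM2r ?invr_gt0//.
  case: ifP => _; last by rewrite mule0.
  by rewrite -!EFinD -EFinM; congr EFin; field; rewrite gt_eqF.
rewrite -[LHS]/(\int[leb1]_t f t)%E (eq_setfun_integral _ E).
rewrite (ge0_integral_mscale (pushm leb1 ms) measurableT k)//.
by rewrite (@ge0_integral_pushm _ _ _ _ _ leb1 _ ms).
Qed.

Lemma ge0_integral_lebm_scale n (c : R) (f : 'rV[R]_n -> \bar R) : 0 < c ->
  mfunT f -> (forall x, 0 <= f x)%E ->
  (\int[lebm n]_x f x = (c ^+ n)%:E * \int[lebm n]_x f (c *: x)%R)%E.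
Proof.
move=> c0; elim: n f => [|n IH] f mf f0.
  have mfc : mfunT (fun x : 'rV[R]_0 => f (c *: x)).
    by apply: (mcomp mf); exact: measurable_rVZ.
  by rewrite expr0 mul1e !integral_lebm0// (_ : c *: 0 = 0)// scaler0.
have mfc : mfunT (fun x : 'rV[R]_n.+1 => f (c *: x)).
  by apply: (mcomp mf); exact: measurable_rVZ.
rewrite (ge0_integral_lebmS mf f0) (ge0_integral_lebmS mfc)//.
have sE t (y : 'rV[R]_n) : c *: cons_rV t y = cons_rV (c * t) (c *: y).
  apply/rowP => i; rewrite [LHS]mxE.
  case: (unliftP ord0 i) => [j|] ->; last by rewrite !cons_rV0.
  by rewrite !cons_rVS [RHS]mxE.
rewrite (ge0_integral_leb1_scale c0); last 2 first.
- exact: measurable_lebm_slice.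
- by move=> t; apply: integral_ge0.
rewrite exprS EFinM -muleA; congr (_ * _)%E.
rewrite -ge0_integralZl//; last 3 first.
- exact: (measurable_lebm_slice mfc).
- by move=> t _; apply: integral_ge0.
- by rewrite lee_fin exprn_ge0// ltW.
apply: eq_integral => t _; rewrite IH//.
  by congr (_ * _)%E; apply: eq_integral => y _; rewrite sE.
by apply: (mcomp mf); exact: measurable_cons_rV2.
Qed.

Lemma Rintegral_lebm_scale n (c : R) (f : 'rV[R]_n -> R) : 0 < c ->
  (lebm n).-intR f ->
  (lebm n).-intR (fun x => f (c *: x)) /\
  \int[lebm n]_x f x = c ^+ n * \int[lebm n]_x f (c *: x).
Proof.
move=> c0 fi.
have mf : mfunT f by apply/measurable_EFinP; case/integrableP: fi.
have cn0 : 0 < c ^+ n by rewrite exprn_gt0.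
have H (h : 'rV[R]_n -> R) : (forall x, 0 <= h x) -> (lebm n).-intR h ->
    (lebm n).-intR (fun x => h (c *: x)) /\
    \int[lebm n]_x h x = c ^+ n * \int[lebm n]_x h (c *: x).
  move=> h0 hi; have mh : mfunT h by apply/measurable_EFinP; case/integrableP: hi.
  have mhc : mfunT (fun x : 'rV[R]_n => h (c *: x)).
    by apply: (mcomp mh); exact: measurable_rVZ.
  have h0e x : (0 <= (h x)%:E)%E by rewrite lee_fin.
  have E := @ge0_integral_lebm_scale n c (fun x => (h x)%:E) c0 (measurable_EFin mh) h0e.
  have hci : (lebm n).-intR (fun x => h (c *: x)).
    apply: integrable_ge0_lty => //; rewrite ltNge leye_eq; apply/negP => /eqP hoo.
    have := integrable_fin_num measurableT hi; rewrite [in X in X -> _]E hoo.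
    by rewrite gt0_muley.
  split=> //; apply: EFin_inj; rewrite EFinM !EFin_Rintegral//.
have [i1 e1] := H (fun x => `|f x| + f x) ltac:(move=> x; have := ler_norm (- f x); rewrite normrN; lra) (integrable_add (integrable_norm fi) fi).
have [i2 e2] := H _ (fun x => normr_ge0 (f x)) (integrable_norm fi).
have fE x : f x = (`|f x| + f x) - `|f x| by ring.
have i3 : (lebm n).-intR (fun x => f (c *: x)).
  rewrite (_ : (fun x => _) = (fun x => (`|f (c *: x)| + f (c *: x)) - `|f (c *: x)|)); last first.
    by apply/funext => x; exact: fE.
  exact: integrable_sub i1 i2.
split => //.
rewrite RintegralD// in e1; last exact: (integrable_norm fi).
rewrite [in RHS](RintegralD measurableT i2 i3) in e1.
by move: e1; rewrite e2 mulrDr => /addrI.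
Qed.

End scaling.

(** * Integrals depending on a parameter *)

Section Fubini_param.
Context {d1 d2} {T1 : measurableType d1} {T2 : measurableType d2} {R : realType}.

Lemma measurable_Rintegral_param (m2 : {sigma_finite_measure set T2 -> \bar R})
    (f : T1 * T2 -> R) : mfunT f ->
  mfunT (fun x => \int[m2]_y f (x, y)).
Proof.
move=> mf; apply: (mcomp (@fine_measurable R setT measurableT)).
have mE : mfunT (fun p => (f p)%:E) by exact: measurable_EFin.
rewrite (_ : (fun x => _) = (fun x => \int[m2]_y ((fun p => (f p)%:E)^\+)%E (x, y) -
    \int[m2]_y ((fun p => (f p)%:E)^\-)%E (x, y))%E); last first.
  apply/funext => x; rewrite integralE; congr (_ - _)%E; apply: eq_integral => y _.
    by rewrite !funeposE.
  by rewrite !funenegE.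
apply: emeasurable_funB.
  by apply: (measurable_fun_fubini_tonelli_F ((fun p => (f p)%:E)^\+)%E) => //; exact: measurable_funepos.
by apply: (measurable_fun_fubini_tonelli_F ((fun p => (f p)%:E)^\-)%E) => //; exact: measurable_funeneg.
Qed.

Variable m1 : {sigma_finite_measure set T1 -> \bar R}.
Variable m2 : {sigma_finite_measure set T2 -> \bar R}.

Lemma RintegralZl0 {dT} {T : measurableType dT} (m : {measure set T -> \bar R}) (c : R) (f : T -> R) :
  (c != 0 -> m.-intR f) ->
  \int[m]_x (c * f x) = c * \int[m]_x f x.
Proof.
have [->|c0] := eqVneq c 0; last by move=> /(_ isT); exact: RintegralZl.
move=> _; rewrite mul0r (_ : (fun x => _) = cst 0); first by rewrite /Rintegral integral0.
by apply/funext => x; rewrite mul0r.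
Qed.

Lemma integrableZ_inv {dT} {T : measurableType dT} (m : {measure set T -> \bar R}) (c : R) (f : T -> R) :
  c != 0 -> m.-intR (fun x => c * f x) -> m.-intR f.
Proof.
move=> c0 /(intgbZ c^-1); congr integrable.
by apply/funext => x; rewrite /= mulrA mulVf// mul1r.
Qed.

(** Only the full product is bounded. Where [w k] or [h x] vanishes the remaining integrand need not
    be integrable, but both sides are then 0; this is the case split made in [RintegralZl0]. *)
Lemma Rintegral_swapM (w : T1 -> R) (h : T2 -> R) (K : T1 * T2 -> R) (A : T1 -> R) (B : T2 -> R) :
  mfunT w -> mfunT h -> mfunT K ->
  (forall k x, `|w k * (h x * K (k, x))| <= A k * B x) ->
  m1.-intR A -> m2.-intR B ->
  \int[m1]_k (w k * \int[m2]_x (h x * K (k, x))) =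
  \int[m2]_x (h x * \int[m1]_k (w k * K (k, x))).
Proof.
move=> mw mh mK wAB iA iB.
have mF : mfunT (fun p => w p.1 * (h p.2 * K p)).
  apply: measurable_funM; first by apply: (mcomp mw); exact: measurable_fst.
  by apply: measurable_funM => //; apply: (mcomp mh); exact: measurable_snd.
transitivity (\int[m1]_k \int[m2]_x (w k * (h x * K (k, x)))).
  congr Rintegral; apply/funext => k; rewrite RintegralZl0// => wk.
  apply: (integrableZ_inv wk); apply: (integrable_le _ (wAB k)).
    by apply: (mcomp mF (measurable_pair1 k)).
  exact: intgbZ.
rewrite (@Rintegral_swap _ _ _ _ _ m1 m2 (fun p => w p.1 * (h p.2 * K p)) A B)//.
  congr Rintegral; apply/funext => x; rewrite -RintegralZl0.
    by congr Rintegral; apply/funext => k; rewrite /= mulrCA.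
  move=> hx; apply: (integrableZ_inv hx).
  rewrite (_ : (fun k => _) = (fun k => w k * (h x * K (k, x)))); last first.
    by apply/funext => k; rewrite mulrCA.
  apply: (integrable_le (g := fun k => B x * A k)).
  - by apply: (mcomp mF (measurable_pair2 x)).
  - by move=> k; rewrite [leRHS]mulrC.
  - exact: intgbZ.
Qed.

End Fubini_param.

(** By Markov's inequality the sets where [f >= 1 / (n+1)] have finite measure, and positivity makes
    them cover the space. With [f] an exponential weight or a Gaussian this makes second moment and
    spectral measures sigma-finite. *)
Lemma integrable_gt0_sigma_finite {dT} {T : measurableType dT} {R : realType}
    (m : {measure set T -> \bar R}) (f : T -> R) : (forall x, 0 < f x) ->
  m.-intR f -> sigma_finite setT m.
Proof.
move=> f0 fi; have mf : mfunT f by apply/measurable_EFinP; case/integrableP: fi.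
pose F n := [set x : T | n.+1%:R^-1 <= f x].
have mF n : measurable (F n).
  by rewrite -[F n]setTI; apply: (measurable_fun_ler (measurable_cst _) mf measurableT).
exists F.
  apply/esym; rewrite -subTset => x _.
  exists (Num.truncn (f x)^-1) => //; rewrite /F/=.
  rewrite -[leRHS]invrK lef_pV2 ?posrE ?invr_gt0//; apply: ltW.
  by rewrite truncnS_gt.
move=> n; split => //.
have n0 : 0 < n.+1%:R :> R by [].
have := intgbZ n.+1%:R fi => /integrable_lty; move=> /(_ measurableT).
apply: le_lt_trans; rewrite -[m _]mul1e -[X in m X]setIT -integral_indic// mul1e.
apply: ge0_le_integral => //.
- by apply: measurable_EFin; apply: measurable_indic.
- by apply: measurable_EFin; apply: measurable_funM.
move=> x _; rewrite lee_fin indicE; case: (boolP (x \in _)) => [/set_mem/=|_].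
  by rewrite /F/= -[n.+1%:R^-1]mul1r ler_pdivrMr// mulrC.
by rewrite mulr_ge0// ltW.
Qed.

Section rho_bounds.
Context {R : realType} {d : nat}.
Local Notation V := 'rV[R]_d.

Lemma gaussn_le_rhoc (a c : R) (x : V) : 0 < a ->
  gaussn a x <= expR (d%:R * (c ^+ 2 / (2 * a))) * rho c x.
Proof.
move=> a0; rewrite /gaussn /rho -expRD ler_expR.
suff : c * l1 x <= a * dotv x x / 2 + d%:R * (c ^+ 2 / (2 * a)) by lra.
rewrite (_ : d%:R * _ = \sum_(i < d) (c ^+ 2 / (2 * a))); last first.
  by rewrite sumr_const card_ord mulr_natl.
rewrite /l1 /dotv !mulr_sumr mulr_suml -big_split/=; apply: ler_sum => i _.
rewrite -expr2 -real_normK ?num_real//; set t := `|_|.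
rewrite -subr_ge0 (_ : _ - _ = (2 * a)^-1 * (a * t - c) ^+ 2); last first.
  by field; rewrite gt_eqF.
by rewrite mulr_ge0 ?sqr_ge0// invr_ge0 mulr_ge0// ltW.
Qed.

Lemma test_function_rho (c : R) (f : V -> R) : 0 <= c -> test_function f ->
  exists2 C : R, 0 <= C & forall x, `|f x| <= C * rho c x.
Proof.
move=> c0 /test_function_cube[L [M [mf M0 fM fL]]].
exists (M * expR (c * (d%:R * L))); first by rewrite mulr_ge0 ?expR_ge0.
move=> x; have [xQ|xQ] := pselect (cube L x); last first.
  by rewrite fL// normr0 !mulr_ge0 ?expR_ge0 ?rho_ge0.
rewrite -mulrA -[leLHS]mulr1 ler_pM// /rho -expRD -mulrBr -{1}(@expR0 R) ler_expR.
rewrite mulr_ge0// subr_ge0; apply: (le_trans (l1_le_normr x)).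
by rewrite ler_wpM2l// ltW.
Qed.

Lemma rhoD (c c' : R) (x : V) : rho (c + c') x = rho c x * rho c' x.
Proof. by rewrite /rho -expRD; congr expR; ring. Qed.

Lemma rho_triangle (x y : V) : rho 1 x * rho 1 y <= rho 1 (x + y).
Proof. by rewrite /rho -expRD ler_expR !mul1r -opprD lerN2 l1D. Qed.

Lemma rho_le1 (c : R) (x : V) : 0 <= c -> rho c x <= 1.
Proof. by move=> c0; rewrite /rho expR_le1 oppr_le0 mulr_ge0 ?l1_ge0. Qed.

End rho_bounds.

(** * Fourier transforms in real form *)

Section trigonometric_transform.
Context {R : realType} {d : nat}.
Local Notation V := 'rV[R]_d.
Implicit Types f g : V -> R.

Definition fcos f (k : V) : R := \int[lebm d]_x (f x * cos (dotv k x)).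
Definition fsin f (k : V) : R := \int[lebm d]_x (f x * sin (dotv k x)).

Lemma integrable_trig f (t : R -> R) (k : V) : (lebm d).-intR f ->
  mfunT t -> (forall a, `|t a| <= 1) ->
  (lebm d).-intR (fun x => f x * t (dotv k x)).
Proof.
move=> fi mt t1; have mf : mfunT f by apply/measurable_EFinP; case/integrableP: fi.
apply: (integrable_le _ _ (integrable_norm fi)).
  by apply: measurable_funM => //; apply: (mcomp mt); exact: measurable_dotv.
by move=> x; rewrite /= normrM ler_piMr.
Qed.

Lemma measurable_cos1 : mfunT (cos : R -> R).
Proof. by apply: continuous_measurable_fun; exact: continuous_cos. Qed.

Lemma measurable_sin1 : mfunT (sin : R -> R).
Proof. by apply: continuous_measurable_fun; exact: continuous_sin. Qed.

Lemma integrable_fcos f (k : V) : (lebm d).-intR f ->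
  (lebm d).-intR (fun x => f x * cos (dotv k x)).
Proof.
by move=> fi; apply: integrable_trig => //; [exact: measurable_cos1|exact: normr_cos_le1].
Qed.

Lemma integrable_fsin f (k : V) : (lebm d).-intR f ->
  (lebm d).-intR (fun x => f x * sin (dotv k x)).
Proof.
by move=> fi; apply: integrable_trig => //; [exact: measurable_sin1|exact: normr_sin_le1].
Qed.

Lemma measurable_ftrig f (t : R -> R) : mfunT f -> mfunT t ->
  mfunT (fun k => \int[lebm d]_x (f x * t (dotv k x))).
Proof.
move=> mf mt.
apply: (@measurable_Rintegral_param _ _ _ _ _ (lebm d) (fun p : V * V => f p.2 * t (dotv p.1 p.2))).
apply: measurable_funM; first by apply: (mcomp mf); exact: measurable_snd.
by apply: (mcomp mt); apply: measurable_dotv; [exact: measurable_fst|exact: measurable_snd].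
Qed.

Lemma measurable_fcos f : mfunT f -> mfunT (fcos f).
Proof. by move=> mf; apply: measurable_ftrig => //; exact: measurable_cos1. Qed.

Lemma measurable_fsin f : mfunT f -> mfunT (fsin f).
Proof. by move=> mf; apply: measurable_ftrig => //; exact: measurable_sin1. Qed.

Lemma fourierE f k : (lebm d).-intR f ->
  fourier f k = (fcos f k +i* - fsin f k)%C.
Proof.
move=> fi; rewrite /fourier /cintegral -lebmE.
have -> : (fun x : V => (complex.Re (expi (- dotv k x) * (f x)%:C%C))%:E) =
    (fun x => (f x * cos (dotv k x))%:E).
  by apply/funext => x; congr EFin; rewrite /= cosN mulr0 subr0 mulrC.
have -> : (fun x : V => (complex.Im (expi (- dotv k x) * (f x)%:C%C))%:E) =
    (fun x => (-1 * (f x * sin (dotv k x)))%:E).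
  by apply/funext => x; congr EFin; rewrite /= sinN; ring.
congr (_ +i* _)%C.
rewrite -[LHS]/(\int[lebm d]_x (-1 * (f x * sin (dotv k x)))).
by rewrite RintegralZl ?mulN1r//; exact: integrable_fsin.
Qed.

(** The left side is the real part of one transform times the conjugate of the other. As a double
    integral in [x - y] it allows the spectral measure to be integrated first; [fsin_double] treats
    the imaginary part. *)
Lemma fcos_double f g k : (lebm d).-intR f ->
  (lebm d).-intR g ->
  fcos f k * fcos g k + fsin f k * fsin g k =
  \int[lebm d]_x (f x * \int[lebm d]_y (g y * cos (dotv k (x - y)))).
Proof.
move=> fi gi.
have E x : \int[lebm d]_y (g y * cos (dotv k (x - y))) =
    cos (dotv k x) * fcos g k + sin (dotv k x) * fsin g k.
  have i1 := intgbZ (cos (dotv k x)) (integrable_fcos k gi).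
  have i2 := intgbZ (sin (dotv k x)) (integrable_fsin k gi).
  rewrite /fcos /fsin -RintegralZl//; last exact: integrable_fcos.
  rewrite -RintegralZl//; last exact: integrable_fsin.
  rewrite -RintegralD//; congr Rintegral; apply/funext => y.
  by rewrite dotvBr cosB; ring.
have -> : (fun x => f x * \int[lebm d]_y (g y * cos (dotv k (x - y)))) =
   (fun x => fcos g k * (f x * cos (dotv k x)) + fsin g k * (f x * sin (dotv k x))).
  by apply/funext => x; rewrite E; ring.
have i1 := intgbZ (fcos g k) (integrable_fcos k fi).
have i2 := intgbZ (fsin g k) (integrable_fsin k fi).
rewrite RintegralD// !RintegralZl//; [|exact: integrable_fsin|exact: integrable_fcos].
by rewrite /fcos /fsin; ring.
Qed.

Lemma fsin_double f g k : (lebm d).-intR f ->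
  (lebm d).-intR g ->
  fcos f k * fsin g k - fsin f k * fcos g k =
  - \int[lebm d]_x (f x * \int[lebm d]_y (g y * sin (dotv k (x - y)))).
Proof.
move=> fi gi.
have E x : \int[lebm d]_y (g y * sin (dotv k (x - y))) =
    sin (dotv k x) * fcos g k - cos (dotv k x) * fsin g k.
  have i1 := intgbZ (sin (dotv k x)) (integrable_fcos k gi).
  have i2 := intgbZ (cos (dotv k x)) (integrable_fsin k gi).
  rewrite /fcos /fsin -RintegralZl//; last exact: integrable_fcos.
  rewrite -RintegralZl//; last exact: integrable_fsin.
  rewrite -RintegralB//; congr Rintegral; apply/funext => y.
  by rewrite dotvBr sinB; ring.
have -> : (fun x => f x * \int[lebm d]_y (g y * sin (dotv k (x - y)))) =
   (fun x => fcos g k * (f x * sin (dotv k x)) - fsin g k * (f x * cos (dotv k x))).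
  by apply/funext => x; rewrite E; ring.
have i1 := intgbZ (fsin g k) (integrable_fcos k fi).
have i2 := intgbZ (fcos g k) (integrable_fsin k fi).
rewrite RintegralB// !RintegralZl//; [|exact: integrable_fcos|exact: integrable_fsin].
by rewrite /fcos /fsin; ring.
Qed.

Lemma normr_Rintegral_leM (h : V -> R) (K : V -> R) (M : R) :
  mfunT K -> (lebm d).-intR h ->
  (forall x, `|K x| <= M) ->
  `|\int[lebm d]_x (h x * K x)| <= M * \int[lebm d]_x `|h x|.
Proof.
move=> mK hi KM.
have mh : mfunT h by apply/measurable_EFinP; case/integrableP: hi.
have ni := integrable_norm hi.
have hM x : `|h x * K x| <= M * `|h x| by rewrite normrM mulrC ler_wpM2r.
rewrite -RintegralZl//; apply: normr_Rintegral_le => //.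
  by apply: (integrable_le _ hM (intgbZ M ni)); exact: measurable_funM.
exact: (intgbZ M ni).
Qed.

Lemma transform_double_swap (beta : {sigma_finite_measure set V -> \bar R}) (e : R)
    (t : R -> R) f g : beta.-intR (gaussn e) ->
  (lebm d).-intR f -> (lebm d).-intR g ->
  mfunT t -> (forall a, `|t a| <= 1) ->
  \int[beta]_k (gaussn e k * \int[lebm d]_x (f x * \int[lebm d]_y (g y * t (dotv k (x - y))))) =
  \int[lebm d]_x (f x * \int[lebm d]_y (g y * \int[beta]_k (gaussn e k * t (dotv k (x - y))))).
Proof.
move=> bi fi gi mt t1.
have mf : mfunT f by apply/measurable_EFinP; case/integrableP: fi.
have mg : mfunT g by apply/measurable_EFinP; case/integrableP: gi.
pose K (p : V * V) : R := \int[lebm d]_y (g y * t (dotv p.1 (p.2 - y))).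
have mK : mfunT K.
  apply: (@measurable_Rintegral_param _ _ _ _ _ (lebm d)
    (fun q : (V * V) * V => g q.2 * t (dotv q.1.1 (q.1.2 - q.2)))).
  apply: measurable_funM; first by apply: (mcomp mg); exact: measurable_snd.
  apply: (mcomp mt); apply: measurable_dotv.
    by apply: (mcomp (@measurable_fst _ _ _ _)); exact: measurable_fst.
  apply: measurable_rVB; last exact: measurable_snd.
  by apply: (mcomp (@measurable_snd _ _ _ _)); exact: measurable_fst.
pose N : R := \int[lebm d]_y `|g y|.
have N0 : 0 <= N by apply: Rintegral_ge0.
have KN p : `|K p| <= N.
  have := @normr_Rintegral_leM g (fun y => t (dotv p.1 (p.2 - y))) 1; rewrite mul1r; apply => //.
  by apply: (mcomp mt); apply: measurable_dotv => //; exact: measurable_rVB.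
rewrite (@Rintegral_swapM _ _ _ _ _ beta (lebm d) (gaussn e) f K (gaussn e) (fun x => N * `|f x|))//; last 3 first.
- exact: measurable_gaussn.
- move=> k x; rewrite normrM ger0_norm ?gaussn_ge0// ler_wpM2l ?gaussn_ge0//.
  by rewrite normrM mulrC ler_wpM2r.
- exact: (intgbZ N (integrable_norm fi)).
congr Rintegral; apply/funext => x; congr (_ * _).
rewrite (@Rintegral_swapM _ _ _ _ _ beta (lebm d) (gaussn e) g
   (fun p : V * V => t (dotv p.1 (x - p.2))) (gaussn e) (fun x => `|g x|))//.
- exact: measurable_gaussn.
- apply: (mcomp mt); apply: measurable_dotv; first exact: measurable_fst.
  by apply: measurable_rVB => //; exact: measurable_snd.
- move=> k y; rewrite !normrM ger0_norm ?gaussn_ge0// ler_wpM2l ?gaussn_ge0//.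
  by rewrite ler_piMr.
- exact: integrable_norm.
Qed.

End trigonometric_transform.

(** * Convolution with a Gaussian *)

Section conv_swap.
Context {R : realType} {d : nat}.
Local Notation V := 'rV[R]_d.
Variable m : {sigma_finite_measure set V -> \bar R}.
Hypothesis m_rho : m.-intR (rho 1).
Variables (a : R) (f g : V -> R) (Cf Cg : R).
Hypotheses (a_gt0 : 0 < a) (mf : mfunT f) (mg : mfunT g).
Hypothesis f_le : forall x, `|f x| <= Cf * rho 2 x.
Hypothesis g_le : forall x, `|g x| <= Cg * rho 2 x.

Let C := expR (d%:R / (2 * a)) : R.
Let E (x : V) : R := expR (l1 x).

Let Cf0 : 0 <= Cf.
Proof. by have := le_trans (normr_ge0 _) (f_le 0); rewrite pmulr_lge0 ?rho_gt0. Qed.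
Let Cg0 : 0 <= Cg.
Proof. by have := le_trans (normr_ge0 _) (g_le 0); rewrite pmulr_lge0 ?rho_gt0. Qed.

Let E0 x : 0 <= E x. Proof. exact: expR_ge0. Qed.

Let ED (x y : V) : E (x - y) <= E x * E y.
Proof. by rewrite /E -expRD ler_expR; apply: (le_trans (l1D _ _)); rewrite l1N. Qed.

Let rho2E (x : V) : rho 2 x * E x = rho 1 x.
Proof. by rewrite /rho /E -expRD; congr expR; ring. Qed.

(** A shift by [x - y] costs the factors [exp (l1 x)] and [exp (l1 y)]. This is why [f] and [g] are
    required to decay like [rho 2]: multiplied by such a factor they still decay like [rho 1]. *)
Let kern_le u x y : gaussn a (u - (x - y)) <= C * E x * E y * rho 1 u.
Proof.
apply: (le_trans (gaussn_shift_le _ _ a_gt0)); rewrite ler_wpM2r ?rho_ge0//.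
by rewrite -!mulrA ler_wpM2l ?expR_ge0//; exact: ED.
Qed.

Let T (z : V) : R := \int[m]_u gaussn a (u - z).

Let mkern : mfunT (fun p : V * V => gaussn a (p.2 - p.1)).
Proof.
apply: (mcomp (@measurable_gaussn _ _ _)); apply: measurable_rVB.
- exact: measurable_snd.
- exact: measurable_fst.
Qed.

Let mT : mfunT T.
Proof. exact: (@measurable_Rintegral_param _ _ _ _ _ m (fun p : V * V => gaussn a (p.2 - p.1)) mkern). Qed.

Let L : R := \int[m]_u rho 1 u.
Let L0 : 0 <= L. Proof. by apply: Rintegral_ge0 => x _; exact: rho_ge0. Qed.

Let T_le x y : `|T (x - y)| <= C * E x * E y * L.
Proof.
have i1 := intgbZ (C * E x * E y) m_rho.
rewrite /L -RintegralZl//; apply: normr_Rintegral_le => //.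
  apply: (integrable_le _ _ i1); first exact: measurable_gaussn_shift.
  by move=> u; rewrite ger0_norm ?gaussn_ge0 ?kern_le.
by move=> u; rewrite ger0_norm ?gaussn_ge0 ?kern_le.
Qed.

Lemma integrable_conv_inner x :
  (lebm d).-intR (fun y => g y * \int[m]_u gaussn a (u - (x - y))).
Proof.
apply: (integrable_le _ _ (intgbZ (C * E x * L * Cg) (integrable_rho d (@ltr01 R)))).
  have mTx : mfunT (fun y : V => T (x - y)).
    by apply: (mcomp mT); exact: measurable_rVB.
  exact: (measurable_funM mg mTx).
move=> y; rewrite -/(T (x - y)) normrM; apply: (@le_trans _ _ (Cg * rho 2 y * (C * E x * E y * L))).
  by rewrite ler_pM// T_le.
by rewrite -rho2E; apply: le_of_eq; ring.
Qed.

Let inner_le x : `|\int[lebm d]_y (g y * \int[m]_u gaussn a (u - (x - y)))| <=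
  E x * (C * L * Cg * \int[lebm d]_y rho 1 y).
Proof.
have i1 := intgbZ (C * E x * L * Cg) (integrable_rho d (@ltr01 R)).
rewrite (_ : E x * _ = (C * E x * L * Cg) * \int[lebm d]_y rho 1 y); last by ring.
rewrite -RintegralZl//; last exact: integrable_rho.
apply: normr_Rintegral_le => //; first exact: integrable_conv_inner.
move=> y; rewrite -/(T (x - y)) normrM; apply: (@le_trans _ _ (Cg * rho 2 y * (C * E x * E y * L))).
  by rewrite ler_pM// T_le.
by rewrite -rho2E; apply: le_of_eq; ring.
Qed.

Lemma integrable_conv_outer : (lebm d).-integrable setT
  (EFin \o (fun x => f x * \int[lebm d]_y (g y * \int[m]_u gaussn a (u - (x - y))))).
Proof.
pose M : R := C * L * Cg * \int[lebm d]_y rho 1 y.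
apply: (integrable_le _ _ (intgbZ (Cf * M) (integrable_rho d (@ltr01 R)))).
  apply: measurable_funM => //.
  apply: (@measurable_Rintegral_param _ _ _ _ _ (lebm d) (fun p : V * V => g p.2 * T (p.1 - p.2))).
  apply: measurable_funM; first by apply: (mcomp mg); exact: measurable_snd.
  apply: (mcomp mT); apply: measurable_rVB; [exact: measurable_fst|exact: measurable_snd].
move=> x; rewrite normrM; apply: (@le_trans _ _ (Cf * rho 2 x * (E x * M))).
  by rewrite ler_pM// inner_le.
by rewrite -rho2E; apply: le_of_eq; ring.
Qed.

Lemma conv_swap :
  \int[lebm d]_x (f x * \int[lebm d]_y (g y * \int[m]_u gaussn a (u - (x - y)))) =
  \int[m]_u \int[lebm d]_x (f x * \int[lebm d]_y (g y * gaussn a (u - (x - y)))).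
Proof.
have mul1 (h : V -> R) : (fun u => cst 1 u * h u) = h.
  by apply/funext => u; rewrite /= mul1r.
pose K (p : V * V) : R := \int[lebm d]_y (g y * gaussn a (p.1 - (p.2 - y))).
have mK : mfunT K.
  apply: (@measurable_Rintegral_param _ _ _ _ _ (lebm d)
    (fun q : (V * V) * V => g q.2 * gaussn a (q.1.1 - (q.1.2 - q.2)))).
  apply: measurable_funM; first by apply: (mcomp mg); exact: measurable_snd.
  apply: (mcomp (@measurable_gaussn _ _ _)); apply: measurable_rVB.
    by apply: (mcomp (@measurable_fst _ _ _ _)); exact: measurable_fst.
  apply: measurable_rVB; last exact: measurable_snd.
  by apply: (mcomp (@measurable_snd _ _ _ _)); exact: measurable_fst.
have kle u x y : `|g y * gaussn a (u - (x - y))| <= C * E x * rho 1 u * Cg * rho 1 y.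
  rewrite normrM (ger0_norm (gaussn_ge0 _ _)).
  apply: (@le_trans _ _ (Cg * rho 2 y * (C * E x * E y * rho 1 u))).
    by rewrite ler_pM ?gaussn_ge0.
  by rewrite -(rho2E y); apply: le_of_eq; ring.
pose N : R := \int[lebm d]_y rho 1 y.
have K_le u x : `|K (u, x)| <= C * E x * rho 1 u * Cg * N.
  have i1 := intgbZ (C * E x * rho 1 u * Cg) (integrable_rho d (@ltr01 R)).
  rewrite /N -RintegralZl//; last exact: integrable_rho.
  apply: normr_Rintegral_le => //.
  apply: (integrable_le _ (kle u x) i1).
  apply: measurable_funM => //; apply: (mcomp (@measurable_gaussn _ _ _)).
  by apply: measurable_rVB => //; exact: measurable_rVB.
have bK u x : `|cst 1 u * (f x * K (u, x))| <= rho 1 u * (C * Cg * N * Cf * rho 1 x).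
  rewrite /= mul1r normrM.
  apply: (@le_trans _ _ (Cf * rho 2 x * (C * E x * rho 1 u * Cg * N))).
    by rewrite ler_pM.
  by rewrite -(rho2E x); apply: le_of_eq; ring.
have S := @Rintegral_swapM _ _ _ _ _ m (lebm d) (cst 1) f K (rho 1)
  (fun x => C * Cg * N * Cf * rho 1 x) (measurable_cst _) mf mK bK m_rho
  (intgbZ _ (integrable_rho d (@ltr01 R))).
transitivity (\int[m]_u (cst 1 u * \int[lebm d]_x (f x * K (u, x)))).
  2: by rewrite mul1.
rewrite S.
congr Rintegral; apply/funext => x; congr (_ * _).
pose K' (p : V * V) : R := gaussn a (p.1 - (x - p.2)).
have mK' : mfunT K'.
  apply: (mcomp (@measurable_gaussn _ _ _)); apply: measurable_rVB; first exact: measurable_fst.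
  by apply: measurable_rVB => //; exact: measurable_snd.
have bK' u y : `|cst 1 u * (g y * K' (u, y))| <= C * E x * Cg * rho 1 u * rho 1 y.
  rewrite /= mul1r; apply: (le_trans (kle u x y)).
  by apply: le_of_eq; ring.
have S' := @Rintegral_swapM _ _ _ _ _ m (lebm d) (cst 1) g K'
  (fun u => C * E x * Cg * rho 1 u) (rho 1) (measurable_cst _) mg mK' bK'
  (intgbZ _ m_rho) (integrable_rho d (@ltr01 R)).
transitivity (\int[m]_u (cst 1 u * \int[lebm d]_y (g y * K' (u, y)))).
  2: by [].
rewrite S'.
by congr Rintegral; apply/funext => y; rewrite mul1.
Qed.

End conv_swap.

(** * Smoothed correlations *)

Section smoothing.
Context {R : realType} {d : nat}.
Local Notation V := 'rV[R]_d.
Variables (f g : V -> R) (Cf Cg : R).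
Hypotheses (tf : test_function f) (tg : test_function g).
Hypothesis f_le : forall x, `|f x| <= Cf * rho 2 x.
Hypothesis g_le : forall x, `|g x| <= Cg * rho 2 x.

Let mf : mfunT f. Proof. by case: tf. Qed.
Let mg : mfunT g. Proof. by case: tg. Qed.
Let Cf0 : 0 <= Cf.
Proof. by have := le_trans (normr_ge0 _) (f_le 0); rewrite pmulr_lge0 ?rho_gt0. Qed.
Let Cg0 : 0 <= Cg.
Proof. by have := le_trans (normr_ge0 _) (g_le 0); rewrite pmulr_lge0 ?rho_gt0. Qed.

Let E (x : V) : R := expR (l1 x).
Let E0 x : 0 <= E x. Proof. exact: expR_ge0. Qed.
Let rho2E (x : V) : rho 2 x * E x = rho 1 x.
Proof. by rewrite /rho /E -expRD; congr expR; ring. Qed.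

Let rho21 (x : V) : rho 2 x <= rho 1 x.
Proof. by rewrite /rho ler_expR lerN2 ler_wpM2r ?l1_ge0// ler1n. Qed.

(** Integrated against the second moment measure, this function of the difference gives the expected
    product of the linear statistics of [f] and [g] ([mixed_moment]). *)
Definition corr (u : V) : R := \int[lebm d]_x (f x * g (x - u)).

(** The correlation with [g] averaged over displacements [r w], where [w] is weighted by an
    unnormalised standard Gaussian. Test functions may be discontinuous; the smoothing links their
    transforms to Gaussian integrals of the spectral measure. *)
Definition smoothed (r : R) (u : V) : R :=
  \int[lebm d]_x (f x * \int[lebm d]_w (gaussn 1 w * g (x - u + r *: w))).

Let EG : (lebm d).-intR (fun w => E w * gaussn 1 w).
Proof.
apply: (integrable_le _ _ (intgbZ (expR (d%:R * (2 ^+ 2 / (2 * 1)))) (integrable_rho d (@ltr01 R)))).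
  apply: measurable_funM; last exact: measurable_gaussn.
  by apply: measurable_expR_comp; exact: measurable_l1.
move=> w; rewrite ger0_norm ?mulr_ge0 ?gaussn_ge0// -rho2E mulrC mulrA ler_wpM2r//.
exact: gaussn_le_rhoc.
Qed.

Let IE : R := \int[lebm d]_w (E w * gaussn 1 w).

Let g_shift_le r u x w : 0 <= r -> r <= 1 ->
  `|g (x - u + r *: w)| <= Cg * (rho 1 u * E x * E w).
Proof.
move=> r0 r1; apply: (le_trans (g_le _)); rewrite ler_wpM2l//.
apply: (le_trans (rho21 _)); rewrite /rho /E -!expRD ler_expR !mul1r.
have uE : u = (x + r *: w) - (x - u + r *: w) by apply/rowP => i; rewrite !mxE; ring.
have h : l1 u <= l1 (x - u + r *: w) + l1 x + l1 w.
  have a1 := l1D (x + r *: w) (- (x - u + r *: w)); rewrite -uE l1N in a1.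
  have a2 := l1D x (r *: w).
  have a3 : l1 (r *: w) <= l1 w by rewrite l1Z ger0_norm// ler_piMl ?l1_ge0.
  lra.
lra.
Qed.

Let mgs r : mfunT (fun q : (V * V) * V => gaussn 1 q.2 * g (q.1.2 - q.1.1 + r *: q.2)).
Proof.
apply: measurable_funM.
  by apply: (mcomp (@measurable_gaussn _ _ _)); exact: measurable_snd.
apply: (mcomp mg); apply: measurable_rVD; last first.
  by apply: measurable_rVZ => //; exact: measurable_snd.
apply: measurable_rVB; [apply: (mcomp (@measurable_snd _ _ _ _))|
  apply: (mcomp (@measurable_fst _ _ _ _))]; exact: measurable_fst.
Qed.

Let inner r (p : V * V) : R := \int[lebm d]_w (gaussn 1 w * g (p.2 - p.1 + r *: w)).

Let minner r : mfunT (inner r).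
Proof. exact: (@measurable_Rintegral_param _ _ _ _ _ (lebm d) _ (mgs r)). Qed.

Let inner_le r u x : 0 <= r -> r <= 1 -> `|inner r (u, x)| <= Cg * IE * rho 1 u * E x.
Proof.
move=> r0 r1; have i1 := intgbZ (Cg * (rho 1 u * E x)) EG.
rewrite (_ : Cg * IE * _ * _ = Cg * (rho 1 u * E x) * IE); last by ring.
have h w : `|gaussn 1 w * g (x - u + r *: w)| <= Cg * (rho 1 u * E x) * (E w * gaussn 1 w).
  rewrite normrM (ger0_norm (gaussn_ge0 _ _)) [leRHS]mulrA [leRHS]mulrC ler_wpM2l ?gaussn_ge0//.
  by rewrite -mulrA; exact: g_shift_le.
rewrite /IE -RintegralZl//; apply: normr_Rintegral_le => //.
apply: (integrable_le _ h i1).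
exact: (mcomp (mgs r) (measurable_pair1 (u, x))).
Qed.

Let outer_le r u x : 0 <= r -> r <= 1 ->
  `|f x * inner r (u, x)| <= Cf * Cg * IE * rho 1 u * rho 1 x.
Proof.
move=> r0 r1; rewrite normrM; apply: (@le_trans _ _ (Cf * rho 2 x * (Cg * IE * rho 1 u * E x))).
  by rewrite ler_pM// inner_le.
by rewrite -(rho2E x); apply: le_of_eq; ring.
Qed.

Let mouter r : mfunT (fun p : V * V => f p.2 * inner r p).
Proof.
by apply: measurable_funM; [apply: (mcomp mf); exact: measurable_snd|exact: minner].
Qed.

Lemma smoothed_le r u : 0 <= r -> r <= 1 ->
  `|smoothed r u| <= Cf * Cg * IE * (\int[lebm d]_x rho 1 x) * rho 1 u.
Proof.
move=> r0 r1; have i1 := intgbZ (Cf * Cg * IE * rho 1 u) (integrable_rho d (@ltr01 R)).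
rewrite mulrAC -RintegralZl//; last exact: integrable_rho.
apply: normr_Rintegral_le => //.
  apply: (integrable_le _ _ i1); first exact: (mcomp (mouter r) (measurable_pair1 u)).
  by move=> x; exact: outer_le.
by move=> x; exact: outer_le.
Qed.

Lemma measurable_smoothed r : mfunT (smoothed r).
Proof. exact: (@measurable_Rintegral_param _ _ _ _ _ (lebm d) _ (mouter r)). Qed.

Let f_leC x : `|f x| <= Cf.
Proof. by apply: (le_trans (f_le x)); rewrite ler_piMr// rho_le1. Qed.
Let g_leC x : `|g x| <= Cg.
Proof. by apply: (le_trans (g_le x)); rewrite ler_piMr// rho_le1. Qed.

Let fi : (lebm d).-intR f.
Proof.
by apply: (integrable_le mf f_le); apply: intgbZ; apply: integrable_rho; rewrite ltr0n.
Qed.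

Let fgi v : (lebm d).-intR (fun x => f x * g (x + v)).
Proof.
apply: (integrable_le _ _ (intgbZ Cg (integrable_norm fi))).
  by apply: measurable_funM => //; apply: (mcomp mg); exact: measurable_rVD.
by move=> x /=; rewrite normrM mulrC ler_wpM2r.
Qed.

(* Swapping the integrals exposes translates of [g] by [r *: w], which converge in L^1. *)
Let smoothedE r u : smoothed r u =
  \int[lebm d]_w (gaussn 1 w * \int[lebm d]_x (f x * g (x - u + r *: w))).
Proof.
apply: (@Rintegral_swapM _ _ _ _ _ (lebm d) (lebm d) f (gaussn 1) (fun p : V * V => g (p.1 - u + r *: p.2))
  (fun x => Cg * `|f x|) (gaussn 1)) => //.
- exact: measurable_gaussn.
- apply: (mcomp mg); apply: measurable_rVD.
    by apply: measurable_rVB => //; exact: measurable_fst.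
  by apply: measurable_rVZ => //; exact: measurable_snd.
- move=> x w; rewrite !normrM (ger0_norm (gaussn_ge0 _ _)) mulrCA mulrC ler_wpM2r ?gaussn_ge0//.
  by rewrite mulrC ler_wpM2r.
- exact: (intgbZ Cg (integrable_norm fi)).
- exact: integrable_gaussn.
Qed.

Let r_ n : R := n.+1%:R^-1.

Let r_cvg0 : r_ n @[n --> \oo] --> (0 : R). Proof. exact: cvg_harmonic. Qed.

Lemma smoothed_cvg u : smoothed (r_ n) u @[n --> \oo] --> Num.sqrt (2 * pi) ^+ d * corr u.
Proof.
have -> : Num.sqrt (2 * pi) ^+ d * corr u = \int[lebm d]_w (corr u * gaussn 1 w).
  rewrite RintegralZl//; last exact: integrable_gaussn.
  by rewrite mulrC /Rintegral integral_gaussn// divr1.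
rewrite (_ : (fun n => _) = (fun n => \int[lebm d]_w (gaussn 1 w *
    \int[lebm d]_x (f x * g (x - u + r_ n *: w))))); last by apply/funext => n; exact: smoothedE.
pose M : R := Cg * \int[lebm d]_x `|f x|.
have bd n w : `|\int[lebm d]_x (f x * g (x - u + r_ n *: w))| <= M.
  apply: normr_Rintegral_leM => //.
  by apply: (mcomp mg); apply: measurable_rVD => //; exact: measurable_rVB.
apply: (Rintegral_dct (g := fun w => M * gaussn 1 w)).
- move=> n; apply: measurable_funM; first exact: measurable_gaussn.
  apply: (@measurable_Rintegral_param _ _ _ _ _ (lebm d) (fun p : V * V => f p.2 * g (p.2 - u + r_ n *: p.1))).
  apply: measurable_funM; first by apply: (mcomp mf); exact: measurable_snd.
  apply: (mcomp mg); apply: measurable_rVD.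
    by apply: measurable_rVB => //; exact: measurable_snd.
  by apply: measurable_rVZ => //; exact: measurable_fst.
- move=> w; rewrite mulrC; apply: cvgM; first exact: cvg_cst.
  have w0 : l1 (r_ n *: w) @[n --> \oo] --> (0 : R).
    rewrite (_ : (fun n => _) = (fun n => r_ n * l1 w)); last first.
      by apply/funext => n; rewrite l1Z ger0_norm// invr_ge0.
    by rewrite -(mul0r (l1 w)); apply: cvgM; [exact: r_cvg0|exact: cvg_cst].
  have [_ Hg] := L1cont_test w0 tg.
  apply/cvgrPdist_le => e e0; have e' : 0 < e / (Cf + 1) by rewrite divr_gt0// ltr_wpDl.
  have := Hg _ e'; apply: filterS => n hn.
  pose v := r_ n *: w.
  have mgu : mfunT (fun x : V => g (x - u)) by apply: (mcomp mg); exact: measurable_rVB.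
  have mguv : mfunT (fun x : V => g (x - u + v)).
    by apply: (mcomp mg); apply: measurable_rVD => //; exact: measurable_rVB.
  have hn' : (\int[lebm d]_x `|g (x - u + v) - g (x - u)|%:E <= (e / (Cf + 1))%:E)%E.
    rewrite (ge0_integral_lebm_shift (- u) (f := fun x => `|g (x + v) - g x|%:E))//.
    by apply: measurable_dist => //; exact: measurable_shift.
  have mD : mfunT (fun x : V => `|g (x - u + v) - g (x - u)|).
    by apply: mcomp => //; exact: measurable_funB.
  have iD : (lebm d).-intR (fun x => `|g (x - u + v) - g (x - u)|).
    by apply: integrable_ge0_lty => //; apply: (le_lt_trans hn'); rewrite ltry.
  rewrite -(EFin_Rintegral iD) lee_fin in hn'.
  have fgi1 := fgi (- u); have fgi2 := fgi (- u + v).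
  rewrite (_ : (fun x => f x * g (x + (- u + v))) = (fun x => f x * g (x - u + v))) in fgi2; last first.
    by apply/funext => x; rewrite addrA.
  rewrite /corr -RintegralB//.
  apply: (@le_trans _ _ (\int[lebm d]_x (Cf * `|g (x - u + v) - g (x - u)|))).
    apply: normr_Rintegral_le; [exact: integrable_sub|exact: intgbZ|].
    by move=> x; rewrite -mulrBr normrM distrC ler_wpM2r.
  rewrite RintegralZl//; apply: (@le_trans _ _ (Cf * (e / (Cf + 1)))); first by rewrite ler_wpM2l.
  by rewrite mulrA ler_pdivrMr ?ltr_wpDl// mulrC ler_wpM2l ?(ltW e0)// lerDl.
- move=> n w; rewrite normrM (ger0_norm (gaussn_ge0 _ _)) mulrC ler_wpM2r ?gaussn_ge0//.
- by apply: intgbZ; exact: integrable_gaussn.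
Qed.

(** Substituting [y = x - u + r w] turns the Gaussian of width [r] into the standard one and
    produces the Jacobian [r ^+ d]. *)
Lemma conv_gaussn_smoothed (r : R) u : 0 < r ->
  \int[lebm d]_x (f x * \int[lebm d]_y (g y * gaussn (r ^+ 2)^-1 (u - (x - y)))) =
  r ^+ d * smoothed r u.
Proof.
move=> r0; have r2 : 0 < (r ^+ 2)^-1 by rewrite invr_gt0 exprn_gt0.
have H x : \int[lebm d]_y (g y * gaussn (r ^+ 2)^-1 (u - (x - y))) = r ^+ d * inner r (u, x).
  have mE : mfunT (fun y : V => (g y * gaussn (r ^+ 2)^-1 (u - (x - y)))%:E).
    apply: measurable_EFin; apply: measurable_funM => //.
    by apply: (mcomp (@measurable_gaussn _ _ _)); apply: measurable_rVB => //; exact: measurable_rVB.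
  have := integral_lebm_shift (x - u) mE.
  have -> : (fun y => (g (y + (x - u)) * gaussn (r ^+ 2)^-1 (u - (x - (y + (x - u)))))%:E) =
      (fun y => (g (y + (x - u)) * gaussn (r ^+ 2)^-1 y)%:E).
    apply/funext => y; congr (_ * gaussn _ _)%:E.
    by apply/rowP => i; rewrite !mxE; ring.
  move=> e1; transitivity (\int[lebm d]_y (g (y + (x - u)) * gaussn (r ^+ 2)^-1 y)).
    by rewrite /Rintegral e1.
  have i1 : (lebm d).-intR (fun y => g (y + (x - u)) * gaussn (r ^+ 2)^-1 y).
    apply: (integrable_le _ _ (intgbZ Cg (integrable_gaussn d r2))).
      apply: measurable_funM; last exact: measurable_gaussn.
      by apply: (mcomp mg); exact: measurable_rVD.
    by move=> y; rewrite normrM (ger0_norm (gaussn_ge0 _ _)) ler_wpM2r ?gaussn_ge0.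
  have [_ ->] := Rintegral_lebm_scale r0 i1; congr (_ * _).
  congr Rintegral; apply/funext => w; rewrite mulrC /= addrC; congr (_ * _).
  by rewrite /gaussn dotvZl dotvZr; congr expR; field; rewrite gt_eqF.
have -> : (fun x => f x * \int[lebm d]_y (g y * gaussn (r ^+ 2)^-1 (u - (x - y)))) =
    (fun x => r ^+ d * (f x * inner r (u, x))).
  by apply/funext => x; rewrite H mulrCA.
rewrite RintegralZl//.
have i1 := intgbZ (Cf * Cg * (\int[lebm d]_w gaussn 1 w)) (integrable_rho d (@ltr01 R)).
apply: (integrable_le _ _ i1); first exact: (mcomp (mouter r) (measurable_pair1 u)).
move=> x; rewrite normrM.
have h : `|inner r (u, x)| <= Cg * \int[lebm d]_w gaussn 1 w.
  have -> : \int[lebm d]_w gaussn (1 : R) w = \int[lebm d]_w `|gaussn 1 w|.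
    by congr Rintegral; apply/funext => w; rewrite ger0_norm ?gaussn_ge0.
  apply: normr_Rintegral_leM => //; last exact: integrable_gaussn.
  by apply: (mcomp mg); apply: measurable_rVD => //; exact: measurable_rVZ.
rewrite mulrC; apply: (le_trans (ler_pM _ _ h (f_le x))) => //.
rewrite (_ : _ * (Cf * _) = Cf * Cg * \int[lebm d]_w gaussn 1 w * rho 2 x); last by ring.
apply: ler_wpM2l => //; rewrite !mulr_ge0//.
by apply: Rintegral_ge0 => w _; exact: gaussn_ge0.
Qed.

End smoothing.

(** * Correlations of decaying functions *)

Section correlation.
Context {R : realType} {d : nat}.
Local Notation V := 'rV[R]_d.
Variables (f g : V -> R) (Cf Cg : R).
Hypotheses (mf : mfunT f) (mg : mfunT g).
Hypothesis f_le : forall x, `|f x| <= Cf * rho 2 x.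
Hypothesis g_le : forall x, `|g x| <= Cg * rho 2 x.

Let Cf0 : 0 <= Cf.
Proof. by have := le_trans (normr_ge0 _) (f_le 0); rewrite pmulr_lge0 ?rho_gt0. Qed.
Let Cg0 : 0 <= Cg.
Proof. by have := le_trans (normr_ge0 _) (g_le 0); rewrite pmulr_lge0 ?rho_gt0. Qed.

(** Of the two factors [rho 1 x] contained in [rho 2 x], one is kept for the integration over [x];
    the other, with one factor at [x - u], gives [rho 1 u] by the triangle inequality. *)
Lemma corr_integrand_le u x : `|f x * g (x - u)| <= Cf * Cg * rho 1 u * rho 1 x.
Proof.
rewrite normrM; apply: (le_trans (ler_pM _ _ (f_le x) (g_le (x - u)))) => //.
rewrite (_ : Cf * Cg * rho 1 u * rho 1 x = (Cf * rho 1 x) * (Cg * rho 1 u)); last by ring.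
have e2 (y : V) : rho 2 y = rho 1 y * rho 1 y by rewrite -rhoD.
apply: (@le_trans _ _ ((Cf * rho 1 x) * (Cg * (rho 1 x * rho 1 (x - u) * rho 1 (x - u))))).
  by rewrite (e2 x) (e2 (x - u)); apply: le_of_eq; ring.
rewrite ler_wpM2l ?mulr_ge0 ?rho_ge0// ler_wpM2l//.
apply: (@le_trans _ _ (rho 1 x * rho 1 (x - u))).
  by rewrite ler_piMr ?mulr_ge0 ?rho_ge0 ?rho_le1.
have := rho_triangle x (u - x); rewrite (_ : x + (u - x) = u); last by rewrite addrC subrK.
by rewrite -(opprB u x) /rho l1N.
Qed.

Lemma integrable_corr_integrand u :
  (lebm d).-intR (fun x => f x * g (x - u)).
Proof.
apply: (integrable_le _ (corr_integrand_le u) (intgbZ _ (integrable_rho d (@ltr01 R)))).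
by apply: measurable_funM => //; apply: (mcomp mg); exact: measurable_rVB.
Qed.

Lemma corr_le u : `|corr f g u| <= Cf * Cg * (\int[lebm d]_x rho 1 x) * rho 1 u.
Proof.
have i1 := intgbZ (Cf * Cg * rho 1 u) (integrable_rho d (@ltr01 R)).
rewrite mulrAC -RintegralZl//; last exact: integrable_rho.
apply: normr_Rintegral_le => //; first exact: integrable_corr_integrand.
exact: corr_integrand_le.
Qed.

Lemma measurable_corr : mfunT (corr f g).
Proof.
apply: (@measurable_Rintegral_param _ _ _ _ _ (lebm d) (fun p : V * V => f p.2 * g (p.2 - p.1))).
apply: measurable_funM; first by apply: (mcomp mf); exact: measurable_snd.
by apply: (mcomp mg); apply: measurable_rVB; [exact: measurable_snd|exact: measurable_fst].
Qed.

Lemma integrable_corr (m : {measure set V -> \bar R}) : m.-intR (rho 1) ->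
  m.-intR (corr f g).
Proof. by move=> mr; exact: (integrable_le measurable_corr corr_le (intgbZ _ mr)). Qed.

Lemma Rintegral_corr : \int[lebm d]_u corr f g u = \int[lebm d]_x f x * \int[lebm d]_x g x.
Proof.
have fi : (lebm d).-intR f.
  by apply: (integrable_le mf f_le); apply: intgbZ; apply: integrable_rho; rewrite ltr0n.
rewrite (@Rintegral_swap _ _ _ _ _ (lebm d) (lebm d) (fun p : V * V => f p.2 * g (p.2 - p.1))
   (fun u => Cf * Cg * rho 1 u) (rho 1)).
- rewrite mulrC -RintegralZl//; congr Rintegral; apply/funext => x; rewrite mulrC.
  have gx : \int[lebm d]_u g (x - u) = \int[lebm d]_u g u.
    exact: (congr1 fine (integral_lebm_refl x (measurable_EFin mg))).
  rewrite -gx; transitivity (\int[lebm d]_u (f x * g (x - u))); first by [].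
  apply: (@RintegralZl0 R _ _ (lebm d) (f x) (fun u : V => g (x - u))) => fx0.
  apply: (integrable_le (g := fun u : V => Cg * rho 2 (x - u))).
  + by apply: (mcomp mg); exact: measurable_rVB.
  + by move=> u; exact: g_le.
  + apply: intgbZ; apply: integrable_ge0_lty.
    * by apply: (mcomp (@measurable_rho _ _ _)); exact: measurable_rVB.
    * by move=> u; exact: rho_ge0.
    * rewrite (integral_lebm_refl x (measurable_EFin (@measurable_rho R d 2))).
      by apply: integral_rho_lty; rewrite ltr0n.
- apply: measurable_funM; first by apply: (mcomp mf); exact: measurable_snd.
  by apply: (mcomp mg); apply: measurable_rVB; [exact: measurable_snd|exact: measurable_fst].
- by move=> u x; exact: corr_integrand_le.
- by apply: intgbZ; exact: integrable_rho.
- exact: integrable_rho.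
Qed.

End correlation.

(** * The isometry on test functions *)

Section isometry.
Context {R : realType} {d : nat}.
Local Notation V := 'rV[R]_d.
Variables (alpha beta : {sigma_finite_measure set V -> \bar R}) (lam2 : R).
Hypothesis alpha_rho : (\int[alpha]_x (rho 1 x)%:E < +oo)%E.
Hypothesis beta_gauss : forall e : R, 0 < e -> beta.-intR (gaussn e).
Hypothesis beta_cos : forall (e : R) z, 0 < e -> \int[beta]_k (cos (dotv z k) * gaussn e k) =
  gmass d e * pairing alpha lam2 (fun u => gaussn e^-1 (u - z)).
Hypothesis beta_sin : forall (e : R) z, 0 < e -> \int[beta]_k (sin (dotv z k) * gaussn e k) = 0.

Let ia : alpha.-intR (rho 1). Proof. exact: integrable_alpha_rho. Qed.
Let il : (lebm d).-intR (rho (1 : R)). Proof. exact: integrable_rho. Qed.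

Section pair.
Variables f g : V -> R.
Hypotheses (tf : test_function f) (tg : test_function g).

(** [Ppart] and [Qpart] are the real and imaginary parts of [fourier f] times the conjugate of
    [fourier g]. *)
Definition Ppart (k : V) : R := fcos f k * fcos g k + fsin f k * fsin g k.
Definition Qpart (k : V) : R := fcos f k * fsin g k - fsin f k * fcos g k.

Let test_integrable (h : V -> R) : test_function h -> (lebm d).-intR h.
Proof.
move=> th; have [C C0 hC] := test_function_le th; have [mh _ _] := th.
exact: (integrable_le mh hC (intgbZ C il)).
Qed.

Lemma gmass_scale (r : R) : 0 < r -> gmass d (r ^+ 2) * r ^+ d = Num.sqrt (2 * pi) ^+ d.
Proof.
move=> r0; rewrite /gmass -exprMn; congr (_ ^+ _).
rewrite sqrtrM; last by rewrite mulr_ge0// pi_ge0.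
by rewrite sqrtrV ?sqr_ge0// sqrtr_sqr ger0_norm ?(ltW r0)// divfK// gt_eqF.
Qed.

Let sm_int (m : {measure set V -> \bar R}) (r : R) : m.-intR (rho 1) ->
  0 <= r -> r <= 1 -> m.-intR (smoothed f g r).
Proof.
move=> mr r0 r1.
have [Cf Cf0 f_le] := @test_function_rho _ _ 2 f ltac:(by []) tf.
have [Cg Cg0 g_le] := @test_function_rho _ _ 2 g ltac:(by []) tg.
apply: (integrable_le _ (fun u => smoothed_le tf tg f_le g_le u r0 r1) (intgbZ _ mr)).
exact: measurable_smoothed.
Qed.

(** The weight [gaussn (r ^+ 2)] on frequencies corresponds to a Gaussian of width [r] in space. Its
    factor [gmass d (r ^+ 2)] cancels the Jacobian of [conv_gaussn_smoothed] up to a power of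
    [2 pi]. *)
Lemma integral_Ppart_gaussn (r : R) : 0 < r -> r <= 1 ->
  \int[beta]_k (gaussn (r ^+ 2) k * Ppart k) =
  Num.sqrt (2 * pi) ^+ d * pairing alpha lam2 (smoothed f g r).
Proof.
move=> r0 r1; have r2 : 0 < r ^+ 2 by rewrite exprn_gt0.
have ri : 0 < (r ^+ 2)^-1 by rewrite invr_gt0.
have [Cf Cf0 f_le] := @test_function_rho _ _ 2 f ltac:(by []) tf.
have [Cg Cg0 g_le] := @test_function_rho _ _ 2 g ltac:(by []) tg.
have fi := test_integrable tf; have gi := test_integrable tg.
have [mf _ _] := tf; have [mg _ _] := tg.
rewrite (_ : (fun k => _) = (fun k => gaussn (r ^+ 2) k *
   \int[lebm d]_x (f x * \int[lebm d]_y (g y * cos (dotv k (x - y)))))); last first.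
  by apply/funext => k; rewrite -fcos_double.
rewrite (transform_double_swap (beta_gauss r2) fi gi measurable_cos1 (@normr_cos_le1 R)).
pose T (m : {measure set V -> \bar R}) (z : V) : R := \int[m]_u gaussn (r ^+ 2)^-1 (u - z).
pose c := gmass d (r ^+ 2).
have bE z : \int[beta]_k (gaussn (r ^+ 2) k * cos (dotv k z)) = c * (T alpha z - lam2 * T (lebm d) z).
  rewrite -[RHS]beta_cos//; congr Rintegral; apply/funext => k.
  by rewrite mulrC (dotvC k).
pose I (m : {measure set V -> \bar R}) x : R := \int[lebm d]_y (g y * T m (x - y)).
have innerE x : \int[lebm d]_y (g y * \int[beta]_k (gaussn (r ^+ 2) k * cos (dotv k (x - y)))) =
    c * (I alpha x - lam2 * I (lebm d) x).
  have i1 := integrable_conv_inner ia ri mg g_le x.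
  have i2 := integrable_conv_inner il ri mg g_le x.
  have i3 := intgbZ lam2 i2.
  rewrite /I -RintegralZl// -RintegralB// -RintegralZl//; last exact: integrable_sub.
  by congr Rintegral; apply/funext => y; rewrite bE /T; ring.
have o1 := integrable_conv_outer ia ri mf mg f_le g_le.
have o2 := integrable_conv_outer il ri mf mg f_le g_le.
have o3 := intgbZ lam2 o2.
transitivity (c * (\int[lebm d]_x (f x * I alpha x) - lam2 * \int[lebm d]_x (f x * I (lebm d) x))).
  rewrite -RintegralZl// -RintegralB// -RintegralZl//; last exact: integrable_sub.
  by congr Rintegral; apply/funext => x; rewrite innerE /I /T; ring.
rewrite (conv_swap ia ri mf mg f_le g_le) (conv_swap il ri mf mg f_le g_le).
have E (m : {measure set V -> \bar R}) : m.-intR (rho 1) ->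
    \int[m]_u \int[lebm d]_x (f x * \int[lebm d]_y (g y * gaussn (r ^+ 2)^-1 (u - (x - y)))) =
    r ^+ d * \int[m]_u smoothed f g r u.
  move=> mr; rewrite -RintegralZl//; last exact: (sm_int mr (ltW r0) r1).
  by congr Rintegral; apply/funext => u; rewrite (conv_gaussn_smoothed tf tg f_le g_le).
by rewrite (E _ ia) (E _ il) -(gmass_scale r0) /pairing /c; ring.
Qed.

Lemma measurable_Ppart : mfunT Ppart.
Proof.
have [mf _ _] := tf; have [mg _ _] := tg.
exact: (measurable_funD (measurable_funM (measurable_fcos mf) (measurable_fcos mg))
  (measurable_funM (measurable_fsin mf) (measurable_fsin mg))).
Qed.

Lemma measurable_Qpart : mfunT Qpart.
Proof.
have [mf _ _] := tf; have [mg _ _] := tg.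
exact: (measurable_funB (measurable_funM (measurable_fcos mf) (measurable_fsin mg))
  (measurable_funM (measurable_fsin mf) (measurable_fcos mg))).
Qed.

Lemma integral_Qpart_gaussn (e : R) : 0 < e -> \int[beta]_k (gaussn e k * Qpart k) = 0.
Proof.
move=> e0; have fi := test_integrable tf; have gi := test_integrable tg.
pose D (k : V) : R := \int[lebm d]_x (f x * \int[lebm d]_y (g y * sin (dotv k (x - y)))).
have QD k : Qpart k = - D k by exact: fsin_double.
have S := transform_double_swap (beta_gauss e0) fi gi measurable_sin1 (@normr_sin_le1 R).
have bE z : \int[beta]_k (gaussn e k * sin (dotv k z)) = 0.
  rewrite -(beta_sin z e0); congr Rintegral; apply/funext => k.
  by rewrite mulrC (dotvC k).
have D0 : \int[beta]_k (gaussn e k * D k) = 0.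
  rewrite S (_ : (fun x => _) = cst 0); first by rewrite /Rintegral integral0.
  apply/funext => x; rewrite (_ : (fun y => _) = cst 0).
    by rewrite /Rintegral integral0/= mulr0.
  by apply/funext => y; rewrite bE mulr0.
have mD : mfunT D.
  rewrite (_ : D = (fun k => -1 * Qpart k)); last by apply/funext => k; rewrite QD mulN1r opprK.
  exact: (measurable_funM (measurable_cst _) measurable_Qpart).
have bi : beta.-intR (fun k => gaussn e k * D k).
  pose M : R := (\int[lebm d]_y `|g y|) * \int[lebm d]_x `|f x|.
  have [mf _ _] := tf; have [mg _ _] := tg.
  apply: (integrable_le (g := fun k => M * gaussn e k)).
  - by apply: measurable_funM => //; exact: measurable_gaussn.
  - move=> k; rewrite normrM (ger0_norm (gaussn_ge0 _ _)) mulrC ler_wpM2r ?gaussn_ge0//.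
    apply: normr_Rintegral_leM => //.
      apply: (@measurable_Rintegral_param _ _ _ _ _ (lebm d) (fun p : V * V => g p.2 * sin (dotv k (p.1 - p.2)))).
      apply: measurable_funM; first by apply: (mcomp mg); exact: measurable_snd.
      apply: (mcomp measurable_sin1); apply: measurable_dotv => //.
      by apply: measurable_rVB; [exact: measurable_fst|exact: measurable_snd].
    move=> x; have := @normr_Rintegral_leM _ _ g (fun y => sin (dotv k (x - y))) 1; rewrite mul1r; apply => //.
      by apply: (mcomp measurable_sin1); apply: measurable_dotv => //; exact: measurable_rVB.
    by move=> y; exact: normr_sin_le1.
  - by apply: intgbZ; exact: beta_gauss.
rewrite (_ : (fun k => _) = (fun k => -1 * (gaussn e k * D k))); last first.
  by apply/funext => k; rewrite QD; ring.
by rewrite RintegralZl// D0 mulr0.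
Qed.

Let r_ n : R := n.+1%:R^-1.
Let r_gt0 n : 0 < r_ n. Proof. by rewrite invr_gt0. Qed.
Let r_le1 n : r_ n <= 1. Proof. by rewrite invf_le1// ler1n. Qed.

Lemma integral_Ppart_cvg : \int[beta]_k (gaussn (r_ n ^+ 2) k * Ppart k) @[n --> \oo] -->
  (2 * pi) ^+ d * pairing alpha lam2 (corr f g).
Proof.
have [Cf Cf0 f_le] := @test_function_rho _ _ 2 f ltac:(by []) tf.
have [Cg Cg0 g_le] := @test_function_rho _ _ 2 g ltac:(by []) tg.
rewrite (_ : (fun n => _) = (fun n => Num.sqrt (2 * pi) ^+ d * pairing alpha lam2 (smoothed f g (r_ n)))); last first.
  by apply/funext => n; exact: integral_Ppart_gaussn.
have -> : (2 * pi) ^+ d * pairing alpha lam2 (corr f g) =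
    Num.sqrt (2 * pi) ^+ d * pairing alpha lam2 (fun u => Num.sqrt (2 * pi) ^+ d * corr f g u).
  have [mf _ _] := tf; have [mg _ _] := tg.
  have c1 := integrable_corr mf mg f_le g_le ia; have c2 := integrable_corr mf mg f_le g_le il.
  rewrite /pairing !RintegralZl//.
  rewrite -{1}(@sqr_sqrtr _ (2 * pi)) ?mulr_ge0 ?pi_ge0// -exprM mulnC exprM.
  by ring.
apply: cvgM; first exact: cvg_cst.
apply: (@pairing_cvg _ _ alpha lam2 alpha_rho).
- by move=> n; exact: measurable_smoothed.
- by move=> u; exact: (smoothed_cvg tf tg f_le g_le).
- by move=> n u; apply: (smoothed_le tf tg f_le g_le); [exact: ltW|exact: r_le1].
Qed.

Let gaussn_cvg1 (u : V) : gaussn (r_ n ^+ 2) u @[n --> \oo] --> (1 : R).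
Proof.
have h : r_ n ^+ 2 * dotv u u / 2 @[n --> \oo] --> (0 : R).
  rewrite -(mul0r (dotv u u / 2)) -(mul0r 0).
  rewrite (_ : (fun n => _) = (fun n => harmonic n * harmonic n * (dotv u u / 2))); last first.
    by apply/funext => n; rewrite /harmonic expr2 mulrA.
  by apply: cvgM; [apply: cvgM; exact: cvg_harmonic|exact: cvg_cst].
have hc : - (r_ n ^+ 2 * dotv u u / 2) @[n --> \oo] --> (0 : R) by rewrite -oppr0; exact: cvgN.
by have := cvg_comp _ _ hc (@continuous_expR R 0); rewrite expR0; apply.
Qed.

(** The Gaussian factors increase to 1 with [n], so monotone convergence gives a limit that is
    already known to be finite. With [g = f], where [Ppart] is the squared modulus of the transform,
    this yields the dominating function for general pairs. *)
Lemma integrable_Ppart_ge0 : (forall k, 0 <= Ppart k) -> beta.-intR Ppart.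
Proof.
move=> P0; apply: integrable_ge0_lty => //; first exact: measurable_Ppart.
pose G n k := (gaussn (r_ n ^+ 2) k * Ppart k)%:E.
have mG n : mfunT (G n).
  apply: measurable_EFin; apply: measurable_funM; [exact: measurable_gaussn|exact: measurable_Ppart].
have G0 n k : (0 <= G n k)%E by rewrite lee_fin mulr_ge0 ?gaussn_ge0.
have ndG k : {homo G^~ k : n m / (n <= m)%N >-> (n <= m)%E}.
  move=> n m nm; rewrite lee_fin ler_wpM2r// ler_expR lerN2 ler_pM2r ?invr_gt0//.
  rewrite ler_wpM2r ?dotv_ge0// ler_pXn2r ?nnegrE ?invr_ge0//.
  by rewrite lef_pV2 ?posrE// ler_nat ltnS.
have := @cvg_monotone_convergence _ _ _ beta setT measurableT G mG (fun n k _ => G0 n k) (fun k _ => ndG k).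
have -> : (fun k => limn (G^~ k)) = EFin \o Ppart.
  apply/funext => k; apply/cvg_lim => //; rewrite /G.
  apply/cvg_EFin; first exact: nearW.
  rewrite [X in _ --> X](_ : _ = 1 * Ppart k); last by rewrite mul1r.
  by apply: cvgM; [exact: gaussn_cvg1|exact: cvg_cst].
have bi n : beta.-intR (fun k => gaussn (r_ n ^+ 2) k * Ppart k).
  have fi := test_integrable tf; have gi := test_integrable tg.
  pose N (h : V -> R) : R := \int[lebm d]_y `|h y|.
  have b (h : V -> R) k : (lebm d).-intR h -> `|fcos h k| <= N h /\ `|fsin h k| <= N h.
    move=> hi; split.
      have := @normr_Rintegral_leM _ _ h (fun x => cos (dotv k x)) 1; rewrite mul1r; apply => //.
        exact: measurable_cos_dotv.
      by move=> x; exact: normr_cos_le1.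
    have := @normr_Rintegral_leM _ _ h (fun x => sin (dotv k x)) 1; rewrite mul1r; apply => //.
      exact: measurable_sin_dotv.
    by move=> x; exact: normr_sin_le1.
  have e0 : 0 < r_ n ^+ 2 by rewrite exprn_gt0.
  apply: (integrable_le _ _ (intgbZ (N f * N g + N f * N g) (beta_gauss e0))).
    by apply: measurable_funM; [exact: measurable_gaussn|exact: measurable_Ppart].
  move=> k; rewrite normrM (ger0_norm (gaussn_ge0 _ _)) mulrC ler_wpM2r ?gaussn_ge0//.
  have [b1 b2] := b f k fi; have [b3 b4] := b g k gi.
  by apply: (le_trans (ler_normD _ _)); rewrite !normrM lerD// ler_pM.
move=> cv; have cv2 := integral_Ppart_cvg.
have cv3 : (\int[beta]_k G n k)%E @[n --> \oo] --> ((2 * pi) ^+ d * pairing alpha lam2 (corr f g))%:E.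
  rewrite (_ : (fun n => _) = (fun n => (\int[beta]_k (gaussn (r_ n ^+ 2) k * Ppart k))%:E)).
    by apply/cvg_EFin; [exact: nearW|exact: cv2].
  by apply/funext => n; rewrite EFin_Rintegral.
have -> : (\int[beta]_x (Ppart x)%:E)%E = ((2 * pi) ^+ d * pairing alpha lam2 (corr f g))%:E.
  exact: (cvg_unique _ cv cv3).
exact: ltry.
Qed.

Lemma integral_part_lim (X Y : V -> R) (l : R) : mfunT X ->
  beta.-intR Y -> (forall k, `|X k| <= Y k) ->
  \int[beta]_k (gaussn (r_ n ^+ 2) k * X k) @[n --> \oo] --> l ->
  \int[beta]_k X k = l.
Proof.
move=> mX iY XY cX; apply: (cvg_unique _ _ cX) => //.
apply: (Rintegral_dct (g := Y)) => //.
- by move=> n; apply: measurable_funM => //; exact: measurable_gaussn.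
- move=> k; rewrite -[X in _ --> X]mul1r; apply: cvgM; [exact: gaussn_cvg1|exact: cvg_cst].
- move=> n k; rewrite normrM (ger0_norm (gaussn_ge0 _ _)); apply: le_trans (XY k).
  by rewrite ler_piMl// gaussn_le1// exprn_ge0// ltW.
Qed.

End pair.

Theorem spectral_isometry (f g : V -> R) : test_function f -> test_function g ->
  cintegrable beta (fun k => fourier f k * (fourier g k)^*%C) /\
  cintegral beta (fun k => fourier f k * (fourier g k)^*%C) =
    ((2 * pi) ^+ d * pairing alpha lam2 (corr f g))%:C%C.
Proof.
move=> tf tg.
have ti (h : V -> R) : test_function h -> (lebm d).-intR h.
  move=> th; have [C C0 hC] := test_function_le th; have [mh _ _] := th.
  exact: (integrable_le mh hC (intgbZ C il)).
have ReE k : complex.Re (fourier f k * (fourier g k)^*%C) = Ppart f g k.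
  by rewrite !fourierE ?ti//= /Ppart; ring.
have ImE k : complex.Im (fourier f k * (fourier g k)^*%C) = Qpart f g k.
  by rewrite !fourierE ?ti//= /Qpart; ring.
have Pge0 h k : 0 <= Ppart h h k by rewrite /Ppart -!expr2 addr_ge0 ?sqr_ge0.
(* By [2 |a b| <= a^2 + b^2] the sum of the two squared moduli dominates both parts of the mixed
   product. *)
pose Y k := Ppart f f k + Ppart g g k.
have iY : beta.-intR Y.
  by apply: integrable_add; apply: integrable_Ppart_ge0.
have PY k : `|Ppart f g k| <= Y k.
  rewrite /Y /Ppart; set a := fcos f k; set b := fcos g k; set c := fsin f k; set e := fsin g k.
  have h1 := sqr_ge0 (a - b); have h2 := sqr_ge0 (a + b); have h3 := sqr_ge0 (c - e); have h4 := sqr_ge0 (c + e).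
  by rewrite ler_norml; apply/andP; split; nra.
have QY k : `|Qpart f g k| <= Y k.
  rewrite /Y /Ppart /Qpart; set a := fcos f k; set b := fcos g k; set c := fsin f k; set e := fsin g k.
  have h1 := sqr_ge0 (a - e); have h2 := sqr_ge0 (a + e); have h3 := sqr_ge0 (c - b); have h4 := sqr_ge0 (c + b).
  by rewrite ler_norml; apply/andP; split; nra.
have mP := measurable_Ppart tf tg; have mQ := measurable_Qpart tf tg.
have iP := integrable_le mP PY iY; have iQ := integrable_le mQ QY iY.
split.
  split.
    by rewrite (_ : (fun k => complex.Re _) = Ppart f g)//; apply/funext => k; exact: ReE.
  by rewrite (_ : (fun k => complex.Im _) = Qpart f g)//; apply/funext => k; exact: ImE.
rewrite /cintegral.
rewrite (_ : (fun k => (complex.Re _)%:E) = (fun k => (Ppart f g k)%:E)); last first.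
  by apply/funext => k; rewrite ReE.
rewrite (_ : (fun k => (complex.Im _)%:E) = (fun k => (Qpart f g k)%:E)); last first.
  by apply/funext => k; rewrite ImE.
rewrite -[fine _]/(\int[beta]_k Ppart f g k) -[fine (\int[beta]_k (Qpart f g k)%:E)%E]/(\int[beta]_k Qpart f g k).
rewrite (integral_part_lim mP iY PY (integral_Ppart_cvg tf tg)).
rewrite (integral_part_lim (l := 0) mQ iY QY)//.
rewrite (_ : (fun n => _) = cst 0); first exact: cvg_cst.
by apply/funext => n; rewrite integral_Qpart_gaussn// exprn_gt0// invr_gt0.
Qed.

End isometry.

(** * Mixtures of measures *)

Section mixture.
Context {dT dU} {T : measurableType dT} {U : measurableType dU} {R : realType}.
Variables (nu : {measure set T -> \bar R}) (k : T -> {measure set U -> \bar R}).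
Hypothesis mk : forall A, measurable A -> mfunT (k ^~ A).
Local Open Scope ereal_scope.

(** The measurability of the family is an argument of the term, so that the measure structure can be
    attached to it. *)
Definition mixture (_ : forall A, measurable A -> mfunT (k ^~ A))
  (A : set U) : \bar R := \int[nu]_t k t A.

Let mix0 : mixture mk set0 = 0.
Proof. by rewrite /mixture (eq_integral (cst 0)) ?integral0// => y _; rewrite measure0. Qed.

Let mix_ge0 A : 0 <= mixture mk A. Proof. exact: integral_ge0. Qed.

Let mix_sigma_additive : semi_sigma_additive (mixture mk).
Proof.
move=> F mF tF mUF; rewrite [X in _ --> X](_ : _ = \int[nu]_t (\sum_(n <oo) k t (F n))); last first.
  by apply: eq_integral => V _; apply/esym/cvg_lim => //; exact/measure_semi_sigma_additive.
apply/cvg_closeP; split.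
  by apply: is_cvg_nneseries => n _ _; exact: integral_ge0.
by rewrite closeE// integral_nneseries// => n; exact: mk.
Qed.

HB.instance Definition _ := isMeasure.Build _ _ R (mixture mk) mix0 mix_ge0 mix_sigma_additive.

Import HBNNSimple.

Let integral_nnsfun (f : {nnsfun U >-> R}) :
  \int[mixture mk]_z (f z)%:E = \int[nu]_y (\int[k y]_z (f z)%:E).
Proof.
under [in LHS]eq_integral do rewrite fimfunE -fsumEFin//.
rewrite ge0_integral_fsum//; last 2 first.
  - by move=> r; exact/measurable_EFinP/mcomp.
  - by move=> r z _; rewrite EFinM nnfun_muleindic_ge0.
under [in RHS]eq_integral.
  move=> y _.
  under eq_integral.
    by move=> z _; rewrite fimfunE -fsumEFin//; over.
  rewrite /= ge0_integral_fsum//; last 2 first.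
    - by move=> r; exact/measurable_EFinP/mcomp.
    - by move=> r z _; rewrite EFinM nnfun_muleindic_ge0.
  under eq_fsbigr.
    move=> r _.
    rewrite (integralZl_indic _ (fun r => f @^-1` [set r]))//; last first.
      by move=> r0; rewrite preimage_nnfun0.
    rewrite integral_indic// setIT.
    over.
  over.
rewrite /= ge0_integral_fsum//; last 2 first.
  - by move=> r; apply: measurable_funeM; exact: mk.
  - move=> n y _.
    have := mulemu_ge0 (fun n => f @^-1` [set n]).
    by apply; exact: preimage_nnfun0.
apply: eq_fsbigr => r _.
rewrite (integralZl_indic _ (fun r => f @^-1` [set r]))//; last first.
  exact: preimage_nnfun0.
rewrite integral_indic// setIT.
have [r0|r0] := leP 0%R r.
  by rewrite ge0_integralZl//; exact: mk.
rewrite preimage_nnfun0// measure0 mule0 integral0_eq// => y _.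
by rewrite measure0 mule0.
Qed.

Lemma ge0_integral_mixture f : (forall z, 0 <= f z) -> mfunT f ->
  \int[mixture mk]_z f z = \int[nu]_y (\int[k y]_z f z).
Proof.
move=> f0 mf.
pose f_ := nnsfun_approx measurableT mf.
transitivity (\int[mixture mk]_z (lim ((f_ n z)%:E @[n --> \oo]))).
  by apply/eq_integral => z _; apply/esym/cvg_lim => //=; exact: cvg_nnsfun_approx.
rewrite monotone_convergence//; last 3 first.
  by move=> n; exact/measurable_EFinP.
  by move=> n z _; rewrite lee_fin.
  by move=> z _ a b ab; rewrite lee_fin; exact/lefP/nd_nnsfun_approx.
rewrite (_ : (fun _ => _) = (fun n => \int[nu]_y (\int[k y]_z (f_ n z)%:E)))//; last first.
  by apply/funext => n; rewrite integral_nnsfun.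
transitivity (\int[nu]_y lim ((\int[k y]_z (f_ n z)%:E) @[n --> \oo])).
  rewrite -monotone_convergence//; last 3 first.
  - move=> n; apply: measurable_fun_integral_kernel => //.
    + by move=> z; rewrite lee_fin.
    + exact/measurable_EFinP.
  - by move=> n y _; apply: integral_ge0 => // z _; rewrite lee_fin.
  - move=> y _ a b ab; apply: ge0_le_integral => //.
    + by move=> z _; rewrite lee_fin.
    + exact/measurable_EFinP.
    + exact/measurable_EFinP.
    + by move=> z _; rewrite lee_fin; exact/lefP/nd_nnsfun_approx.
apply: eq_integral => y _; rewrite -monotone_convergence//; last 3 first.
  - by move=> n; exact/measurable_EFinP.
  - by move=> n z _; rewrite lee_fin.
  - by move=> z _ a b ab; rewrite lee_fin; exact/lefP/nd_nnsfun_approx.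
by apply: eq_integral => z _; apply/cvg_lim => //; exact: cvg_nnsfun_approx.
Qed.

End mixture.

(** * Second moments of random measures *)

Section locally_finite_family.
Context {R : realType} {d : nat}.
Local Notation V := 'rV[R]_d.

Lemma measurable_enorm : mfunT (@enorm R d).
Proof.
rewrite (_ : enorm = Num.sqrt \o (fun x : V => dotv x x))//.
apply: mcomp; first exact: (continuous_measurable_fun (@sqrt_continuous R)).
exact: measurable_dotv_id.
Qed.

Lemma measurable_eball (r : R) : measurable (@eball R d r).
Proof.
by rewrite -[eball r]setTI; apply: (measurable_fun_ltr measurable_enorm (measurable_cst r) measurableT).
Qed.

Lemma bigcup_eball : \bigcup_n (@eball R d n%:R) = setT.
Proof.
rewrite -subTset => x _; exists (Num.truncn (enorm x)).+1 => //.
by rewrite /eball/= truncnS_gt.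
Qed.

Lemma subset_eball (r s : R) : r <= s -> @eball R d r `<=` eball s.
Proof. by move=> rs x /= /lt_le_trans; apply. Qed.

Lemma locally_finite_sigma_finite (m : {measure set V -> \bar R}) :
  locally_finite m -> sigma_finite setT m.
Proof.
move=> lf; exists (fun n => eball n%:R); first by rewrite bigcup_eball.
by move=> n; split; [exact: measurable_eball|exact: lf].
Qed.

Context {dX} {X : measurableType dX}.
Variable l : X -> {measure set V -> \bar R}.
Hypothesis ml : forall A, measurable A -> mfunT (l ^~ A).
Hypothesis lf : forall x, locally_finite (l x).

Let K : kernel X V R := HB.pack l (isKernel.Build _ _ X V R l ml).

(** The family is finite on balls only: it is cut off by the ball of radius [n], where the result
    for bounded kernels applies, and the cut-off values increase to the full one. *)
Lemma measurable_xsection_lf (A : set (X * V)) : measurable A ->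
  mfunT (fun x => l x (xsection A x)).
Proof.
move=> mA; apply: (emeasurable_fun_cvg (fun n x => l x (xsection A x `&` eball n%:R))).
  move=> n; have [|_] := @measurable_prod_subset_xsection_kernel _ _ _ _ _ K _ (measurable_eball n%:R) _ A mA; last by [].
  move=> x; exists (fine (l x (eball n%:R)) + 1) => B mB.
  apply: (@le_lt_trans _ _ (l x (eball n%:R))).
    rewrite /mrestr le_measure ?inE//; first by apply: measurableI => //; exact: measurable_eball.
    exact: measurable_eball.
  rewrite EFinD fineK ?ge0_fin_numE ?lf// lteDl ?lte01//.
  by rewrite ge0_fin_numE ?lf.
move=> x _.
have -> : l x (xsection A x) = l x (\bigcup_n (xsection A x `&` eball n%:R)).
  by rewrite -setI_bigcupr bigcup_eball setIT.
have mAx : measurable (xsection A x) by exact: measurable_xsection.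
apply: (nondecreasing_cvg_mu (mu := l x)).
- by move=> n; apply: measurableI => //; exact: measurable_eball.
- by apply: bigcupT_measurable => n; apply: measurableI => //; exact: measurable_eball.
- move=> n m nm; apply/subsetPset; apply: setIS; apply: subset_eball.
  by rewrite ler_nat.
Qed.

Import HBNNSimple.

Lemma measurable_lf_integral (k : X * V -> \bar R) : mfunT k ->
  (forall p, 0 <= k p)%E -> mfunT (fun x => \int[l x]_y k (x, y))%E.
Proof.
move=> mk k0; pose k_ := nnsfun_approx measurableT mk.
apply: (@measurable_fun_xsection_integral _ _ _ _ _ k l k_).
- by move=> a b ab; exact/nd_nnsfun_approx.
- by move=> z; exact/cvg_nnsfun_approx.
- move=> n r; have mA : measurable ((k_ n : X * V -> R) @^-1` [set r]) by [].
  exact: (measurable_xsection_lf mA).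
Qed.

End locally_finite_family.

(** * Joint measurability of continuous fields *)

Section joint_measurability.
Context {R : realType} {d : nat} {dT} {T : measurableType dT}.
Local Notation V := 'rV[R]_d.
Variable Z : T -> V -> V.
Hypothesis Z_cont : forall t, continuous (Z t).
Hypothesis Z_meas : forall x, mfunT (Z ^~ x).

Let q n (x : V) : 'rV[int]_d := \row_i Num.floor (x 0 i * n.+1%:R).
Let g n (z : 'rV[int]_d) : V := \row_i ((z 0 i)%:~R / n.+1%:R).

Let q_le n x : `|x - g n (q n x)| <= n.+1%:R^-1.
Proof.
rewrite /Num.norm/= mx_normrE; apply: bigmax_le; first by rewrite invr_ge0.
move=> [i j] _ /=; rewrite ord1 !mxE.
have /andP[h1 h2] := floor_itv (x 0 j * n.+1%:R); set z := (Num.floor _)%:~R in h1 *.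
rewrite intrD -/z in h2; have n0 : 0 < n.+1%:R :> R by [].
have -> : x 0 j - z / n.+1%:R = (x 0 j * n.+1%:R - z) / n.+1%:R.
  by field; rewrite gt_eqF.
rewrite normrM ger0_norm ?subr_ge0// ger0_norm ?invr_ge0// -[leRHS]mul1r ler_wpM2r ?invr_ge0//.
by rewrite lerBlDl ltW.
Qed.

Let q_cvg x : g n (q n x) @[n --> \oo] --> x.
Proof.
apply/cvgrPdist_lt => e e0; near=> n; apply: (le_lt_trans (q_le n x)).
near: n; have := cvg0_norm_lt (@cvg_harmonic R) e0; apply: filterS => n.
by rewrite /harmonic ger0_norm// invr_ge0.
Unshelve. all: by end_near. Qed.

Let mq n z : measurable [set x : V | q n x = z].
Proof.
rewrite (_ : [set x | _] = \bigcap_(i in [set: 'I_d]) [set x : V | (z 0 i)%:~R <= x 0 i * n.+1%:R < (z 0 i + 1)%:~R]).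
  apply: fin_bigcap_measurable => // i _.
  have mc : mfunT (fun x : V => x 0 i * n.+1%:R).
    by apply: measurable_funM => //; exact: measurable_coord.
  rewrite (_ : [set x | _] = (fun x : V => x 0 i * n.+1%:R) @^-1` `[(z 0 i)%:~R, (z 0 i + 1)%:~R[).
    by rewrite -[X in measurable X]setTI; apply: mc.
  by apply/seteqP; split => x /=; rewrite in_itv.
apply/seteqP; split => [x /= <- i _ /=|x /= h].
  by rewrite mxE; exact: floor_itv.
by apply/rowP => i; rewrite mxE; apply: floor_def; exact: (h i I).
Qed.

(** Rounding [x] down to the grid of mesh [1 / (n+1)] leaves countably many points, at each of which
    the field is measurable in [t]; continuity of the paths gives the limit in [n]. *)
Lemma measurable_joint : mfunT (fun p : T * V => Z p.1 p.2).
Proof.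
apply: measurable_fun_rV => i.
apply: (measurable_fun_cvg (h := fun n p => Z p.1 (g n (q n p.2)) 0 i)); last first.
  move=> [t x] _ /=.
  have : Z t (g n (q n x)) @[n --> \oo] --> Z t x.
    apply: (@cvg_comp _ _ _ (fun n => g n (q n x)) (Z t) _ _ _ (@q_cvg x)); exact: Z_cont.
  move=> h; apply: (@cvg_comp _ _ _ (fun n => Z t (g n (q n x))) (fun v : V => v 0 i) _ _ _ h); exact: coord_continuous.
move=> n _ B mB; rewrite setTI.
rewrite (_ : _ @^-1` B = \bigcup_z (((fun t => Z t (g n z) 0 i) @^-1` B) `*` [set x | q n x = z])); last first.
  apply/seteqP; split => [[t x] /= tB|[t x] [z _ /= [tB qz]]]; last by rewrite qz.
  by exists (q n x).
apply: countable_bigcupT_measurable; first exact: countableP.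
move=> z; apply: measurableX => //.
rewrite -[X in measurable X]setTI; apply: (mcomp (@measurable_coord R d i) (Z_meas (g n z))) => //.
Qed.

End joint_measurability.

(** * Boxes and balls *)

Section boxes.
Context {R : realType} {d : nat}.
Local Notation V := 'rV[R]_d.

Definition box (r : R) : set V := [set x | forall i, 0 <= x 0 i < r].

Lemma measurable_box r : measurable (box r).
Proof.
rewrite (_ : box r = \bigcap_(i in [set: 'I_d]) ((fun x : V => x 0 i) @^-1` `[0, r[)).
  apply: fin_bigcap_measurable => // i _; rewrite -[X in measurable X]setTI.
  exact: measurable_coord.
by apply/seteqP; split => [x h i _|x h i] /=; [rewrite in_itv; exact: h|have := h i I; rewrite /= in_itv].
Qed.

Lemma integral_box r : 0 <= r -> (\int[lebm d]_x (\1_(box r) x)%:E = (r ^+ d)%:E)%E.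
Proof.
move=> r0; rewrite (_ : (fun x => _) = (fun x : V => (\prod_i (\1_(`[0, r[%classic : set R) (x 0 i) : R))%:E)).
  rewrite ge0_integral_lebm_prod//.
  transitivity (lebesgue_measure (`[0%R, r[%classic : set R) ^+ d)%E.
    by rewrite integral_indic// setIT.
  rewrite lebesgue_measure_itv/= lte_fin.
  case: ltgtP r0 => // [r0 _|<- _]; first by rewrite -EFinB subr0 EFin_expe.
  by rewrite EFin_expe.
apply/funext => x; congr EFin; rewrite indicE.
have [/set_mem xb|xb] := boolP (x \in _).
  rewrite big1// => i _; rewrite indicE mem_set//= in_itv; exact: xb.
apply/eqP; rewrite eq_sym prodf_seq_eq0; apply/hasP.
have /existsNP[i xi] : ~ forall i, 0 <= x 0 i < r by move=> h; move/negP: xb; apply; exact/mem_set.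
exists i; first exact: mem_index_enum.
by rewrite /= indicE memNset//= in_itv.
Qed.

Lemma enorm_le_l1 (x : V) : enorm x <= l1 x.
Proof.
rewrite /enorm -[l1 x]ger0_norm ?l1_ge0// -sqrtr_sqr ler_wsqrtr//.
rewrite expr2 {2}/l1 mulr_sumr /dotv; apply: ler_sum => i _.
apply: (le_trans (ler_norm _)); rewrite normrM ler_wpM2r//; exact: normr_coord_le.
Qed.

(** With [d.+1] instead of [d] the sum of the coordinates stays strictly below 1, also in dimension
    0. *)
Let r0 : R := d.+1%:R^-1.

Lemma l1_small_box x : box r0 x -> l1 x < 1.
Proof.
move=> xb; apply: (@le_lt_trans _ _ (d%:R * r0)).
  rewrite (_ : d%:R * r0 = \sum_(i < d) r0); last by rewrite sumr_const card_ord mulr_natl.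
  by apply: ler_sum => i _; have /andP[h1 h2] := xb i; rewrite ger0_norm// ltW.
by rewrite /r0 ltr_pdivrMr// mul1r ltr_nat.
Qed.

Lemma small_box_eball : box r0 `<=` eball 1.
Proof. by move=> x xb; apply: (le_lt_trans (enorm_le_l1 x)); exact: l1_small_box. Qed.

End boxes.

Lemma mule_le_sqr {R : realType} (a b : \bar R) : (0 <= a -> 0 <= b -> a * b <= a * a + b * b)%E.
Proof.
case: a => [a| |]; case: b => [b| |] //.
- move=> a0 b0; rewrite -!EFinM -EFinD lee_fin.
  have := sqr_ge0 (a - b); rewrite !lee_fin in a0 b0.
  have := mulr_ge0 a0 b0; nra.
- by move=> _ _; rewrite mulyy addey ?leey// -EFinM.
- by move=> _ _; rewrite mulyy addye ?leey// -EFinM.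
Qed.

(** * Stationary random measures and Campbell formulas *)

Section stationary.
Context {R : realType} {d : nat} {dO} {Omega : measurableType dO} {P : probability Omega R}.
Local Notation V := 'rV[R]_d.
Variables (theta : V -> Omega -> Omega) (Phi : Omega -> {measure set V -> \bar R}).
Hypotheses (flow : preserving_flow P theta)
  (mPhi : forall A, measurable A -> mfunT (Phi ^~ A))
  (lfPhi : forall w, locally_finite (Phi w)) (invPhi : invariant_measure theta Phi).
Local Open Scope ereal_scope.

Let sPhi w := sfm_of (locally_finite_sigma_finite (lfPhi w)).

Lemma measurable_theta t : mfunT (theta t).
Proof. exact: (mcomp (measurable_flow flow) (measurable_pair2 t)). Qed.

Lemma integral_flow t (F : Omega -> \bar R) : mfunT F ->
  \int[P]_w F (theta t w) = \int[P]_w F w.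
Proof.
by apply: integral_mpres; [exact: measurable_theta|move=> A mA; exact: (flow_preserves flow)].
Qed.

Lemma translateE (B : set V) x : translate B x = (fun y : V => y - x)%R @^-1` B.
Proof.
apply/seteqP; split => [_ [b Bb <-]|y By] /=; first by rewrite addrK.
by exists (y - x)%R => //; rewrite subrK.
Qed.

Lemma measurable_subr (t : V) : mfunT (fun y : V => y - t)%R.
Proof. exact: measurable_rVB. Qed.

Lemma integral_shift t w (h : V -> \bar R) : mfunT h -> (forall x, 0 <= h x) ->
  \int[Phi (theta t w)]_x h x = \int[Phi w]_x h (x - t)%R.
Proof.
move=> mh h0; rewrite -(ge0_integral_pushm (Phi w) (measurable_subr t) mh h0).
by apply: eq_setfun_integral => A mA; rewrite invPhi// translateE.
Qed.

Lemma Tonelli_lebm (f : V * (Omega * V) -> \bar R) : mfunT f -> (forall p, 0 <= f p) ->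
  \int[lebm d]_t \int[P]_w \int[Phi w]_x f (t, (w, x)) =
  \int[P]_w \int[Phi w]_x \int[lebm d]_t f (t, (w, x)).
Proof.
move=> mf f0.
have mg : mfunT (fun p : V * Omega => \int[Phi p.2]_x f (p.1, (p.2, x))).
  apply: (@measurable_lf_integral R d _ _ (fun p : V * Omega => Phi p.2) _ _
    (fun q : (V * Omega) * V => f (q.1.1, (q.1.2, q.2)))) => //.
    by move=> A mA; apply: (mcomp (mPhi mA)); exact: measurable_snd.
  apply: (mcomp mf); apply: measurable_fun_pair.
    by apply: (mcomp (@measurable_fst _ _ _ _)); exact: measurable_fst.
  apply: measurable_fun_pair; last exact: measurable_snd.
  by apply: (mcomp (@measurable_snd _ _ _ _)); exact: measurable_fst.
rewrite (@fubini_tonelli _ _ _ _ _ (lebm d) P (fun p => \int[Phi p.2]_x f (p.1, (p.2, x))))//=; last first.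
  by move=> p; exact: integral_ge0.
apply: eq_integral => w _.
apply: (@fubini_tonelli _ _ _ _ _ (lebm d) (sPhi w) (fun p : V * V => f (p.1, (w, p.2)))) => //.
apply: (mcomp mf); apply: measurable_fun_pair; first exact: measurable_fst.
by apply: measurable_fun_pair => //; exact: measurable_snd.
Qed.

Lemma measurable_Phi_integral (f : Omega * V -> \bar R) : mfunT f -> (forall p, 0 <= f p) ->
  mfunT (fun w => \int[Phi w]_x f (w, x)).
Proof. exact: (measurable_lf_integral mPhi lfPhi). Qed.

Let c (x : V) : \bar R := (\1_(@unit_cube R d) x)%:E.
Let mc : mfunT c.
Proof. by apply: measurable_EFin; apply: measurable_indic; exact: (measurable_box 1). Qed.
Let c0 x : 0 <= c x. Proof. by rewrite lee_fin indicE. Qed.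

Section palm.
Variable D : V * (Omega * V) -> \bar R.
Hypotheses (mD : mfunT D) (D0 : forall p, 0 <= D p).
Hypothesis Dinv : forall s t w x, D (s, (theta t w, x)) = D (s, (w, x + t)%R).

Let msub : mfunT (fun p : V * (Omega * V) => p.2.2 - p.1)%R.
Proof.
apply: measurable_rVB; last exact: measurable_fst.
by apply: (mcomp (@measurable_snd _ _ _ _)); exact: measurable_snd.
Qed.

(** By stationarity the left side may be averaged over shifts [t] in the unit cube. The substitution
    [s = x - t] moves the cube to [s] and turns the location [x] in [D] into the free variable [s];
    stationarity under [theta s] brings the cube back to the origin. *)
Lemma palm : \int[P]_w \int[Phi w]_x D (x, (w, x)) =
  \int[lebm d]_s \int[P]_w \int[Phi w]_x (c x * D (s, (w, x))).
Proof.
have mwx : mfunT (fun p : Omega * V => D (p.2, p)).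
  by apply: (mcomp mD); apply: measurable_fun_pair => //; exact: measurable_snd.
have shiftL t : \int[P]_w \int[Phi w]_x D (x, (w, x)) = \int[P]_w \int[Phi w]_x D ((x - t)%R, (w, x)).
  rewrite -[LHS](integral_flow t); last exact: (measurable_Phi_integral mwx).
  apply: eq_integral => w _; rewrite integral_shift//.
    by apply: eq_integral => x _; rewrite Dinv subrK.
  exact: (mcomp mwx (measurable_pair1 (theta t w))).
have md1 : mfunT (fun p : V * (Omega * V) => D ((p.2.2 - p.1)%R, p.2)).
  by apply: (mcomp mD); apply: measurable_fun_pair => //; exact: measurable_snd.
have mf1 : mfunT (fun p : V * (Omega * V) => c p.1 * D ((p.2.2 - p.1)%R, p.2)).
  by apply: emeasurable_funM => //; apply: (mcomp mc); exact: measurable_fst.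
have mf2 : mfunT (fun p : V * (Omega * V) => c (p.2.2 - p.1)%R * D p).
  by apply: emeasurable_funM => //; apply: (mcomp mc).
have mI t : mfunT (fun w => \int[Phi w]_x D ((x - t)%R, (w, x))).
  apply: (measurable_Phi_integral (f := fun q : Omega * V => D ((q.2 - t)%R, q))) => //.
  exact: (mcomp md1 (measurable_pair1 t)).
transitivity (\int[lebm d]_t (c t * \int[P]_w \int[Phi w]_x D (x, (w, x)))).
  rewrite ge0_integralZr//; last by do 2 apply: integral_ge0 => ? _.
  have c1 : \int[lebm d]_x c x = 1.
    by rewrite -[LHS]/(\int[lebm d]_x (\1_(box (1 : R)) x)%:E) integral_box// expr1n.
  by rewrite c1 mul1e.
transitivity (\int[lebm d]_t \int[P]_w \int[Phi w]_x (c t * D ((x - t)%R, (w, x)))).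
  apply: eq_integral => t _; rewrite (shiftL t) -ge0_integralZl//; last first.
    by move=> w _; apply: integral_ge0.
  apply: eq_integral => w _; rewrite -ge0_integralZl//.
  exact: (mcomp (mcomp md1 (measurable_pair1 t)) (measurable_pair1 w)).
apply: (etrans (Tonelli_lebm mf1 (fun p => mule_ge0 (c0 p.1) (D0 _)))).
transitivity (\int[P]_w \int[Phi w]_x \int[lebm d]_s (c (x - s)%R * D (s, (w, x)))).
  apply: eq_integral => w _; apply: eq_integral => x _.
  have mG := mcomp mf2 (measurable_pair2 (w, x)).
  rewrite -(integral_lebm_refl x mG)/=; apply: eq_integral => t _.
  by rewrite opprB addrCA subrr addr0.
apply: (etrans (esym (Tonelli_lebm mf2 (fun p => mule_ge0 (c0 _) (D0 p))))).
apply: eq_integral => s _.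
have mH : mfunT (fun p : Omega * V => c p.2 * D (s, p)).
  apply: emeasurable_funM; first by apply: (mcomp mc); exact: measurable_snd.
  exact: (mcomp mD (measurable_pair1 s)).
rewrite -[RHS](integral_flow s); last first.
  by apply: (measurable_Phi_integral mH) => p; exact: mule_ge0.
apply: eq_integral => w _; rewrite integral_shift//.
- by apply: eq_integral => x _; rewrite Dinv subrK.
- exact: (mcomp mH (measurable_pair1 (theta s w))).
- by move=> x; exact: mule_ge0.
Qed.

End palm.

Definition intensity : \bar R := \int[P]_w \int[Phi w]_x c x.

Lemma mean_measure (h : V -> \bar R) : mfunT h -> (forall x, 0 <= h x) ->
  \int[P]_w \int[Phi w]_x h x = intensity * \int[lebm d]_x h x.
Proof.
move=> mh h0; have mI : mfunT (fun w => \int[Phi w]_x c x).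
  apply: (measurable_Phi_integral (f := fun q : Omega * V => c q.2)) => //.
  by apply: (mcomp mc); exact: measurable_snd.
rewrite (palm (D := fun p => h p.1))//; last by apply: (mcomp mh); exact: measurable_fst.
rewrite -ge0_integralZl//; last by do 2 apply: integral_ge0 => ? _.
apply: eq_integral => s _; rewrite -ge0_integralZr//; last by move=> w _; apply: integral_ge0.
by apply: eq_integral => w _; rewrite -ge0_integralZr.
Qed.

Let mcube : measurable (@unit_cube R d). Proof. exact: (measurable_box 1). Qed.

(** The iterated integral [reduced_second_moment] becomes a measure as a mixture of mixtures: for
    fixed [y] the image of [Phi w] restricted to the cube, mixed over [y] with weight [Phi w] and
    then over [w]. *)
Definition inner_second_moment w (y : V) : {measure set V -> \bar R} :=
  pushm (mrestr (Phi w) mcube) (measurable_subr y).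

Let ismE w y A : measurable A ->
  inner_second_moment w y A = \int[Phi w]_x (c x * (\1_A (x - y)%R)%:E).
Proof.
move=> mA; rewrite -[LHS]mul1e -[A in LHS]setIT -integral_indic// mul1e.
have mi : mfunT (fun x : V => (\1_A x : R)%:E) by apply: measurable_EFin; exact: measurable_indic.
rewrite ge0_integral_pushm// ge0_integral_mrestr//; last first.
  by apply: (mcomp mi); exact: measurable_subr.
rewrite integral_mkcond; apply: eq_integral => x _; rewrite patchE /c !indicE.
by case: (x \in unit_cube); rewrite ?mul1e ?mul0e.
Qed.

Lemma measurable_Phi_integral2 (f : (Omega * V) * V -> \bar R) :
  mfunT f -> (forall p, 0 <= f p) ->
  mfunT (fun q : Omega * V => \int[Phi q.1]_x f (q, x)).
Proof.
apply: (@measurable_lf_integral R d _ _ (fun q : Omega * V => Phi q.1)) => //.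
by move=> A mA; apply: (mcomp (mPhi mA)); exact: measurable_fst.
Qed.

Let mdiff : mfunT (fun p : (Omega * V) * V => p.2 - p.1.2)%R.
Proof.
apply: measurable_rVB; first exact: measurable_snd.
by apply: (mcomp (@measurable_snd _ _ _ _)); exact: measurable_fst.
Qed.

Let mcdiff (h : V -> \bar R) : mfunT h ->
  mfunT (fun p : (Omega * V) * V => c p.2 * h (p.2 - p.1.2)%R).
Proof.
move=> mh; apply: emeasurable_funM; last exact: (mcomp mh mdiff).
by apply: (mcomp mc); exact: measurable_snd.
Qed.

Let mI A : measurable A -> mfunT (fun x : V => (\1_A x : R)%:E).
Proof. by move=> mA; apply: measurable_EFin; exact: measurable_indic. Qed.

Let mism2 A : measurable A -> mfunT (fun q : Omega * V => inner_second_moment q.1 q.2 A).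
Proof.
move=> mA; rewrite (_ : (fun q => _) = (fun q : Omega * V =>
    \int[Phi q.1]_x (c x * (\1_A (x - q.2)%R)%:E))); last by apply/funext => q; rewrite ismE.
apply: (measurable_Phi_integral2 (f := fun p : (Omega * V) * V => c p.2 * (\1_A (p.2 - p.1.2)%R)%:E)).
  exact: (mcdiff (mI mA)).
by move=> p; rewrite mule_ge0// lee_fin indicE.
Qed.

Lemma measurable_ism w A : measurable A -> mfunT (fun y => inner_second_moment w y A).
Proof. by move=> mA; exact: (mcomp (mism2 mA) (measurable_pair1 w)). Qed.

Lemma measurable_mism A : measurable A ->
  mfunT (fun w => mixture (Phi w) (measurable_ism w) A).
Proof.
move=> mA; apply: (measurable_Phi_integral (f := fun q : Omega * V => inner_second_moment q.1 q.2 A)) => //.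
exact: mism2.
Qed.

Definition second_moment_measure : {measure set V -> \bar R} := mixture P measurable_mism.

Lemma integral_second_moment (h : V -> \bar R) : mfunT h -> (forall x, 0 <= h x) ->
  \int[second_moment_measure]_u h u = \int[P]_w \int[Phi w]_y \int[Phi w]_x (c x * h (x - y)%R).
Proof.
move=> mh h0; rewrite ge0_integral_mixture//; apply: eq_integral => w _.
rewrite ge0_integral_mixture//; apply: eq_integral => y _.
have mhy : mfunT (fun x : V => h (x - y)%R).
  by apply: (mcomp mh); exact: measurable_subr.
rewrite ge0_integral_pushm// ge0_integral_mrestr//.
rewrite integral_mkcond; apply: eq_integral => x _; rewrite patchE /c !indicE.
by case: (x \in unit_cube); rewrite ?mul1e ?mul0e.
Qed.

Lemma second_moment_measureE B : measurable B ->
  second_moment_measure B = reduced_second_moment P Phi B.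
Proof.
move=> mB; rewrite -[LHS]mul1e -[B in LHS]setIT -integral_indic// mul1e integral_second_moment//.
exact: mI.
Qed.

Lemma Phi_swap w (f : V * V -> \bar R) : mfunT f -> (forall p, 0 <= f p) ->
  \int[Phi w]_x \int[Phi w]_y f (x, y) = \int[Phi w]_y \int[Phi w]_x f (x, y).
Proof. by move=> mf f0; exact: (@fubini_tonelli _ _ _ _ _ (sPhi w) (sPhi w) f). Qed.

(** [palm] is applied to the integral of [k (s, x - y)] over [y]: since only the difference enters,
    moving along the flow has the same effect as moving [x]. *)
Lemma campbell (k : V * V -> \bar R) : mfunT k -> (forall p, 0 <= k p) ->
  \int[P]_w \int[Phi w]_x \int[Phi w]_y k (x, (x - y)%R) =
  \int[lebm d]_s \int[second_moment_measure]_u k (s, u).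
Proof.
move=> mk k0.
have mk2 : mfunT (fun p : (V * (Omega * V)) * V => k (p.1.1, (p.1.2.2 - p.2)%R)).
  apply: (mcomp mk); apply: measurable_fun_pair.
    by apply: (mcomp (@measurable_fst _ _ _ _)); exact: measurable_fst.
  apply: measurable_rVB; last exact: measurable_snd.
  apply: (mcomp (@measurable_snd _ _ _ _)).
  by apply: (mcomp (@measurable_snd _ _ _ _)); exact: measurable_fst.
have mD : mfunT (fun p : V * (Omega * V) => \int[Phi p.2.1]_y k (p.1, (p.2.2 - y)%R)).
  apply: (@measurable_lf_integral R d _ _ (fun p : V * (Omega * V) => Phi p.2.1) _ _
    (fun p : (V * (Omega * V)) * V => k (p.1.1, (p.1.2.2 - p.2)%R))) => //.
  move=> A mA; apply: (mcomp (mPhi mA)).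
  by apply: (mcomp (@measurable_fst _ _ _ _)); exact: measurable_snd.
rewrite (palm mD)/=; last 2 first.
- by move=> p; apply: integral_ge0.
- move=> s t w x /=; rewrite integral_shift//.
    by apply: eq_integral => y _; rewrite opprB addrA addrAC -addrA.
  exact: (mcomp mk2 (measurable_pair1 (s, (theta t w, x)))).
apply: eq_integral => s _.
have mks : mfunT (fun u => k (s, u)) by exact: (mcomp mk (measurable_pair1 s)).
rewrite (integral_second_moment mks (fun u => k0 (s, u))); apply: eq_integral => w _.
have mf : mfunT (fun p : V * V => c p.1 * k (s, (p.1 - p.2)%R)).
  apply: emeasurable_funM; first by apply: (mcomp mc); exact: measurable_fst.
  by apply: (mcomp mks); apply: measurable_rVB; [exact: measurable_fst|exact: measurable_snd].
apply: (etrans _ (Phi_swap w mf (fun p => mule_ge0 (c0 p.1) (k0 _)))).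
apply: eq_integral => x _; rewrite -ge0_integralZl//.
by apply: (mcomp mks); exact: measurable_rVB.
Qed.

Hypothesis sqPhi : locally_square_integrable P Phi.

Let r : R := d.+1%:R^-1.
Let r_gt0 : (0 < r)%R. Proof. by rewrite invr_gt0. Qed.
Let rd_gt0 : (0 < r ^+ d)%R. Proof. by rewrite exprn_gt0. Qed.
Let b (x : V) : \bar R := (\1_(@box R d r) x)%:E.
Let mb : mfunT b. Proof. by apply: mI; exact: measurable_box. Qed.
Let b0 x : 0 <= b x. Proof. by rewrite lee_fin indicE. Qed.
Let N w : \bar R := \int[Phi w]_x b x.
Let mN : mfunT N.
Proof.
apply: (measurable_Phi_integral (f := fun q : Omega * V => b q.2)) => //.
by apply: (mcomp mb); exact: measurable_snd.
Qed.
Let N0 w : 0 <= N w. Proof. exact: integral_ge0. Qed.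

Let N_sq : \int[P]_w (N w * N w) < +oo.
Proof.
apply: (le_lt_trans _ sqPhi); apply: ge0_le_integral => //.
- by move=> w _; rewrite mule_ge0.
- exact: emeasurable_funM.
- have := mPhi (measurable_eball 1) => mE.
  by apply: (eq_measurable_fun (fun w => Phi w (eball 1) * Phi w (eball 1))) => //; exact: emeasurable_funM.
move=> w _; have h : N w <= Phi w (eball 1).
  rewrite /N integral_indic ?setIT//; last exact: measurable_box.
  by apply: le_measure; rewrite ?inE; [exact: measurable_box|exact: measurable_eball|exact: small_box_eball].
exact: lee_pmul.
Qed.

Lemma intensity_lty : intensity < +oo.
Proof.
have h : intensity * (r ^+ d)%:E < +oo.
  rewrite -(@integral_box R d r (ltW r_gt0)) -mean_measure//.
  apply: (@le_lt_trans _ _ (\int[P]_w (1 + N w * N w))).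
    rewrite -[leLHS]/(\int[P]_w N w); apply: ge0_le_integral => //; first by apply: emeasurable_funD => //; exact: emeasurable_funM.
    move=> w _; case: (N w) (N0 w) => [a| |]// a0.
      by rewrite -EFinM -EFinD lee_fin; have := sqr_ge0 (a - 1)%R; rewrite lee_fin in a0; nra.
  rewrite ge0_integralD//; last 2 first.
  - by move=> w _; rewrite mule_ge0.
  - exact: emeasurable_funM.
  rewrite (_ : \int[P]__ 1 = 1); first by rewrite lte_add_pinfty// ltry.
  by rewrite (integral_cst P measurableT 1) mul1e; exact: probability_setT.
rewrite ltNge leye_eq; apply/negP => /eqP ioo; move: h.
by rewrite ioo gt0_mulye ?lte_fin// ltxx.
Qed.

(** Across the small box [rho 1] varies by a factor at most [exp 1], so it is bounded by an average
    over a box of volume [r ^+ d]. An integral over shifts, which the flow can handle, thus replaces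
    a sum over a covering. *)
Let rho_le (y : V) : (rho 1 y)%:E <= (expR 1 / r ^+ d)%:E * \int[lebm d]_t ((rho 1 t)%:E * b (y - t)%R).
Proof.
have mbt : mfunT (fun t : V => b (y - t)%R).
  by apply: (mcomp mb); exact: measurable_rVB.
have mr : mfunT (fun t : V => (rho 1 t : R)%:E).
  by apply: measurable_EFin; exact: measurable_rho.
have h : (expR (-1) * rho 1 y)%:E * \int[lebm d]_t b (y - t)%R <= \int[lebm d]_t ((rho 1 t)%:E * b (y - t)%R).
  rewrite -ge0_integralZl//; last by rewrite lee_fin mulr_ge0 ?expR_ge0 ?rho_ge0.
  apply: ge0_le_integral => //.
  - by move=> t _; rewrite mule_ge0// lee_fin mulr_ge0 ?expR_ge0 ?rho_ge0.
  - by apply: emeasurable_funM.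
  - by apply: emeasurable_funM.
  move=> t _; rewrite /b indicE; have [/set_mem/= bt|_] := boolP (_ \in _); last by rewrite !mule0.
  rewrite !mule1 lee_fin /rho -expRD ler_expR.
  have h1 := l1_small_box bt; have := l1D y (- (y - t))%R.
  rewrite l1N (_ : y + - (y - t) = t)%R; first lra.
  by rewrite opprB addrCA subrr addr0.
have -> : (rho 1 y)%:E = (expR 1 / r ^+ d)%:E * ((expR (-1) * rho 1 y)%:E * \int[lebm d]_t b (y - t)%R).
  rewrite (integral_lebm_refl y mb) integral_box ?(ltW r_gt0)// -!EFinM; congr EFin.
  rewrite -mulrA [(_^-1 * _)%R]mulrC -!mulrA mulfV ?gt_eqF// mulr1 mulrA -expRD subrr expR0 mul1r//.
by apply: lee_wpmul2l => //; rewrite lee_fin divr_ge0 ?expR_ge0// ltW.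
Qed.

(** By [rho_le] the integral is at most a constant times the integral over [t] of [rho 1 t] times
    the expectation of [N w * N (theta t w)]. A product is at most the sum of the squares, and
    stationarity bounds this expectation by twice the second moment of [N]. *)
Lemma second_moment_rho : \int[second_moment_measure]_u (rho 1 u)%:E < +oo.
Proof.
have mr : mfunT (fun t : V => (rho 1 t : R)%:E).
  by apply: measurable_EFin; exact: measurable_rho.
have r0 (x : V) : 0 <= (rho 1 x : R)%:E by rewrite lee_fin rho_ge0.
suff h : \int[second_moment_measure]_u (rho 1 u)%:E * (r ^+ d)%:E < +oo.
  rewrite ltNge leye_eq; apply/negP => /eqP ioo; move: h.
  by rewrite ioo gt0_mulye ?lte_fin// ltxx.
rewrite muleC -(@integral_box R d r (ltW r_gt0)) -ge0_integralZr//; last exact: integral_ge0.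
have -> : \int[lebm d]_x (b x * \int[second_moment_measure]_u (rho 1 u)%:E) =
   \int[lebm d]_s \int[second_moment_measure]_u (b s * (rho 1 u)%:E).
  by apply: eq_integral => s _; rewrite ge0_integralZl.
have mk : mfunT (fun p : V * V => b p.1 * (rho 1 p.2)%:E).
  apply: emeasurable_funM; first by apply: (mcomp mb); exact: measurable_fst.
  by apply: (mcomp mr); exact: measurable_snd.
have /= C1 := campbell mk (fun p => mule_ge0 (b0 p.1) (r0 p.2)).
rewrite -C1 {C1}.
pose C : R := (expR 1 * (expR 1 / r ^+ d))%R.
have C0 : (0 <= C)%R by rewrite mulr_ge0 ?divr_ge0 ?expR_ge0// ltW.
have mNt : mfunT (fun p : Omega * V => N (theta p.2 p.1)).
  exact: (mcomp mN (measurable_flow flow)).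
have mrN : mfunT (fun p : Omega * V => (rho 1 p.2)%:E * (N p.1 * N (theta p.2 p.1))).
  apply: emeasurable_funM; first by apply: (mcomp mr); exact: measurable_snd.
  by apply: emeasurable_funM => //; apply: (mcomp mN); exact: measurable_fst.
apply: (@le_lt_trans _ _ (C%:E * \int[P]_w \int[lebm d]_t ((rho 1 t)%:E * (N w * N (theta t w))))).
  rewrite -ge0_integralZl//; last 2 first.
  - by apply: (measurable_fun_fubini_tonelli_F (fun p : Omega * V => (rho 1 p.2)%:E * (N p.1 * N (theta p.2 p.1)))) => // p; rewrite !mule_ge0.
  - by move=> w _; apply: integral_ge0 => t _; rewrite !mule_ge0.
  apply: ge0_le_integral => //.
  - by move=> w _; apply: integral_ge0 => x _; apply: integral_ge0 => y _; rewrite mule_ge0.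
  - apply: (measurable_Phi_integral (f := fun q : Omega * V => \int[Phi q.1]_y (b q.2 * (rho 1 (q.2 - y))%:E))) => //.
      apply: (measurable_Phi_integral2 (f := fun q : (Omega * V) * V => b q.1.2 * (rho 1 (q.1.2 - q.2))%:E)).
        apply: emeasurable_funM.
          apply: (mcomp mb); apply: (mcomp (@measurable_snd _ _ _ _)); exact: measurable_fst.
        apply: (mcomp mr); apply: measurable_rVB; last exact: measurable_snd.
        by apply: (mcomp (@measurable_snd _ _ _ _)); exact: measurable_fst.
      by move=> q; rewrite mule_ge0.
    by move=> q; apply: integral_ge0 => y _; rewrite mule_ge0.
  - apply: emeasurable_funM => //.
    by apply: (measurable_fun_fubini_tonelli_F (fun p : Omega * V => (rho 1 p.2)%:E * (N p.1 * N (theta p.2 p.1)))) => // p; rewrite !mule_ge0.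
  move=> w _.
  have N1 : \int[Phi w]_y (rho 1 y)%:E <= (expR 1 / r ^+ d)%:E * \int[lebm d]_t ((rho 1 t)%:E * N (theta t w)).
    have mq : mfunT (fun p : V * V => (rho 1 p.1)%:E * b (p.2 - p.1)%R).
      apply: emeasurable_funM; first by apply: (mcomp mr); exact: measurable_fst.
      by apply: (mcomp mb); apply: measurable_rVB; [exact: measurable_snd|exact: measurable_fst].
    have -> : \int[lebm d]_t ((rho 1 t)%:E * N (theta t w)) =
        \int[Phi w]_y \int[lebm d]_t ((rho 1 t)%:E * b (y - t)%R).
      rewrite -(@fubini_tonelli _ _ _ _ _ (lebm d) (sPhi w) (fun p : V * V => (rho 1 p.1)%:E * b (p.2 - p.1)%R))//=.
        apply: eq_integral => t _; rewrite /N integral_shift// ge0_integralZl//.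
        by apply: (mcomp mb); exact: measurable_subr.
      by move=> p; rewrite mule_ge0.
    have mq2 : mfunT (fun y : V => \int[lebm d]_t ((rho 1 t)%:E * b (y - t)%R)).
      apply: (measurable_fun_fubini_tonelli_F (fun p : V * V => (rho 1 p.2)%:E * b (p.1 - p.2)%R)); last by move=> p; rewrite mule_ge0.
      apply: emeasurable_funM; first by apply: (mcomp mr); exact: measurable_snd.
      by apply: (mcomp mb); apply: measurable_rVB; [exact: measurable_fst|exact: measurable_snd].
    rewrite -ge0_integralZl//; last 2 first.
    - by move=> y _; apply: integral_ge0 => t _; rewrite mule_ge0.
    - by rewrite lee_fin divr_ge0 ?expR_ge0// ltW.
    by apply: ge0_le_integral => //; exact: emeasurable_funM.
  apply: (@le_trans _ _ (\int[Phi w]_x \int[Phi w]_y (b x * ((expR 1)%:E * (rho 1 y)%:E)))).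
    apply: ge0_le_integral => //.
    - by move=> x _; apply: integral_ge0 => y _; rewrite mule_ge0.
    - apply: (@measurable_fun_fubini_tonelli_F _ _ _ _ _ (sPhi w) (fun p : V * V => b p.1 * (rho 1 (p.1 - p.2))%:E)); last by move=> p; rewrite mule_ge0.
      apply: emeasurable_funM; first by apply: (mcomp mb); exact: measurable_fst.
      by apply: (mcomp mr); apply: measurable_rVB; [exact: measurable_fst|exact: measurable_snd].
    - apply: (@measurable_fun_fubini_tonelli_F _ _ _ _ _ (sPhi w) (fun p : V * V => b p.1 * ((expR 1)%:E * (rho 1 p.2)%:E))); last by move=> p; rewrite !mule_ge0// lee_fin expR_ge0.
      apply: emeasurable_funM; first by apply: (mcomp mb); exact: measurable_fst.
      by apply: emeasurable_funM => //; apply: (mcomp mr); exact: measurable_snd.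
    move=> x _; apply: ge0_le_integral => //.
    - by move=> y _; rewrite mule_ge0.
    - by apply: emeasurable_funM => //; apply: (mcomp mr); exact: measurable_rVB.
    - by apply: emeasurable_funM => //; exact: emeasurable_funM.
    move=> y _; rewrite /b indicE; have [/set_mem/= bx|_] := boolP (_ \in _); last by rewrite !mul0e.
    rewrite !mul1e -EFinM lee_fin /rho -expRD ler_expR.
    have h1 := l1_small_box bx; have := l1D (- (x - y))%R x; rewrite l1N opprB subrK; lra.
  have -> : \int[Phi w]_x \int[Phi w]_y (b x * ((expR 1)%:E * (rho 1 y)%:E)) =
      N w * ((expR 1)%:E * \int[Phi w]_y (rho 1 y)%:E).
    rewrite /N -ge0_integralZr//; last by rewrite mule_ge0 ?lee_fin ?expR_ge0//; exact: integral_ge0.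
    apply: eq_integral => x _; rewrite ge0_integralZl//; last 2 first.
    - by apply: emeasurable_funM.
    - by move=> y _; rewrite mule_ge0// lee_fin expR_ge0.
    by rewrite ge0_integralZl// lee_fin expR_ge0.
  have mtw : mfunT (fun t : V => N (theta t w)).
    exact: (mcomp mNt (measurable_pair1 w)).
  have -> : \int[lebm d]_t ((rho 1 t)%:E * (N w * N (theta t w))) = N w * \int[lebm d]_t ((rho 1 t)%:E * N (theta t w)).
    rewrite -ge0_integralZl//; first by apply: eq_integral => t _; rewrite muleCA.
    - by apply: emeasurable_funM.
    - by move=> t _; rewrite mule_ge0.
  rewrite [leRHS]muleCA; apply: lee_wpmul2l => //; rewrite /C EFinM -muleA; apply: lee_wpmul2l => //.
rewrite (@fubini_tonelli _ _ _ _ _ P (lebm d) (fun p : Omega * V => (rho 1 p.2)%:E * (N p.1 * N (theta p.2 p.1))))//=; last first.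
  by move=> p; rewrite !mule_ge0.
pose S := \int[P]_w (N w * N w).
have mNN : mfunT (fun w => N w * N w) by exact: emeasurable_funM.
have NN0 w : 0 <= N w * N w by rewrite mule_ge0.
have S0 : 0 <= S by exact: integral_ge0.
have inner t : \int[P]_w ((rho 1 t)%:E * (N w * N (theta t w))) <= (rho 1 t)%:E * (S + S).
  have mtt : mfunT (fun w => N (theta t w)).
    by apply: (mcomp mN); exact: measurable_theta.
  rewrite ge0_integralZl//; last 2 first.
  - exact: emeasurable_funM.
  - by move=> w _; rewrite mule_ge0.
  apply: lee_wpmul2l => //; rewrite {2}/S -(integral_flow t mNN) /S -ge0_integralD//; last first.
    by apply: emeasurable_funM.
  apply: ge0_le_integral => //.
  - by move=> w _; rewrite mule_ge0.
  - exact: emeasurable_funM.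
  - by apply: emeasurable_funD => //; exact: emeasurable_funM.
  by move=> w _; exact: mule_le_sqr.
have SS : S + S < +oo by rewrite lte_add_pinfty.
apply: (@le_lt_trans _ _ (C%:E * (\int[lebm d]_t (rho 1 t)%:E * (S + S)))).
  apply: lee_wpmul2l; first by rewrite lee_fin.
  rewrite -ge0_integralZr//; last by rewrite adde_ge0.
  apply: ge0_le_integral => //.
  - by move=> t _; apply: integral_ge0 => w _; rewrite !mule_ge0.
  - apply: (@measurable_fun_fubini_tonelli_G _ _ _ _ _ P (fun p : Omega * V => (rho 1 p.2)%:E * (N p.1 * N (theta p.2 p.1)))) => // p.
    by rewrite !mule_ge0.
  - by apply: emeasurable_funM.
have lr := integral_rho_lty d (@ltr01 R).
have lr0 : 0 <= \int[lebm d]_t (rho 1 t : R)%:E by exact: integral_ge0.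
have f1 : \int[lebm d]_t (rho 1 t : R)%:E * (S + S) \is a fin_num.
  by rewrite fin_numM// ge0_fin_numE// adde_ge0.
by rewrite -(fineK f1) -EFinM ltry.
Qed.

End stationary.

(** * Second-order structure of a random measure *)

Section ae_integral.
Context {dT} {T : measurableType dT} {R : realType} (m : {measure set T -> \bar R}).

Lemma ae_Rintegral (F G : T -> R) : mfunT F -> mfunT G ->
  {ae m, forall x, F x = G x} -> m.-intR G ->
  m.-intR F /\ \int[m]_x F x = \int[m]_x G x.
Proof.
move=> mF mG FG Gi.
have mFE : mfunT (EFin \o F) by exact/measurable_EFinP.
have mGE : mfunT (EFin \o G) by exact/measurable_EFinP.
have FGE : ae_eq m setT (EFin \o G) (EFin \o F).
  by apply: filterS FG => x /= ->.
split.
  apply/integrableP; split => //; case/integrableP: Gi => _; apply: le_lt_trans.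
  apply: le_of_eq; apply: ae_eq_integral => //.
  - exact: mcomp.
  - exact: mcomp.
  - by apply: filterS FG => x /= ->.
rewrite /Rintegral; congr fine; apply/esym; by apply: ae_eq_integral.
Qed.

End ae_integral.

(** What the spectral theory uses of a random measure: its mean, its mixed second moments and the
    integrability of [rho 1]. Both [Phi] and [Psi] provide it, the latter by computing with the
    stationarity of [Phi] and [Z], so one construction of a Bartlett measure serves both. *)
Record second_order {R : realType} {d : nat} {dO} {Omega : measurableType dO} (P : probability Omega R)
  (X : Omega -> {measure set 'rV[R]_d -> \bar R}) (alpha : {sigma_finite_measure set 'rV[R]_d -> \bar R})
  (lam : R) : Prop := SecondOrder {
  so_meas : forall h : 'rV[R]_d -> \bar R, mfunT h -> (forall x, 0 <= h x)%E ->
    mfunT (fun w => \int[X w]_x h x)%E ;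
  so_mean : forall h : 'rV[R]_d -> \bar R, mfunT h -> (forall x, 0 <= h x)%E ->
    (\int[P]_w \int[X w]_x h x = lam%:E * \int[lebm d]_x h x)%E ;
  so_mixed : forall f g : 'rV[R]_d -> \bar R, mfunT f -> mfunT g ->
    (forall x, 0 <= f x)%E -> (forall x, 0 <= g x)%E ->
    (\int[P]_w ((\int[X w]_x f x) * (\int[X w]_x g x)) =
     \int[lebm d]_t \int[alpha]_u (f t * g (t - u)%R))%E ;
  so_rho : (\int[alpha]_u (rho 1 u)%:E < +oo)%E }.

Section covariance.
Context {R : realType} {d : nat} {dO} {Omega : measurableType dO} {P : probability Omega R}.
Local Notation V := 'rV[R]_d.
Variables (X : Omega -> {measure set V -> \bar R}) (alpha : {sigma_finite_measure set V -> \bar R}) (lam : R).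
Hypothesis so : second_order P X alpha lam.

Let ia : alpha.-intR (rho 1).
Proof. exact: (integrable_alpha_rho (so_rho so)). Qed.

(** For suitable [C] this class contains the test functions and the Gaussians, and correlations of
    its members decay like [rho 1]. *)
Definition dominated (C : R) (f : V -> R) := mfunT f /\ forall x, `|f x| <= C * rho 2 x.

Lemma measurable_linear_stat (f : V -> R) : mfunT f ->
  mfunT (fun w => \int[X w]_x f x).
Proof.
move=> mf; have mE := measurable_EFin mf.
apply: (mcomp (@fine_measurable R setT measurableT)).
rewrite (_ : (fun w => _) = (fun w => \int[X w]_x ((fun x => (f x)%:E)^\+)%E x -
    \int[X w]_x ((fun x => (f x)%:E)^\-)%E x)%E); last by apply/funext => w; rewrite integralE.
apply: emeasurable_funB; apply: (so_meas so) => //; by [exact: measurable_funepos|exact: measurable_funeneg].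
Qed.

Let mrho c : mfunT (fun x : V => (rho c x : R)%:E).
Proof. by apply: measurable_EFin; exact: measurable_rho. Qed.

(** The integral of [rho 1] has a finite mean. Linear statistics of dominated functions are
    therefore absolutely convergent for almost every [w], and identities between them are used
    almost everywhere. *)
Lemma ae_integrable_rho : {ae P, forall w, (X w).-intR (rho 1)}.
Proof.
have mr := so_meas so (mrho 1) (fun x => rho_ge0 1 x : (0 <= (rho 1 x)%:E)%E).
have h : P.-integrable setT (fun w => \int[X w]_x (rho 1 x)%:E)%E.
  apply/integrableP; split => //.
  rewrite (_ : (\int[P]_w `|_|)%E = (\int[P]_w \int[X w]_x (rho 1 x)%:E)%E); last first.
    by apply: eq_integral => w _; rewrite gee0_abs//; apply: integral_ge0 => x _; rewrite lee_fin rho_ge0.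
  rewrite (so_mean so (mrho 1)); last by move=> x; rewrite lee_fin rho_ge0.
  have lr := integral_rho_lty d (@ltr01 R).
  have f0 : (\int[lebm d]_x (rho 1 x : R)%:E)%E \is a fin_num.
    by rewrite ge0_fin_numE//; apply: integral_ge0 => x _; rewrite lee_fin rho_ge0.
  by rewrite -(fineK f0) -EFinM ltry.
have := integrable_ae measurableT h; apply: filterS => w /(_ I) hw.
apply: integrable_ge0_lty; [exact: measurable_rho|exact: rho_ge0|].
rewrite -ge0_fin_numE//; apply: integral_ge0 => x _; rewrite lee_fin rho_ge0//.
Qed.

Lemma dominated_integrable C f w : (X w).-intR (rho 1) -> dominated C f ->
  (X w).-intR f.
Proof.
move=> Xr [mf fC]; have C0 : 0 <= C by have := le_trans (normr_ge0 _) (fC 0); rewrite pmulr_lge0 ?rho_gt0.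
apply: (integrable_le mf _ (intgbZ C Xr)) => x; apply: (le_trans (fC x)).
rewrite ler_wpM2l// /rho ler_expR lerN2 ler_wpM2r ?l1_ge0// ler1n//.
Qed.

Lemma dominated_rho (C : R) : 0 <= C -> dominated C (fun x => C * rho 2 x).
Proof.
move=> C0; split; first by apply: measurable_funM => //; exact: measurable_rho.
by move=> x; rewrite ger0_norm// mulr_ge0 ?rho_ge0.
Qed.

(** Adding [C * rho 2] makes a dominated function nonnegative without leaving the class, so signed
    functions reduce to nonnegative ones by subtraction. *)
Lemma dominatedD C f : 0 <= C -> dominated C f -> dominated (C + C) (fun x => f x + C * rho 2 x) /\
  forall x, 0 <= f x + C * rho 2 x.
Proof.
move=> C0 [mf fC]; split; last by move=> x; have := fC x; rewrite ler_norml => /andP[h _]; lra.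
split; first by apply: measurable_funD => //; apply: measurable_funM => //; exact: measurable_rho.
move=> x; apply: (le_trans (ler_normD _ _)); rewrite mulrDl lerD//.
by rewrite ger0_norm// mulr_ge0 ?rho_ge0.
Qed.

Let S f w : R := \int[X w]_x f x.

Lemma mixed_moment_ge0 C f g : dominated C f -> dominated C g -> (forall x, 0 <= f x) -> (forall x, 0 <= g x) ->
  P.-intR (fun w => S f w * S g w) /\
  \int[P]_w (S f w * S g w) = \int[alpha]_u corr f g u.
Proof.
move=> df dg f0 g0; have [mf fC] := df; have [mg gC] := dg.
have mfE := measurable_EFin mf; have mgE := measurable_EFin mg.
have f0E x : (0 <= (f x)%:E)%E by rewrite lee_fin.
have g0E x : (0 <= (g x)%:E)%E by rewrite lee_fin.
have mS : mfunT (fun w => S f w * S g w).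
  by apply: measurable_funM; exact: measurable_linear_stat.
have E : (\int[P]_w (S f w * S g w)%:E = (\int[alpha]_u corr f g u)%:E)%E.
  transitivity (\int[P]_w ((\int[X w]_x (f x)%:E) * (\int[X w]_x (g x)%:E)))%E.
    apply: ae_eq_integral => //.
    - exact: measurable_EFin.
    - by apply: emeasurable_funM; exact: (so_meas so).
    - apply: filterS ae_integrable_rho => w Xr _.
      by rewrite EFinM /S !EFin_Rintegral//; exact: (dominated_integrable Xr).
  rewrite (so_mixed so mfE mgE f0E g0E).
  rewrite (@fubini_tonelli _ _ _ _ _ (lebm d) alpha (fun p : V * V => ((f p.1)%:E * (g (p.1 - p.2)%R)%:E)%E)); last 2 first.
  - apply: emeasurable_funM; first by apply: (mcomp mfE); exact: measurable_fst.
    by apply: (mcomp mgE); apply: measurable_rVB; [exact: measurable_fst|exact: measurable_snd].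
  - by move=> p; rewrite mule_ge0.
  rewrite (EFin_Rintegral (integrable_corr mf mg fC gC ia)).
  apply: eq_integral => u _; rewrite /corr (EFin_Rintegral (integrable_corr_integrand mf mg fC gC u)).
  by apply: eq_integral => x _; rewrite EFinM.
split; last by rewrite /Rintegral E.
apply: integrable_ge0_lty => //.
- move=> w; rewrite mulr_ge0//; by apply: Rintegral_ge0.
- by rewrite E ltry.
Qed.

Lemma mean_ge0 C f : dominated C f -> (forall x, 0 <= f x) ->
  P.-intR (S f) /\ \int[P]_w S f w = lam * \int[lebm d]_x f x.
Proof.
move=> df f0; have [mf fC] := df.
have mfE := measurable_EFin mf.
have f0E x : (0 <= (f x)%:E)%E by rewrite lee_fin.
have fi : (lebm d).-intR f.
  by apply: (integrable_le mf fC); apply: intgbZ; apply: integrable_rho; rewrite ltr0n.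
have mS := measurable_linear_stat mf.
have E : (\int[P]_w (S f w)%:E = (lam * \int[lebm d]_x f x)%:E)%E.
  transitivity (\int[P]_w (\int[X w]_x (f x)%:E))%E.
    apply: ae_eq_integral => //.
    - exact: measurable_EFin.
    - exact: (so_meas so).
    - apply: filterS ae_integrable_rho => w Xr _.
      by rewrite /S EFin_Rintegral//; exact: (dominated_integrable Xr).
  by rewrite (so_mean so mfE f0E) EFinM EFin_Rintegral.
split; last by rewrite /Rintegral E.
apply: integrable_ge0_lty => //.
- by move=> w; apply: Rintegral_ge0.
- by rewrite E ltry.
Qed.

Let SD C f : 0 <= C -> dominated C f ->
  {ae P, forall w, S f w = S (fun x => f x + C * rho 2 x) w - S (fun x => C * rho 2 x) w}.
Proof.
move=> C0 df; apply: filterS ae_integrable_rho => w Xr.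
have i1 := dominated_integrable Xr df.
have i2 := dominated_integrable Xr (dominated_rho C0).
by rewrite /S RintegralD// addrK.
Qed.

Lemma mean_dominated C f : dominated C f ->
  P.-intR (S f) /\ \int[P]_w S f w = lam * \int[lebm d]_x f x.
Proof.
move=> df; have [mf fC] := df.
have C0 : 0 <= C by have := le_trans (normr_ge0 _) (fC 0); rewrite pmulr_lge0 ?rho_gt0.
have [d1 p1] := dominatedD C0 df; have d2 := dominated_rho C0.
have p2 x : 0 <= C * rho 2 (x : V) by rewrite mulr_ge0 ?rho_ge0.
have [i1 e1] := mean_ge0 d1 p1; have [i2 e2] := mean_ge0 d2 p2.
have int_dom C' h : dominated C' h -> (lebm d).-intR h.
  by move=> [mh hC]; apply: (integrable_le mh hC); apply: intgbZ; apply: integrable_rho; rewrite ltr0n.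
have [i3 e3] := ae_Rintegral (measurable_linear_stat mf)
  (measurable_funB (measurable_linear_stat d1.1) (measurable_linear_stat d2.1)) (SD C0 df) (integrable_sub i1 i2).
split; first exact: i3.
rewrite e3 RintegralB// e1 e2 RintegralD ?addrDl//; [|exact: int_dom df|exact: int_dom d2].
by rewrite mulrDr addrK.
Qed.

(** With [q = C * rho 2] both functions are differences [f1 - q] and [g1 - q] of nonnegative ones.
    Expanding the product gives four nonnegative moments, and correlations expand in the same
    way. *)
Lemma mixed_moment C f g : dominated C f -> dominated C g ->
  P.-intR (fun w => S f w * S g w) /\
  \int[P]_w (S f w * S g w) = \int[alpha]_u corr f g u.
Proof.
move=> df dg; have [mf fC] := df; have [mg gC] := dg.
have C0 : 0 <= C by have := le_trans (normr_ge0 _) (fC 0); rewrite pmulr_lge0 ?rho_gt0.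
have CC : 0 <= C + C by rewrite addr_ge0.
have up h : dominated C h -> dominated (C + C) h.
  move=> [mh hC]; split => // x; apply: (le_trans (hC x)).
  by rewrite mulrDl lerDl mulr_ge0 ?rho_ge0.
pose q (x : V) : R := C * rho 2 x.
have [df1 f1p] := dominatedD C0 df; have [dg1 g1p] := dominatedD C0 dg.
have dq : dominated (C + C) q by apply: up; exact: dominated_rho.
have q0 x : 0 <= q x by rewrite mulr_ge0 ?rho_ge0.
set f1 := (fun x => f x + C * rho 2 x) in df1 f1p; set g1 := (fun x => g x + C * rho 2 x) in dg1 g1p.
have [i11 e11] := mixed_moment_ge0 df1 dg1 f1p g1p.
have [i12 e12] := mixed_moment_ge0 df1 dq f1p q0.
have [i21 e21] := mixed_moment_ge0 dq dg1 q0 g1p.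
have [i22 e22] := mixed_moment_ge0 dq dq q0 q0.
have iA := integrable_sub (integrable_sub i11 i12) (integrable_sub i21 i22).
have ms h : dominated (C + C) h -> mfunT (S h) by move=> [mh _]; exact: measurable_linear_stat.
have [i e] : P.-intR (fun w => S f w * S g w) /\
    \int[P]_w (S f w * S g w) = \int[P]_w
    (S f1 w * S g1 w - S f1 w * S q w - (S q w * S g1 w - S q w * S q w)).
  apply: ae_Rintegral => //.
  - by apply: measurable_funM; apply: ms; apply: up.
  - by apply: measurable_funB; apply: measurable_funB; apply: measurable_funM; apply: ms.
  - apply: filterS2 (SD C0 df) (SD C0 dg) => w -> ->; rewrite /f1 /g1 /q; ring.
split; first exact: i.
rewrite e.
rewrite (RintegralB measurableT (integrable_sub i11 i12) (integrable_sub i21 i22)).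
rewrite (RintegralB measurableT i11 i12) (RintegralB measurableT i21 i22) e11 e12 e21 e22.
have ic a b : dominated (C + C) a -> dominated (C + C) b -> alpha.-intR (corr a b).
  by move=> [ma Ha] [mb Hb]; exact: (integrable_corr ma mb Ha Hb ia).
have c11 := ic _ _ df1 dg1; have c12 := ic _ _ df1 dq; have c21 := ic _ _ dq dg1; have c22 := ic _ _ dq dq.
rewrite -(RintegralB measurableT c11 c12) -(RintegralB measurableT c21 c22).
rewrite -(RintegralB measurableT (integrable_sub c11 c12) (integrable_sub c21 c22)).
congr Rintegral; apply/funext => u.
have it a b : dominated (C + C) a -> dominated (C + C) b ->
    (lebm d).-intR (fun x => a x * b (x - u)).
  by move=> [ma Ha] [mb Hb]; exact: (integrable_corr_integrand ma mb Ha Hb u).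
have t11 := it _ _ df1 dg1; have t12 := it _ _ df1 dq; have t21 := it _ _ dq dg1; have t22 := it _ _ dq dq.
rewrite /corr -(RintegralB measurableT t11 t12) -(RintegralB measurableT t21 t22).
rewrite -(RintegralB measurableT (integrable_sub t11 t12) (integrable_sub t21 t22)).
by congr Rintegral; apply/funext => x; rewrite /f1 /g1 /q; ring.
Qed.

Lemma covariance_pairing C f g : dominated C f -> dominated C g ->
  fine (covariance P (S f) (S g)) = pairing alpha (lam ^+ 2) (corr f g).
Proof.
move=> df dg; have [mf fC] := df; have [mg gC] := dg.
have [i e] := mixed_moment df dg; have [i1 e1] := mean_dominated df; have [i2 e2] := mean_dominated dg.
have L (h : Omega -> R) : P.-intR h -> h \in Lfun P 1 by move=> hi; exact/Lfun1_integrable.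
rewrite covarianceE; [|exact: L|exact: L|exact: L].
rewrite unlock -!EFin_Rintegral//= e e1 e2 /pairing (Rintegral_corr mf mg fC gC); ring.
Qed.

(** The pairing is the variance of the linear statistic of [f], written as the mean of a square. *)
Lemma pairing_corr_ge0 C f : dominated C f -> 0 <= pairing alpha (lam ^+ 2) (corr f f).
Proof.
move=> df; have [mf fC] := df.
have [i e] := mixed_moment df df; have [i1 e1] := mean_dominated df.
rewrite /pairing (Rintegral_corr mf mf fC fC) -e.
set m := lam * \int[lebm d]_x f x in e1.
have -> : lam ^+ 2 * (\int[lebm d]_x f x * \int[lebm d]_x f x) = m ^+ 2 by rewrite /m; ring.
have i3 := intgbZ (2 * m) i1.
have i4 : P.-intR (cst (m ^+ 2)) by exact: finite_measure_integrable_cst.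
have -> : \int[P]_w (S f w * S f w) - m ^+ 2 =
    \int[P]_w (S f w * S f w - 2 * m * S f w + cst (m ^+ 2) w).
  rewrite RintegralD//; last exact: integrable_sub.
  rewrite RintegralB// RintegralZl// e1.
  have -> : \int[P]_w cst (m ^+ 2) w = m ^+ 2.
    transitivity (fine ((m ^+ 2)%:E * P setT)%E); first by congr fine; exact: (integral_cst P measurableT (m ^+ 2)%:E).
    by rewrite (_ : P setT = 1%E) ?mule1//; exact: probability_setT.
  ring.
apply: Rintegral_ge0 => w _.
by rewrite (_ : _ + _ = (S f w - m) ^+ 2) ?sqr_ge0//= ; ring.
Qed.

End covariance.

(** * Gaussians as correlations *)

Section gaussian_correlation.
Context {R : realType} {d : nat}.
Local Notation V := 'rV[R]_d.

Lemma gaussn_dominated (s : R) (z : V) : 0 < s -> exists2 C : R, 0 <= C &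
  dominated C (fun x : V => gaussn s (x - z)).
Proof.
move=> s0; exists (expR (d%:R * (2 ^+ 2 / (2 * s))) * expR (2 * l1 z)); first by rewrite mulr_ge0 ?expR_ge0.
split; first exact: measurable_gaussn_shift.
move=> x; rewrite ger0_norm ?gaussn_ge0//; apply: (le_trans (gaussn_le_rhoc 2 _ s0)).
by rewrite -mulrA ler_wpM2l ?expR_ge0//; exact: rho_shift_le.
Qed.

Lemma dominated_mul C (f : V -> R) (t : V -> R) : dominated C f -> mfunT t ->
  (forall x, `|t x| <= 1) -> dominated C (fun x => t x * f x).
Proof.
move=> [mf fC] mt t1; split; first exact: measurable_funM.
by move=> x; rewrite normrM; apply: le_trans (fC x); rewrite ler_piMl.
Qed.

(** Completing the square. It exhibits [gaussn s], up to the constant [gmass d (4 * s)], as the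
    correlation of [gaussn (2 * s)] with itself. *)
Lemma gaussn_mul (s : R) (x u : V) :
  gaussn (2 * s) x * gaussn (2 * s) (x - u) = gaussn s u * gaussn (4 * s) (x - 2^-1 *: u).
Proof.
rewrite /gaussn -!expRD; congr expR.
by rewrite !dotvBl !dotvBr dotvZl dotvZl dotvZr (dotvC u x) dotvZr; field.
Qed.

Lemma Rintegral_gaussn_shift (a : R) (v : V) : 0 < a ->
  (lebm d).-intR (fun x => gaussn a (x - v)) /\
  \int[lebm d]_x gaussn a (x - v) = gmass d a.
Proof.
move=> a0; have mE : mfunT (fun x : V => (gaussn a x)%:E).
  by apply: measurable_EFin; exact: measurable_gaussn.
have E : (\int[lebm d]_x (gaussn a (x - v))%:E = (gmass d a)%:E)%E.
  by rewrite (integral_lebm_shift (- v) mE) integral_gaussn.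
split; last by rewrite /Rintegral E.
apply: integrable_ge0_lty; [exact: measurable_gaussn_shift|by move=> x; exact: gaussn_ge0|].
by rewrite E ltry.
Qed.

Lemma corr_gaussn (s : R) (z v : V) (u : V) : 0 < s ->
  corr (fun x => gaussn (2 * s) (x - z)) (fun x => gaussn (2 * s) (x - v)) u =
  gmass d (4 * s) * gaussn s (u + (v - z)).
Proof.
move=> s0; have s4 : 0 < 4 * s by rewrite mulr_gt0.
rewrite /corr (_ : (fun x => _) = (fun x => gaussn s (u + (v - z)) *
    gaussn (4 * s) (x - (z + 2^-1 *: (u + (v - z)))))).
  have [i e] := Rintegral_gaussn_shift (z + 2^-1 *: (u + (v - z))) s4.
  by rewrite RintegralZl// e mulrC.
apply/funext => x; rewrite (_ : x - u - v = x - z - (u + (v - z))).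
  by rewrite gaussn_mul; congr (_ * gaussn _ _); apply/rowP => i; rewrite !mxE; ring.
by apply/rowP => i; rewrite !mxE; ring.
Qed.

(** The cosine subtraction formula combines the two correlations into a modulated Gaussian, which is
    thus a sum of correlations of functions with themselves and has a nonnegative pairing. *)
Lemma corr_trig_gaussn (s : R) (k u : V) : 0 < s ->
  corr (fun x => cos (dotv k x) * gaussn (2 * s) x) (fun x => cos (dotv k x) * gaussn (2 * s) x) u +
  corr (fun x => sin (dotv k x) * gaussn (2 * s) x) (fun x => sin (dotv k x) * gaussn (2 * s) x) u =
  gmass d (4 * s) * (cos (dotv k u) * gaussn s u).
Proof.
move=> s0; have s2 : 0 < 2 * s by rewrite mulr_gt0.
have [C C0] := gaussn_dominated 0 s2; under eq_fun do rewrite subr0; move=> dC.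
have dcos := dominated_mul dC (measurable_cos_dotv k) (fun x => normr_cos_le1 _).
have dsin := dominated_mul dC (measurable_sin_dotv k) (fun x => normr_sin_le1 _).
rewrite /corr -RintegralD//; last 2 first.
- exact: (integrable_corr_integrand dcos.1 dcos.1 dcos.2 dcos.2 u).
- exact: (integrable_corr_integrand dsin.1 dsin.1 dsin.2 dsin.2 u).
have e := corr_gaussn 0 0 u s0; rewrite subrr addr0 in e; rewrite mulrCA -e.
rewrite /corr -RintegralZl//; last first.
  have [C' C'0 dC'] := gaussn_dominated 0 s2.
  exact: (integrable_corr_integrand dC'.1 dC'.1 dC'.2 dC'.2 u).
congr Rintegral; apply/funext => x; rewrite !subr0.
have -> : dotv k u = dotv k x - dotv k (x - u) by rewrite dotvBr; ring.
by rewrite cosB; ring.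
Qed.

End gaussian_correlation.

(** * Existence of a Bartlett spectral measure *)

Section bartlett.
Context {R : realType} {d : nat} {dO} {Omega : measurableType dO} {P : probability Omega R}.
Local Notation V := 'rV[R]_d.
Variables (X : Omega -> {measure set V -> \bar R}) (alpha : {sigma_finite_measure set V -> \bar R}) (lam : R).
Hypothesis so : second_order P X alpha lam.

Let ia : alpha.-intR (rho 1).
Proof. exact: (integrable_alpha_rho (so_rho so)). Qed.
Let il : (lebm d).-intR (rho (1 : R)). Proof. exact: integrable_rho. Qed.

Lemma gmass_gt0 (s : R) : 0 < s -> 0 < gmass d s.
Proof. by move=> s0; rewrite exprn_gt0// sqrtr_gt0 divr_gt0// mulr_gt0// pi_gt0. Qed.

Lemma second_order_pd (k : V) (s : R) : 0 < s ->
  0 <= pairing alpha (lam ^+ 2) (fun x => cos (dotv k x) * gaussn s x).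
Proof.
move=> s0; have s2 : 0 < 2 * s by rewrite mulr_gt0.
have [C C0] := @gaussn_dominated R d _ 0 s2; under eq_fun do rewrite subr0; move=> dC.
have dcos := dominated_mul dC (measurable_cos_dotv k) (fun x => normr_cos_le1 _).
have dsin := dominated_mul dC (measurable_sin_dotv k) (fun x => normr_sin_le1 _).
have g4 : 0 < gmass d (4 * s) by rewrite gmass_gt0// mulr_gt0.
rewrite -(pmulr_rge0 _ g4).
have h1 := pairing_corr_ge0 so dcos; have h2 := pairing_corr_ge0 so dsin.
apply: (le_trans (addr_ge0 h1 h2)).
have ic (m : {measure set V -> \bar R}) : m.-intR (rho 1) ->
    m.-intR (fun x => cos (dotv k x) * gaussn s x).
  move=> mr; apply: (integrable_le _ _ (intgbZ (expR (d%:R / (2 * s))) mr)).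
    by apply: measurable_funM; [exact: measurable_cos_dotv|exact: measurable_gaussn].
  move=> x; rewrite normrM (ger0_norm (gaussn_ge0 _ _)).
  by apply: le_trans (gaussn_le_rho _ s0); rewrite ler_piMl ?gaussn_ge0 ?normr_cos_le1.
have E (m : {measure set V -> \bar R}) : m.-intR (rho 1) ->
  \int[m]_u corr (fun x => cos (dotv k x) * gaussn (2 * s) x) (fun x => cos (dotv k x) * gaussn (2 * s) x) u +
  \int[m]_u corr (fun x => sin (dotv k x) * gaussn (2 * s) x) (fun x => sin (dotv k x) * gaussn (2 * s) x) u =
  gmass d (4 * s) * \int[m]_u (cos (dotv k u) * gaussn s u).
  move=> mr; rewrite -RintegralZl//; last exact: ic.
  rewrite -RintegralD//; last 2 first.
  - exact: (integrable_corr dcos.1 dcos.1 dcos.2 dcos.2 mr).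
  - exact: (integrable_corr dsin.1 dsin.1 dsin.2 dsin.2 mr).
  by congr Rintegral; apply/funext => u; exact: corr_trig_gaussn.
by rewrite /pairing mulrBr mulrCA -(E _ ia) -(E _ il) mulrDr opprD addrACA.
Qed.

(** The expectation of a product does not depend on the order of its factors, while exchanging two
    shifted Gaussians in a correlation reverses the shift. *)
Lemma second_order_sym (z : V) (s : R) : 0 < s ->
  \int[alpha]_x gaussn s (x - z) = \int[alpha]_x gaussn s (x + z).
Proof.
move=> s0; have s2 : 0 < 2 * s by rewrite mulr_gt0.
have g4 : 0 < gmass d (4 * s) by rewrite gmass_gt0// mulr_gt0.
have ig v : alpha.-intR (fun u => gaussn s (u - v)).
  apply: (integrable_le _ _ (intgbZ (expR (d%:R / (2 * s)) * expR (l1 v)) ia)).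
    exact: measurable_gaussn_shift.
  by move=> x; rewrite (ger0_norm (gaussn_ge0 _ _)); exact: (gaussn_shift_le x v s0).
have ig' := ig (- z); rewrite opprK in ig'.
have E1 u : corr (fun x => gaussn (2 * s) (x - z)) (fun x => gaussn (2 * s) (x - 0)) u =
    gmass d (4 * s) * gaussn s (u - z) by rewrite (corr_gaussn _ _ _ s0) sub0r.
have E2 u : corr (fun x => gaussn (2 * s) (x - 0)) (fun x => gaussn (2 * s) (x - z)) u =
    gmass d (4 * s) * gaussn s (u + z) by rewrite (corr_gaussn _ _ _ s0) subr0.
have [C1 C10 d1] := @gaussn_dominated R d _ 0 s2; have [C2 C20 d2] := @gaussn_dominated R d _ z s2.
have up C C' f : C <= C' -> dominated C f -> @dominated R d C' f.
  move=> CC [mf fC]; split => // x; apply: (le_trans (fC x)); by rewrite ler_wpM2r ?rho_ge0.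
have le1 : C1 <= C1 + C2 by rewrite lerDl.
have le2 : C2 <= C1 + C2 by rewrite lerDr.
have d1' := up _ _ _ le1 d1.
have d2' := up _ _ _ le2 d2.
have [_ e1] := mixed_moment so d2' d1'; have [_ e2] := mixed_moment so d1' d2'.
have e12 : \int[alpha]_u corr (fun x => gaussn (2 * s) (x - z)) (fun x => gaussn (2 * s) (x - 0)) u =
   \int[alpha]_u corr (fun x => gaussn (2 * s) (x - 0)) (fun x => gaussn (2 * s) (x - z)) u.
  apply: (etrans (esym e1)); apply: (etrans _ e2).
  by apply: eq_Rintegral => w _; exact: mulrC.
rewrite (funext E1) (funext E2) (RintegralZl _ measurableT (ig z)) (RintegralZl _ measurableT ig') in e12.
by apply: (mulfI _ e12); rewrite gt_eqF.
Qed.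

Lemma second_order_square_integrable : locally_square_integrable P X.
Proof.
have mB := @measurable_eball R d 1.
(* Each coordinate of a point of the unit ball is at most 1 in absolute value, so its l1 norm is at
   most [d]; this gives the constant [exp (2 d)]. *)
have dI : dominated (expR (2 * d%:R)) (\1_(@eball R d 1) : V -> R).
  split; first exact: measurable_indic.
  move=> x; rewrite indicE; have [/set_mem/= xB|_] := boolP (x \in _); last first.
    by rewrite normr0 mulr_ge0 ?expR_ge0 ?rho_ge0.
  rewrite normr1 /rho -expRD -{1}(@expR0 R) ler_expR subr_ge0 ler_wpM2l//.
  rewrite (_ : d%:R = \sum_(i < d) (1 : R)); last by rewrite sumr_const card_ord.
  apply: ler_sum => i _; rewrite -ler_sqr ?nnegrE// real_normK ?num_real// expr1n.
  have h : dotv x x <= 1.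
    move: xB; rewrite /eball/= /enorm => /ltW h; rewrite -[dotv x x]sqr_sqrtr ?dotv_ge0//.
    by rewrite expr_le1// sqrtr_ge0.
  apply: le_trans h; rewrite /dotv (bigD1 i)//= -expr2 lerDl; apply: sumr_ge0 => j _.
  by rewrite -expr2 sqr_ge0.
have p0 x : 0 <= (\1_(@eball R d 1) x : R) by rewrite indicE.
have [i _] := mixed_moment_ge0 so dI dI p0 p0.
move/integrableP: i => [_]; apply: le_lt_trans.
apply: le_of_eq.
have mI := measurable_EFin dI.1.
apply: ae_eq_integral => //.
- rewrite (_ : (fun w => _) = (fun w => (\int[X w]_x (\1_(@eball R d 1) x)%:E) * (\int[X w]_x (\1_(@eball R d 1) x)%:E)))%E.
    by apply: emeasurable_funM; exact: (so_meas so).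
  by apply/funext => w; rewrite !integral_indic// setIT.
- apply: mcomp => //; apply: measurable_EFin; apply: measurable_funM;
  exact: (measurable_linear_stat so dI.1).
- apply: filterS (ae_integrable_rho so) => w Xr _ /=.
  rewrite ger0_norm; last by rewrite mulr_ge0//; apply: Rintegral_ge0.
  rewrite EFinM !EFin_Rintegral; [|exact: (dominated_integrable Xr dI)].
  by rewrite !integral_indic// setIT.
Qed.

Theorem second_order_bartlett : exists beta : {measure set V -> \bar R},
  [/\ bartlett_spectral_measure P X beta,
      forall e : R, 0 < e -> beta.-intR (gaussn e) &
      forall (e : R) z, 0 < e -> \int[beta]_k (cos (dotv z k) * gaussn e k) =
        gmass d e * pairing alpha (lam ^+ 2) (fun u => gaussn e^-1 (u - z))].
Proof.
have l2 : 0 <= lam ^+ 2 by rewrite sqr_ge0.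
have [beta [bg bc bs]] := spectral_measure_exists l2 (so_rho so) second_order_pd second_order_sym.
exists beta; split => //.
have sb := integrable_gt0_sigma_finite (gaussn_gt0 1) (bg 1 ltr01).
have iso f g := @spectral_isometry R d alpha (sfm_of sb) (lam ^+ 2) (so_rho so) bg bc bs f g.
split.
- exact: second_order_square_integrable.
- move=> r; have mB := @measurable_eball R d r.
  have h := intgbZ (expR (r ^+ 2 / 2)) (bg 1 ltr01).
  have := integrable_lty measurableT h; apply: le_lt_trans.
  rewrite -[leLHS]mul1e -[X in beta X]setIT -integral_indic// mul1e.
  apply: ge0_le_integral => //.
  + by apply: measurable_EFin; exact: measurable_indic.
  + by apply: measurable_EFin; apply: measurable_funM => //; exact: measurable_gaussn.
  move=> x _; rewrite lee_fin indicE; have [/set_mem/= xB|_] := boolP (x \in _); last first.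
    by rewrite mulr_ge0 ?expR_ge0.
  rewrite /gaussn -expRD -{1}(@expR0 R) ler_expR mul1r -mulrBl divr_ge0// subr_ge0.
  rewrite -[dotv x x]sqr_sqrtr ?dotv_ge0// ler_sqr ?nnegrE ?sqrtr_ge0//; first exact: ltW.
  by apply: ltW; apply: le_lt_trans xB; exact: sqrtr_ge0.
- by move=> f g tf tg; exact: (iso f g tf tg).1.
- move=> f g tf tg; have [_ ->] := iso f g tf tg.
  have [Cf Cf0 f_le] := @test_function_rho _ _ 2 f ltac:(by []) tf.
  have [Cg Cg0 g_le] := @test_function_rho _ _ 2 g ltac:(by []) tg.
  have [mf _ _] := tf; have [mg _ _] := tg.
  have df : dominated (Cf + Cg) f.
    by split => // x; apply: (le_trans (f_le x)); rewrite ler_wpM2r ?rho_ge0// lerDl.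
  have dg : dominated (Cf + Cg) g.
    by split => // x; apply: (le_trans (g_le x)); rewrite ler_wpM2r ?rho_ge0// lerDr.
  rewrite (covariance_pairing so df dg).
  have pi0 : (2 * pi) ^+ d != 0 :> R by rewrite expf_neq0// mulf_neq0// gt_eqF// pi_gt0.
  by rewrite -rmorphM/= mulrA mulVf// mul1r.
Qed.

End bartlett.

(** * Independence as a product measure *)

Section independence.
Context {R : realType} {dO} {Omega : measurableType dO} {P : probability Omega R}.
Variables G1 G2 : set (set Omega).
Hypotheses (mG1 : G1 `<=` measurable) (mG2 : G2 `<=` measurable).
Hypothesis indep : forall A B, <<s G1 >> A -> <<s G2 >> B -> P (A `&` B) = (P A * P B)%E.

Let T1 := g_sigma_algebraType G1.
Let T2 := g_sigma_algebraType G2.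

Lemma measurable_id_sub (G : set (set Omega)) : G `<=` measurable ->
  mfunT (fun w : Omega => w : g_sigma_algebraType G).
Proof.
move=> mG; apply: (@measurability _ _ Omega (g_sigma_algebraType G) setT _ G) => //.
by move=> _ [B GB <-]; rewrite setTI; exact: mG.
Qed.

Let m1 := measurable_id_sub mG1.
Let m2 := measurable_id_sub mG2.

Lemma pushm_sigma_finite {dU} {U : measurableType dU} (f : Omega -> U) (mf : mfunT f) :
  sigma_finite setT (pushm P mf).
Proof.
exists (fun=> setT); first by rewrite bigcup_const//; exists 0%N.
move=> n; split; first exact: measurableT.
rewrite /pushm /= /pushforward preimage_setT (_ : P setT = 1%E) ?ltry//; exact: probability_setT.
Qed.

Let P1 := sfm_of (pushm_sigma_finite m1).
Let P2 := sfm_of (pushm_sigma_finite m2).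

Let mdiag : mfunT (fun w : Omega => (w : T1, w : T2)).
Proof. exact: measurable_fun_pair. Qed.

(** [T1] and [T2] are copies of [Omega] carrying the two sub-sigma-algebras. Independence says that
    the image of [P] on the diagonal agrees with the product measure on rectangles, hence
    everywhere; then Tonelli applies. *)
Lemma integral_indep (F : T1 * T2 -> \bar R) : mfunT F -> (forall p, 0 <= F p)%E ->
  (\int[P]_w F (w, w) = \int[P]_w \int[P]_w' F (w, w'))%E.
Proof.
move=> mF F0; rewrite -(ge0_integral_pushm P mdiag mF F0).
have E A : measurable A -> pushm P mdiag A = (P1 \x P2)%E A.
  move=> mA; apply/esym; apply: (@product_measure_unique _ _ _ _ _ P1 P2 (pushm P mdiag)) => // B C mB mC.
rewrite (eq_setfun_integral _ E) fubini_tonelli1//.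
rewrite (@ge0_integral_pushm _ _ _ _ _ P _ m1 (fubini_F P2 F)); last 2 first.
- exact: measurable_fun_fubini_tonelli_F.
- by move=> w; apply: integral_ge0.
apply: eq_integral => w _; rewrite /fubini_F.
rewrite (@ge0_integral_pushm _ _ _ _ _ P _ m2 (fun w' => F (w, w')))//.
apply: (mcomp (g := fun w' : T2 => (w : T1, w')) mF).
by apply: measurable_fun_pair; [exact: measurable_cst|exact: measurable_id].
Qed.

End independence.

(** * Moments of the perturbed measure *)

Section perturbation.
Context {R : realType} {d : nat} {dO} {Omega : measurableType dO} {P : probability Omega R}.
Local Notation V := 'rV[R]_d.
Variables (theta : V -> Omega -> Omega) (Phi : Omega -> {measure set V -> \bar R}).
Hypotheses (flow : preserving_flow P theta)
  (mPhi : forall A, measurable A -> mfunT (Phi ^~ A))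
  (lfPhi : forall w, locally_finite (Phi w)) (invPhi : invariant_measure theta Phi)
  (sqPhi : locally_square_integrable P Phi).
Local Open Scope ereal_scope.

Let sPhi w := sfm_of (locally_finite_sigma_finite (lfPhi w)).
Let alpha0 := second_moment_measure (P := P) mPhi lfPhi.

Lemma second_moment_integrable_rho : alpha0.-intR (rho 1).
Proof.
apply: integrable_ge0_lty; [exact: measurable_rho|by move=> x; exact: rho_ge0|].
exact: (second_moment_rho flow mPhi lfPhi invPhi sqPhi).
Qed.

Definition second_moment_sf : {sigma_finite_measure set V -> \bar R} :=
  sfm_of (integrable_gt0_sigma_finite (rho_gt0 1) second_moment_integrable_rho).

Definition lamPhi : R := fine (intensity (P := P) (d := d) Phi).

Let intensityE : intensity (P := P) Phi = lamPhi%:E.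
Proof.
rewrite fineK// ge0_fin_numE; first exact: (intensity_lty flow mPhi lfPhi invPhi sqPhi).
by apply: integral_ge0 => w _; apply: integral_ge0 => x _; rewrite lee_fin indicE.
Qed.

Lemma measurable_stat (h : V -> \bar R) : mfunT h -> (forall x, 0 <= h x) ->
  mfunT (fun w => \int[Phi w]_x h x).
Proof.
move=> mh h0; apply: (measurable_Phi_integral mPhi lfPhi (f := fun q : Omega * V => h q.2)) => //.
by apply: (mcomp mh); exact: measurable_snd.
Qed.

Lemma second_order_stationary : second_order P Phi second_moment_sf lamPhi.
Proof.
split.
- exact: measurable_stat.
- by move=> h mh h0; rewrite (mean_measure flow mPhi lfPhi invPhi mh h0) intensityE.
- move=> f g mf mg f0 g0.
  have mk : mfunT (fun p : V * V => f p.1 * g (p.1 - p.2)%R).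
    apply: emeasurable_funM; first by apply: (mcomp mf); exact: measurable_fst.
    by apply: (mcomp mg); apply: measurable_rVB; [exact: measurable_fst|exact: measurable_snd].
  rewrite -(campbell flow mPhi lfPhi invPhi mk (fun p => mule_ge0 (f0 p.1) (g0 _))).
  apply: eq_integral => w _; rewrite -ge0_integralZr//; last by apply: integral_ge0.
  apply: eq_integral => x _; rewrite -ge0_integralZl//.
  by apply: eq_integral => y _ /=; rewrite opprB addrCA subrr addr0.
- exact: (second_moment_rho flow mPhi lfPhi invPhi sqPhi).
Qed.

Variable Z : Omega -> V -> V.
Hypotheses (Zc : forall w, continuous (Z w)) (mZ : forall x, mfunT (Z ^~ x))
  (Zinv : invariant_field theta Z) (indep : field_measure_independent P Z Phi).

Let mZj : mfunT (fun p : Omega * V => Z p.1 p.2).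
Proof. exact: measurable_joint. Qed.

Lemma measurable_rV_continuous (f : V -> V) : continuous f -> mfunT f.
Proof.
move=> cf; apply: (measurability (@open V)) => // _ [U oU <-]; rewrite setTI.
by apply: open_rV_measurable; apply: open_comp => // x _; exact: cf.
Qed.

Lemma measurable_field {dT} {T : measurableType dT} (s : T -> Omega) (x : T -> V) :
  mfunT s -> mfunT x -> mfunT (fun t => Z (s t) (x t)).
Proof.
move=> ms mx.
apply: (mcomp (f := fun p : Omega * V => Z p.1 p.2) (g := fun t => (s t, x t)) mZj).
exact: measurable_fun_pair.
Qed.

Let mperturb w : mfunT (fun x : V => x + Z w x)%R.
Proof. by apply: measurable_rVD => //; exact: measurable_rV_continuous. Qed.

Variable Psi : Omega -> {measure set V -> \bar R}.
Hypothesis PsiE : forall w B, measurable B -> Psi w B = \int[Phi w]_x (\1_B (x + Z w x)%R)%:E.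

Lemma integral_Psi w (h : V -> \bar R) : mfunT h -> (forall x, 0 <= h x) ->
  \int[Psi w]_x h x = \int[Phi w]_x h (x + Z w x)%R.
Proof.
move=> mh h0; rewrite -(ge0_integral_pushm (Phi w) (mperturb w) mh h0).
apply: eq_setfun_integral => A mA; rewrite PsiE// -[RHS]mul1e -[A in RHS]setIT -integral_indic// mul1e.
have mA' : mfunT (fun x : V => (\1_A x : R)%:E) by apply: measurable_EFin; exact: measurable_indic.
by rewrite (ge0_integral_pushm (Phi w) (mperturb w) mA')// => x; rewrite lee_fin indicE.
Qed.

Lemma measurable_integral_Psi (h : V -> \bar R) : mfunT h -> (forall x, 0 <= h x) ->
  mfunT (fun w => \int[Psi w]_x h x).
Proof.
move=> mh h0; rewrite (_ : (fun w => _) = (fun w => \int[Phi w]_x h (x + Z w x)%R)); last first.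
  by apply/funext => w; exact: integral_Psi.
apply: (measurable_Phi_integral mPhi lfPhi (f := fun q : Omega * V => h (q.2 + Z q.1 q.2)%R)) => //.
by apply: (mcomp mh); apply: measurable_rVD => //; exact: measurable_snd.
Qed.

Let mG1 : measure_events Phi `<=` measurable.
Proof.
by move=> _ [B [C [mB mC ->]]]; rewrite -[X in measurable X]setTI; exact: mPhi.
Qed.
Let mG2 : field_events Z `<=` measurable.
Proof.
by move=> _ [x [B [mB ->]]]; rewrite -[X in measurable X]setTI; exact: mZ.
Qed.

Let T1 := g_sigma_algebraType (measure_events Phi).
Let T2 := g_sigma_algebraType (field_events Z).

Let mPhi1 A : measurable A -> mfunT (fun w : T1 => Phi w A).
Proof.
move=> mA _ C mC; rewrite setTI; apply: sub_sigma_algebra.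
by exists A, C; split.
Qed.

Let mZ2 : mfunT (fun p : T2 * V => Z p.1 p.2).
Proof.
apply: measurable_joint => // x _ B mB; rewrite setTI; apply: sub_sigma_algebra.
by exists x, B; split.
Qed.

(** The first copy of [w] drives [Phi] and the second drives [Z]; by independence they may be
    sampled separately. This requires the field to be jointly measurable for its own sigma-algebra,
    hence [mZ2]. *)
Let integral_indep2 (k : (T1 * T2) * (V * V) -> \bar R) : mfunT k -> (forall p, 0 <= k p) ->
  \int[P]_w \int[Phi w]_x \int[Phi w]_y k ((w, w), (x, y)) =
  \int[P]_w \int[P]_w' \int[Phi w]_x \int[Phi w]_y k ((w, w'), (x, y)).
Proof.
move=> mk k0.
apply: (@integral_indep R _ Omega P _ _ mG1 mG2 _
  (fun p : T1 * T2 => \int[Phi p.1]_x \int[Phi p.1]_y k (p, (x, y)))).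
- move=> A B GA GB; rewrite setIC (indep GB GA) muleC//.
- apply: (@measurable_lf_integral R d _ _ (fun p : T1 * T2 => Phi p.1) _ _
    (fun q : (T1 * T2) * V => \int[Phi q.1.1]_y k (q.1, (q.2, y)))) => //.
  + by move=> A mA; apply: (mcomp (mPhi1 mA)); exact: measurable_fst.
  + apply: (@measurable_lf_integral R d _ _ (fun q : (T1 * T2) * V => Phi q.1.1) _ _
      (fun q : ((T1 * T2) * V) * V => k (q.1.1, (q.1.2, q.2)))) => //.
      move=> A mA; apply: (mcomp (mPhi1 mA)).
      by apply: (mcomp (@measurable_fst _ _ _ _)); exact: measurable_fst.
    apply: (mcomp mk); apply: measurable_fun_pair.
      by apply: (mcomp (@measurable_fst _ _ _ _)); exact: measurable_fst.
    apply: measurable_fun_pair; last exact: measurable_snd.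
    by apply: (mcomp (@measurable_snd _ _ _ _)); exact: measurable_fst.
  + by move=> q; apply: integral_ge0.
- by move=> p; apply: integral_ge0 => x _; apply: integral_ge0.
Qed.

Let Z2 (h : V -> \bar R) : mfunT h ->
  mfunT (fun p : (T1 * T2) * (V * V) => h (p.2.1 + Z p.1.2 p.2.1)%R) /\
  mfunT (fun p : (T1 * T2) * (V * V) => h (p.2.2 + Z p.1.2 p.2.2)%R).
Proof.
move=> mh.
have ms : mfunT (fun p : (T1 * T2) * (V * V) => p.1.2).
  by apply: (mcomp (@measurable_snd _ _ _ _)); exact: measurable_fst.
have mx : mfunT (fun p : (T1 * T2) * (V * V) => p.2.1).
  by apply: (mcomp (@measurable_fst _ _ _ _)); exact: measurable_snd.
have my : mfunT (fun p : (T1 * T2) * (V * V) => p.2.2).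
  by apply: (mcomp (@measurable_snd _ _ _ _)); exact: measurable_snd.
by split; apply: (mcomp mh); apply: measurable_rVD => //;
  [apply: (mcomp (f := fun q : T2 * V => Z q.1 q.2) (g := fun p : (T1 * T2) * (V * V) => (p.1.2, p.2.1)) mZ2)
  |apply: (mcomp (f := fun q : T2 * V => Z q.1 q.2) (g := fun p : (T1 * T2) * (V * V) => (p.1.2, p.2.2)) mZ2)];
  apply: measurable_fun_pair.
Qed.

Let flowZ t w x : Z (theta t w) x = Z w (x + t)%R. Proof. exact: Zinv. Qed.

Lemma field_stationary (h : V -> V -> \bar R) x y : mfunT (fun p : V * V => h p.1 p.2) ->
  \int[P]_w h (Z w x) (Z w y) = \int[P]_w h (Z w (x - y)%R) (Z w 0%R).
Proof.
move=> mh; have mF : mfunT (fun w => h (Z w (x - y)%R) (Z w 0%R)).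
  apply: (mcomp (f := fun p : V * V => h p.1 p.2) (g := fun w => (Z w (x - y)%R, Z w 0%R)) mh).
  by apply: measurable_fun_pair; exact: mZ.
rewrite -(integral_flow flow y mF); apply: eq_integral => w _.
by rewrite !flowZ subrK add0r.
Qed.

Let mshift (h : V -> \bar R) (f : Omega * V -> V) : mfunT h -> mfunT f ->
  mfunT (fun p : Omega * V => h (f p + Z p.1 p.2)%R).
Proof. by move=> mh mf; apply: (mcomp mh); apply: measurable_rVD. Qed.

(** After decoupling, [Z w x] may be replaced by [Z w 0]: each point is displaced by a vector whose
    law does not depend on its position, and Lebesgue measure absorbs the shift. The intensity of
    [Psi] is that of [Phi]. *)
Lemma mean_Psi (h : V -> \bar R) : mfunT h -> (forall x, 0 <= h x) ->
  \int[P]_w \int[Psi w]_x h x = lamPhi%:E * \int[lebm d]_x h x.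
Proof.
move=> mh h0.
transitivity (\int[P]_w \int[Phi w]_x h (x + Z w x)%R).
  by apply: eq_integral => w _; exact: integral_Psi.
pose F (p : T1 * T2) := \int[Phi p.1]_x h (x + Z p.2 x)%R.
have mF : mfunT F.
  apply: (@measurable_lf_integral R d _ _ (fun p : T1 * T2 => Phi p.1) _ _
    (fun q : (T1 * T2) * V => h (q.2 + Z q.1.2 q.2)%R)) => //.
    by move=> A mA; apply: (mcomp (mPhi1 mA)); exact: measurable_fst.
  apply: (mcomp mh); apply: measurable_rVD; first exact: measurable_snd.
  apply: (mcomp (f := fun q : T2 * V => Z q.1 q.2)
    (g := fun q : (T1 * T2) * V => (q.1.2, q.2)) mZ2); apply: measurable_fun_pair; last exact: measurable_snd.
  by apply: (mcomp (@measurable_snd _ _ _ _)); exact: measurable_fst.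
have ind A B : <<s measure_events Phi >> A -> <<s field_events Z >> B -> P (A `&` B) = (P A * P B).
  by move=> GA GB; rewrite setIC (indep GB GA) muleC.
rewrite (@integral_indep R _ Omega P _ _ mG1 mG2 ind F mF)/=; last by move=> p; apply: integral_ge0.
pose H x := \int[P]_w h (x + Z w 0%R)%R.
have mHz : mfunT (fun p : V * Omega => h (p.1 + Z p.2 0)%R).
  apply: (mcomp mh); apply: measurable_rVD; first exact: measurable_fst.
  by apply: (mcomp (mZ 0)); exact: measurable_snd.
have mH : mfunT H.
  by apply: (measurable_fun_fubini_tonelli_F (fun p : V * Omega => h (p.1 + Z p.2 0%R)%R)).
have H0 x : 0 <= H x by apply: integral_ge0.
transitivity (\int[P]_w \int[Phi w]_x H x).
  apply: eq_integral => w _; rewrite /F/=.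
  rewrite (@fubini_tonelli _ _ _ _ _ P (sPhi w) (fun p : Omega * V => h (p.2 + Z p.1 p.2)%R)); last 2 first.
  - by apply: mshift => //; exact: measurable_snd.
  - by move=> p; exact: h0.
  apply: eq_integral => x _ /=; rewrite (@field_stationary (fun a b => h (x + b)%R) x x)//.
  by apply: (mcomp mh); apply: measurable_rVD => //; exact: measurable_snd.
rewrite (mean_measure flow mPhi lfPhi invPhi mH H0) intensityE; congr (_ * _).
rewrite (@fubini_tonelli _ _ _ _ _ (lebm d) P (fun p : V * Omega => h (p.1 + Z p.2 0)%R))//.
transitivity (\int[P]_w \int[lebm d]_x h x).
  by apply: eq_integral => w _; rewrite (ge0_integral_lebm_shift (Z w 0) mh h0).
transitivity (\int[P]_w cst (\int[lebm d]_x h x) w); first by [].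
by rewrite integral_cst//= (_ : P setT = 1) ?mule1//; exact: probability_setT.
Qed.

Let mdisp : mfunT (fun p : V * Omega => p.1 + Z p.2 p.1 - Z p.2 0)%R.
Proof.
apply: measurable_rVB; first apply: measurable_rVD; first exact: measurable_fst.
- by apply: measurable_field; [exact: measurable_snd|exact: measurable_fst].
- by apply: (mcomp (mZ 0)); exact: measurable_snd.
Qed.

Definition displaced_second_moment : {measure set V -> \bar R} :=
  pushm (prodm second_moment_sf P) mdisp.

Lemma integral_displaced (h : V -> \bar R) : mfunT h -> (forall x, 0 <= h x) ->
  \int[displaced_second_moment]_v h v =
  \int[second_moment_sf]_u \int[P]_w h (u + Z w u - Z w 0)%R.
Proof.
move=> mh h0; rewrite ge0_integral_pushm//.
by rewrite (@fubini_tonelli1 _ _ _ _ _ second_moment_sf P)//; exact: (mcomp mh mdisp).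
Qed.

Hypothesis exp_moment : \int[P]_w (expR (2 * l1 (Z w 0)))%:E < +oo.

(** A displacement costs at most [exp (l1 (Z w u)) * exp (l1 (Z w 0))]. The product is at most the
    sum of the squares, and by stationarity each square has the mean [M]; hence [M + M]. *)
Lemma displaced_rho : \int[displaced_second_moment]_v (rho 1 v)%:E < +oo.
Proof.
have mr : mfunT (fun v : V => (rho 1 v : R)%:E) by apply: measurable_EFin; exact: measurable_rho.
rewrite integral_displaced//; last by move=> x; rewrite lee_fin rho_ge0.
have mE : mfunT (fun z : V => (expR (2 * l1 z) : R)%:E).
  apply: measurable_EFin; apply: measurable_expR_comp; apply: measurable_funM => //; exact: measurable_l1.
pose M := \int[P]_w (expR (2 * l1 (Z w 0)))%:E.
have mEx x : mfunT (fun w => (expR (2 * l1 (Z w x)))%:E) by exact: (mcomp mE (mZ x)).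
have Mx x : \int[P]_w (expR (2 * l1 (Z w x)))%:E = M.
  rewrite (@field_stationary (fun a b => (expR (2 * l1 b))%:E) x x)//.
  by apply: (mcomp mE); exact: measurable_snd.
have M0 : 0 <= M by apply: integral_ge0 => w _; rewrite lee_fin expR_ge0.
apply: (@le_lt_trans _ _ (\int[second_moment_sf]_u ((rho 1 u)%:E * (M + M)))).
  apply: ge0_le_integral => //.
  - by move=> u _; apply: integral_ge0 => w _; rewrite lee_fin rho_ge0.
  - apply: (@measurable_fun_fubini_tonelli_F _ _ _ _ _ P (fun p : V * Omega => (rho 1 (p.1 + Z p.2 p.1 - Z p.2 0))%:E)).
      exact: (mcomp mr mdisp).
    by move=> p; rewrite lee_fin rho_ge0.
  - by apply: emeasurable_funM.
  move=> u _; rewrite -{1}(Mx u) /M -ge0_integralD//.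
  rewrite -ge0_integralZl//; last 3 first.
  - by apply: emeasurable_funD.
  - by move=> w _; rewrite adde_ge0 ?lee_fin ?expR_ge0.
  - by rewrite lee_fin rho_ge0.
  apply: ge0_le_integral => //.
  - by move=> w _; rewrite lee_fin rho_ge0.
  - by apply: (mcomp mr); apply: measurable_rVB => //; apply: measurable_rVD.
  - by apply: emeasurable_funM => //; apply: emeasurable_funD.
  move=> w _; rewrite -EFinD -EFinM lee_fin.
  set a := l1 (Z w u); set b := l1 (Z w 0).
  have h : (rho 1 (u + Z w u - Z w 0) <= rho 1 u * (expR a * expR b) :> R)%R.
    rewrite /rho -!expRD ler_expR !mul1r.
    have h1 := l1D (u + Z w u - Z w 0) (Z w 0); rewrite subrK in h1.
    have h2 := l1D (u + Z w u) (- Z w u); rewrite addrK l1N in h2.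
    rewrite /a /b; lra.
  apply: (le_trans h); rewrite ler_wpM2l ?rho_ge0//.
  have e2 (c : R) : (expR (2 * c) = expR c * expR c)%R by rewrite -expRD; congr expR; ring.
  rewrite !e2; have h3 := expR_ge0 a; have h4 := expR_ge0 b; have := sqr_ge0 (expR a - expR b).
  have := mulr_ge0 h3 h4; nra.
have MM : M + M < +oo by rewrite lte_add_pinfty.
rewrite ge0_integralZr//; last 2 first.
- by move=> x _; rewrite lee_fin rho_ge0.
- by rewrite adde_ge0.
have ar := second_moment_rho flow mPhi lfPhi invPhi sqPhi.
have r0 : 0 <= \int[second_moment_sf]_u (rho 1 u : R)%:E by apply: integral_ge0 => x _; rewrite lee_fin rho_ge0.
by apply: lte_mul_pinfty => //; rewrite ge0_fin_numE.
Qed.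

Lemma displaced_integrable_rho : displaced_second_moment.-intR (rho 1).
Proof.
apply: integrable_ge0_lty; [exact: measurable_rho|by move=> x; exact: rho_ge0|exact: displaced_rho].
Qed.

Definition displaced_sf : {sigma_finite_measure set V -> \bar R} :=
  sfm_of (integrable_gt0_sigma_finite (rho_gt0 1) displaced_integrable_rho).

(** Independence decouples [Z] from [Phi], stationarity of the field moves the pair [x, y] to
    [x - y, 0], and [campbell] integrates over [Phi]. A translation of [t] by [Z w u] then leaves
    the displaced difference [u + Z w u - Z w 0]. *)
Lemma mixed_Psi (f g : V -> \bar R) : mfunT f -> mfunT g ->
  (forall x, 0 <= f x) -> (forall x, 0 <= g x) ->
  \int[P]_w ((\int[Psi w]_x f x) * (\int[Psi w]_x g x)) =
  \int[lebm d]_t \int[displaced_sf]_u (f t * g (t - u)%R).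
Proof.
move=> mf mg f0 g0.
have fz0 w x : 0 <= f (x + Z w x)%R by [].
transitivity (\int[P]_w \int[Phi w]_x \int[Phi w]_y (f (x + Z w x)%R * g (y + Z w y)%R)).
  apply: eq_integral => w _; rewrite !integral_Psi//.
  have mfw : mfunT (fun x : V => f (x + Z w x)%R) by exact: (mcomp mf (mperturb w)).
  have mgw : mfunT (fun x : V => g (x + Z w x)%R) by exact: (mcomp mg (mperturb w)).
  rewrite -ge0_integralZr//; last by apply: integral_ge0.
  by apply: eq_integral => x _; rewrite -ge0_integralZl.
have [mf1 _] := Z2 mf; have [_ mg2] := Z2 mg.
rewrite (integral_indep2 (emeasurable_funM mf1 mg2) (fun p => mule_ge0 (f0 _) (g0 _)))/=.
have mfz : mfunT (fun p : Omega * V => f (p.2 + Z p.1 p.2)%R) by apply: mshift => //; exact: measurable_snd.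
have mgz : mfunT (fun p : Omega * V => g (p.2 + Z p.1 p.2)%R) by apply: mshift => //; exact: measurable_snd.
pose k (p : V * V) := \int[P]_w (f (p.1 + Z w p.2)%R * g (p.1 - p.2 + Z w 0)%R).
have mkw : mfunT (fun q : (V * V) * Omega => f (q.1.1 + Z q.2 q.1.2)%R * g (q.1.1 - q.1.2 + Z q.2 0)%R).
  have q11 : mfunT (fun q : (V * V) * Omega => q.1.1).
    by apply: (mcomp (@measurable_fst _ _ _ _)); exact: measurable_fst.
  have q12 : mfunT (fun q : (V * V) * Omega => q.1.2).
    by apply: (mcomp (@measurable_snd _ _ _ _)); exact: measurable_fst.
  apply: emeasurable_funM.
    apply: (mcomp mf); apply: measurable_rVD => //.
    by apply: measurable_field => //; exact: measurable_snd.
  apply: (mcomp mg); apply: measurable_rVD; first exact: measurable_rVB.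
  by apply: (mcomp (mZ 0)); exact: measurable_snd.
have mk : mfunT k.
  apply: (@measurable_fun_fubini_tonelli_F _ _ _ _ _ P (fun q : (V * V) * Omega =>
    f (q.1.1 + Z q.2 q.1.2)%R * g (q.1.1 - q.1.2 + Z q.2 0)%R)) => //.
  by move=> q; rewrite mule_ge0.
have k0 p : 0 <= k p by apply: integral_ge0 => w _; rewrite mule_ge0.
transitivity (\int[P]_w \int[Phi w]_x \int[Phi w]_y k (x, (x - y)%R)).
  apply: eq_integral => w _.
  have mtot : mfunT (fun q : (Omega * V) * V => f (q.1.2 + Z q.1.1 q.1.2)%R * g (q.2 + Z q.1.1 q.2)%R).
    apply: emeasurable_funM; first by apply: (mcomp mfz); exact: measurable_fst.
    apply: (mcomp mg); apply: measurable_rVD; first exact: measurable_snd.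
    apply: measurable_field; last exact: measurable_snd.
    by apply: (mcomp (@measurable_fst _ _ _ _)); exact: measurable_fst.
  have tot0 (q : (Omega * V) * V) : 0 <= f (q.1.2 + Z q.1.1 q.1.2)%R * g (q.2 + Z q.1.1 q.2)%R by rewrite mule_ge0.
  rewrite (@fubini_tonelli _ _ _ _ _ P (sPhi w) (fun p : Omega * V => \int[Phi w]_y (f (p.2 + Z p.1 p.2)%R * g (y + Z p.1 y)%R))); last 2 first.
  - exact: (@measurable_fun_fubini_tonelli_F _ _ _ _ _ (sPhi w) _ mtot tot0).
  - by move=> p; apply: integral_ge0 => y _; rewrite mule_ge0.
  apply: eq_integral => x _ /=.
  rewrite (@fubini_tonelli _ _ _ _ _ P (sPhi w) (fun p : Omega * V => f (x + Z p.1 x)%R * g (p.2 + Z p.1 p.2)%R)); last 2 first.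
  - apply: emeasurable_funM => //; apply: (mcomp mf); apply: measurable_rVD => //.
    by apply: (mcomp (mZ x)); exact: measurable_fst.
  - by move=> p; rewrite mule_ge0.
  apply: eq_integral => y _ /=.
  rewrite (@field_stationary (fun a b => f (x + a)%R * g (y + b)%R) x y).
    by rewrite /k/= opprB addrCA subrr addr0.
  apply: emeasurable_funM.
    by apply: (mcomp mf); apply: measurable_rVD => //; exact: measurable_fst.
  by apply: (mcomp mg); apply: measurable_rVD => //; exact: measurable_snd.
rewrite (campbell flow mPhi lfPhi invPhi mk k0).
have mkT : mfunT (fun p : V * V => k (p.1, p.2)) by [].
rewrite (@fubini_tonelli _ _ _ _ _ (lebm d) second_moment_sf k)//.
transitivity (\int[second_moment_sf]_u \int[P]_w \int[lebm d]_t (f t * g (t - (u + Z w u - Z w 0))%R)).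
  apply: eq_integral => u _; rewrite /k/=.
  rewrite (@fubini_tonelli _ _ _ _ _ (lebm d) P (fun p : V * Omega => f (p.1 + Z p.2 u)%R * g (p.1 - u + Z p.2 0)%R)); last 2 first.
  - apply: (mcomp mkw (f := fun q : (V * V) * Omega => _) (g := fun p : V * Omega => ((p.1, u), p.2))).
    by apply: measurable_fun_pair; [apply: measurable_fun_pair; [exact: measurable_fst|exact: measurable_cst]|exact: measurable_snd].
  - by move=> p; rewrite mule_ge0.
  apply: eq_integral => w _ /=.
  rewrite -[RHS](ge0_integral_lebm_shift (Z w u)); last 2 first.
  - by apply: emeasurable_funM => //; apply: (mcomp mg); exact: measurable_rVB.
  - by move=> t; rewrite mule_ge0.
  apply: eq_integral => t _; congr (_ * g _).
  by apply/rowP => i; rewrite !mxE; ring.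
have mfg : mfunT (fun p : V * V => f p.1 * g (p.1 - p.2)%R).
  apply: emeasurable_funM; first by apply: (mcomp mf); exact: measurable_fst.
  by apply: (mcomp mg); apply: measurable_rVB; [exact: measurable_fst|exact: measurable_snd].
rewrite (@fubini_tonelli _ _ _ _ _ (lebm d) displaced_sf (fun p : V * V => f p.1 * g (p.1 - p.2)%R))//=; last first.
  by move=> p; rewrite mule_ge0.
apply/esym; apply: integral_displaced.
- apply: (measurable_fun_fubini_tonelli_G (fun p : V * V => f p.1 * g (p.1 - p.2)%R)) => // p.
  by rewrite mule_ge0.
- by move=> v; apply: integral_ge0 => t _; rewrite mule_ge0.
Qed.

Lemma second_order_displaced : second_order P Psi displaced_sf lamPhi.
Proof.
split.
- exact: measurable_integral_Psi.
- exact: mean_Psi.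
- exact: mixed_Psi.
- exact: displaced_rho.
Qed.

End perturbation.

(** * Comparison of Gaussian displacements *)

Section gaussian_variable.
Context {R : realType} {dO} {Omega : measurableType dO} {P : probability Omega R}.
Implicit Types (X : Omega -> R) (phi : R -> R).

Let leb1 := @leb1 R.

Lemma measurable_density (f : R -> {nonneg R}) : mfunT (fun x => (f x)%:num) ->
  forall A : set (measurableTypeR R), measurable A ->
  mfunT (fun x : measurableTypeR R => mscale (f x) (dirac x) A).
Proof.
move=> mf A mA; rewrite (_ : (fun x => _) = (fun x => ((f x)%:num * \1_A x)%:E)).
  by apply: measurable_EFin; apply: measurable_funM => //; exact: measurable_indic.
by apply/funext => x; rewrite /mscale /= diracE indicE EFinM.
Qed.

(** A law with a density is a mixture of point masses weighted by the density, so the change of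
    measure is an instance of [ge0_integral_mixture]. *)
Lemma ge0_integral_normal_prob (m s : R) (h : R -> \bar R) : mfunT h ->
  (forall x, (0 <= h x)%E) ->
  (\int[normal_prob m s]_x h x = \int[leb1]_x ((normal_pdf m s x)%:E * h x))%E.
Proof.
move=> mh h0; pose f x := NngNum (normal_pdf_ge0 m s x).
have mf : mfunT (fun x => (f x)%:num) by exact: measurable_normal_pdf.
rewrite (_ : integral _ _ _ = (\int[mixture leb1 (measurable_density mf)]_x h x)%E).
  rewrite ge0_integral_mixture//; apply: eq_integral => x _.
  by rewrite ge0_integral_mscale// integral_dirac// diracT mul1e.
apply: eq_setfun_integral => A mA; rewrite /mixture /normal_prob [LHS]integral_mkcond.
apply: eq_integral => x _; rewrite patchE [RHS](_ : _ = ((f x)%:num%:E * (\1_A x)%:E)%E)//.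
by rewrite indicE; case: ifPn => xA; rewrite ?mule1 ?mule0.
Qed.

Lemma gaussian_integral X : gaussian_rv P X -> exists m s : R,
  forall h : R -> \bar R, mfunT h -> (forall x, (0 <= h x)%E) ->
  (\int[P]_w h (X w) = if (s == 0)%R then h m else
    \int[leb1]_x ((normal_peak s * gexp (s ^- 2) x)%R%:E * h (x + m)%R))%E.
Proof.
move=> [mX [m [s Xs]]]; exists m, s => h mh h0.
have mX' : mfunT (X : Omega -> measurableTypeR R) := mX.
rewrite -(ge0_integral_pushm P mX' mh h0).
have [s0|s0] := eqVneq s 0.
  rewrite (_ : integral _ _ _ = (\int[@dirac _ (measurableTypeR R) m R]_x h x)%E).
    by rewrite integral_dirac// diracT mul1e.
  by apply: eq_setfun_integral => A mA; have := Xs A mA; rewrite s0 eqxx.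
rewrite (_ : integral _ _ _ = (\int[normal_prob m s]_x h x)%E); last first.
  apply: eq_setfun_integral => A mA; have := Xs A mA; by rewrite (negbTE s0).
rewrite ge0_integral_normal_prob// -(ge0_integral_leb1_shift m); last first.
  by apply: emeasurable_funM => //; apply: measurable_EFin; exact: measurable_normal_pdf.
apply: eq_integral => x _; congr (_%:E * _)%E.
rewrite (normal_pdfE m s0) /normal_fun /gexp addrK; congr (_ * expR _).
by rewrite mulNr -mulr_natr invfM; congr (- _); ring.
Qed.

Lemma gaussian_exp_moment X (c : R) : gaussian_rv P X -> (\int[P]_w (expR (c * X w))%:E < +oo)%E.
Proof.
move=> GX; have [m [s H]] := gaussian_integral GX.
rewrite (H (fun x => (expR (c * x))%:E)); last 2 first.
- by apply: measurable_EFin; apply: measurable_expR_comp; exact: measurable_funM.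
- by move=> x; rewrite lee_fin expR_ge0.
case: eqP => [_|/eqP s0]; first by rewrite ltry.
pose a := s ^- 2; have a0 : 0 < a by rewrite invr_gt0 exprn_even_gt0.
have K0 : 0 <= normal_peak s by exact: normal_peak_ge0.
under eq_integral do rewrite -EFinM.
(* Completing the square with half of the exponent: [c x <= a x^2 / 4 + c^2 / a]. *)
have ig := intgbZ (normal_peak s * expR (c * m + c ^+ 2 / a)) (@integrable_gexp R (a / 2) (divr_gt0 a0 (ltr0Sn _ 1))).
have mg : mfunT (fun x : R => normal_peak s * expR (c * m + c ^+ 2 / a) * gexp (a / 2) x).
  by apply: measurable_funM => //; exact: measurable_gexp.
apply: (@ge0_integral_lty _ _ _ leb1 _ (fun x : R => normal_peak s * expR (c * m + c ^+ 2 / a) * gexp (a / 2) x)).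
- apply: measurable_funM; first by apply: measurable_funM => //; exact: measurable_gexp.
  by apply: measurable_expR_comp; apply: measurable_funM => //; exact: measurable_funD.
- exact: mg.
- by move=> x; rewrite !mulr_ge0 ?expR_ge0 ?gexp_ge0.
- move=> x; rewrite -!mulrA ler_wpM2l// /gexp -!expRD ler_expR -/a.
  rewrite -subr_ge0 (_ : _ - _ = a * (x / 2 - c / a) ^+ 2); last by field; rewrite gt_eqF.
  by rewrite mulr_ge0 ?sqr_ge0 ?ltW.
- by rewrite -(EFin_Rintegral ig) ltry.
Qed.

(** [gaussian_integral] applies to the nonnegative function [1 + phi]; the constant 1 is then
    removed, since the density has total mass 1. *)
Lemma gaussian_bounded X : gaussian_rv P X -> exists m s : R,
  forall phi : R -> R, mfunT phi -> (forall x, `|phi x| <= 1) ->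
  \int[P]_w phi (X w) = if s == 0 then phi m else
    normal_peak s * \int[leb1]_x (phi (x + m) * gexp (s ^- 2) x).
Proof.
move=> GX; have [m [s H]] := gaussian_integral GX; exists m, s => phi mp phi1.
have mX : mfunT X by case: GX.
have p0 x : 0 <= 1 + phi x by have := phi1 x; rewrite ler_norml => /andP[]; lra.
have mp1 : mfunT (fun x => 1 + phi x) by exact: measurable_funD.
have iP1 : P.-intR (cst 1) by exact: finite_measure_integrable_cst.
have iP : P.-intR (fun w => phi (X w)).
  by apply: (integrable_le _ _ iP1) => //; exact: (mcomp mp mX).
have E1 : \int[P]_w (1 + phi (X w)) = 1 + \int[P]_w phi (X w).
  rewrite (RintegralD measurableT iP1 iP); congr (_ + _).
  rewrite Rintegral_cst// mul1r; apply: (congr1 fine (y := 1%E)); exact: probability_setT.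
have := H (fun x => (1 + phi x)%:E) (measurable_EFin mp1) (fun x => p0 x).
case: eqP => [_ E|/eqP s0 E].
  by apply: (addrI 1); rewrite -E1 /Rintegral E.
have a0 : 0 < s ^- 2 by rewrite invr_gt0 exprn_even_gt0.
have ig := integrable_gexp a0.
have k1 : normal_peak s * Num.sqrt (2 * pi / s ^- 2) = 1.
  rewrite /normal_peak invrK (_ : 2 * pi * s ^+ 2 = s ^+ 2 * pi *+ 2); last by rewrite -mulr_natr; ring.
  by rewrite mulVf// gt_eqF// sqrtr_gt0 pmulrn_lgt0// mulr_gt0 ?exprn_even_gt0 ?pi_gt0.
have ipg : leb1.-intR (fun x : R => phi (x + m) * gexp (s ^- 2) x).
  apply: (integrable_le _ _ ig).
    by apply: measurable_funM; [apply: (mcomp mp); exact: measurable_funD|exact: measurable_gexp].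
  by move=> x; rewrite normrM (ger0_norm (gexp_ge0 _ _)) ler_piMl ?gexp_ge0.
apply: (addrI 1); rewrite -E1 {1}/Rintegral E -[in RHS]k1.
have -> : Num.sqrt (2 * pi / s ^- 2) = \int[leb1]_x gexp (s ^- 2) x.
  by rewrite /Rintegral [X in fine X](integral_gexp a0).
rewrite -mulrDr -(RintegralD measurableT ig ipg) -RintegralZl//; last exact: integrable_add.
rewrite /Rintegral; congr fine; apply: eq_integral => x _; rewrite -EFinM; congr (_%:E); ring.
Qed.

(** Here [m] and [v] are parameters of the law; that they are the mean and the variance is found in
    [gaussian_cos]. A point mass has [v = 0]. *)
Lemma gaussian_char X : gaussian_rv P X -> exists m v : R, 0 <= v /\ forall c,
  \int[P]_w cos (c * (X w - m)) = expR (- (v * c ^+ 2 / 2)) /\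
  \int[P]_w sin (c * (X w - m)) = 0.
Proof.
move=> GX; have [m [s H]] := gaussian_bounded GX; exists m, (s ^+ 2); split; first exact: sqr_ge0.
move=> c.
have ml : mfunT (fun x : R => c * (x - m)).
  by apply: measurable_funM => //; exact: measurable_funB.
have mc := measurable_cos_comp ml; have ms := measurable_sin_comp ml.
rewrite (H _ mc (fun=> normr_cos_le1 _)) (H _ ms (fun=> normr_sin_le1 _)).
case: eqP => [->|/eqP s0]; first by rewrite subrr mulr0 cos0 sin0 expr0n/= !mul0r oppr0 expR0.
have a0 : 0 < s ^- 2 by rewrite invr_gt0 exprn_even_gt0.
have k0 : Num.sqrt (2 * pi / s ^- 2) != 0 by rewrite gt_eqF// sqrtr_gt0 divr_gt0// mulr_gt0// pi_gt0.
split.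
  have -> : \int[leb1]_x (cos (c * (x + m - m)) * gexp (s ^- 2) x) =
      \int[leb1]_x (cos (c * x) * gexp (s ^- 2) x).
    by apply: eq_Rintegral => x _; rewrite addrK.
  rewrite [X in _ * X](Rintegral_cos_gexp c a0) mulrA.
  have -> : normal_peak s * Num.sqrt (2 * pi / s ^- 2) = 1.
    rewrite /normal_peak (_ : 2 * pi / s ^- 2 = s ^+ 2 * pi *+ 2); last by rewrite invrK -mulr_natr; ring.
    by rewrite mulVf// (_ : s ^+ 2 * pi *+ 2 = 2 * pi / s ^- 2)// invrK -mulr_natr; ring.
  by rewrite mul1r /gexp invrK.
set I := Rintegral _ _ _; suff -> : I = 0 by rewrite mulr0.
suff : I = - I by move=> /eqP; rewrite -addr_eq0 -mulr2n mulrn_eq0/= => /eqP.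
have mS : mfunT (fun x : R => sin (c * x) * gexp (s ^- 2) x).
  by apply: measurable_funM; [apply: measurable_sin_comp; exact: measurable_funM|exact: measurable_gexp].
have -> : I = \int[leb1]_x (sin (c * x) * gexp (s ^- 2) x).
  by apply: eq_Rintegral => x _; rewrite addrK.
rewrite {1}/Rintegral -[X in fine X](integral_leb1_opp (measurable_EFin mS)).
rewrite -mulN1r -RintegralZl//; last first.
  apply: (@integrable_le _ _ _ leb1 _ (gexp (s ^- 2)) mS _ (integrable_gexp a0)) => x.
  by rewrite normrM (ger0_norm (gexp_ge0 _ _)) ler_piMl ?gexp_ge0 ?normr_sin_le1.
rewrite /Rintegral; congr fine; apply: eq_integral => x _.
by rewrite gexpN mulrN sinN mulN1r mulNr.
Qed.

End gaussian_variable.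

(** * Elementary limits with rates *)

Section rates.
Context {R : realType}.

Lemma cvg_rate (u : nat -> R) (l C : R) : (forall n, `|u n - l| <= C / n.+1%:R) ->
  u n @[n --> \oo] --> l.
Proof.
move=> H.
have h0 : C / n.+1%:R @[n --> \oo] --> (0 : R).
  by rewrite -(mulr0 C); apply: cvgM; [exact: cvg_cst|exact: cvg_harmonic].
apply/cvgrPdist_lt => e e0; have /cvgrPdist_lt/(_ _ e0) := h0; apply: filterS => n.
rewrite sub0r normrN => h; rewrite distrC; apply: (le_lt_trans (H n)).
exact: (le_lt_trans (ler_norm _) h).
Qed.

Lemma sin_sub_le (h : R) : `|sin h - h| <= h ^+ 2.
Proof.
suff H (x : R) : 0 <= x -> `|sin x - x| <= x ^+ 2.
  case: (leP 0 h) => [|/ltW] h0; first exact: H.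
  have := H (- h); rewrite oppr_ge0 => /(_ h0); rewrite sinN sqrrN opprK => h1.
  by rewrite -normrN opprB addrC.
move=> x0; have [|c /[!in_itv]/= /andP[c0 cx]] := @MVT_segment R sin cos 0 x x0 (fun y _ => is_derive_sin y).
  by apply: continuous_subspaceT => y; exact: continuous_sin.
rewrite sin0 !subr0 => ->; rewrite -[X in _ - X]mul1r -mulrBl normrM (ger0_norm x0) expr2 ler_wpM2r//.
by rewrite -[1 in X in X <= _]cos0; apply: (le_trans (cos_lip _ _)); rewrite subr0 ger0_norm.
Qed.

(** Bounded trigonometric functions approximate the identity and, by [sin_scaled_le], are dominated
    by it. Through them a moment, or a factor [k_i] in a Fourier integral, is reached from
    characteristic functions. *)
Lemma sin_scaled_cvg (y : R) : n.+1%:R * sin (y / n.+1%:R) @[n --> \oo] --> y.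
Proof.
apply: (@cvg_rate _ _ (y ^+ 2)) => n.
have n0 : 0 < n.+1%:R :> R by rewrite ltr0n.
rewrite [X in _ - X](_ : y = n.+1%:R * (y / n.+1%:R)); last by rewrite mulrC divfK// gt_eqF.
rewrite -mulrBr normrM gtr0_norm// mulrC -ler_pdivlMr//.
by apply: (le_trans (sin_sub_le _)); rewrite expr_div_n expr2 invfM mulrA.
Qed.

Lemma sin_scaled_le (y : R) n : `|n.+1%:R * sin (y / n.+1%:R)| <= `|y|.
Proof.
have n0 : 0 < n.+1%:R :> R by rewrite ltr0n.
rewrite normrM gtr0_norm// mulrC -ler_pdivlMr//.
by have := sin_lip (y / n.+1%:R) 0; rewrite sin0 !subr0 normrM normfV (gtr0_norm n0).
Qed.

Lemma expR_sub_le (x : R) : 0 <= x -> `|1 - expR (- x) - x| <= x ^+ 2.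
Proof.
move=> x0; have h1 := expR_ge1Dx (- x).
rewrite ler0_norm; last by lra.
have e1 := expR_ge1Dx x; have e0 := expR_gt0 (- x).
have e2 : expR (- x) * expR x = 1 by rewrite -expRD addNr expR0.
have e3 : expR (- x) * (1 + x) <= 1 by rewrite -[leRHS]e2; apply: ler_wpM2l => //; exact: ltW.
suff : expR (- x) <= 1 - x + x ^+ 2 by lra.
have x1 : 0 < 1 + x by lra.
rewrite -(ler_pM2r x1); apply: (le_trans e3).
have x2 : 0 <= x ^+ 2 * x by rewrite mulr_ge0 ?sqr_ge0.
rewrite (_ : (1 - x + x ^+ 2) * (1 + x) = 1 + x ^+ 2 * x); last by ring.
by rewrite lerDl.
Qed.

Lemma expR_scaled_cvg (v : R) : 0 <= v ->
  n.+1%:R ^+ 2 * (1 - expR (- (v / n.+1%:R ^+ 2))) @[n --> \oo] --> v.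
Proof.
move=> v0; apply: (@cvg_rate _ _ (v ^+ 2)) => n.
have n1 : 1 <= n.+1%:R :> R by rewrite ler1n.
move: (n.+1%:R : R) n1 => N n1; have n0 : 0 < N by lra.
have N2 : 0 < N ^+ 2 by rewrite exprn_gt0.
rewrite [X in _ - X](_ : v = N ^+ 2 * (v / N ^+ 2)); last by rewrite mulrC divfK// gt_eqF.
rewrite -mulrBr normrM (gtr0_norm N2).
have := @expR_sub_le (v / N ^+ 2) (divr_ge0 v0 (ltW N2)) => h.
apply: (le_trans (ler_wpM2l (ltW N2) h)).
rewrite (_ : N ^+ 2 * (v / N ^+ 2) ^+ 2 = v ^+ 2 / (N * N)); last by field; rewrite gt_eqF.
rewrite ler_wpM2l ?sqr_ge0// lef_pV2 ?posrE ?mulr_gt0//; nra.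
Qed.

Lemma sqr_le_expR (x : R) : x ^+ 2 <= 2 * (expR x + expR (- x)).
Proof.
suff H (y : R) : 0 <= y -> y ^+ 2 <= 2 * (expR y + expR (- y)).
  case: (leP 0 x) => [|/ltW] x0; first exact: H.
  by have := H (- x); rewrite oppr_ge0 sqrrN opprK [expR (- x) + _]addrC; apply.
move=> y0; have := expR_ge1Dxn 1 y0; have := expR_ge0 (- y).
by rewrite (_ : 2`!%:R = 2) // => h1 h2; lra.
Qed.

End rates.

(** * Mean and variance of a Gaussian variable *)

Section gaussian_moments.
Context {R : realType} {dO} {Omega : measurableType dO} {P : probability Omega R}.
Variable X : Omega -> R.
Hypothesis GX : gaussian_rv P X.

Lemma integrable_prob_cst (c : R) : P.-intR (fun=> c).
Proof. exact: finite_measure_integrable_cst. Qed.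

Lemma Rintegral_prob_cst (c : R) : \int[P]_w c = c.
Proof.
transitivity (\int[P]_w cst c w); first by [].
rewrite Rintegral_cst// -[RHS]mulr1; congr (_ * _).
by apply: (congr1 fine (y := 1%E)); exact: probability_setT.
Qed.

Let mX : mfunT X. Proof. by case: GX. Qed.

Lemma gaussian_integrable_exp (c : R) : P.-intR (fun w => expR (c * X w)).
Proof.
apply: integrable_ge0_lty; first by apply: measurable_expR_comp; exact: measurable_funM.
- by move=> w; exact: expR_ge0.
- exact: gaussian_exp_moment.
Qed.

Lemma gaussian_integrable_sqr : P.-intR (fun w => X w ^+ 2).
Proof.
apply: (@integrable_le _ _ _ _ _ (fun w => 2 * (expR (1 * X w) + expR (-1 * X w)))).
- exact: measurable_funX.
- by move=> w; rewrite ger0_norm ?sqr_ge0// mul1r mulN1r; exact: sqr_le_expR.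
- by apply: intgbZ; apply: integrable_add; exact: gaussian_integrable_exp.
Qed.

Lemma gaussian_integrable : P.-intR X.
Proof.
apply: (@integrable_le _ _ _ _ _ (fun w => 1 + X w ^+ 2)) => //.
- by move=> w; rewrite ler_norml; apply/andP; split; have := sqr_ge0 (X w - 1); have := sqr_ge0 (X w + 1); nra.
- by apply: integrable_add; [exact: integrable_prob_cst|exact: gaussian_integrable_sqr].
Qed.

(** The sine transform vanishes at every frequency, so [N sin ((X - m) / N)] has mean 0, and in the
    limit [m] is the mean. Likewise [(N sin (x / N))^2] equals [N^2 / 2 * (1 - cos (2 x / N))],
    whose mean at [x = X - m] is explicit and tends to [v]. *)
Lemma gaussian_cos : let m := \int[P]_w X w in
  \int[P]_w cos (X w - m) = expR (- (\int[P]_w (X w - m) ^+ 2 / 2)) /\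
  \int[P]_w sin (X w - m) = 0.
Proof.
have [m [v [v0 H]]] := gaussian_char GX.
have mXm : mfunT (fun w => X w - m) by exact: measurable_funB.
have iXm : P.-intR (fun w => X w - m).
  by apply: integrable_sub; [exact: gaussian_integrable|exact: integrable_prob_cst].
have mE : \int[P]_w X w = m.
  pose f n w := n.+1%:R * sin ((X w - m) / n.+1%:R).
  have mf n : mfunT (f n).
    by apply: measurable_funM => //; apply: measurable_sin_comp; exact: measurable_funM.
  have cf w : f n w @[n --> \oo] --> X w - m by exact: sin_scaled_cvg.
  have bf n w : `|f n w| <= `|X w - m| by exact: sin_scaled_le.
  have c1 := Rintegral_dct mf cf bf (integrable_norm iXm).
  have z n : \int[P]_w (n.+1%:R * sin ((X w - m) / n.+1%:R)) = 0.
    rewrite RintegralZl//; last first.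
      apply: (integrable_le _ _ (integrable_prob_cst 1)); last by move=> w; exact: normr_sin_le1.
      by apply: measurable_sin_comp; exact: measurable_funM.
    transitivity (n.+1%:R * \int[P]_w sin (n.+1%:R^-1 * (X w - m))).
      by congr (_ * _); apply: eq_Rintegral => w _; rewrite mulrC.
    by rewrite (H _).2 mulr0.
  have c0 : \int[P]_w (n.+1%:R * sin ((X w - m) / n.+1%:R)) @[n --> \oo] --> (0 : R).
    by rewrite (funext z); exact: cvg_cst.
  have E0 : \int[P]_w (X w - m) = 0 by exact: (cvg_unique _ c1 c0).
  move: E0; rewrite (RintegralB measurableT gaussian_integrable (integrable_prob_cst m)).
  by rewrite Rintegral_prob_cst => E0; lra.
rewrite mE /=.
have iX2 : P.-intR (fun w => (X w - m) ^+ 2).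
  apply: (@integrable_le _ _ _ _ _ (fun w => 2 * (X w ^+ 2 + m ^+ 2))).
  - exact: measurable_funX.
  - by move=> w; rewrite ger0_norm ?sqr_ge0//; have := sqr_ge0 (X w + m); nra.
  - by apply: intgbZ; apply: integrable_add; [exact: gaussian_integrable_sqr|exact: integrable_prob_cst].
have vE : \int[P]_w (X w - m) ^+ 2 = v.
  pose f n w := (n.+1%:R * sin ((X w - m) / n.+1%:R)) ^+ 2.
  have mf n : mfunT (f n).
    by apply: measurable_funX; apply: measurable_funM => //; apply: measurable_sin_comp; exact: measurable_funM.
  have cf w : f n w @[n --> \oo] --> (X w - m) ^+ 2.
    by rewrite /f expr2; under eq_fun do rewrite expr2; apply: cvgM; exact: sin_scaled_cvg.
  have bf n w : `|f n w| <= (X w - m) ^+ 2.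
    rewrite /f normrX -[leRHS]real_normK ?num_real//; apply: lerXn2r; rewrite ?nnegrE//; exact: sin_scaled_le.
  have c1 := Rintegral_dct mf cf bf iX2.
  have fE n w : f n w = n.+1%:R ^+ 2 / 2 * (1 - cos (2 / n.+1%:R * (X w - m))).
    have -> : 2 / n.+1%:R * (X w - m) = ((X w - m) / n.+1%:R) *+ 2 by rewrite -mulr_natr; ring.
    by rewrite /f cosD -!expr2 cos2sin2; field.
  have z n : \int[P]_w f n w = n.+1%:R ^+ 2 * (1 - expR (- (2 * v / n.+1%:R ^+ 2))) / 2.
    transitivity (\int[P]_w (n.+1%:R ^+ 2 / 2 * (1 - cos (2 / n.+1%:R * (X w - m))))).
      by apply: eq_Rintegral => w _; exact: fE.
    have ic : P.-intR (fun w => cos (2 / n.+1%:R * (X w - m))).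
      apply: (integrable_le _ _ (integrable_prob_cst 1)); last by move=> w; exact: normr_cos_le1.
      by apply: measurable_cos_comp; exact: measurable_funM.
    have i1 := integrable_prob_cst 1.
    rewrite RintegralZl//; last exact: integrable_sub.
    rewrite (RintegralB measurableT i1 ic) Rintegral_prob_cst (H _).1.
    have n0 : n.+1%:R != 0 :> R by [].
    rewrite (_ : v * (2 / n.+1%:R) ^+ 2 / 2 = 2 * v / n.+1%:R ^+ 2); last by field.
    by rewrite mulrAC.
  have c0 : \int[P]_w f n w @[n --> \oo] --> v.
    rewrite (funext z) [X in _ --> X](_ : v = 2 * v / 2); last by rewrite mulrC mulKf.
    by apply: cvgM; [apply: expR_scaled_cvg; exact: mulr_ge0|exact: cvg_cst].
  exact: (cvg_unique _ c1 c0).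
have [c1 s1] := H 1; split.
- transitivity (\int[P]_w cos (1 * (X w - m))); first by apply: eq_Rintegral => w _; rewrite mul1r.
  by rewrite c1 expr1n mulr1 -vE.
- by rewrite -s1; apply: eq_Rintegral => w _; rewrite mul1r.
Qed.

End gaussian_moments.

Lemma Rintegral_scale {dT} {T : measurableType dT} {R : realType} (m : {measure set T -> \bar R}) (c : R)
    (f : T -> R) : m.-intR f -> \int[m]_x (c * f x) = c * \int[m]_x f x.
Proof. by move=> fi; exact: RintegralZl. Qed.

(** * Laws with a symmetric characteristic function *)

Section symmetric_laws.
Context {R : realType} {d : nat}.
Local Notation V := 'rV[R]_d.
Implicit Types (m : {sigma_finite_measure set V -> \bar R}) (kappa : V -> R).

(* The law of a random vector with symmetric characteristic function [expR (- kappa)]. *)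
Record symmetric_law m kappa (M : R) : Prop := SymmetricLaw {
  law_exp : m.-intR (fun w : V => expR (2 * l1 w)) ;
  law_exp_le : \int[m]_w expR (2 * l1 w) <= M ;
  law_ge0 : forall k, 0 <= kappa k ;
  law_cos : forall k, \int[m]_w cos (dotv k w) = expR (- kappa k) ;
  law_sin : forall k, \int[m]_w sin (dotv k w) = 0 }.

Lemma expR_l1_ge1 (w : V) : 1 <= expR (2 * l1 w).
Proof. by rewrite -[leLHS]expR0 ler_expR mulr_ge0 ?l1_ge0. Qed.

Lemma law_bounded m kappa M (f : V -> R) : symmetric_law m kappa M -> mfunT f ->
  (forall w, `|f w| <= 1) -> m.-intR f.
Proof.
move=> L mf f1; apply: (integrable_le mf _ (law_exp L)) => w.
exact: (le_trans (f1 w) (expR_l1_ge1 w)).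
Qed.

Lemma law_cos_shift m kappa M (c : R) (k : V) : symmetric_law m kappa M ->
  \int[m]_w cos (c + dotv k w) = cos c * expR (- kappa k).
Proof.
move=> L.
have ic := law_bounded L (measurable_cos_dotv k) (fun=> normr_cos_le1 _).
have is_ := law_bounded L (measurable_sin_dotv k) (fun=> normr_sin_le1 _).
transitivity (\int[m]_w (cos c * cos (dotv k w) - sin c * sin (dotv k w))).
  by apply: eq_Rintegral => w _; rewrite cosD.
rewrite (RintegralB measurableT (intgbZ _ ic) (intgbZ _ is_)).
by rewrite (Rintegral_scale (cos c) ic) (Rintegral_scale (sin c) is_) (law_cos L) (law_sin L) mulr0 subr0.
Qed.

Lemma law_sin_shift m kappa M (c : R) (k : V) : symmetric_law m kappa M ->
  \int[m]_w sin (c + dotv k w) = sin c * expR (- kappa k).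
Proof.
move=> L.
have ic := law_bounded L (measurable_cos_dotv k) (fun=> normr_cos_le1 _).
have is_ := law_bounded L (measurable_sin_dotv k) (fun=> normr_sin_le1 _).
transitivity (\int[m]_w (sin c * cos (dotv k w) + cos c * sin (dotv k w))).
  by apply: eq_Rintegral => w _; rewrite sinD.
rewrite (RintegralD measurableT (intgbZ _ ic) (intgbZ _ is_)).
by rewrite (Rintegral_scale (sin c) ic) (Rintegral_scale (cos c) is_) (law_cos L) (law_sin L) mulr0 addr0.
Qed.

Section mixing.
Variables (m1 m2 : {sigma_finite_measure set V -> \bar R}) (kappa1 kappa2 : V -> R) (M1 M2 : R).
Hypotheses (L1 : symmetric_law m1 kappa1 M1) (L2 : symmetric_law m2 kappa2 M2).
Variable t : R.
Hypotheses (t0 : 0 <= t) (t1 : t <= 1).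

Let a := Num.sqrt (1 - t).
Let b := Num.sqrt t.
Let f (p : V * V) : V := a *: p.1 + b *: p.2.

Let mf : mfunT f.
Proof.
by apply: measurable_rVD; apply: measurable_rVZ.
Qed.

Let law0 := pushm (prodm m1 m2) mf.

Let Emix (x y : V) : expR (2 * l1 (a *: x + b *: y)) <= expR (2 * l1 x) * expR (2 * l1 y).
Proof.
rewrite -expRD ler_expR -mulrDr ler_wpM2l//; apply: (le_trans (l1D _ _)); rewrite !l1Z.
have a0 : 0 <= a by exact: sqrtr_ge0.
have b0 : 0 <= b by exact: sqrtr_ge0.
have a1 : a <= 1 by rewrite -[leRHS]sqrtr1 ler_wsqrtr// gerBl.
have b1 : b <= 1 by rewrite -[leRHS]sqrtr1 ler_wsqrtr.
by rewrite !ger0_norm//; apply: lerD; rewrite ler_piMl ?l1_ge0.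
Qed.

Let Rintegral_law0 (h : V -> R) (C : R) : mfunT h ->
  (forall w, `|h w| <= C * expR (2 * l1 w)) ->
  law0.-intR h /\
  \int[law0]_w h w = \int[m1]_x \int[m2]_y h (a *: x + b *: y).
Proof.
move=> mh hC.
have C0 : 0 <= C.
  have := le_trans (normr_ge0 _) (hC 0); rewrite pmulr_lge0 ?expR_gt0//.
have mhf : mfunT (fun p => h (f p)) by exact: (mcomp mh mf).
have dom x y : `|h (f (x, y))| <= (C * expR (2 * l1 x)) * expR (2 * l1 y).
  by apply: (le_trans (hC _)); rewrite -mulrA; apply: ler_wpM2l => //; exact: Emix.
have fi := integrable_prod_dom mhf dom (intgbZ C (law_exp L1)) (law_exp L2).
split.
  apply/integrableP; split; first exact: measurable_EFin.
  rewrite ge0_integral_pushm; last 2 first.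
  - by apply: mcomp => //; exact: measurable_EFin.
  - by [].
  by case/integrableP: fi.
rewrite /Rintegral integral_pushm; last exact: measurable_EFin.
congr fine; rewrite -[LHS](integral12_prod_meas1 fi); apply: eq_integral => x _; rewrite /fubini_F/=.
rewrite -EFin_Rintegral//.
apply: (@integrable_le _ _ _ _ _ (fun y => (C * expR (2 * l1 x)) * expR (2 * l1 y))).
- exact: (mcomp mhf (measurable_pair1 x)).
- by move=> y; exact: dom.
- by apply: intgbZ; exact: (law_exp L2).
Qed.

(** Homogeneity of degree 2 makes the exponents of the two independent parts combine linearly in
    [t]. The weights are at most 1, so the exponential moments multiply, with a bound that does not
    depend on [t]. *)
Lemma symmetric_law_mix : (forall c k, kappa1 (c *: k) = c ^+ 2 * kappa1 k) ->
  (forall c k, kappa2 (c *: k) = c ^+ 2 * kappa2 k) ->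
  exists m, symmetric_law m (fun k => (1 - t) * kappa1 k + t * kappa2 k) (M1 * M2).
Proof.
move=> k1 k2.
have k1a k : kappa1 (a *: k) = (1 - t) * kappa1 k by rewrite k1 sqr_sqrtr// subr_ge0.
have k2b k : kappa2 (b *: k) = t * kappa2 k by rewrite k2 sqr_sqrtr.
have mE : mfunT (fun w : V => expR (2 * l1 w)).
  by apply: measurable_expR_comp; apply: measurable_funM => //; exact: measurable_l1.
have bE (w : V) : `|expR (2 * l1 w)| <= 1 * expR (2 * l1 w) by rewrite mul1r ger0_norm ?expR_ge0.
have [iE IE] := Rintegral_law0 mE bE.
have law_sf := integrable_gt0_sigma_finite (fun w => expR_gt0 _) iE.
have one (g : R -> R) : (forall x, `|g x| <= 1) -> forall (k w : V), `|g (dotv k w)| <= 1 * expR (2 * l1 w).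
  by move=> g1 k w; rewrite mul1r; exact: (le_trans (g1 _) (expR_l1_ge1 w)).
have u0 : 0 <= 1 - t by rewrite subr_ge0.
have iE1 := law_exp L1; have iE2 := law_exp L2.
exists (sfm_of law_sf); split.
- exact: iE.
- rewrite [leLHS]IE.
  have M20 : 0 <= M2.
    by apply: (le_trans _ (law_exp_le L2)); apply: Rintegral_ge0 => w _; exact: expR_ge0.
  have bd x : `|\int[m2]_y expR (2 * l1 (a *: x + b *: y))| <= M2 * expR (2 * l1 x).
    have h : \int[m2]_y (expR (2 * l1 x) * expR (2 * l1 y)) <= M2 * expR (2 * l1 x).
      by rewrite (Rintegral_scale _ iE2) mulrC; apply: ler_wpM2r; [exact: expR_ge0|exact: (law_exp_le L2)].
    have b2 y : `|expR (2 * l1 (a *: x + b *: y))| <= expR (2 * l1 x) * expR (2 * l1 y).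
      by rewrite ger0_norm ?expR_ge0//; exact: Emix.
    apply: (le_trans _ h); apply: normr_Rintegral_le => //; last exact: intgbZ.
    apply: (integrable_le _ b2 (intgbZ (expR (2 * l1 x)) iE2)).
    exact: (mcomp (mcomp mE mf) (measurable_pair1 x)).
  apply: (le_trans (ler_norm _)); apply: (@le_trans _ _ (\int[m1]_x (M2 * expR (2 * l1 x)))).
    apply: normr_Rintegral_le => //; last exact: intgbZ.
    apply: (integrable_le _ bd (intgbZ M2 iE1)).
    apply: (@measurable_Rintegral_param _ _ _ _ _ m2 (fun p : V * V => expR (2 * l1 (a *: p.1 + b *: p.2)))).
    exact: (mcomp mE mf).
  by rewrite (Rintegral_scale _ iE1) mulrC; apply: ler_wpM2r => //; exact: (law_exp_le L1).
- by move=> k; apply: addr_ge0; apply: mulr_ge0 => //; [exact: (law_ge0 L1)|exact: (law_ge0 L2)].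
- move=> k; have [_ ->] := Rintegral_law0 (measurable_cos_dotv k) (one _ (@normr_cos_le1 R) k).
  transitivity (\int[m1]_x (expR (- (t * kappa2 k)) * cos (dotv (a *: k) x))).
    apply: eq_Rintegral => x _; rewrite -k2b mulrC -(law_cos_shift _ _ L2).
    by apply: eq_Rintegral => y _; rewrite dotvDr !dotvZl !dotvZr.
  by rewrite (Rintegral_scale _ (law_bounded L1 (measurable_cos_dotv _) (fun=> normr_cos_le1 _))) (law_cos L1) k1a -expRD; congr expR; ring.
- move=> k; have [_ ->] := Rintegral_law0 (measurable_sin_dotv k) (one _ (@normr_sin_le1 R) k).
  transitivity (\int[m1]_x (expR (- (t * kappa2 k)) * sin (dotv (a *: k) x))).
    apply: eq_Rintegral => x _; rewrite -k2b mulrC -(law_sin_shift _ _ L2).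
    by apply: eq_Rintegral => y _; rewrite dotvDr !dotvZl !dotvZr.
  by rewrite (Rintegral_scale _ (law_bounded L1 (measurable_sin_dotv _) (fun=> normr_sin_le1 _))) (law_sin L1) mulr0.
Qed.

End mixing.

(** [gaussn s] is the cosine transform of [gaussn s^-1] up to the factor [gmass d s^-1]; averaging
    over the law multiplies the frequency side by the characteristic function. *)
Lemma law_gaussn m kappa M (s : R) (y : V) : 0 < s -> symmetric_law m kappa M ->
  (lebm d).-intR (fun k : V => cos (dotv y k) * expR (- kappa k) * gaussn s^-1 k) /\
  \int[lebm d]_k (cos (dotv y k) * expR (- kappa k) * gaussn s^-1 k) =
  gmass d s^-1 * \int[m]_w gaussn s (y + w).
Proof.
move=> s0 L; have s1 : 0 < s^-1 by rewrite invr_gt0.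
pose F (p : V * V) := cos (dotv (y + p.2) p.1) * gaussn s^-1 p.1.
have mF : mfunT F.
  apply: measurable_funM; last by apply: (mcomp (@measurable_gaussn R d _)); exact: measurable_fst.
  apply: measurable_cos_comp; apply: measurable_dotv; last exact: measurable_fst.
  by apply: measurable_rVD => //; exact: measurable_snd.
have FE k : \int[m]_w F (k, w) = cos (dotv y k) * expR (- kappa k) * gaussn s^-1 k.
  transitivity (\int[m]_w (gaussn s^-1 k * cos (dotv y k + dotv k w))).
    by apply: eq_Rintegral => w _; rewrite /F /= dotvDl [dotv w k]dotvC mulrC.
  rewrite Rintegral_scale; first by rewrite (law_cos_shift _ _ L) mulrC.
  apply: (law_bounded L); last by move=> w; exact: normr_cos_le1.
  by apply: measurable_cos_comp; apply: measurable_funD => //; exact: measurable_dotv.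
have dF k w : `|F (k, w)| <= gaussn s^-1 k * expR (2 * l1 w).
  rewrite /F/= normrM mulrC (ger0_norm (gaussn_ge0 _ _)) ler_wpM2l ?gaussn_ge0//.
  exact: (le_trans (normr_cos_le1 _) (expR_l1_ge1 w)).
have swap := Rintegral_swap mF dF (@integrable_gaussn R d _ s1) (law_exp L).
have mk : mfunT (fun k : V => cos (dotv y k) * expR (- kappa k) * gaussn s^-1 k).
  by rewrite -(funext FE); exact: (measurable_Rintegral_param m mF).
split.
  apply: (integrable_le mk _ (@integrable_gaussn R d _ s1)) => k.
  rewrite normrM (ger0_norm (gaussn_ge0 _ _)) ler_piMl ?gaussn_ge0// normrM.
  apply: mulr_ile1 => //; first exact: normr_cos_le1.
  by rewrite ger0_norm ?expR_ge0// expR_le1 oppr_le0 (law_ge0 L).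
rewrite -(funext FE) swap -Rintegral_scale; last first.
  apply: (law_bounded L); last by move=> w; rewrite ger0_norm ?gaussn_ge0// gaussn_le1// ltW.
  by apply: (mcomp (@measurable_gaussn R d s)); exact: measurable_rVD.
by apply: eq_Rintegral => w _; rewrite /F/= Rintegral_cos_gaussn// /gmass invrK.
Qed.

End symmetric_laws.

(** * Second differences of a Gaussian *)

Section second_difference.
Context {R : realType} {d : nat}.
Local Notation V := 'rV[R]_d.

Lemma expR_norm_sub_le (z : R) : `|expR z - expR (- z)| <= 2 * `|z| * expR `|z|.
Proof.
suff H (x : R) : 0 <= x -> `|expR x - expR (- x)| <= 2 * x * expR x.
  case: (leP 0 z) => [z0|/ltW z0]; first by rewrite (ger0_norm z0); exact: H.
  by rewrite (ler0_norm z0) distrC; have := H (- z); rewrite opprK oppr_ge0; apply.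
move=> x0; rewrite ger0_norm; last by rewrite subr_ge0 ler_expR; lra.
rewrite (_ : expR (- x) = expR (- (2 * x)) * expR x); last by rewrite -expRD; congr expR; ring.
have := expR_ge1Dx (- (2 * x)); have := expR_gt0 x => e0 e1.
rewrite -{1}[expR x]mul1r -mulrBl; apply: ler_wpM2r; first exact: ltW.
by lra.
Qed.

Lemma gaussn_add (s : R) (x b : V) : gaussn s (x + b) =
  gaussn s x * (expR (- (s * dotv b b / 2)) * expR (- (s * dotv x b))).
Proof.
rewrite /gaussn -!expRD; congr expR.
by rewrite dotvDl !dotvDr [dotv b x]dotvC; field.
Qed.

(** The terms linear in [z] cancel, because [exp z + exp (- z) - 2] is the square of
    [exp (z/2) - exp (- z/2)]; this leaves the order [s h^2]. Powers of [r = sqrt s * l1 x] are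
    absorbed by part of the Gaussian decay. *)
Lemma gaussn_second_difference (s h : R) (x b : V) : 0 < s -> s <= 1 -> 0 <= h -> h <= 1 ->
  l1 b <= 2 * h ->
  `|gaussn s (x + b) + gaussn s (x - b) - 2 * gaussn s x| <=
  24 * expR (d%:R * 18) * s * h ^+ 2 * rho (2 * Num.sqrt s) x.
Proof.
move=> s0 s1 h0 h1 bh.
set q := s * dotv b b / 2; set z := s * dotv x b; set r := Num.sqrt s * l1 x.
have ss : Num.sqrt s ^+ 2 = s by rewrite sqr_sqrtr ?ltW.
have sq0 : 0 <= Num.sqrt s by exact: sqrtr_ge0.
have sq1 : Num.sqrt s <= 1 by rewrite -[leRHS]sqrtr1 ler_wsqrtr.
have r0 : 0 <= r by rewrite mulr_ge0 ?l1_ge0.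
have q0 : 0 <= q by rewrite divr_ge0// mulr_ge0 ?dotv_ge0 ?ltW.
have bb : dotv b b <= 4 * h ^+ 2.
  apply: (le_trans (ler_norm _)); apply: (le_trans (normr_dotv_l1 _ _)).
  rewrite (_ : 4 * h ^+ 2 = (2 * h) * (2 * h)); last by ring.
  by apply: ler_pM; rewrite ?l1_ge0.
have q1 : q <= 2 * s * h ^+ 2 by rewrite /q; nra.
have z1 : `|z| <= 2 * h * Num.sqrt s * r.
  rewrite /z normrM (gtr0_norm s0) /r.
  apply: (@le_trans _ _ (s * (l1 x * (2 * h)))).
    apply: ler_wpM2l; first exact: ltW.
    by apply: (le_trans (normr_dotv_l1 _ _)); apply: ler_wpM2l; rewrite ?l1_ge0.
  rewrite -{1}ss expr2; apply: le_of_eq; ring.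
have z2 : `|z| <= 2 * r.
  apply: (le_trans z1); apply: ler_wpM2r => //.
  have := mulr_ge0 h0 sq0; nra.
rewrite !gaussn_add dotvNl dotvNr opprK dotvNr mulrN opprK -/q -/z.
set G := gaussn s x; have G0 : 0 <= G by exact: gaussn_ge0.
have -> : G * (expR (- q) * expR (- z)) + G * (expR (- q) * expR z) - 2 * G =
   G * (expR (- q) * (expR z + expR (- z) - 2) - 2 * (1 - expR (- q))) by ring.
rewrite normrM (ger0_norm G0).
have e2 : expR z + expR (- z) - 2 = (expR (z / 2) - expR (- (z / 2))) ^+ 2.
  have ea : expR z = expR (z / 2) ^+ 2 by rewrite -expRM_natl; congr expR; field.
  have eb : expR (- z) = expR (- (z / 2)) ^+ 2 by rewrite -expRM_natl; congr expR; field.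
  have ec : expR (z / 2) * expR (- (z / 2)) = 1 by rewrite -expRD subrr expR0.
  by rewrite ea eb sqrrB ec; ring.
have e3 : `|expR z + expR (- z) - 2| <= 4 * s * h ^+ 2 * r ^+ 2 * expR (2 * r).
  rewrite e2 normrX.
  have n2 : `|z / 2| = `|z| / 2 by rewrite normrM (ger0_norm (_ : 0 <= 2^-1)) ?invr_ge0.
  have := expR_norm_sub_le (z / 2); rewrite n2 => e4.
  have e5 : expR (`|z| / 2) <= expR r by rewrite ler_expR; lra.
  have e6 : `|expR (z / 2) - expR (- (z / 2))| <= (2 * h * Num.sqrt s * r) * expR r.
    apply: (le_trans e4); rewrite (_ : 2 * (`|z| / 2) = `|z|); last by field.
    by apply: ler_pM; rewrite ?expR_ge0.
  have e7 := lerXn2r 2 (normr_ge0 _ : _ \is Num.nneg) (le_trans (normr_ge0 _) e6 : _ \is Num.nneg) e6.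
  apply: (le_trans e7); apply: le_of_eq.
  rewrite (_ : expR (2 * r) = expR r ^+ 2); last by rewrite -expRM_natl.
  by rewrite -[in RHS]ss; ring.
have e8 : r ^+ 2 <= 4 * expR r.
  have := sqr_le_expR r; have : expR (- r) <= expR r by rewrite ler_expR; lra.
  by lra.
have e9 : 1 <= expR (3 * r) by rewrite -[leLHS]expR0 ler_expR; lra.
have e10 : r ^+ 2 * expR (2 * r) <= 4 * expR (3 * r).
  rewrite (_ : 3 * r = r + 2 * r); last by ring.
  by rewrite expRD mulrA; apply: ler_wpM2r; rewrite ?expR_ge0.
have sh : 0 <= s * h ^+ 2 by rewrite mulr_ge0 ?sqr_ge0 ?ltW.
(* The term in [z] contributes 16 and the term in [q] at most 4. *)
have e11 : `|expR (- q) * (expR z + expR (- z) - 2) - 2 * (1 - expR (- q))| <= 24 * (s * h ^+ 2) * expR (3 * r).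
  have qq : expR (- q) <= 1 by rewrite expR_le1 oppr_le0.
  have qq2 := expR_ge1Dx (- q); have qq0 := expR_ge0 (- q).
  apply: (le_trans (ler_normB _ _)); rewrite !normrM (ger0_norm qq0) (ger0_norm (_ : 0 <= 2 :> R))//.
  rewrite (ger0_norm (_ : 0 <= 1 - expR (- q))); last by lra.
  have e12 : expR (- q) * `|expR z + expR (- z) - 2| <= 16 * (s * h ^+ 2) * expR (3 * r).
    apply: (@le_trans _ _ (1 * `|expR z + expR (- z) - 2|)); first exact: ler_wpM2r.
    rewrite mul1r; apply: (le_trans e3).
    rewrite (_ : _ * expR (2 * r) = 4 * (s * h ^+ 2) * (r ^+ 2 * expR (2 * r))); last by ring.
    rewrite (_ : 16 * _ * _ = 4 * (s * h ^+ 2) * (4 * expR (3 * r))); last by ring.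
    by apply: ler_wpM2l => //; rewrite mulr_ge0.
  have := ler_wpM2l sh e9; lra.
(* The second difference grows like [exp (3 r)] and [exp (- 2 r)] must remain, hence the rate 5. Its
   cost is [exp (25 d / 2)], and [25 / 2 <= 18]. *)
have e13 : G <= expR (d%:R * 18) * expR (- (5 * r)).
  have s5 : Num.sqrt s != 0 by rewrite gt_eqF// sqrtr_gt0.
  apply: (le_trans (gaussn_le_rhoc (5 * Num.sqrt s) x s0)); apply: ler_pM; rewrite ?expR_ge0 ?rho_ge0//.
    rewrite ler_expR; apply: ler_wpM2l => //.
    rewrite (_ : (5 * Num.sqrt s) ^+ 2 / (2 * s) = 25 / 2); first by lra.
    by rewrite exprMn ss; field; rewrite gt_eqF.
  by rewrite /rho /r mulrA.
apply: (le_trans (ler_pM G0 (normr_ge0 _) e13 e11)).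
rewrite (_ : rho (2 * Num.sqrt s) x = expR (- (5 * r)) * expR (3 * r)); last first.
  by rewrite /rho -expRD; congr expR; rewrite /r; ring.
by apply: le_of_eq; ring.
Qed.

End second_difference.

(* The path from one law to the other mixes them with weights [sqrt t] and [sqrt (1 - t)];
   its derivative in the Fourier variable [k] is [exp (- kappa_t k)] times the quadratic
   form [C], and writing [k_i k_j] as a limit of [N^2 sin (k_i / N) sin (k_j / N)] turns
   that into second differences of Gaussian averages. *)

Section interpolation.
Context {R : realType} {d : nat}.
Local Notation V := 'rV[R]_d.

Lemma rho_shift_law (s : R) (y w : V) : 0 < s -> s <= 1 ->
  rho (2 * Num.sqrt s) (y + w) <= rho (2 * Num.sqrt s) y * expR (2 * l1 w).
Proof.
move=> s0 s1; have sq0 : 0 <= Num.sqrt s by exact: sqrtr_ge0.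
have sq1 : Num.sqrt s <= 1 by rewrite -[leRHS]sqrtr1 ler_wsqrtr.
have := rho_shift_le (c := 2 * Num.sqrt s) y (- w) (mulr_ge0 (ler0n _ 2) sq0).
rewrite opprK l1N => h; apply: (le_trans h); rewrite mulrC; apply: ler_wpM2l; first exact: rho_ge0.
by rewrite ler_expR; apply: ler_wpM2r; [exact: l1_ge0|lra].
Qed.

Lemma cos_sin_sin (A x y : R) : 4 * (cos A * (sin x * sin y)) =
  cos (A + (x - y)) + cos (A - (x - y)) - (cos (A + (x + y)) + cos (A - (x + y))).
Proof. by rewrite !cosD !cosN !sinN !cosB !cosD; ring. Qed.

Section one_law.
Variables (m : {sigma_finite_measure set V -> \bar R}) (kappa : V -> R) (M : R).
Hypothesis L : symmetric_law m kappa M.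
Variable s : R.
Hypotheses (s0 : 0 < s) (s1 : s <= 1).
Let K := 24 * expR (d%:R * 18) * s.
Let J (y : V) := \int[m]_w gaussn s (y + w).

Let integrable_G (y : V) : m.-intR (fun w => gaussn s (y + w)).
Proof.
apply: (law_bounded L); last by move=> w; rewrite ger0_norm ?gaussn_ge0// gaussn_le1// ltW.
by apply: (mcomp (@measurable_gaussn R d s)); exact: measurable_rVD.
Qed.

Let law_second_difference (h : R) (y b : V) : 0 <= h -> h <= 1 -> l1 b <= 2 * h ->
  `|J (y + b) + J (y - b) - 2 * J y| <=
  K * h ^+ 2 * rho (2 * Num.sqrt s) y * M.
Proof.
move=> h0 h1 bh.
have i1 := integrable_G (y + b); have i2 := integrable_G (y - b).
have i3 := intgbZ 2 (integrable_G y).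
rewrite /J -(Rintegral_scale 2 (integrable_G y)) -(RintegralD measurableT i1 i2).
rewrite -(RintegralB measurableT (integrable_add i1 i2) i3).
have K0 : 0 <= K * h ^+ 2 * rho (2 * Num.sqrt s) y.
  by rewrite !mulr_ge0 ?expR_ge0 ?sqr_ge0 ?rho_ge0// ltW.
apply: (@le_trans _ _ (\int[m]_w (K * h ^+ 2 * rho (2 * Num.sqrt s) y * expR (2 * l1 w)))).
  apply: normr_Rintegral_le.
  - exact: integrable_sub (integrable_add i1 i2) i3.
  - exact: intgbZ (law_exp L).
  move=> w; have := gaussn_second_difference (y + w) s0 s1 h0 h1 bh.
  rewrite (_ : y + w + b = y + b + w); last by rewrite addrAC.
  rewrite (_ : y + w - b = y - b + w); last by rewrite addrAC.
  move=> H; apply: (le_trans H); rewrite -/K -[leRHS]mulrA; apply: ler_wpM2l; last exact: rho_shift_law.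
  by rewrite !mulr_ge0 ?expR_ge0 ?sqr_ge0// ltW.
by rewrite (Rintegral_scale _ (law_exp L)); apply: ler_wpM2l => //; exact: (law_exp_le L).
Qed.

(** By [cos_sin_sin] the two sines turn the Fourier integral into one quarter of the difference of
    two second differences, in the directions [e_i - e_j] and [e_i + e_j], of l1 length at most 2.
    The constant 12 is [2 * 24 / 4]. *)
Lemma law_sin_sin (h : R) (y : V) (i j : 'I_d) : 0 <= h -> h <= 1 ->
  let f (k : V) := cos (dotv y k) * expR (- kappa k) * gaussn s^-1 k * (sin (k 0 i * h) * sin (k 0 j * h)) in
  (lebm d).-intR f /\
  `|\int[lebm d]_k f k| <= gmass d s^-1 * (12 * expR (d%:R * 18) * s * h ^+ 2 * rho (2 * Num.sqrt s) y * M).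
Proof.
move=> h0 h1 f.
pose e (i : 'I_d) : V := delta_mx 0 i.
have de (i' : 'I_d) (k : V) : dotv (e i') k = k 0 i'.
  rewrite /dotv (bigD1 i')//= big1 ?addr0; last by move=> l li; rewrite mxE (negbTE li) andbF mul0r.
  by rewrite mxE !eqxx mul1r.
have le1 (i' : 'I_d) : l1 (e i') = 1.
  rewrite /l1 (bigD1 i')//= big1 ?addr0; last by move=> l li; rewrite mxE (negbTE li) andbF normr0.
  by rewrite mxE !eqxx normr1.
pose bm := h *: (e i - e j); pose bp := h *: (e i + e j).
have lm : l1 bm <= 2 * h.
  rewrite /bm l1Z (ger0_norm h0) mulrC; apply: ler_wpM2r => //.
  by apply: (le_trans (l1D _ _)); rewrite l1N !le1.
have lp : l1 bp <= 2 * h.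
  rewrite /bp l1Z (ger0_norm h0) mulrC; apply: ler_wpM2r => //.
  by apply: (le_trans (l1D _ _)); rewrite !le1.
pose g (y' k : V) := cos (dotv y' k) * expR (- kappa k) * gaussn s^-1 k.
have gi y' : (lebm d).-intR (g y') by exact: (law_gaussn y' s0 L).1.
have gE y' : \int[lebm d]_k g y' k = gmass d s^-1 * J y'.
  exact: (law_gaussn y' s0 L).2.
have fE : f = fun k => 4^-1 * ((g (y + bm) k + g (y - bm) k) - (g (y + bp) k + g (y - bp) k)).
  apply/funext => k; rewrite /f /g !dotvDl !dotvNl /bm /bp !dotvZl dotvDl dotvDl dotvNl !de.
  have := cos_sin_sin (dotv y k) (k 0 i * h) (k 0 j * h).
  rewrite (_ : k 0 i * h - k 0 j * h = h * (k 0 i - k 0 j)); last by ring.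
  rewrite (_ : k 0 i * h + k 0 j * h = h * (k 0 i + k 0 j)); last by ring.
  set c0 := cos (dotv y k); set ss := sin _ * sin _ => E.
  rewrite (_ : c0 * _ * _ * ss = 4^-1 * (4 * (c0 * ss)) * (expR (- kappa k) * gaussn s^-1 k)); last by field.
  by rewrite E; ring.
have i1 := integrable_add (gi (y + bm)) (gi (y - bm)).
have i2 := integrable_add (gi (y + bp)) (gi (y - bp)).
split; first by rewrite fE; exact: intgbZ (integrable_sub i1 i2).
rewrite fE (Rintegral_scale _ (integrable_sub i1 i2)) (RintegralB measurableT i1 i2).
rewrite (RintegralD measurableT (gi _) (gi _)) (RintegralD measurableT (gi _) (gi _)) !gE.
have := law_second_difference y h0 h1 lm; have := law_second_difference y h0 h1 lp.
move: (J (y + bm)) (J (y - bm)) (J (y + bp)) (J (y - bp)) (J y) => a3 a4 a1 a2 a0 H1 H2.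
rewrite (_ : 4^-1 * _ = gmass d s^-1 * (4^-1 * ((a3 + a4 - 2 * a0) - (a1 + a2 - 2 * a0)))); last by ring.
rewrite normrM (ger0_norm (gmass_ge0 _ _)); apply: ler_wpM2l; first exact: gmass_ge0.
rewrite normrM (ger0_norm (_ : 0 <= 4^-1)) ?invr_ge0//.
have := ler_normB (a3 + a4 - 2 * a0) (a1 + a2 - 2 * a0).
have -> : 12 * expR (d%:R * 18) * s * h ^+ 2 * rho (2 * Num.sqrt s) y * M =
  2^-1 * (K * h ^+ 2 * rho (2 * Num.sqrt s) y * M) by rewrite /K; field.
move: H1 H2; move: (K * _ * _ * M) => B; lra.
Qed.

End one_law.

(** Exponentials of nonpositive numbers are at most 1, so the tangent at [A] has an error that is
    uniform in [A]. Over [N] steps of size [1 / N] these squares add up to order [1 / N]. *)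
Lemma expRN_step (A B : R) : 0 <= A -> 0 <= B ->
  `|expR (- B) - expR (- A) - expR (- A) * (A - B)| <= (A - B) ^+ 2.
Proof.
move=> A0 B0.
have le1 (x : R) : 0 <= x -> expR (- x) <= 1 by move=> x0; rewrite expR_le1 oppr_le0.
case: (leP A B) => [AB|/ltW AB].
  have x0 : 0 <= B - A by rewrite subr_ge0.
  have -> : expR (- B) = expR (- A) * expR (- (B - A)) by rewrite -expRD; congr expR; ring.
  rewrite (_ : _ - _ - _ = - (expR (- A) * (1 - expR (- (B - A)) - (B - A)))); last by ring.
  rewrite normrN normrM (ger0_norm (expR_ge0 _)) -[leRHS]mul1r; apply: ler_pM => //.
  - exact: le1.
  - by have := expR_sub_le x0; rewrite (_ : (B - A) ^+ 2 = (A - B) ^+ 2)//; ring.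
have x0 : 0 <= A - B by rewrite subr_ge0.
have -> : expR (- A) = expR (- B) * expR (- (A - B)) by rewrite -expRD; congr expR; ring.
set x := A - B in x0 *.
rewrite (_ : _ - _ - _ = expR (- B) * (1 - expR (- x) - expR (- x) * x)); last by ring.
rewrite normrM (ger0_norm (expR_ge0 _)) -[leRHS]mul1r; apply: ler_pM => //.
- exact: le1.
have h1 := expR_ge1Dx (- x); have h2 := expR_gt0 (- x).
have h3 : expR (- x) * (1 + x) <= 1.
  rewrite -[leRHS](_ : expR (- x) * expR x = 1); last by rewrite -expRD addNr expR0.
  by apply: ler_wpM2l; [exact: ltW|exact: expR_ge1Dx].
rewrite ger0_norm; last by lra.
nra.
Qed.

Section comparison.
Variables (m1 m2 : {sigma_finite_measure set V -> \bar R}) (sigma tau : V -> R) (M : R).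
Hypotheses (L1 : symmetric_law m1 sigma M) (L2 : symmetric_law m2 tau M).
Hypotheses (sigmaZ : forall c k, sigma (c *: k) = c ^+ 2 * sigma k)
  (tauZ : forall c k, tau (c *: k) = c ^+ 2 * tau k).
Variable C : 'I_d -> 'I_d -> R.
Hypothesis CE : forall k, sigma k - tau k = \sum_i \sum_j C i j * (k 0 i * k 0 j).
Variable s : R.
Hypotheses (s0 : 0 < s) (s1 : s <= 1).
Variable u : V.

Let S := \sum_i \sum_j `|C i j|.
Let N (n : nat) : R := n.+1%:R.
Let N0 n : 0 < N n. Proof. by rewrite ltr0n. Qed.
Let kap n (j : 'I_n.+1) (k : V) := (1 - j%:R / N n) * sigma k + j%:R / N n * tau k.
Let term n (j : 'I_n.+1) (a b : 'I_d) (k : V) :=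
  cos (dotv u k) * expR (- kap j k) * gaussn s^-1 k * (sin (k 0 a * (N n)^-1) * sin (k 0 b * (N n)^-1)).
(** A Riemann sum for the derivative along the path: the prefactor [N n] is the [N^2] that belongs
    to the two sines, divided by the number [N n] of steps. *)
Let f n (k : V) := \sum_j \sum_a \sum_b (N n * C a b) * term (n := n) j a b k.
Let B := gmass d s^-1 * (12 * expR (d%:R * 18) * s * rho (2 * Num.sqrt s) u * (M * M)).

Let ratio n (j : nat) : (j <= n.+1)%N -> 0 <= j%:R / N n /\ j%:R / N n <= 1.
Proof.
move=> jn; split; first by apply: divr_ge0; [exact: ler0n|exact: ltW].
by rewrite ler_pdivrMr// mul1r ler_nat.
Qed.

Let mix_ge0 n (j : nat) k : (j <= n.+1)%N -> 0 <= (1 - j%:R / N n) * sigma k + j%:R / N n * tau k.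
Proof.
move=> /ratio[t0 t1]; apply: addr_ge0; apply: mulr_ge0 => //.
- by rewrite subr_ge0.
- exact: (law_ge0 L1).
- exact: (law_ge0 L2).
Qed.

Let term_bound n (j : 'I_n.+1) a b : (lebm d).-intR (term j a b) /\
  `|\int[lebm d]_k term j a b k| <= (N n)^-1 ^+ 2 * B.
Proof.
have [t0 t1] := ratio (ltnW (ltn_ord j)).
have [m Lm] := symmetric_law_mix L1 L2 t0 t1 sigmaZ tauZ.
have h0 : 0 <= (N n)^-1 by rewrite invr_ge0 ltW.
have h1 : (N n)^-1 <= 1 by rewrite invf_le1// ler1n.
have [ti tb] := law_sin_sin Lm s0 s1 u a b h0 h1; split; first exact: ti.
apply: (le_trans tb); apply: le_of_eq; rewrite /B; ring.
Qed.

Let f_integrable n : (lebm d).-intR (f n).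
Proof.
apply: integrable_sum_seq => j; apply: integrable_sum_seq => a; apply: integrable_sum_seq => b.
apply: intgbZ; exact: (term_bound j a b).1.
Qed.

(** The second difference bound with step [1 / N] makes each term of order [1 / N^2], which
    compensates the prefactor [N] and the [N] values of [j]. *)
Let f_bound n : `|\int[lebm d]_k f n k| <= S * B.
Proof.
have i1 j a b := intgbZ (N n * C a b) (term_bound (n := n) j a b).1.
have i2 j a := integrable_sum_seq (index_enum _) (i1 j a).
have i3 j := integrable_sum_seq (index_enum _) (i2 j).
rewrite (Rintegral_sum_seq (index_enum _) i3); apply: (le_trans (ler_norm_sum _ _ _)).
rewrite (_ : S * B = \sum_(j < n.+1) (N n)^-1 * (S * B)); last first.
  by rewrite sumr_const card_ord -mulr_natl mulrA divff ?mul1r// gt_eqF.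
apply: ler_sum => j _; rewrite (Rintegral_sum_seq (index_enum _) (i2 j)).
apply: (le_trans (ler_norm_sum _ _ _)); rewrite /S mulr_suml mulr_sumr; apply: ler_sum => a _.
rewrite (Rintegral_sum_seq (index_enum _) (i1 j a)).
apply: (le_trans (ler_norm_sum _ _ _)); rewrite mulr_suml mulr_sumr; apply: ler_sum => b _.
rewrite (Rintegral_scale _ (term_bound j a b).1) !normrM (gtr0_norm (N0 n)).
apply: (le_trans (ler_wpM2l _ (term_bound j a b).2)); first by rewrite mulr_ge0// ltW.
apply: le_of_eq; field.
by rewrite gt_eqF.
Qed.

Let Q n (k : V) := \sum_a \sum_b C a b * (N n * sin (k 0 a / N n) * (N n * sin (k 0 b / N n))).
Let T n (k : V) := (N n)^-1 * \sum_(j < n.+1) expR (- kap j k).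

Let fE n k : f n k = cos (dotv u k) * gaussn s^-1 k * (T n k * Q n k).
Proof.
rewrite [RHS](_ : _ = \sum_(j < n.+1)
    cos (dotv u k) * gaussn s^-1 k * ((N n)^-1 * expR (- kap j k) * Q n k)); last first.
  by rewrite -mulr_sumr -mulr_suml -mulr_sumr.
apply: eq_bigr => j _; rewrite /Q !mulr_sumr; apply: eq_bigr => a _.
rewrite !mulr_sumr; apply: eq_bigr => b _.
rewrite /term; field; by rewrite gt_eqF.
Qed.

Let T01 n k : 0 <= T n k <= 1.
Proof.
apply/andP; split.
  apply: mulr_ge0; first by rewrite invr_ge0 ltW.
  by apply: sumr_ge0 => j _; exact: expR_ge0.
rewrite /T mulrC ler_pdivrMr// mul1r (_ : N n = \sum_(j < n.+1) 1); last by rewrite sumr_const card_ord.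
by apply: ler_sum => j _; rewrite expR_le1 oppr_le0 mix_ge0// ltnW.
Qed.

Let Q_le n k : `|Q n k| <= S * l1 k ^+ 2.
Proof.
apply: (le_trans (ler_norm_sum _ _ _)); rewrite /S mulr_suml; apply: ler_sum => a _.
apply: (le_trans (ler_norm_sum _ _ _)); rewrite mulr_suml; apply: ler_sum => b _.
rewrite normrM; apply: ler_wpM2l => //; rewrite normrM expr2; apply: ler_pM => //.
- exact: (le_trans (sin_scaled_le _ _) (normr_coord_le _ _)).
- exact: (le_trans (sin_scaled_le _ _) (normr_coord_le _ _)).
Qed.

Let q (k : V) := sigma k - tau k.

(** The difference of the exponentials telescopes along the path, and each step is compared with its
    tangent by [expRN_step]. *)
Let T_rate n k : `|expR (- tau k) - expR (- sigma k) - T n k * q k| <= q k ^+ 2 / N n.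
Proof.
pose a j := (1 - j%:R / N n) * sigma k + j%:R / N n * tau k.
have Nn0 : N n != 0 by rewrite gt_eqF.
have -> : expR (- tau k) - expR (- sigma k) = \sum_(j < n.+1) (expR (- a j.+1) - expR (- a j)).
  rewrite -(big_mkord xpredT (fun j => expR (- a j.+1) - expR (- a j))) telescope_sumr// /a.
  rewrite -/(N n) divff// mul0r; congr (expR (- _) - expR (- _)); ring.
rewrite /T mulrC mulrA mulr_sumr -sumrB; apply: (le_trans (ler_norm_sum _ _ _)).
rewrite (_ : q k ^+ 2 / N n = \sum_(j < n.+1) (q k / N n) ^+ 2); last first.
  by rewrite sumr_const card_ord -mulr_natl -/(N n); field.
apply: ler_sum => j _.
have aE : a j - a j.+1 = q k / N n by rewrite /a /q -(natr1 j); field.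
have a0 : 0 <= a j by apply: mix_ge0; exact: ltnW.
have a1 : 0 <= a j.+1 by apply: mix_ge0; exact: ltn_ord.
have := expRN_step a0 a1; rewrite aE; apply: le_trans.
by apply: le_of_eq; congr (`| _ - _ |); rewrite -/(a j); ring.
Qed.

Let Q_rate n k : `|Q n k - q k| <=
  (\sum_a \sum_b `|C a b| * (`|k 0 a| * k 0 b ^+ 2 + k 0 a ^+ 2 * `|k 0 b|)) / N n.
Proof.
rewrite /Q /q CE -sumrB mulr_suml; apply: (le_trans (ler_norm_sum _ _ _)); apply: ler_sum => a _.
rewrite -sumrB mulr_suml; apply: (le_trans (ler_norm_sum _ _ _)); apply: ler_sum => b _.
rewrite -mulrBr normrM -[leRHS]mulrA; apply: ler_wpM2l => //.
have rate (y : R) : `|N n * sin (y / N n) - y| <= y ^+ 2 / N n.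
  have -> : N n * sin (y / N n) - y = N n * (sin (y / N n) - y / N n) by field; rewrite gt_eqF.
  rewrite normrM gtr0_norm//; apply: (le_trans (ler_wpM2l (ltW (N0 n)) (sin_sub_le _))).
  by apply: le_of_eq; field; rewrite gt_eqF.
set x := k 0 a; set y := k 0 b; set x' := N n * sin (x / N n); set y' := N n * sin (y / N n).
rewrite (_ : x' * y' - x * y = x' * (y' - y) + (x' - x) * y); last by ring.
apply: (le_trans (ler_normD _ _)); rewrite (normrM x') (normrM (x' - x)) mulrDl; apply: lerD.
  by rewrite -[leRHS]mulrA; apply: ler_pM => //; [exact: sin_scaled_le|exact: rate].
by rewrite [leRHS]mulrAC; apply: ler_wpM2r => //; exact: rate.
Qed.

Let f_cvg k : f n k @[n --> \oo] -->
  cos (dotv u k) * gaussn s^-1 k * (expR (- tau k) - expR (- sigma k)).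
Proof.
under eq_fun do rewrite fE; apply: cvgM; first exact: cvg_cst.
pose D := \sum_a \sum_b `|C a b| * (`|k 0 a| * k 0 b ^+ 2 + k 0 a ^+ 2 * `|k 0 b|).
apply: (@cvg_rate _ _ _ (D + q k ^+ 2)) => n; rewrite mulrDl.
rewrite (_ : T n k * Q n k - _ = T n k * (Q n k - q k) - (expR (- tau k) - expR (- sigma k) - T n k * q k)); last by ring.
apply: (le_trans (ler_normB _ _)); apply: lerD; last exact: T_rate.
apply: (le_trans _ (Q_rate n k)); rewrite normrM; have /andP[T0 T1] := T01 n k.
by rewrite (ger0_norm T0); apply: ler_piMl.
Qed.

(** Dominated convergence identifies the limit of the integrals of [f n] as [gmass d s^-1] times the
    difference of the averages, and the uniform [f_bound] survives. The dominating constant [A]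
    depends badly on [s], but only the existence of the limit relies on it. *)
Lemma gaussian_compare : `|\int[m2]_w gaussn s (u + w) - \int[m1]_w gaussn s (u + w)| <=
  12 * expR (d%:R * 18) * s * rho (2 * Num.sqrt s) u * (M * M) * S.
Proof.
have si0 : 0 < s^-1 by rewrite invr_gt0.
pose A := S * (4 * expR (d%:R * (2 ^+ 2 / (2 * s^-1)))).
have S0 : 0 <= S by apply: sumr_ge0 => a _; apply: sumr_ge0.
have dom n k : `|f n k| <= A * rho 1 k.
  rewrite fE normrM (normrM (T n k)) (normrM (cos _)) (ger0_norm (gaussn_ge0 _ _)); have /andP[T0 T1] := T01 n k; rewrite (ger0_norm T0).
  have h1 : gaussn s^-1 k <= expR (d%:R * (2 ^+ 2 / (2 * s^-1))) * rho 2 k by exact: gaussn_le_rhoc.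
  have h2 : l1 k ^+ 2 <= 4 * expR (l1 k).
    have := sqr_le_expR (l1 k); have : expR (- l1 k) <= expR (l1 k) by rewrite ler_expR; have := l1_ge0 k; lra.
    by lra.
  have h3 : T n k * `|Q n k| <= S * (4 * expR (l1 k)).
    apply: (@le_trans _ _ (1 * (S * l1 k ^+ 2))); first by apply: ler_pM.
    by rewrite mul1r; apply: ler_wpM2l.
  have h4 : `|cos (dotv u k)| * gaussn s^-1 k <= 1 * (expR (d%:R * (2 ^+ 2 / (2 * s^-1))) * rho 2 k).
    by apply: ler_pM => //; [exact: gaussn_ge0|exact: normr_cos_le1].
  have p1 : 0 <= `|cos (dotv u k)| * gaussn s^-1 k by apply: mulr_ge0 => //; exact: gaussn_ge0.
  have p2 : 0 <= T n k * `|Q n k| by exact: mulr_ge0.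
  apply: (le_trans (ler_pM p1 p2 h4 h3)); apply: le_of_eq.
  have -> : rho 1 k = rho 2 k * expR (l1 k) by rewrite /rho -expRD; congr expR; ring.
  by rewrite /A; ring.
have iA := intgbZ A (@integrable_rho R d 1 ltr01).
have mf n : mfunT (f n) by apply/measurable_EFinP; case/integrableP: (f_integrable n).
have lim := Rintegral_dct mf f_cvg dom iA.
have limE : \int[lebm d]_k (cos (dotv u k) * gaussn s^-1 k * (expR (- tau k) - expR (- sigma k))) =
    gmass d s^-1 * (\int[m2]_w gaussn s (u + w) - \int[m1]_w gaussn s (u + w)).
  have [i2 E2] := law_gaussn u s0 L2; have [i1 E1] := law_gaussn u s0 L1.
  rewrite mulrBr -E1 -E2 -(RintegralB measurableT i2 i1).
  by apply: eq_Rintegral => k _; ring.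
rewrite limE in lim.
have gm0 : 0 < gmass d s^-1 by exact: gmass_gt0.
rewrite -(ler_pM2l gm0) -{1}[gmass d s^-1](gtr0_norm gm0) -normrM.
have lim2 : `|\int[lebm d]_k f n k| @[n --> \oo] --> `|gmass d s^-1 *
  (\int[m2]_w gaussn s (u + w) - \int[m1]_w gaussn s (u + w))| by apply: cvg_norm; exact: lim.
rewrite -(cvg_lim _ lim2)//.
apply: limr_le; first exact: (cvgP _ lim2).
apply: nearW => n; apply: (le_trans (f_bound n)); apply: le_of_eq.
by rewrite /B; ring.
Qed.

End comparison.

End interpolation.

Lemma Rintegral_pushm {d1 d2} {T : measurableType d1} {U : measurableType d2} {R : realType}
    (m : {measure set T -> \bar R}) (f : T -> U) (mf : mfunT f) (h : U -> R) :
  mfunT h -> \int[pushm m mf]_y h y = \int[m]_x h (f x).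
Proof. by move=> mh; rewrite /Rintegral integral_pushm//; exact: measurable_EFin. Qed.

Lemma integrable_pushm {d1 d2} {T : measurableType d1} {U : measurableType d2} {R : realType}
    (m : {measure set T -> \bar R}) (f : T -> U) (mf : mfunT f) (h : U -> R) :
  mfunT h -> m.-intR (h \o f) ->
  (pushm m mf).-intR h.
Proof.
move=> mh /integrableP[_ fi]; apply/integrableP; split; first exact: measurable_EFin.
rewrite ge0_integral_pushm//; last by apply: mcomp => //; exact: measurable_EFin.
Qed.

Lemma Rintegral_prodm {d1 d2} {T1 : measurableType d1} {T2 : measurableType d2} {R : realType}
    (m1 : {sigma_finite_measure set T1 -> \bar R}) (m2 : {sigma_finite_measure set T2 -> \bar R})
    (f : T1 * T2 -> R) (g : T1 -> R) (h : T2 -> R) :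
  mfunT f -> (forall x y, `|f (x, y)| <= g x * h y) ->
  m1.-intR g -> m2.-intR h ->
  (prodm m1 m2).-intR f /\
  \int[prodm m1 m2]_p f p = \int[m1]_x \int[m2]_y f (x, y).
Proof.
move=> mf fgh ig ih; have fi := integrable_prod_dom mf fgh ig ih; split; first exact: fi.
rewrite /Rintegral; congr fine; rewrite -[LHS](integral12_prod_meas1 fi).
apply: eq_integral => x _; rewrite /fubini_F/= -EFin_Rintegral//.
apply: (integrable_le (g := fun y => g x * h y)) => //.
  exact: (mcomp mf (measurable_pair1 x)).
exact: intgbZ.
Qed.

(** * Increments of the field and independent copies *)

Section gaussian_displacement.
Context {R : realType} {d : nat} {dO} {Omega : measurableType dO} {P : probability Omega R}.
Local Notation V := 'rV[R]_d.
Variables (theta : V -> Omega -> Omega) (Z : Omega -> V -> V).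
Hypotheses (flow : preserving_flow P theta) (GZ : gaussian_field P Z) (Zinv : invariant_field theta Z).

Let mZ x : mfunT (Z ^~ x). Proof. exact: (field_measurable GZ). Qed.

(** Some coordinate is at least [l1 z / d] in absolute value, so a single coordinate, with its
    Gaussian exponential moments, bounds the whole. The summand 1 covers dimension 0. *)
Lemma expR_l1_le (c : R) (z : V) : 0 <= c ->
  expR (c * l1 z) <= 1 + \sum_i (expR (c * d%:R * z 0 i) + expR (- (c * d%:R) * z 0 i)).
Proof.
move=> c0.
have s0 : 0 <= \sum_i (expR (c * d%:R * z 0 i) + expR (- (c * d%:R) * z 0 i)).
  by apply: sumr_ge0 => i _; rewrite addr_ge0 ?expR_ge0.
have [/existsP[i zi]|/existsPn H] := boolP [exists i, l1 z <= d%:R * `|z 0 i|].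
  rewrite (bigD1 i)//= addrCA -[leLHS]addr0; apply: lerD; last first.
    by apply: addr_ge0 => //; apply: sumr_ge0 => j _; rewrite addr_ge0 ?expR_ge0.
  have h : expR (c * l1 z) <= expR (c * d%:R * `|z 0 i|).
    by rewrite ler_expR -mulrA; apply: ler_wpM2l.
  apply: (le_trans h); case: (leP 0 (z 0 i)) => zi0; first by rewrite ger0_norm// lerDl expR_ge0.
  by rewrite ltr0_norm// mulrN -mulNr lerDr expR_ge0.
suff -> : l1 z = 0 by rewrite mulr0 expR0 lerDl.
apply/eqP; rewrite eq_le l1_ge0 andbT leNgt; apply/negP => l0.
case: (posnP d) => d0.
  by move: l0; rewrite /l1 big1 ?ltxx// => i _; have := ltn_ord i; rewrite [X in (_ < X)%N]d0.
have : \sum_(i < d) (d%:R * `|z 0 i|) < \sum_(i < d) l1 z.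
  apply: ltr_sum.
    by apply/hasP; exists (Ordinal d0) => //; rewrite mem_index_enum.
  by move=> i _; rewrite ltNge; exact: H.
have -> : \sum_(i < d) d%:R * `|z 0 i| = d%:R * l1 z by rewrite -mulr_sumr.
by rewrite sumr_const card_ord mulr_natl ltxx.
Qed.

Lemma gaussian_linear (k : V) x : gaussian_rv P (fun w => dotv k (Z w x)).
Proof.
have := @field_gaussian _ _ _ _ _ _ GZ 1 (fun=> x) (fun=> k).
by under eq_fun do rewrite big_ord_recl big_ord0 addr0.
Qed.

Lemma gaussian_increment (k : V) x y : gaussian_rv P (fun w => dotv k (Z w x - Z w y)).
Proof.
have := @field_gaussian _ _ _ _ _ _ GZ 2 (fun j => if j == 0 then x else y) (fun j => if j == 0 then k else - k).
rewrite (_ : (fun w => _) = (fun w => dotv k (Z w x - Z w y)))//.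
by apply/funext => w; rewrite big_ord_recl big_ord_recl big_ord0 addr0/= dotvNl dotvBr.
Qed.

Lemma dotv_delta (i : 'I_d) (k : V) : dotv (delta_mx 0 i) k = k 0 i.
Proof.
rewrite /dotv (bigD1 i)//= big1 ?addr0; last by move=> l li; rewrite mxE (negbTE li) andbF mul0r.
by rewrite mxE !eqxx mul1r.
Qed.

Lemma gaussian_coord x i : gaussian_rv P (fun w => Z w x 0 i).
Proof. by have := gaussian_linear (delta_mx 0 i) x; under eq_fun do rewrite dotv_delta. Qed.

Lemma Rintegral_stationary (h : V -> R) x : mfunT h ->
  \int[P]_w h (Z w x) = \int[P]_w h (Z w 0).
Proof.
move=> mh; rewrite /Rintegral -(integral_flow flow x (F := fun w => (h (Z w 0))%:E)).
  by congr fine; apply: eq_integral => w _; rewrite Zinv add0r.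
by apply: measurable_EFin; exact: (mcomp mh (mZ 0)).
Qed.

Lemma integrable_exp_field (c : R) x : 0 <= c -> P.-intR (fun w => expR (c * l1 (Z w x))).
Proof.
move=> c0; apply: (@integrable_le _ _ _ _ _ (fun w => 1 +
    \sum_i (expR (c * d%:R * Z w x 0 i) + expR (- (c * d%:R) * Z w x 0 i)))).
- apply: measurable_expR_comp; apply: measurable_funM => //.
  by apply: (mcomp (@measurable_l1 R d)).
- by move=> w; rewrite ger0_norm ?expR_ge0//; exact: expR_l1_le.
- apply: integrable_add; first exact: integrable_prob_cst.
  apply: integrable_sum_seq => i; apply: integrable_add.
    exact: (gaussian_integrable_exp (gaussian_coord x i) (c * d%:R)).
  exact: (gaussian_integrable_exp (gaussian_coord x i) (- (c * d%:R))).
Qed.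

(** The exponent 4 comes from [expR_sub_le_half]: an exponential moment of order 2 of a difference
    costs order 4 for each term. By stationarity one bound serves all [u] and both laws. *)
Definition exp_bound : R := \int[P]_w expR (4 * l1 (Z w 0)).

Let mean (k : V) := \int[P]_w dotv k (Z w 0).
Let var (k : V) := \int[P]_w (dotv k (Z w 0) - mean k) ^+ 2.

Let mdot k x : mfunT (fun w => dotv k (Z w x)).
Proof. by apply: measurable_dotv. Qed.

Let mdotk (k : V) : mfunT (fun z : V => dotv k z).
Proof. by apply: measurable_dotv. Qed.

Let meanE k x : \int[P]_w dotv k (Z w x) = mean k.
Proof. exact: (Rintegral_stationary x (mdotk k)). Qed.

Let msq k : mfunT (fun z : V => (dotv k z - mean k) ^+ 2).
Proof. by apply: measurable_funX; apply: measurable_funB => //; exact: mdotk. Qed.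

Let varE k x : \int[P]_w (dotv k (Z w x) - mean k) ^+ 2 = var k.
Proof. exact: (Rintegral_stationary x (msq k)). Qed.

Let cos_field k x : \int[P]_w cos (dotv k (Z w x) - mean k) = expR (- (var k / 2)) /\
  \int[P]_w sin (dotv k (Z w x) - mean k) = 0.
Proof. by have [] := gaussian_cos (gaussian_linear k x); rewrite meanE varE. Qed.

Let expM x : \int[P]_w expR (4 * l1 (Z w x)) = exp_bound.
Proof.
apply: (@Rintegral_stationary (fun z : V => expR (4 * l1 z))).
apply: measurable_expR_comp; apply: measurable_funM => //; exact: measurable_l1.
Qed.

Lemma expR_sub_le_half (x y : V) : expR (2 * l1 (x - y)) <= 2^-1 * (expR (4 * l1 x) + expR (4 * l1 y)).
Proof.
have h : expR (2 * l1 (x - y)) <= expR (2 * l1 x) * expR (2 * l1 y).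
  rewrite -expRD ler_expR -mulrDr; apply: ler_wpM2l => //.
  by apply: (le_trans (l1D _ _)); rewrite l1N.
have e4 (z : V) : expR (4 * l1 z) = expR (2 * l1 z) ^+ 2.
  by rewrite -expRM_natl; congr expR; ring.
apply: (le_trans h); rewrite !e4; have := sqr_ge0 (expR (2 * l1 x) - expR (2 * l1 y)); lra.
Qed.

Variable u : V.

Let m2f : mfunT (fun w => Z w u - Z w 0).
Proof. by apply: measurable_rVB; exact: mZ. Qed.

Let m1f : mfunT (fun p : Omega * Omega => Z p.1 u - Z p.2 0).
Proof.
apply: measurable_rVB.
- by apply: (mcomp (mZ u)); exact: measurable_fst.
- by apply: (mcomp (mZ 0)); exact: measurable_snd.
Qed.

Let mexp : mfunT (fun w : V => expR (2 * l1 w)).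
Proof. by apply: measurable_expR_comp; apply: measurable_funM => //; exact: measurable_l1. Qed.

Let iE x : P.-intR (fun w => expR (4 * l1 (Z w x))).
Proof. exact: integrable_exp_field. Qed.

Let iE2 : (pushm P m2f).-intR (fun w : V => expR (2 * l1 w)).
Proof.
apply: (integrable_pushm _ mexp); apply: (integrable_le _ _ (intgbZ 2^-1 (integrable_add (iE u) (iE 0)))).
- exact: (mcomp mexp m2f).
- by move=> w; rewrite ger0_norm ?expR_ge0//; exact: expR_sub_le_half.
Qed.

Let law2 := sfm_of (integrable_gt0_sigma_finite (fun w => expR_gt0 _) iE2).

Let dom1 (w w' : Omega) : expR (2 * l1 (Z w u - Z w' 0)) <= expR (4 * l1 (Z w u)) * expR (4 * l1 (Z w' 0)).
Proof.
rewrite -expRD ler_expR -mulrDr; apply: (@le_trans _ _ (2 * (l1 (Z w u) + l1 (Z w' 0)))).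
  by apply: ler_wpM2l => //; apply: (le_trans (l1D _ _)); rewrite l1N.
by apply: ler_wpM2r => //; [rewrite addr_ge0 ?l1_ge0|lra].
Qed.

Let prod1 (h : V -> R) : mfunT h -> (forall w, `|h w| <= expR (2 * l1 w)) ->
  (prodm P P).-intR (fun p => h (Z p.1 u - Z p.2 0)) /\
  \int[prodm P P]_p h (Z p.1 u - Z p.2 0) = \int[P]_w \int[P]_w' h (Z w u - Z w' 0).
Proof.
move=> mh hb; apply: (@Rintegral_prodm _ _ _ _ _ P P (fun p => h (Z p.1 u - Z p.2 0)) _ _ _ _ (iE u) (iE 0)).
- exact: (mcomp mh m1f).
- by move=> w w'; exact: (le_trans (hb _) (dom1 w w')).
Qed.

Let iE1 : (pushm (prodm P P) m1f).-intR (fun w : V => expR (2 * l1 w)).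
Proof.
apply: (integrable_pushm _ mexp); apply: (prod1 mexp _).1.
by move=> w; rewrite ger0_norm ?expR_ge0.
Qed.

Let law1 := sfm_of (integrable_gt0_sigma_finite (fun w => expR_gt0 _) iE1).

(** Exponent of the true increment, half its variance. For independent copies the exponent is [var],
    since two halves of the variance at one point add up. *)
Let tau (k : V) := 2^-1 * \int[P]_w dotv k (Z w u - Z w 0) ^+ 2.

Let symmetric_law2 : symmetric_law law2 tau exp_bound.
Proof.
have incr k : \int[P]_w dotv k (Z w u - Z w 0) = 0.
  transitivity (\int[P]_w (dotv k (Z w u) - dotv k (Z w 0))).
    by apply: eq_Rintegral => w _; rewrite dotvBr.
  rewrite (RintegralB measurableT (gaussian_integrable (gaussian_linear k u)) (gaussian_integrable (gaussian_linear k 0))).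
  by rewrite !meanE subrr.
have gc k := gaussian_cos (gaussian_increment k u 0).
split.
- exact: iE2.
- rewrite [leLHS](Rintegral_pushm P m2f mexp).
  apply: (@le_trans _ _ (\int[P]_w (2^-1 * (expR (4 * l1 (Z w u)) + expR (4 * l1 (Z w 0)))))).
    apply: (le_trans (ler_norm _)); apply: normr_Rintegral_le.
    + apply: (integrable_le _ _ (intgbZ 2^-1 (integrable_add (iE u) (iE 0)))).
        exact: (mcomp mexp m2f).
      by move=> w; rewrite ger0_norm ?expR_ge0//; exact: expR_sub_le_half.
    + exact: intgbZ (integrable_add (iE u) (iE 0)).
    + by move=> w; rewrite ger0_norm ?expR_ge0//; exact: expR_sub_le_half.
  rewrite (Rintegral_scale _ (integrable_add (iE u) (iE 0))) (RintegralD measurableT (iE u) (iE 0)) !expM.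
  by lra.
- by move=> k; apply: mulr_ge0; [rewrite invr_ge0|apply: Rintegral_ge0 => w _; exact: sqr_ge0].
- move=> k; rewrite [LHS](Rintegral_pushm P m2f (measurable_cos_dotv k)).
  have [c _] := gc k; rewrite incr in c.
  transitivity (\int[P]_w cos (dotv k (Z w u - Z w 0) - 0)); first by apply: eq_Rintegral => w _; rewrite subr0.
  rewrite c.
  have -> : \int[P]_w (dotv k (Z w u - Z w 0) - 0) ^+ 2 = \int[P]_w dotv k (Z w u - Z w 0) ^+ 2.
    by apply: eq_Rintegral => w _; rewrite subr0.
  by rewrite /tau mulrC.
- move=> k; rewrite [LHS](Rintegral_pushm P m2f (measurable_sin_dotv k)).
  have [_ s] := gc k; rewrite incr in s; rewrite -[RHS]s.
  by apply: eq_Rintegral => w _; rewrite subr0.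
Qed.

Let bounded_field (f : Omega -> R) : mfunT f -> (forall w, `|f w| <= 1) ->
  P.-intR f.
Proof. by move=> mf f1; apply: (integrable_le mf f1); exact: integrable_prob_cst. Qed.

Let symmetric_law1 : symmetric_law law1 var exp_bound.
Proof.
have mB k x : mfunT (fun w => dotv k (Z w x) - mean k) by exact: measurable_funB.
have ic k x := bounded_field (measurable_cos_comp (mB k x)) (fun=> normr_cos_le1 _).
have is_ k x := bounded_field (measurable_sin_comp (mB k x)) (fun=> normr_sin_le1 _).
have inner (h : R -> R) k w (c s : R) : (forall w', h (dotv k (Z w u - Z w' 0)) =
    c * cos (dotv k (Z w' 0) - mean k) + s * sin (dotv k (Z w' 0) - mean k)) ->
    \int[P]_w' h (dotv k (Z w u - Z w' 0)) = c * expR (- (var k / 2)).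
  move=> H; transitivity (\int[P]_w' (c * cos (dotv k (Z w' 0) - mean k) + s * sin (dotv k (Z w' 0) - mean k))).
    by apply: eq_Rintegral => w' _; exact: H.
  rewrite (RintegralD measurableT (intgbZ c (ic k 0)) (intgbZ s (is_ k 0))).
  rewrite (Rintegral_scale _ (ic k 0)) (Rintegral_scale _ (is_ k 0)).
  by rewrite (cos_field k 0).1 (cos_field k 0).2 mulr0 addr0.
have one (h : R -> R) k (w : V) : (forall x, `|h x| <= 1) -> `|h (dotv k w)| <= expR (2 * l1 w).
  by move=> h1; exact: (le_trans (h1 _) (expR_l1_ge1 w)).
split.
- exact: iE1.
- rewrite [leLHS](Rintegral_pushm (prodm P P) m1f mexp).
  have ia : (prodm P P).-intR (fun p => 2^-1 * (expR (4 * l1 (Z p.1 u)) + expR (4 * l1 (Z p.2 0)))) /\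
    \int[prodm P P]_p (2^-1 * (expR (4 * l1 (Z p.1 u)) + expR (4 * l1 (Z p.2 0)))) =
    \int[P]_w \int[P]_w' (2^-1 * (expR (4 * l1 (Z w u)) + expR (4 * l1 (Z w' 0)))).
    apply: (@Rintegral_prodm _ _ _ _ _ P P (fun p => 2^-1 * (expR (4 * l1 (Z p.1 u)) + expR (4 * l1 (Z p.2 0))))
      (fun w => expR (4 * l1 (Z w u))) (fun w => expR (4 * l1 (Z w 0))) _ _ (iE u) (iE 0)).
    + have me x : mfunT (fun w => expR (4 * l1 (Z w x))).
        by apply: measurable_expR_comp; apply: measurable_funM => //; exact: (mcomp (@measurable_l1 R d) (mZ x)).
      apply: measurable_funM => //; apply: measurable_funD.
        by apply: (mcomp (me u)); exact: measurable_fst.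
      by apply: (mcomp (me 0)); exact: measurable_snd.
    + move=> w w' /=; have a1 : 1 <= expR (4 * l1 (Z w u)) by rewrite -[leLHS]expR0 ler_expR mulr_ge0 ?l1_ge0.
      have b1 : 1 <= expR (4 * l1 (Z w' 0)) by rewrite -[leLHS]expR0 ler_expR mulr_ge0 ?l1_ge0.
      by rewrite ger0_norm; [nra|lra].
  have [i0 E0] := ia.
  apply: (@le_trans _ _ (\int[prodm P P]_p (2^-1 * (expR (4 * l1 (Z p.1 u)) + expR (4 * l1 (Z p.2 0)))))).
    have ix := (prod1 mexp (fun w => ltac:(by rewrite ger0_norm ?expR_ge0))).1.
    apply: (le_trans (ler_norm _)); apply: normr_Rintegral_le => //.
    by move=> p; rewrite ger0_norm ?expR_ge0//; exact: expR_sub_le_half.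
  rewrite E0; apply: le_of_eq.
  transitivity (\int[P]_w (2^-1 * (expR (4 * l1 (Z w u)) + exp_bound))).
    apply: eq_Rintegral => w _.
    have i1 := integrable_prob_cst (P := P) (expR (4 * l1 (Z w u))).
    rewrite (Rintegral_scale _ (integrable_add i1 (iE 0))) (RintegralD measurableT i1 (iE 0)).
    by rewrite Rintegral_prob_cst expM.
  have i2 := integrable_prob_cst (P := P) exp_bound.
  rewrite (Rintegral_scale _ (integrable_add (iE u) i2)) (RintegralD measurableT (iE u) i2).
  by rewrite Rintegral_prob_cst expM; field.
- by move=> k; apply: Rintegral_ge0 => w _; exact: sqr_ge0.
- move=> k; rewrite [LHS](Rintegral_pushm (prodm P P) m1f (measurable_cos_dotv k)).
  rewrite (prod1 (measurable_cos_dotv k) (fun w => one cos k w (@normr_cos_le1 R))).2.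
  transitivity (\int[P]_w (expR (- (var k / 2)) * cos (dotv k (Z w u) - mean k))).
    apply: eq_Rintegral => w _; rewrite mulrC; apply: (inner cos k w _ (sin (dotv k (Z w u) - mean k))) => w'.
    by rewrite -cosB dotvBr; congr cos; ring.
  by rewrite (Rintegral_scale _ (ic k u)) (cos_field k u).1 -expRD; congr expR; field.
- move=> k; rewrite [LHS](Rintegral_pushm (prodm P P) m1f (measurable_sin_dotv k)).
  rewrite (prod1 (measurable_sin_dotv k) (fun w => one sin k w (@normr_sin_le1 R))).2.
  transitivity (\int[P]_w (expR (- (var k / 2)) * sin (dotv k (Z w u) - mean k))).
    apply: eq_Rintegral => w _; rewrite mulrC; apply: (inner sin k w _ (- cos (dotv k (Z w u) - mean k))) => w'.
    by rewrite mulNr -sinB dotvBr; congr sin; ring.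
  by rewrite (Rintegral_scale _ (is_ k u)) (cos_field k u).2 mulr0.
Qed.

Let C := covariance_mx P (Z ^~ u) (Z ^~ 0).

Let product_moment (X Y : Omega -> R) : gaussian_rv P X -> gaussian_rv P Y ->
  P.-intR (fun w => X w * Y w).
Proof.
move=> GX GY; have [mX _] := GX; have [mY _] := GY.
apply: (integrable_le _ _ (integrable_add (gaussian_integrable_sqr GX) (gaussian_integrable_sqr GY))).
- exact: measurable_funM.
- move=> w; rewrite ler_norml; apply/andP; split;
    have := sqr_ge0 (X w + Y w); have := sqr_ge0 (X w - Y w); nra.
Qed.

Let covE i j : C i j = \int[P]_w ((Z w u 0 i - \int[P]_w Z w u 0 i) * (Z w 0 0 j - \int[P]_w Z w 0 0 j)).
Proof. by rewrite /C mxE covariance.unlock expectation.unlock. Qed.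

(** The mean of [(A - B)^2] is twice [var k] minus twice the mean of [A * B], so the two exponents
    differ by the covariance of the projections on [k]; expanding in coordinates gives the matrix
    entries. *)
Let covariance_form k : var k - tau k = \sum_i \sum_j C i j * (k 0 i * k 0 j).
Proof.
pose A w := dotv k (Z w u) - mean k; pose B w := dotv k (Z w 0) - mean k.
have iXY (X Y : Omega -> R) (a b : R) : gaussian_rv P X -> gaussian_rv P Y ->
    P.-intR (fun w => (X w - a) * (Y w - b)).
  move=> GX GY.
  rewrite (_ : (fun w => _) = (fun w => (X w * Y w - (b * X w + a * Y w)) + a * b)); last by apply/funext => w; ring.
  apply: integrable_add; last exact: integrable_prob_cst.
  apply: integrable_sub; first exact: product_moment.
  by apply: integrable_add; apply: intgbZ; exact: gaussian_integrable.
have Gu := gaussian_linear k u; have G0 := gaussian_linear k 0.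
have iAA : P.-intR (fun w => A w ^+ 2) by exact: iXY.
have iBB : P.-intR (fun w => B w ^+ 2) by exact: iXY.
have iAB : P.-intR (fun w => A w * B w) by exact: iXY.
have tE : \int[P]_w dotv k (Z w u - Z w 0) ^+ 2 = 2 * var k - 2 * \int[P]_w (A w * B w).
  transitivity (\int[P]_w ((A w ^+ 2 + B w ^+ 2) - 2 * (A w * B w))).
    by apply: eq_Rintegral => w _; rewrite dotvBr /A /B; ring.
  rewrite (RintegralB measurableT (integrable_add iAA iBB) (intgbZ 2 iAB)).
  rewrite (RintegralD measurableT iAA iBB) (Rintegral_scale 2 iAB) [\int[P]_w A w ^+ 2]varE.
  by rewrite [\int[P]_w B w ^+ 2]varE; ring.
rewrite /tau tE (_ : _ - _ = \int[P]_w (A w * B w)); last by field.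
pose F i j w := (Z w u 0 i - \int[P]_w Z w u 0 i) * (Z w 0 0 j - \int[P]_w Z w 0 0 j).
have iF i j : P.-intR (F i j) by apply: iXY; exact: gaussian_coord.
have lin x w : dotv k (Z w x) - mean k = \sum_i k 0 i * (Z w x 0 i - \int[P]_w Z w x 0 i).
  have -> : mean k = \sum_i k 0 i * \int[P]_w Z w x 0 i.
    rewrite -(meanE k x).
    transitivity (\int[P]_w (\sum_i k 0 i * Z w x 0 i)); first by [].
    rewrite Rintegral_sum_seq; last by move=> i; apply: intgbZ; exact: gaussian_integrable (gaussian_coord x i).
    by apply: eq_bigr => i _; rewrite (Rintegral_scale _ (gaussian_integrable (gaussian_coord x i))).
  by rewrite /dotv -sumrB; apply: eq_bigr => i _; rewrite mulrBr.
have i1 i j := intgbZ (k 0 i * k 0 j) (iF i j).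
have i2 i := integrable_sum_seq (index_enum _) (i1 i).
transitivity (\int[P]_w (\sum_i \sum_j (k 0 i * k 0 j) * F i j w)).
  apply: eq_Rintegral => w _; rewrite /A /B !lin big_distrl/=; apply: eq_bigr => i _.
  by rewrite mulr_sumr; apply: eq_bigr => j _; rewrite /F; ring.
rewrite (Rintegral_sum_seq (index_enum _) i2); apply: eq_bigr => i _.
rewrite (Rintegral_sum_seq (index_enum _) (i1 i)); apply: eq_bigr => j _.
by rewrite (Rintegral_scale _ (iF i j)) covE mulrC.
Qed.

Let varZ c k : var (c *: k) = c ^+ 2 * var k.
Proof.
have i2 : P.-intR (fun w => (dotv k (Z w 0) - mean k) ^+ 2).
  have G0 := gaussian_linear k 0; have [m0 _] := G0.
  apply: (integrable_le _ _ (intgbZ 2 (integrable_add (gaussian_integrable_sqr G0) (integrable_prob_cst (mean k ^+ 2))))).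
  - by apply: measurable_funX; exact: measurable_funB.
  - by move=> w; rewrite ger0_norm ?sqr_ge0//; have := sqr_ge0 (dotv k (Z w 0) + mean k); nra.
rewrite /var -(Rintegral_scale _ i2); apply: eq_Rintegral => w _.
have -> : mean (c *: k) = c * mean k.
  rewrite /mean -(Rintegral_scale _ (gaussian_integrable (gaussian_linear k 0))).
  by apply: eq_Rintegral => w' _; rewrite dotvZl.
by rewrite dotvZl -mulrBr exprMn.
Qed.

Let tauZ c k : tau (c *: k) = c ^+ 2 * tau k.
Proof.
rewrite /tau mulrCA; congr (_ * _).
rewrite -(Rintegral_scale _ (gaussian_integrable_sqr (gaussian_increment k u 0))).
by apply: eq_Rintegral => w _; rewrite dotvZl exprMn.
Qed.

Lemma frobenius_entry m n (A : 'M[R]_(m, n)) i j : `|A i j| <= frobenius_norm A.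
Proof.
rewrite -sqrtr_sqr; apply: ler_wsqrtr; rewrite (bigD1 i)//= (bigD1 j)//= -addrA lerDl.
apply: addr_ge0; first by apply: sumr_ge0 => b _; exact: sqr_ge0.
by apply: sumr_ge0 => a _; apply: sumr_ge0 => b _; exact: sqr_ge0.
Qed.

(** The factor [d * d] bounds the sum of the absolute values of the matrix entries by the Frobenius
    norm. *)
Definition compare_const : R := 12 * expR (d%:R * 18) * (exp_bound * exp_bound) * (d%:R * d%:R).

Lemma gaussian_field_compare (s : R) : 0 < s -> s <= 1 ->
  `|\int[P]_w gaussn s (u + (Z w u - Z w 0)) - \int[P]_w \int[P]_w' gaussn s (u + (Z w u - Z w' 0))| <=
  compare_const * s * rho (2 * Num.sqrt s) u * frobenius_norm C.
Proof.
move=> s0 s1.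
have mg : mfunT (fun w : V => gaussn s (u + w)).
  by apply: (mcomp (@measurable_gaussn R d s)); exact: measurable_rVD.
have gb (w : V) : `|gaussn s (u + w)| <= expR (2 * l1 w).
  by rewrite ger0_norm ?gaussn_ge0//; exact: (le_trans (gaussn_le1 _ (ltW s0)) (expR_l1_ge1 w)).
have := gaussian_compare symmetric_law1 symmetric_law2 varZ tauZ covariance_form s0 s1 u.
rewrite [\int[law2]_w _](Rintegral_pushm P m2f mg) [\int[law1]_w _](Rintegral_pushm (prodm P P) m1f mg).
rewrite (prod1 mg gb).2 => H; apply: (le_trans H).
have Cs : \sum_i \sum_j `|C i j| <= d%:R * d%:R * frobenius_norm C.
  apply: (@le_trans _ _ (\sum_(i < d) \sum_(j < d) frobenius_norm C)).
    by apply: ler_sum => i _; apply: ler_sum => j _; exact: frobenius_entry.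
  by rewrite !sumr_const card_ord -mulrnA -[leLHS]mulr_natl natrM.
rewrite /compare_const (_ : 12 * _ * _ * _ * s * _ * _ = 12 * expR (d%:R * 18) * s *
  rho (2 * Num.sqrt s) u * (exp_bound * exp_bound) * (d%:R * d%:R * frobenius_norm C)); last by ring.
apply: ler_wpM2l; last exact: Cs.
apply: mulr_ge0; last by rewrite -expr2 sqr_ge0.
apply: mulr_ge0; last exact: rho_ge0.
by apply: mulr_ge0; [apply: mulr_ge0; [exact: ler0n|exact: expR_ge0]|exact: ltW].
Qed.

End gaussian_displacement.

(** * Small balls *)

Section spectral_energy.
Context {R : realType} {d : nat} {dO} {Omega : measurableType dO} {P : probability Omega R}.
Local Notation V := 'rV[R]_d.
Variables (X : Omega -> {measure set V -> \bar R}) (alpha : {sigma_finite_measure set V -> \bar R}) (lam : R).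
Hypothesis so : second_order P X alpha lam.
Variable beta : {measure set V -> \bar R}.
Hypothesis Bb : bartlett_spectral_measure P X beta.

Let pair (f : V -> R) := pairing alpha (lam ^+ 2) (corr f f).
(** The squared modulus of [fourier f]. *)
Definition energy (f : V -> R) (k : V) : R := fcos f k ^+ 2 + fsin f k ^+ 2.

Let il2 : (lebm d).-intR (rho (2 : R)). Proof. exact: integrable_rho. Qed.

Lemma dominated_lebm C (f : V -> R) : dominated C f -> (lebm d).-intR f.
Proof. by move=> [mf fC]; exact: (integrable_le mf fC (intgbZ C il2)). Qed.

Lemma measurable_energy f : mfunT f -> mfunT (energy f).
Proof.
move=> mf; apply: measurable_funD; apply: measurable_funX; [exact: measurable_fcos|exact: measurable_fsin].
Qed.

Lemma energy_ge0 f k : 0 <= energy f k. Proof. by rewrite addr_ge0 ?sqr_ge0. Qed.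

Let c2pi : 0 < (2 * pi) ^+ d :> R. Proof. by rewrite exprn_gt0// mulr_gt0 ?pi_gt0. Qed.

Lemma test_energy C f : test_function f -> dominated C f ->
  (\int[beta]_k (energy f k)%:E = ((2 * pi) ^+ d * pair f)%:E)%E.
Proof.
move=> tf df; have fi := dominated_lebm df.
have ReE k : complex.Re (fourier f k * (fourier f k)^*%C) = energy f k.
  by rewrite !fourierE//= /energy; ring.
have [i1 _] := bartlett_integrable Bb tf tf.
have ie : beta.-intR (energy f).
  by move: i1; rewrite (funext ReE).
have Rec (c a b : R) : complex.Re (c%:C%C * (a +i* b)%C) = c * a by rewrite /= mul0r subr0.
have -> : pair f = (2 * pi) ^- d * \int[beta]_k energy f k.
  rewrite /pair -(covariance_pairing so df df) -(funext ReE).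
  have := congr1 (@complex.Re R) (bartlett_covariance Bb tf tf).
  by rewrite /cintegral Rec; apply.
by rewrite mulrA divff ?gt_eqF// mul1r EFin_Rintegral.
Qed.

Lemma fcos_cvg C (f_ : nat -> V -> R) (f : V -> R) (k : V) : (forall n, dominated C (f_ n)) ->
  (forall x, f_ n x @[n --> \oo] --> f x) -> fcos (f_ n) k @[n --> \oo] --> fcos f k.
Proof.
move=> df cf; apply: (Rintegral_dct _ _ _ (intgbZ C il2)).
- by move=> n; apply: measurable_funM; [exact: (df n).1|exact: measurable_cos_dotv].
- by move=> x; apply: cvgM; [exact: cf|exact: cvg_cst].
- by move=> n x; rewrite normrM; apply: (le_trans _ ((df n).2 x)); rewrite ler_piMr ?normr_cos_le1.
Qed.

Lemma fsin_cvg C (f_ : nat -> V -> R) (f : V -> R) (k : V) : (forall n, dominated C (f_ n)) ->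
  (forall x, f_ n x @[n --> \oo] --> f x) -> fsin (f_ n) k @[n --> \oo] --> fsin f k.
Proof.
move=> df cf; apply: (Rintegral_dct _ _ _ (intgbZ C il2)).
- by move=> n; apply: measurable_funM; [exact: (df n).1|exact: measurable_sin_dotv].
- by move=> x; apply: cvgM; [exact: cf|exact: cvg_cst].
- by move=> n x; rewrite normrM; apply: (le_trans _ ((df n).2 x)); rewrite ler_piMr ?normr_sin_le1.
Qed.

Lemma energy_cvg C (f_ : nat -> V -> R) (f : V -> R) (k : V) : (forall n, dominated C (f_ n)) ->
  (forall x, f_ n x @[n --> \oo] --> f x) -> energy (f_ n) k @[n --> \oo] --> energy f k.
Proof.
move=> df cf; rewrite /energy expr2 (expr2 (fsin f k)).
under eq_fun do rewrite expr2 (expr2 (fsin _ _)).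
have c1 := @fcos_cvg C f_ f k df cf; have c2 := @fsin_cvg C f_ f k df cf.
by apply: cvgD; apply: cvgM.
Qed.

Lemma dominated_lim C (f_ : nat -> V -> R) (f : V -> R) : (forall n, dominated C (f_ n)) ->
  (forall x, f_ n x @[n --> \oo] --> f x) -> dominated C f.
Proof.
move=> df cf; split; first by apply: (measurable_fun_cvg (h := f_)) => [n|x _]; [exact: (df n).1|exact: cf].
move=> x; have c : `|f_ n x| @[n --> \oo] --> `|f x| by apply: cvg_norm; exact: cf.
rewrite -(cvg_lim _ c)//; apply: limr_le; first exact: cvgP c.
by apply: nearW => n; exact: (df n).2.
Qed.

Lemma pair_cvg C (f_ : nat -> V -> R) (f : V -> R) : (forall n, dominated C (f_ n)) ->
  (forall x, f_ n x @[n --> \oo] --> f x) -> pair (f_ n) @[n --> \oo] --> pair f.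
Proof.
move=> df cf; have dfl := @dominated_lim C f_ f df cf.
apply: (@pairing_cvg R d alpha (lam ^+ 2) (so_rho so) (fun n => corr (f_ n) (f_ n)) (corr f f)
  (C * C * \int[lebm d]_x rho 1 x)).
- by move=> n; apply: measurable_corr; exact: (df n).1.
- move=> u; apply: (Rintegral_dct _ _ _ (intgbZ (C * C) il2)).
  + move=> n; apply: measurable_funM; first exact: (df n).1.
    by apply: (mcomp (df n).1); exact: measurable_rVB.
  + by move=> x; apply: cvgM; exact: cf.
  + move=> n x; rewrite normrM mulrC -[leRHS]mulrA.
    have C0 : 0 <= C by have := le_trans (normr_ge0 _) ((df 0%N).2 0); rewrite pmulr_lge0 ?rho_gt0.
    apply: ler_pM => //; last exact: (df n).2.
    apply: (le_trans ((df n).2 _)); rewrite ler_piMr//.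
    by rewrite /rho expR_le1 oppr_le0 mulr_ge0 ?l1_ge0.
- by move=> n u; apply: corr_le; by [exact: (df n).1|exact: (df n).2].
Qed.

(** For test functions energy and pairing agree up to a constant. In the limit Fatou keeps an
    inequality for the energy, whereas the pairing converges because all functions obey a common
    [rho 2] bound. *)
Lemma energy_fatou C (f_ : nat -> V -> R) (f : V -> R) : (forall n, test_function (f_ n)) -> (forall n, dominated C (f_ n)) ->
  (forall x, f_ n x @[n --> \oo] --> f x) ->
  (\int[beta]_k (energy f k)%:E <= ((2 * pi) ^+ d * pair f)%:E)%E.
Proof.
move=> tf df cf.
have := @fatou _ _ _ beta setT measurableT (fun n k => (energy (f_ n) k)%:E)
  (fun n => measurable_EFin (measurable_energy (df n).1)) (fun n k _ => energy_ge0 (f_ n) k).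
have cI : (\int[beta]_k (energy (f_ n) k)%:E)%E @[n --> \oo] --> ((2 * pi) ^+ d * pair f)%:E.
  under eq_fun do rewrite (test_energy (tf _) (df _)).
  apply: cvg_EFin; first exact: nearW.
  by apply: cvgM; [exact: cvg_cst|exact: (@pair_cvg C f_ f df cf)].
have -> : limn_einf (fun n => \int[beta]_k (energy (f_ n) k)%:E)%E = ((2 * pi) ^+ d * pair f)%:E.
  by rewrite is_cvg_limn_einfE; [exact: (cvg_lim _ cI)|exact: (cvgP _ cI)].
apply: le_trans; apply: le_of_eq; apply: eq_integral => k _.
have ck : (energy (f_ n) k)%:E @[n --> \oo] --> (energy f k)%:E.
  by apply: cvg_EFin; [exact: nearW|exact: (@energy_cvg C f_ f k df cf)].
by rewrite is_cvg_limn_einfE; [apply/esym; exact: (cvg_lim _ ck)|exact: (cvgP _ ck)].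
Qed.

Let trunc (g : V -> R) n (x : V) := g x * \1_(cube n.+1%:R) x.

Let trunc_le g n x : `|trunc g n x| <= `|g x|.
Proof. by rewrite /trunc normrM ler_piMr// indicE; case: (_ \in _); rewrite ?normr1 ?normr0. Qed.

Let trunc_dominated C g n : dominated C g -> dominated C (trunc g n).
Proof.
move=> [mg gC]; split; last by move=> x; exact: (le_trans (trunc_le _ _ _) (gC x)).
by apply: measurable_funM => //; apply: measurable_indic; exact: measurable_cube.
Qed.

Let dominated_bound C (g : V -> R) x : dominated C g -> `|g x| <= C.
Proof.
move=> [_ gC]; have C0 : 0 <= C by have := le_trans (normr_ge0 _) (gC 0); rewrite pmulr_lge0 ?rho_gt0.
by apply: (le_trans (gC x)); rewrite ler_piMr// /rho expR_le1 oppr_le0 mulr_ge0 ?l1_ge0.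
Qed.

Lemma compact_cball (r : R) : compact [set x : V | `|x| <= r].
Proof.
apply: bounded_closed_compact; first by exists r; split; [exact: num_real|move=> M rM x /= xr; exact: (le_trans xr (ltW rM))].
apply: (@closed_comp _ _ (fun x : V => `|x|) [set y : R | y <= r]).
  by move=> x _; exact: norm_continuous.
exact: closed_le.
Qed.

Let trunc_test C g n m : dominated C g -> test_function (fun x => trunc g n x - trunc g m x).
Proof.
move=> dg; split.
- by apply: measurable_funB; exact: (trunc_dominated _ dg).1.
- exists (C + C) => x; apply: (le_trans (ler_normB _ _)); apply: lerD;
    by apply: (le_trans (trunc_le _ _ _)); exact: dominated_bound dg.
exists [set x : V | `|x| <= n.+1%:R + m.+1%:R]; first exact: compact_cball.
move=> x /negP; rewrite -ltNge => nx; rewrite /trunc !indicE !memNset ?mulr0 ?subr0//= /cube/= => h; move: nx; rewrite ltNge => /negP; apply.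
- by apply: (le_trans (ltW h)); rewrite lerDr.
- by apply: (le_trans (ltW h)); rewrite lerDl.
Qed.

Let trunc_cvg g x : trunc g n x @[n --> \oo] --> g x.
Proof.
apply: (@cvg_trans _ (g x @[n --> \oo])); last exact: cvg_cst.
have [N _ HN] := @nbhs_infty_gtr R `|x|.
apply: near_eq_cvg; near=> n; rewrite /trunc indicE mem_set ?mulr1//= /cube/=.
rewrite (lt_trans (HN n _))//; last by rewrite ltr_nat.
by near: n; exact: nbhs_infty_ge.
Unshelve. all: by end_near. Qed.

(** A converse of [energy_fatou] up to a factor 2: the energy of a truncation of [g] is at most
    twice that of [g] plus twice that of the tail [h n], and the energy of the tail is at most a
    multiple of its pairing, which tends to 0. *)
Lemma pair_le_energy C (g : V -> R) : dominated C g -> beta.-intR (energy g) ->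
  (2 * pi) ^+ d * pair g <= 2 * \int[beta]_k energy g k.
Proof.
move=> dg ig; pose h n x := trunc g n x - g x.
have dh n : dominated (C + C) (h n).
  split; first by apply: measurable_funB; [exact: (trunc_dominated _ dg).1|exact: dg.1].
  move=> x; rewrite mulrDl; apply: (le_trans (ler_normB _ _)); apply: lerD; last exact: (dg.2 x).
  exact: (le_trans (trunc_le _ _ _) (dg.2 x)).
(* The tail has no compact support; it is the limit in [m] of differences of two truncations, which
   are test functions. *)
have hE n : (\int[beta]_k (energy (h n) k)%:E <= ((2 * pi) ^+ d * pair (h n))%:E)%E.
  apply: (@energy_fatou (C + C) (fun m x => trunc g n x - trunc g m x)).
  - by move=> m; exact: (trunc_test _ _ dg).
  - move=> m; split; first by apply: measurable_funB; exact: (trunc_dominated _ dg).1.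
    move=> x; rewrite mulrDl; apply: (le_trans (ler_normB _ _)); apply: lerD;
      exact: (le_trans (trunc_le _ _ _) (dg.2 x)).
  - by move=> x; apply: cvgB; [exact: cvg_cst|exact: trunc_cvg].
have trE n k : energy (trunc g n) k <= 2 * energy g k + 2 * energy (h n) k.
  have ig0 := dominated_lebm dg; have ih0 := dominated_lebm (dh n).
  have c : fcos (trunc g n) k = fcos g k + fcos (h n) k.
    rewrite /fcos -RintegralD//.
    - by apply: eq_Rintegral => x _; rewrite /h; ring.
    - by apply: (integrable_le _ _ (integrable_norm ig0)) => [|x]; [apply: measurable_funM; [exact: dg.1|exact: measurable_cos_dotv]|rewrite normrM ler_piMr ?normr_cos_le1].
    - by apply: (integrable_le _ _ (integrable_norm ih0)) => [|x]; [apply: measurable_funM; [exact: (dh n).1|exact: measurable_cos_dotv]|rewrite normrM ler_piMr ?normr_cos_le1].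
  have s : fsin (trunc g n) k = fsin g k + fsin (h n) k.
    rewrite /fsin -RintegralD//.
    - by apply: eq_Rintegral => x _; rewrite /h; ring.
    - by apply: (integrable_le _ _ (integrable_norm ig0)) => [|x]; [apply: measurable_funM; [exact: dg.1|exact: measurable_sin_dotv]|rewrite normrM ler_piMr ?normr_sin_le1].
    - by apply: (integrable_le _ _ (integrable_norm ih0)) => [|x]; [apply: measurable_funM; [exact: (dh n).1|exact: measurable_sin_dotv]|rewrite normrM ler_piMr ?normr_sin_le1].
  rewrite /energy c s; have := sqr_ge0 (fcos g k - fcos (h n) k); have := sqr_ge0 (fsin g k - fsin (h n) k); nra.
have ih n : beta.-intR (energy (h n)).
  apply: integrable_ge0_lty; [exact: measurable_energy (dh n).1|by move=> k; exact: energy_ge0|].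
  exact: (le_lt_trans (hE n) (ltry _)).
have test0 n : test_function (trunc g n).
  have := trunc_test n n dg => _; split; first exact: (trunc_dominated _ dg).1.
    by exists C => x; apply: (le_trans (trunc_le _ _ _)); exact: dominated_bound dg.
  exists [set x : V | `|x| <= n.+1%:R]; first exact: compact_cball.
  move=> x /negP; rewrite -ltNge => nx; rewrite /trunc indicE memNset ?mulr0//= /cube/= => h1.
  by have := lt_trans h1 nx; rewrite ltxx.
have H n : (2 * pi) ^+ d * pair (trunc g n) <= 2 * \int[beta]_k energy g k + 2 * ((2 * pi) ^+ d * pair (h n)).
  have dt := trunc_dominated n dg.
  have E := test_energy (test0 n) dt.
  have it : beta.-intR (energy (trunc g n)).
    apply: integrable_ge0_lty; [exact: measurable_energy dt.1|by move=> k; exact: energy_ge0|by rewrite E ltry].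
  have -> : (2 * pi) ^+ d * pair (trunc g n) = \int[beta]_k energy (trunc g n) k by rewrite /Rintegral E.
  apply: (@le_trans _ _ (\int[beta]_k (2 * energy g k + 2 * energy (h n) k))).
    apply: le_Rintegral => //; exact: integrable_add (intgbZ 2 ig) (intgbZ 2 (ih n)).
  rewrite (RintegralD measurableT (intgbZ 2 ig) (intgbZ 2 (ih n))).
  rewrite (Rintegral_scale 2 ig) (Rintegral_scale 2 (ih n)); apply: lerD => //; apply: ler_wpM2l => //.
  by rewrite -lee_fin EFin_Rintegral.
have p0 : pair (fun=> 0) = 0.
  have c0 : corr (fun=> 0) (fun=> 0) = (fun=> 0) :> (V -> R).
    apply/funext => u; rewrite /corr (_ : (fun x => _) = cst 0) ?Rintegral_cst0//.
      by rewrite /Rintegral integral0.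
    by apply/funext => x /=; rewrite mul0r.
  by rewrite /pair c0 /pairing /Rintegral !integral0/= mulr0 subr0.
have L1 : (2 * pi) ^+ d * pair (trunc g n) @[n --> \oo] --> (2 * pi) ^+ d * pair g.
  apply: cvgM; first exact: cvg_cst.
  by apply: (@pair_cvg C (trunc g) g) => [n|x]; [exact: trunc_dominated|exact: trunc_cvg].
have L2 : 2 * \int[beta]_k energy g k + 2 * ((2 * pi) ^+ d * pair (h n)) @[n --> \oo] --> 2 * \int[beta]_k energy g k.
  rewrite -[X in _ --> X]addr0; apply: cvgD; first exact: cvg_cst.
  rewrite -(mulr0 2) -(mulr0 ((2 * pi) ^+ d)) -p0.
  apply: cvgM; first exact: cvg_cst.
  apply: cvgM; first exact: cvg_cst.
  apply: (@pair_cvg (C + C) h (fun=> 0)) => [n|x]; first exact: dh.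
  by rewrite -(subrr (g x)); apply: cvgB; [exact: trunc_cvg|exact: cvg_cst].
have := ler_cvg_to L1 L2; apply; exact: nearW.
Qed.

(** The correlation of [gaussn (2 * s)] with itself is a multiple of [gaussn s], and its energy is a
    multiple of [gaussn s^-1]. The rest compares powers of [pi] and [s]. *)
Lemma pairing_gaussn_le (s : R) : 0 < s ->
  beta.-intR (gaussn s^-1) /\
  gmass d s^-1 * pairing alpha (lam ^+ 2) (gaussn s) <= 2 * \int[beta]_k gaussn s^-1 k.
Proof.
move=> s0; pose g := fun x : V => gaussn (2 * s) (x - 0).
have s2 : 0 < 2 * s by rewrite mulr_gt0.
have [C _ dg] := gaussn_dominated (d := d) 0 s2.
have gE : g = gaussn (2 * s) by apply/funext => x; rewrite /g subr0.
have cE k : fcos g k = gmass d (2 * s) * gaussn (2 * s)^-1 k.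
  rewrite /fcos gE -[RHS](Rintegral_cos_gaussn k s2); apply: eq_Rintegral => x _; exact: mulrC.
have sE k : fsin g k = 0.
  rewrite /fsin gE -[RHS](Rintegral_sin_gaussn k s2); apply: eq_Rintegral => x _; exact: mulrC.
have eE k : energy g k = gmass d (2 * s) ^+ 2 * gaussn s^-1 k.
  rewrite /energy cE sE expr0n addr0 exprMn; congr (_ * _).
  by rewrite /gaussn -expRM_natl; congr expR; field; rewrite gt_eqF.
have pE : pair g = gmass d (4 * s) * pairing alpha (lam ^+ 2) (gaussn s).
  rewrite /pair; have -> : corr g g = (fun u => gmass d (4 * s) * gaussn s u).
    by apply/funext => u; rewrite /g (corr_gaussn 0 0 u s0) subrr addr0.
  have ia := integrable_alpha_rho (so_rho so).
  have [K _ [mK dK]] := gaussn_dominated (d := d) 0 s0.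
  have ga : alpha.-intR (gaussn s).
    apply: (integrable_le (@measurable_gaussn R d s) _ (intgbZ (expR (d%:R / (2 * s))) ia)) => x.
    by rewrite ger0_norm ?gaussn_ge0//; exact: gaussn_le_rho.
  by rewrite /pairing (Rintegral_scale _ ga) (Rintegral_scale _ (@integrable_gaussn R d s s0)); ring.
have m2 : 0 < gmass d (2 * s) by exact: gmass_gt0.
have ie : beta.-intR (energy g).
  apply: integrable_ge0_lty; [exact: measurable_energy dg.1|by move=> k; exact: energy_ge0|].
  apply: (le_lt_trans _ (ltry ((2 * pi) ^+ d * pair g))).
  apply: (@energy_fatou C (trunc g)).
  - move=> n; split; first exact: (trunc_dominated _ dg).1.
      by exists C => x; apply: (le_trans (trunc_le _ _ _)); exact: dominated_bound dg.
    exists [set x : V | `|x| <= n.+1%:R]; first exact: compact_cball.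
    move=> x /negP; rewrite -ltNge => nx; rewrite /trunc indicE memNset ?mulr0//= /cube/= => h1.
    by have := lt_trans h1 nx; rewrite ltxx.
  - by move=> n; exact: trunc_dominated.
  - by move=> x; exact: trunc_cvg.
have ig : beta.-intR (gaussn s^-1).
  have := intgbZ (gmass d (2 * s) ^- 2) ie; congr (_.-integrable _ _).
  by apply/funext => k /=; rewrite eE mulrA mulVf ?mul1r// sqrf_eq0 gt_eqF.
split => //.
have := pair_le_energy dg ie; rewrite (funext eE) (Rintegral_scale _ ig) pE.
move: (pairing _ _ _) (\int[beta]_k _) => p I H.
have q0 : 0 < s * pi by rewrite mulr_gt0 ?pi_gt0.
have sq (x : R) : 0 <= x -> Num.sqrt x ^+ d * Num.sqrt x ^+ d = x ^+ d.
  by move=> x0; rewrite -exprMn -expr2 sqr_sqrtr.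
have e1 : gmass d (2 * s) ^+ 2 = (pi / s) ^+ d.
  rewrite /gmass expr2 sq; first by congr (_ ^+ _); field; rewrite gt_eqF.
  by rewrite divr_ge0 ?mulr_ge0 ?pi_ge0 ?ltW.
have e2 : gmass d s^-1 = (2 * s) ^+ d * gmass d (4 * s).
  rewrite /gmass -exprMn; congr (_ ^+ _).
  rewrite -[2 * s in RHS](ger0_norm (ltW s2)) -sqrtr_sqr -sqrtrM ?sqr_ge0//; congr Num.sqrt.
  by rewrite invrK; field; rewrite gt_eqF.
rewrite e2; rewrite e1 in H.
have k0 : 0 < (pi / s) ^+ d :> R by rewrite exprn_gt0// divr_gt0 ?pi_gt0.
rewrite -(ler_pM2l k0) [leLHS](_ : _ = (2 * pi) ^+ d * (gmass d (4 * s) * p)); last first.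
  by rewrite !mulrA -exprMn; congr (_ ^+ _ * _ * _); field; rewrite gt_eqF.
by apply: (le_trans H); rewrite mulrCA.
Qed.

End spectral_energy.

(** * Gaussian mass from the masses of balls *)

Section layers.
Context {R : realType} {d : nat}.
Local Notation V := 'rV[R]_d.

Lemma exp_ge_pow (x : R) m : 0 <= x -> x ^+ m <= m`!%:R * expR x.
Proof.
case: m => [|m] x0.
  by rewrite expr0 fact0 mul1r -[leLHS]expR0 ler_expR.
have := expR_ge1Dxn m x0 => h; rewrite mulrC -ler_pdivrMr ?ltr0n ?fact_gt0//; lra.
Qed.

Lemma exp_ge_powR (x a : R) m : 0 <= a -> a <= m%:R -> 0 <= x -> x `^ a <= (1 + m`!%:R) * expR x.
Proof.
move=> a0 am x0; have e1 : 1 <= expR x by rewrite -[leLHS]expR0 ler_expR.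
have f0 : 0 <= m`!%:R * expR x by rewrite mulr_ge0 ?expR_ge0.
rewrite mulrDl mul1r; case: (leP x 1) => x1.
  apply: (@le_trans _ _ 1); last by lra.
  have := ge0_ler_powR a0 x0 (ler01 : (1 : R) \in Num.nneg) x1; by rewrite powR1.
have h : x `^ a <= x `^ m%:R by apply: ler_powR => //; exact: ltW.
rewrite powR_mulrn// in h; apply: (le_trans h); apply: (le_trans (exp_ge_pow m x0)).
by rewrite lerDr; lra.
Qed.

Lemma half_geometric N : \sum_(n < N) expR (- n%:R) <= 2 :> R.
Proof.
have e2 : expR (-1) <= 2^-1 :> R.
  by rewrite expRN lef_pV2 ?posrE ?expR_gt0//; have := expR_ge1Dx (1 : R); lra.
suff H : \sum_(n < N) expR (- n%:R) <= 2 - 2 * 2^-1 ^+ N :> R.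
  by apply: (le_trans H); rewrite gerDl oppr_le0 mulr_ge0 ?exprn_ge0 ?invr_ge0.
elim: N => [|N IH]; first by rewrite big_ord0 expr0 mulr1 subrr.
have h : expR (- N%:R) <= 2^-1 ^+ N :> R.
  rewrite (_ : expR (- N%:R) = expR (-1) ^+ N); last by rewrite -expRM_natl mulrN mulr1.
  by apply: lerXn2r => //; rewrite ?nnegrE ?expR_ge0 ?invr_ge0.
rewrite big_ord_recr/= exprS; move: IH h; set S := \sum_(_ < _) _; lra.
Qed.

Lemma enorm_sqr (x : V) : enorm x ^+ 2 = dotv x x.
Proof. by rewrite sqr_sqrtr// dotv_ge0. Qed.

Lemma enorm_ge0 (x : V) : 0 <= enorm x. Proof. exact: sqrtr_ge0. Qed.

Variable beta : {measure set V -> \bar R}.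
Hypotheses (lf : locally_finite beta) (ig : forall s : R, 0 < s -> beta.-intR (gaussn s^-1)).
Let b (r : R) := fine (beta (eball r)).

Let integrable_ball (r : R) : beta.-intR (\1_(@eball R d r) : V -> R).
Proof.
apply: integrable_ge0_lty; first by apply: measurable_indic; exact: measurable_eball.
  by move=> x; rewrite indicE.
by rewrite integral_indic ?setIT ?lf//; exact: measurable_eball.
Qed.

Let int_ball (r : R) : \int[beta]_x \1_(@eball R d r) x = b r.
Proof. by rewrite /Rintegral integral_indic ?setIT//; exact: measurable_eball. Qed.

Lemma ball_le_gaussn (e : R) : 0 < e -> b e <= expR 2^-1 * \int[beta]_k gaussn (e ^+ 2)^-1 k.
Proof.
move=> e0; have e20 : 0 < e ^+ 2 by rewrite exprn_gt0.
rewrite -int_ball -(Rintegral_scale _ (ig e20)); apply: le_Rintegral => //.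
  exact: intgbZ (ig e20).
move=> x _; rewrite indicE; case: (boolP (x \in eball e)) => xe; last by rewrite mulr_ge0 ?expR_ge0.
rewrite inE /eball/= in xe; rewrite /gaussn -expRD -[leLHS]expR0 ler_expR.
have xe2 : dotv x x <= e ^+ 2.
  by rewrite -enorm_sqr; apply: lerXn2r; rewrite ?nnegrE ?enorm_ge0//; exact: ltW.
have : (e ^+ 2)^-1 * dotv x x <= 1 by rewrite mulrC ler_pdivrMr// mul1r.
by lra.
Qed.

(** Inside radius [r0], reached by [N] layers, the layer number [n] has Gaussian values at most
    [exp (- n^2 / 2)]. Outside, [gaussn 1] is split off, and the remaining exponent [e^-2 - 1] is
    evaluated at [r0]. *)
Lemma gaussn_layers (e r0 : R) N (k : V) : 0 < e -> e <= 1 -> 0 < r0 -> r0 <= N%:R * e ->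
  gaussn (e ^+ 2)^-1 k <= \sum_(n < N) expR (- ((n%:R : R) ^+ 2 / 2)) * \1_(@eball R d (n.+1%:R * e)) k +
    expR (- (r0 ^+ 2 / 2 * ((e ^+ 2)^-1 - 1))) * gaussn 1 k.
Proof.
move=> e0 e1 r00 rN; have e20 : 0 < e ^+ 2 by rewrite exprn_gt0.
have s0 : 0 <= \sum_(n < N) expR (- ((n%:R : R) ^+ 2 / 2)) * \1_(@eball R d (n.+1%:R * e)) k.
  by apply: sumr_ge0 => n _; rewrite mulr_ge0 ?expR_ge0// indicE.
have t0 : 0 <= expR (- (r0 ^+ 2 / 2 * ((e ^+ 2)^-1 - 1))) * gaussn 1 k by rewrite mulr_ge0 ?expR_ge0.
case: (leP r0 (enorm k)) => rk.
  rewrite -[leLHS]add0r; apply: lerD => //; rewrite /gaussn -expRD ler_expR.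
  have k2 : r0 ^+ 2 <= dotv k k by rewrite -enorm_sqr; apply: lerXn2r => //; rewrite nnegrE; [exact: ltW|exact: enorm_ge0].
  have a1 : 0 <= (e ^+ 2)^-1 - 1 by rewrite subr_ge0 invf_ge1// expr_le1// ltW.
  have := ler_wpM2r a1 k2; lra.
rewrite -[leLHS]addr0; apply: lerD => //.
have ke0 : 0 <= enorm k / e by rewrite divr_ge0 ?enorm_ge0 ?ltW.
have /andP[n1 n2] := truncn_itv ke0; set n := Num.truncn _ in n1 n2.
have nN : (n < N)%N.
  by rewrite -(ltr_nat R); apply: (le_lt_trans n1); rewrite ltr_pdivrMr//; exact: lt_le_trans rN.
rewrite (bigD1 (Ordinal nN))//= -[leLHS]addr0; apply: lerD; last first.
  by apply: sumr_ge0 => j _; rewrite mulr_ge0 ?expR_ge0// indicE.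
rewrite indicE mem_set ?mulr1; last by rewrite /eball/= -ltr_pdivrMr.
rewrite /gaussn ler_expR lerN2; apply: ler_wpM2r => //.
rewrite -enorm_sqr mulrC -expr_div_n; apply: lerXn2r; rewrite ?nnegrE//.
Qed.

(** The order of the quantifiers matters: [S] depends on [a] alone, so a small constant [c] on balls
    stays small, while [K], which depends on the radius up to which the ball bound holds, comes with
    an extra factor [e]. *)
Lemma gaussian_mass_layers (a : R) : 0 <= a -> exists S : R, 0 <= S /\ forall c r1 : R, 0 <= c -> 0 < r1 ->
  (forall r, 0 < r -> r < r1 -> b r <= c * r `^ a) -> exists K e0 : R, [/\ 0 <= K, 0 < e0 & forall e, 0 < e -> e < e0 ->
  \int[beta]_k gaussn (e ^+ 2)^-1 k <= (S * c + K * e) * e `^ a].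
Proof.
(* [m >= a + 1] gives [e^(2 m) <= e * e^a] for the tail, and [m >= a] serves the polynomial bound on
   the layers. *)
move=> a0; pose m := (Num.truncn (a + 1)).+1.
have am : a + 1 <= m%:R.
  have a1 : 0 <= a + 1 by rewrite addr_ge0.
  by apply/ltW; have /andP[] := truncn_itv a1.
exists ((1 + m`!%:R) * expR 3 * 2); split.
  by rewrite !mulr_ge0 ?expR_ge0 ?addr_ge0.
(* Half the radius leaves room for the last layer: its outer radius is at most [r0 + e], below [r1]
   because [e < r0]. *)
move=> c r1 c0 r10 H; pose r0 := r1 / 2; have r00 : 0 < r0 by rewrite divr_gt0.
pose I1 := \int[beta]_k gaussn 1 k; have I10 : 0 <= I1 by apply: Rintegral_ge0 => k _; exact: gaussn_ge0.
exists (expR (r0 ^+ 2 / 2) * (m`!%:R * (2 / r0 ^+ 2) ^+ m) * I1), (Num.min 1 r0); split.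
- by rewrite !mulr_ge0 ?expR_ge0 ?exprn_ge0 ?divr_ge0 ?sqr_ge0.
- by rewrite lt_min ltr01.
move=> e e0; rewrite lt_min => /andP[e1 er]; have e20 : 0 < e ^+ 2 by rewrite exprn_gt0.
have re : 0 <= r0 / e by rewrite divr_ge0 ?ltW.
have /andP[N1 N2] := truncn_itv re; set N := Num.truncn (r0 / e) in N1 N2.
have rN : r0 <= N.+1%:R * e by rewrite -ler_pdivrMr// ltW.
have ig1 : beta.-intR (gaussn 1) by have := ig ltr01; rewrite invr1.
have ib n := intgbZ (expR (- ((n%:R : R) ^+ 2 / 2))) (integrable_ball (n.+1%:R * e)).
have is_ := integrable_sum_seq (index_enum _) (fun n : 'I_N.+1 => ib n).
have it := intgbZ (expR (- (r0 ^+ 2 / 2 * ((e ^+ 2)^-1 - 1)))) ig1.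
apply: (@le_trans _ _ (\int[beta]_k (\sum_(n < N.+1) expR (- ((n%:R : R) ^+ 2 / 2)) * \1_(@eball R d (n.+1%:R * e)) k +
    expR (- (r0 ^+ 2 / 2 * ((e ^+ 2)^-1 - 1))) * gaussn 1 k))).
  apply: le_Rintegral => //; [exact: ig|exact: integrable_add|].
  by move=> k _; apply: gaussn_layers => //; exact: ltW.
rewrite (RintegralD measurableT is_ it) (Rintegral_sum_seq (index_enum _) (fun n : 'I_N.+1 => ib n)).
rewrite (Rintegral_scale _ ig1) -/I1 mulrDl; apply: lerD.
  apply: (@le_trans _ _ (\sum_(n < N.+1) (1 + m`!%:R) * expR 3 * c * e `^ a * expR (- n%:R))); last first.
    rewrite -mulr_sumr (_ : _ * 2 * c * e `^ a = (1 + m`!%:R) * expR 3 * c * e `^ a * 2); last by ring.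
    by apply: ler_wpM2l; [rewrite !mulr_ge0 ?expR_ge0 ?powR_ge0 ?addr_ge0|exact: half_geometric].
  apply: ler_sum => n _; rewrite (Rintegral_scale _ (integrable_ball _)) int_ball.
  have n0 : 0 < n.+1%:R :> R by rewrite ltr0n.
  have bn : b (n.+1%:R * e) <= c * (n.+1%:R `^ a * e `^ a).
    rewrite -(powRM _ (ltW n0) (ltW e0)); apply: H; first exact: mulr_gt0.
    apply: (@le_lt_trans _ _ (r0 + e)); last by rewrite /r0 in er *; lra.
    rewrite -(natr1 n) mulrDl mul1r lerD2r; have nN : n%:R <= r0 / e.
      by apply: (le_trans _ N1); rewrite ler_nat -ltnS.
    by rewrite ler_pdivlMr in nN.
  have pn : n.+1%:R `^ a <= (1 + m`!%:R) * expR n.+1%:R.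
    by apply: exp_ge_powR => //; lra.
  (* By [(n - 2)^2 >= 0] one has [- n^2 / 2 + n + 1 <= 3 - n], which leaves a geometric series. *)
  have en : expR (- ((n%:R : R) ^+ 2 / 2)) * expR n.+1%:R <= expR 3 * expR (- n%:R) :> R.
    by rewrite -!expRD ler_expR -(natr1 n); move: (n%:R : R) => x; have := sqr_ge0 (x - 2); nra.
  apply: (le_trans (ler_wpM2l (expR_ge0 _) bn)).
  have h : expR (- ((n%:R : R) ^+ 2 / 2)) * n.+1%:R `^ a <= (1 + m`!%:R) * (expR 3 * expR (- n%:R)).
    apply: (le_trans (ler_wpM2l (expR_ge0 _) pn)); rewrite mulrCA.
    by apply: ler_wpM2l; [apply: addr_ge0|exact: en].
  rewrite (_ : _ * (c * _) = c * e `^ a * (expR (- ((n%:R : R) ^+ 2 / 2)) * n.+1%:R `^ a)); last by ring.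
  rewrite (_ : _ * expR (- n%:R) = c * e `^ a * ((1 + m`!%:R) * (expR 3 * expR (- n%:R)))); last by ring.
  by apply: ler_wpM2l => //; rewrite mulr_ge0 ?powR_ge0.
rewrite (_ : expR (r0 ^+ 2 / 2) * _ * I1 * e * e `^ a =
  (expR (r0 ^+ 2 / 2) * (m`!%:R * (2 / r0 ^+ 2) ^+ m) * (e * e `^ a)) * I1); last by ring.
apply: ler_wpM2r => //; pose x := r0 ^+ 2 / (2 * e ^+ 2).
have x0 : 0 < x by rewrite divr_gt0 ?mulr_gt0 ?exprn_gt0.
have -> : expR (- (r0 ^+ 2 / 2 * ((e ^+ 2)^-1 - 1))) = expR (r0 ^+ 2 / 2) * expR (- x).
  by rewrite -expRD; congr expR; rewrite /x; field; rewrite gt_eqF.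
rewrite -mulrA; apply: ler_wpM2l; first exact: expR_ge0.
(* From [x^m <= m! exp x] at [x = r0^2 / (2 e^2)]: the tail is at most a constant times
   [e^(2 m)]. *)
have h1 : expR (- x) <= m`!%:R * (x^-1) ^+ m.
  rewrite exprVn ler_pdivlMr ?exprn_gt0//.
  apply: (le_trans (ler_wpM2l (expR_ge0 _) (exp_ge_pow m (ltW x0)))).
  by rewrite mulrCA -expRD addNr expR0 mulr1.
apply: (le_trans h1); rewrite -mulrA; apply: ler_wpM2l => //.
have -> : x^-1 = 2 / r0 ^+ 2 * e ^+ 2.
  by rewrite /x; field; rewrite !gt_eqF.
rewrite exprMn; apply: ler_wpM2l; first by rewrite exprn_ge0// divr_ge0 ?sqr_ge0.
rewrite -exprM (_ : e * e `^ a = e `^ (1 + a)); last first.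
  by rewrite powRD; [rewrite (powRr1 (ltW e0))|rewrite (gt_eqF e0) implybT].
rewrite -(powR_mulrn _ (ltW e0)); apply: ger_powR; first by rewrite e0 ltW.
by rewrite natrM; have : 0 <= m%:R :> R by []; lra.
Qed.

End layers.

(** * Pairings with the displaced second moment measure *)

Section displaced_pairing.
Context {R : realType} {d : nat} {dO} {Omega : measurableType dO} {P : probability Omega R}.
Local Notation V := 'rV[R]_d.
Variables (theta : V -> Omega -> Omega) (Phi : Omega -> {measure set V -> \bar R}) (Z : Omega -> V -> V).
Hypotheses (flow : preserving_flow P theta)
  (mPhi : forall A, measurable A -> mfunT (Phi ^~ A))
  (lfPhi : forall w, locally_finite (Phi w)) (invPhi : invariant_measure theta Phi)
  (sqPhi : locally_square_integrable P Phi)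
  (GZ : gaussian_field P Z) (Zinv : invariant_field theta Z).

Let Zc w : continuous (Z w). Proof. exact: (field_continuous GZ). Qed.
Let mZ x : mfunT (Z ^~ x). Proof. exact: (field_measurable GZ). Qed.

Lemma field_exp_moment : (\int[P]_w (expR (2 * l1 (Z w 0)))%:E < +oo)%E.
Proof.
have i := integrable_exp_field GZ 0 (ler0n R 2).
by rewrite -(EFin_Rintegral i) ltry.
Qed.

Let alphaPhi := second_moment_sf flow mPhi lfPhi invPhi sqPhi.
Let alphaPsi := displaced_sf flow mPhi lfPhi invPhi sqPhi Zc mZ Zinv field_exp_moment.
Let lam := lamPhi (P := P) Phi.
Let soPhi := second_order_stationary flow mPhi lfPhi invPhi sqPhi.
Let iPhi : alphaPhi.-intR (rho 1).
Proof. exact: (integrable_alpha_rho (so_rho soPhi)). Qed.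

Definition field_frobenius (u : V) : R := frobenius_norm (covariance_mx P (Z ^~ u) (Z ^~ 0)).

Let mZj {dT} {T : measurableType dT} (s : T -> Omega) (x : T -> V) :
  mfunT s -> mfunT x -> mfunT (fun t => Z (s t) (x t)).
Proof. exact: measurable_field. Qed.

Lemma measurable_field_frobenius : mfunT field_frobenius.
Proof.
have mcoord (i : 'I_d) : mfunT (fun p : V * Omega => Z p.2 p.1 0 i).
  by apply: measurable_rVP; apply: mZj; [exact: measurable_snd|exact: measurable_fst].
have mmean (i : 'I_d) : mfunT (fun u : V => \int[P]_w Z w u 0 i).
  exact: (measurable_Rintegral_param P (mcoord i)).
have mC (i j : 'I_d) : mfunT (fun u => covariance_mx P (Z ^~ u) (Z ^~ 0) i j).
  rewrite (_ : (fun u => _) = (fun u => \int[P]_w ((Z w u 0 i - \int[P]_w Z w u 0 i) * (Z w 0 0 j - \int[P]_w Z w 0 0 j)))).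
    apply: (@measurable_Rintegral_param _ _ _ _ _ P (fun p : V * Omega =>
      (Z p.2 p.1 0 i - \int[P]_w Z w p.1 0 i) * (Z p.2 0 0 j - \int[P]_w Z w 0 0 j))).
    apply: measurable_funM; apply: measurable_funB => //.
      by apply: (mcomp (mmean i)); exact: measurable_fst.
    by apply: measurable_rVP; apply: (mcomp (mZ 0)); exact: measurable_snd.
  by apply/funext => u; rewrite mxE covariance.unlock expectation.unlock.
apply: (mcomp (f := @Num.sqrt R)); first exact: (continuous_measurable_fun (@sqrt_continuous R)).
by apply: measurable_sum => i; apply: measurable_sum => j; exact: measurable_funX.
Qed.

Variable s : R.
Hypotheses (s0 : 0 < s) (s1 : s <= 1).

Let mG {dT} {T : measurableType dT} (f : T -> V) : mfunT f -> mfunT (fun t => gaussn s (f t)).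
Proof. by move=> mf; apply: (mcomp (@measurable_gaussn R d s)). Qed.

(** Through a Bartlett measure of [Phi] the two pairings are Gaussian integrals with and without a
    cosine, which is at most 1, and their Lebesgue terms agree. *)
Let shift_le (z : V) : \int[alphaPhi]_u gaussn s (u - z) <= \int[alphaPhi]_u gaussn s u.
Proof.
have [beta [_ bi bE]] := second_order_bartlett soPhi.
have e0 : 0 < s^-1 by rewrite invr_gt0.
have g0 : 0 < gmass d s^-1 by exact: gmass_gt0.
have h : \int[beta]_k (cos (dotv z k) * gaussn s^-1 k) <= \int[beta]_k (cos (dotv 0 k) * gaussn s^-1 k).
  have ic x : beta.-intR (fun k => cos (dotv x k) * gaussn s^-1 k).
    apply: (integrable_le _ _ (bi _ e0)).
      by apply: measurable_funM; [exact: measurable_cos_dotv|exact: measurable_gaussn].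
    by move=> k; rewrite normrM (ger0_norm (gaussn_ge0 _ _)) ler_piMl ?gaussn_ge0 ?normr_cos_le1.
  apply: le_Rintegral => // k _; apply: ler_wpM2r; first exact: gaussn_ge0.
  by rewrite [dotv 0 k]/dotv big1 ?cos0 ?cos_le1// => i _; rewrite mxE mul0r.
rewrite !bE// ler_pM2l// invrK /pairing in h.
have E0 : (fun u : V => gaussn s (u - 0)) = gaussn s by apply/funext => u; rewrite subr0.
have El := (Rintegral_gaussn_shift z s0).2; have El0 := (Rintegral_gaussn_shift (0 : V) s0).2.
by rewrite El El0 E0 lerD2r in h.
Qed.

Let Q := prodm P P.
Let c (p : Omega * Omega) : V := Z p.1 0 - Z p.2 0.

Let mc : mfunT c.
Proof.
by apply: measurable_rVB; apply: (mcomp (mZ 0)); [exact: measurable_fst|exact: measurable_snd].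
Qed.

Let e2 (w : Omega) := expR (2 * l1 (Z w 0)).
Let ie2 : P.-intR e2. Proof. exact: integrable_exp_field. Qed.
Let me2 : mfunT e2.
Proof.
apply: measurable_expR_comp; apply: measurable_funM => //.
exact: (mcomp (@measurable_l1 R d) (mZ 0)).
Qed.

Let dom2 (p : Omega * Omega) := e2 p.1 * e2 p.2.
Let idom2 : Q.-intR dom2.
Proof.
apply: (@Rintegral_prodm _ _ _ _ _ P P dom2 e2 e2 _ _ ie2 ie2).1.
- by apply: measurable_funM; apply: (mcomp me2); [exact: measurable_fst|exact: measurable_snd].
- by move=> w w'; rewrite /dom2 ger0_norm// mulr_ge0 ?expR_ge0.
Qed.

Let K : R := expR (d%:R / (2 * s)).
Let K0 : 0 <= K. Proof. exact: expR_ge0. Qed.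

Let G_le (u z : V) : gaussn s (u + z) <= K * rho 1 u * expR (2 * l1 z).
Proof.
have := gaussn_shift_le u (- z) s0; rewrite opprK l1N => h; apply: (le_trans h); rewrite mulrAC.
apply: ler_wpM2l; first by apply: mulr_ge0; [exact: K0|exact: rho_ge0].
by rewrite ler_expR; have := l1_ge0 z; lra.
Qed.

Let c_le p : expR (2 * l1 (c p)) <= dom2 p.
Proof.
rewrite /dom2 /e2 -expRD ler_expR -mulrDr; apply: ler_wpM2l => //.
by apply: (le_trans (l1D _ _)); rewrite l1N.
Qed.

Let f (q : V * (Omega * Omega)) := gaussn s (q.1 + c q.2).
Let mf : mfunT f.
Proof.
apply: mG; apply: measurable_rVD; first exact: measurable_fst.
by apply: (mcomp mc); exact: measurable_snd.
Qed.

Let f_le u p : `|f (u, p)| <= (K * rho 1 u) * dom2 p.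
Proof.
rewrite ger0_norm ?gaussn_ge0//; apply: (le_trans (G_le _ _)).
by apply: ler_wpM2l; [apply: mulr_ge0; [exact: K0|exact: rho_ge0]|exact: c_le].
Qed.

Let A u := \int[P]_w gaussn s (u + (Z w u - Z w 0)).
Let Bf u := \int[P]_w \int[P]_w' gaussn s (u + (Z w u - Z w' 0)).

(** [Z w u] and [Z w' 0] are sampled independently, so stationarity may replace [Z w u] by [Z w 0]
    on its own; the displacement [c] no longer depends on [u]. *)
Let BfE u : Bf u = \int[Q]_p f (u, p).
Proof.
pose h z := \int[P]_w' gaussn s (u + (z - Z w' 0)).
have mhz : mfunT h.
  apply: (@measurable_Rintegral_param _ _ _ _ _ P (fun p : V * Omega => gaussn s (u + (p.1 - Z p.2 0)))).
  apply: mG; apply: measurable_rVD => //; apply: measurable_rVB; first exact: measurable_fst.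
  by apply: (mcomp (mZ 0)); exact: measurable_snd.
rewrite /Bf (_ : (fun w => _) = (fun w => h (Z w u)))//.
rewrite (Rintegral_stationary flow GZ Zinv u mhz).
have mfu : mfunT (fun p : Omega * Omega => gaussn s (u + c p)).
  by apply: mG; apply: measurable_rVD.
have b w w' : `|gaussn s (u + c (w, w'))| <= (K * rho 1 u * e2 w) * e2 w'.
  by rewrite -mulrA; exact: (f_le u (w, w')).
by rewrite [RHS](Rintegral_prodm mfu b (intgbZ (K * rho 1 u) ie2) ie2).2.
Qed.

Let iBf : alphaPhi.-intR Bf.
Proof.
rewrite (funext BfE); apply: (integrable_le (measurable_Rintegral_param Q mf) _ (intgbZ (K * \int[Q]_p dom2 p) iPhi)) => u.
have H : `|\int[Q]_p f (u, p)| <= \int[Q]_p (K * rho 1 u * dom2 p).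
  apply: normr_Rintegral_le => //; last exact: intgbZ idom2.
  apply: (integrable_le _ (f_le u) (intgbZ (K * rho 1 u) idom2)).
  exact: (mcomp mf (measurable_pair1 u)).
by apply: (le_trans H); rewrite (Rintegral_scale _ idom2) mulrAC.
Qed.

(** Once the integrals are exchanged, [shift_le] applies to each fixed displacement [c p], and [Q]
    averages a constant. *)
Let Bf_le : \int[alphaPhi]_u Bf u <= \int[alphaPhi]_u gaussn s u.
Proof.
rewrite (funext BfE) (Rintegral_swap mf f_le (intgbZ K iPhi) idom2).
pose T := \int[alphaPhi]_u gaussn s u.
have T0 : 0 <= T by apply: Rintegral_ge0 => u _; exact: gaussn_ge0.
have [iT ET] := @Rintegral_prodm _ _ _ _ _ P P (cst T) (cst T) (cst 1) (measurable_cst _)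
  (fun _ _ => ltac:(by rewrite /= mulr1 ger0_norm)) (integrable_prob_cst T) (integrable_prob_cst 1).
have QT : \int[Q]_p cst T p = T.
  by rewrite [LHS]ET/=; transitivity (\int[P]_w T); [apply: eq_Rintegral => w _|]; exact: Rintegral_prob_cst.
rewrite -/T -[leRHS]QT.
have iI : Q.-intR (fun p => \int[alphaPhi]_u f (u, p)).
  have mI : mfunT (fun p => \int[alphaPhi]_u f (u, p)).
    apply: (@measurable_Rintegral_param _ _ _ _ _ alphaPhi (fun q : (Omega * Omega) * V => f (q.2, q.1))).
    apply: (mcomp (f := f) (g := fun q : (Omega * Omega) * V => (q.2, q.1))) => //.
    by apply: measurable_fun_pair; [exact: measurable_snd|exact: measurable_fst].
  apply: (integrable_le mI _ (intgbZ (K * \int[alphaPhi]_u rho 1 u) idom2)) => p.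
  have H : `|\int[alphaPhi]_u f (u, p)| <= \int[alphaPhi]_u (dom2 p * K * rho 1 u).
    have b u : `|f (u, p)| <= dom2 p * K * rho 1 u.
      by rewrite -mulrA mulrC; exact: f_le.
    apply: normr_Rintegral_le => //; last exact: intgbZ iPhi.
    apply: (integrable_le _ b (intgbZ (dom2 p * K) iPhi)).
    exact: (mcomp mf (measurable_pair2 p)).
  by apply: (le_trans H); rewrite (Rintegral_scale _ iPhi); apply: le_of_eq; ring.
apply: le_Rintegral => // p _; rewrite /f/=.
by have := shift_le (- c p); under eq_Rintegral do rewrite opprK.
Qed.

Let iA_E : alphaPhi.-intR A /\ \int[alphaPsi]_v gaussn s v = \int[alphaPhi]_u A u.
Proof.
have mAi : mfunT (fun p : V * Omega => gaussn s (p.1 + (Z p.2 p.1 - Z p.2 0))).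
  apply: mG; apply: measurable_rVD; first exact: measurable_fst.
  apply: measurable_rVB; last by apply: (mcomp (mZ 0)); exact: measurable_snd.
  by apply: mZj; [exact: measurable_snd|exact: measurable_fst].
have mA : mfunT A by exact: (measurable_Rintegral_param P mAi).
have A0 u : 0 <= A u by apply: Rintegral_ge0 => w _; exact: gaussn_ge0.
have AE u : (A u)%:E = (\int[P]_w (gaussn s (u + Z w u - Z w 0))%:E)%E.
  rewrite /A EFin_Rintegral.
    by apply: eq_integral => w _; rewrite addrA.
  apply: (integrable_le _ _ (integrable_prob_cst 1)); first exact: (mcomp mAi (measurable_pair1 u)).
  by move=> w; rewrite ger0_norm ?gaussn_ge0// gaussn_le1// ltW.
have E : (\int[alphaPsi]_v (gaussn s v)%:E = \int[alphaPhi]_u (A u)%:E)%E.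
  transitivity (\int[alphaPhi]_u \int[P]_w (gaussn s (u + Z w u - Z w 0))%:E)%E; last first.
    by apply: eq_integral => u _; rewrite AE.
  apply: (@integral_displaced _ _ _ _ _ _ _ flow mPhi lfPhi invPhi sqPhi _ Zc mZ (fun v => (gaussn s v)%:E)).
  - exact: (measurable_EFin (@measurable_gaussn R d s)).
  - by move=> v; rewrite lee_fin gaussn_ge0.
have iG : alphaPsi.-intR (gaussn s).
  have ir : alphaPsi.-intR (rho 1) by exact: (displaced_integrable_rho flow mPhi lfPhi invPhi sqPhi Zc mZ Zinv field_exp_moment).
  apply: (integrable_le (@measurable_gaussn R d s) _ (intgbZ K ir)) => v.
  by rewrite ger0_norm ?gaussn_ge0//; exact: gaussn_le_rho.
split; last by rewrite /Rintegral E.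
apply: integrable_ge0_lty => //; rewrite -E -(EFin_Rintegral iG); exact: ltry.
Qed.

(** Both pairings carry the same Lebesgue term, so only integrals against second moments are
    compared: [A] stands for the true increments and [Bf] for the independent copies. *)
Lemma pairing_displaced_le :
  alphaPhi.-intR (fun u => rho (2 * Num.sqrt s) u * field_frobenius u) ->
  pairing alphaPsi (lam ^+ 2) (gaussn s) <= pairing alphaPhi (lam ^+ 2) (gaussn s) +
  compare_const (P := P) Z * s * \int[alphaPhi]_u (rho (2 * Num.sqrt s) u * field_frobenius u).
Proof.
move=> ifr; have [iA E] := iA_E; rewrite /pairing E.
rewrite -(Rintegral_scale _ ifr); set CC := compare_const Z * s.
have iC := intgbZ CC ifr.
have h : \int[alphaPhi]_u A u <= \int[alphaPhi]_u (Bf u + CC * (rho (2 * Num.sqrt s) u * field_frobenius u)).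
  apply: le_Rintegral => //; first exact: integrable_add.
  move=> u _; have := gaussian_field_compare flow GZ Zinv u s0 s1.
  rewrite -/(A u) -/(Bf u) -mulrA -/CC -/(field_frobenius u) => hu.
  by have := le_trans (ler_norm _) hu; lra.
rewrite (RintegralD measurableT iBf iC) in h.
rewrite addrAC; apply: lerB => //; apply: (le_trans h); apply: lerD => //; exact: Bf_le.
Qed.

End displaced_pairing.

(** * The weight of the covariance condition *)

Section weight.
Context {R : realType} {d : nat}.
Local Notation V := 'rV[R]_d.
Variable q : R.
Hypotheses (q0 : 0 <= q) (qd : q <= d.+2%:R).

(** [e^q rho (2 e) y] divided by the weight [1 / (1 + |y|^q)] of the hypothesis. It is bounded
    uniformly for [e <= 1], which gives the order [e^p]; for [q > 0] it tends to 0 at each [y],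
    which gives [o(e^p)]. *)
Definition weight (e : R) (y : V) : R := e `^ q * (rho (2 * e) y * (1 + enorm y `^ q)).

Let qpos (y : V) : 0 < 1 + enorm y `^ q. Proof. by rewrite ltr_pwDl// powR_ge0. Qed.

Lemma weight_ge0 e y : 0 <= weight e y.
Proof. by apply: mulr_ge0; [exact: powR_ge0|apply: mulr_ge0; [exact: rho_ge0|exact: ltW]]. Qed.

Lemma weight_le_pow e y : 0 < e -> weight e y <= e `^ q * (1 + enorm y `^ q).
Proof.
move=> e0; apply: ler_wpM2l; first exact: powR_ge0.
apply: ler_piMl; first exact: ltW.
rewrite /rho expR_le1 oppr_le0; apply: mulr_ge0; last exact: l1_ge0.
by rewrite mulr_ge0// ltW.
Qed.

(** With [x = e |y|] the growing part is [x^q], at most [(1 + (d+2)!) exp x] because [q <= d + 2],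
    while [rho (2 e) y] is at most [exp (- x)]. *)
Lemma weight_bounded e y : 0 < e -> e <= 1 -> weight e y <= 2 + (d.+2)`!%:R.
Proof.
move=> e0 e1; rewrite /weight mulrCA mulrDr mulr1 mulrDr.
have r1 : rho (2 * e) y <= 1.
  by rewrite /rho expR_le1 oppr_le0; apply: mulr_ge0; [rewrite mulr_ge0// ltW|exact: l1_ge0].
have eq1 : e `^ q <= 1.
  by rewrite -[leRHS](powRr0 e); apply: ger_powR; rewrite // e0.
rewrite (_ : 2 + _ = 1 + (1 + (d.+2)`!%:R)); last by ring.
apply: lerD; first by apply: mulr_ile1 => //; [exact: rho_ge0|exact: powR_ge0].
rewrite -(powRM _ (ltW e0) (enorm_ge0 y)) mulrC; set x := e * enorm y.
have x0 : 0 <= x by rewrite mulr_ge0 ?enorm_ge0 ?ltW.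
apply: (@le_trans _ _ ((1 + (d.+2)`!%:R) * expR x * expR (- x))).
  apply: ler_pM; [exact: powR_ge0|exact: rho_ge0|exact: exp_ge_powR|].
  rewrite /rho ler_expR lerN2 /x -mulrA; have h := enorm_le_l1 y; have l := l1_ge0 y.
  by have := ler_wpM2l (ltW e0) h; have := mulr_ge0 (ltW e0) l; lra.
by rewrite -mulrA -expRD subrr expR0 mulr1.
Qed.

Lemma measurable_enorm_powR : mfunT (fun y : V => 1 + enorm y `^ q).
Proof.
apply: measurable_funD => //.
by apply: (mcomp (f := fun x : R => x `^ q)); [exact: measurable_powR|exact: measurable_enorm].
Qed.

Lemma measurable_weight e : mfunT (weight e).
Proof.
apply: measurable_funM => //; apply: measurable_funM; first exact: measurable_rho.
exact: measurable_enorm_powR.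
Qed.

Variables (alpha : {sigma_finite_measure set V -> \bar R}) (h : V -> R).
Hypotheses (h0 : forall y, 0 <= h y) (mh : mfunT h).
Hypothesis ih : alpha.-intR (fun y => h y / (1 + enorm y `^ q)).

Definition weighted (e : R) : R := \int[alpha]_y (weight e y * (h y / (1 + enorm y `^ q))).

Let hw0 y : 0 <= h y / (1 + enorm y `^ q). Proof. by apply: divr_ge0 => //; exact: ltW. Qed.

Let mw e : mfunT (fun y => weight e y * (h y / (1 + enorm y `^ q))).
Proof.
apply: measurable_funM; first exact: measurable_weight.
by apply/measurable_EFinP; case/integrableP: ih.
Qed.

Let weighted_dom e y : 0 < e -> e <= 1 ->
  `|weight e y * (h y / (1 + enorm y `^ q))| <= (2 + (d.+2)`!%:R) * (h y / (1 + enorm y `^ q)).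
Proof.
move=> e0 e1; have w0 := weight_ge0 e y.
by rewrite ger0_norm; [apply: ler_wpM2r => //; exact: weight_bounded|exact: mulr_ge0].
Qed.

Lemma weighted_le e : 0 < e -> e <= 1 ->
  weighted e <= (2 + (d.+2)`!%:R) * \int[alpha]_y (h y / (1 + enorm y `^ q)).
Proof.
move=> e0 e1; rewrite -(Rintegral_scale _ ih); apply: (le_trans (ler_norm _)); apply: normr_Rintegral_le.
- exact: (integrable_le (mw e) (fun y => weighted_dom y e0 e1) (intgbZ _ ih)).
- exact: intgbZ.
- by move=> y; exact: weighted_dom.
Qed.

Lemma weightedE e : 0 < e -> e <= 1 ->
  alpha.-intR (fun y => rho (2 * Num.sqrt (e ^+ 2)) y * h y) /\
  e `^ q * \int[alpha]_y (rho (2 * Num.sqrt (e ^+ 2)) y * h y) = weighted e.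
Proof.
move=> e0 e1; have eq0 : e `^ q != 0 by rewrite gt_eqF// powR_gt0.
have E y : weight e y * (h y / (1 + enorm y `^ q)) = e `^ q * (rho (2 * Num.sqrt (e ^+ 2)) y * h y).
  rewrite sqrtr_sqr (gtr0_norm e0) /weight; field; by rewrite gt_eqF.
have iw : alpha.-intR (fun y => weight e y * (h y / (1 + enorm y `^ q))).
  exact: (integrable_le (mw e) (fun y => weighted_dom y e0 e1) (intgbZ _ ih)).
have ir : alpha.-intR (fun y => rho (2 * Num.sqrt (e ^+ 2)) y * h y).
  have := intgbZ (e `^ q)^-1 iw; congr (_.-integrable _ _).
  by apply/funext => y /=; rewrite E mulrA mulVf// mul1r.
split => //; rewrite -(Rintegral_scale _ ir); apply: eq_Rintegral => y _; exact/esym/E.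
Qed.

Lemma weighted_cvg0 : 0 < q -> weighted e @[e --> 0^'+] --> (0 : R).
Proof.
move=> q1; apply/cvg_at_rightP => u [u0 cu].
(* The uniform bound needs [e <= 1]; cutting the sequence at 1 changes finitely many terms only. *)
pose v n := Num.min (u n) 1.
have v0 n : 0 < v n by rewrite lt_min u0 ltr01.
have v1 n : v n <= 1 by rewrite ge_min lexx orbT.
have H : weighted (v n) @[n --> \oo] --> \int[alpha]_y 0.
  apply: (@Rintegral_dct _ _ _ alpha _ _ (fun y => (2 + (d.+2)`!%:R) * (h y / (1 + enorm y `^ q)))).
  - by move=> n; exact: mw.
  - move=> y; rewrite -(mul0r (h y / (1 + enorm y `^ q))); apply: cvgM; last exact: cvg_cst.
    have cq : v n `^ q @[n --> \oo] --> (0 : R).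
      have vu n : v n `^ q <= u n `^ q.
        by apply: ge0_ler_powR => //; rewrite ?nnegrE; [exact: ltW|exact: ltW|rewrite /v ge_min lexx].
      apply: (squeeze_cvgr (f := fun=> 0) (h := fun n => u n `^ q)); last 2 first.
      - exact: cvg_cst.
      - have := @powR_cvg0 R q q1 => /cvg_at_rightP; apply; split => //.
      by apply: nearW => n; rewrite powR_ge0 vu.
    apply: (squeeze_cvgr (f := fun=> 0) (h := fun n => v n `^ q * (1 + enorm y `^ q))); last 2 first.
    - exact: cvg_cst.
    - by rewrite -(mul0r (1 + enorm y `^ q)); apply: cvgM => //; exact: cvg_cst.
    by apply: nearW => n; rewrite weight_ge0 weight_le_pow.
  - by move=> n y; exact: weighted_dom.
  - exact: intgbZ.
have Z0 : \int[alpha]_y 0 = 0 :> R by rewrite /Rintegral integral0.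
rewrite Z0 in H; apply: cvg_trans H; apply: near_eq_cvg.
have /cvgrPdist_lt/(_ _ ltr01) := cu; apply: filterS => n; rewrite sub0r normrN gtr0_norm// => un.
by rewrite /v min_l// ltW.
Qed.

End weight.

(** * Uniformity of the perturbed measure *)

Theorem proposition5p29 (R : realType) (d : nat) (dO : measure_display)
  (Omega : measurableType dO) (P : probability Omega R)
  (theta : 'rV[R]_d -> Omega -> Omega)
  (theta_flow : preserving_flow P theta)
  (p : R) (p_ge : - d%:R <= p) (p_le : p <= 2)
  (Z : Omega -> 'rV[R]_d -> 'rV[R]_d)
  (Z_gaussian : gaussian_field P Z)
  (Z_invariant : invariant_field theta Z)
  (Phi : R.-ker Omega ~> 'rV[R]_d)
  (Phi_locally_finite : forall w, locally_finite (Phi w))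
  (Phi_invariant : invariant_measure theta Phi)
  (Phi_square_integrable : locally_square_integrable P Phi)
  (ZPhi_independent : field_measure_independent P Z Phi)
  (Psi : Omega -> {measure set 'rV[R]_d -> \bar R})
  (PsiE : forall w (B : set 'rV[R]_d), measurable B ->
    Psi w B = (\int[Phi w]_x (\1_B (x + Z w x))%:E)%E)
  (cov_integral : (\int[reduced_second_moment P Phi]_y
    (frobenius_norm (covariance_mx P (Z ^~ y) (Z ^~ 0)) /
     (1 + enorm y `^ (2 - p)))%:E < +oo)%E) :
  (p_uniform P p Phi -> p_uniform P p Psi) /\
  (p < 2 -> beyond_p_uniform P p Phi -> beyond_p_uniform P p Psi).
Proof.
have mPhi A : measurable A -> mfunT (fun w => Phi w A) by exact: measurable_kernel.
have soPhi := second_order_stationary theta_flow mPhi Phi_locally_finite Phi_invariant Phi_square_integrable.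
set alpha := second_moment_sf _ _ _ _ _ in soPhi.
set lam := lamPhi _ in soPhi.
have soPsi := second_order_displaced theta_flow mPhi Phi_locally_finite Phi_invariant Phi_square_integrable
  (field_continuous Z_gaussian) (field_measurable Z_gaussian) Z_invariant ZPhi_independent PsiE
  (field_exp_moment Z_gaussian).
have [betaPsi [BPsi gPsi EPsi]] := second_order_bartlett soPsi.
pose q := 2 - p; have q0 : 0 <= q by rewrite subr_ge0.
(* This is [p >= - d]; it bounds the power [q] by the integer whose factorial appears in
   [weight_bounded]. *)
have qd : q <= d.+2%:R by rewrite /q -[d.+2%:R]natr1 -natr1; lra.
pose h := field_frobenius (P := P) Z.
have h0 y : 0 <= h y by exact: sqrtr_ge0.
have mh : mfunT h by exact: (measurable_field_frobenius Z_gaussian).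
have ih : alpha.-intR (fun y => h y / (1 + enorm y `^ q)).
  apply: integrable_ge0_lty.
  - apply: measurable_funM => //.
    rewrite (_ : (fun y => _) = (fun y => (1 + enorm y `^ q) `^ (-1))).
      by apply: (mcomp (f := fun x : R => x `^ (-1))); [exact: measurable_powR|exact: measurable_enorm_powR].
    by apply/funext => y; rewrite powR_inv1// addr_ge0 ?powR_ge0.
  - by move=> y; apply: divr_ge0 => //; rewrite addr_ge0 ?powR_ge0.
  have aE A : measurable A -> alpha A = reduced_second_moment P Phi A.
    exact: (second_moment_measureE mPhi Phi_locally_finite).
  by rewrite (eq_setfun_integral _ aE); exact: cov_integral.
pose cc := compare_const (P := P) Z.
have cc0 : 0 <= cc.
  rewrite /cc /compare_const; apply: mulr_ge0; last by rewrite mulr_ge0.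
  by apply: mulr_ge0; [rewrite mulr_ge0 ?expR_ge0|rewrite -expr2 sqr_ge0].
(* Exponent of the ball mass itself, before division by [e^d]; it is nonnegative because
   [p >= - d]. *)
pose a := d%:R + p; have a0 : 0 <= a by rewrite /a; lra.
pose D : R := Num.sqrt (2 * pi) ^+ d; have D0 : 0 <= D by rewrite exprn_ge0 ?sqrtr_ge0.
pose E2 : R := expR 2^-1; have E20 : 0 <= E2 by exact: expR_ge0.
pose W := weighted q alpha h.
have ed e : 0 < e -> e ^- d * e `^ a = e `^ p.
  move=> e0; rewrite /a powRD; last by rewrite (gt_eqF e0) implybT.
  by rewrite powR_mulrn ?ltW// mulKf// expf_neq0// gt_eqF.
(* Stated for every Bartlett measure [beta] of [Phi], since the hypothesis supplies an unknown one.
   The two terms are the Gaussian mass of [beta] and the cost of passing to independent copies, both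
   at [s = e^2]. *)
have main beta (e : R) : bartlett_spectral_measure P Phi beta -> 0 < e -> e <= 1 ->
    e ^- d * fine (betaPsi (eball e)) <=
    E2 * (2 * (e ^- d * \int[beta]_k gaussn (e ^+ 2)^-1 k) + D * cc * e `^ p * W e).
  move=> Bb e0 e1; have s0 : 0 < e ^+ 2 by rewrite exprn_gt0.
  have s1 : e ^+ 2 <= 1 by rewrite expr_le1// ltW.
  have si : 0 < (e ^+ 2)^-1 by rewrite invr_gt0.
  have [ir wE] := weightedE q0 qd h0 ih e0 e1.
  have [_ hPhi] := pairing_gaussn_le soPhi Bb s0.
  have hPsi := @pairing_displaced_le R d dO Omega P theta Phi Z theta_flow mPhi Phi_locally_finite
    Phi_invariant Phi_square_integrable Z_gaussian Z_invariant _ s0 s1 ir.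
  have gm : gmass d (e ^+ 2)^-1 = D * e ^+ d.
    by rewrite /gmass invrK sqrtrM ?mulr_ge0 ?pi_ge0// sqrtr_sqr (gtr0_norm e0) exprMn.
  have gm0 : 0 <= gmass d (e ^+ 2)^-1 by exact: gmass_ge0.
  have F1 : fine (betaPsi (eball e)) <= E2 * \int[betaPsi]_k gaussn (e ^+ 2)^-1 k.
    apply: ball_le_gaussn => //; first exact: (bartlett_locally_finite BPsi).
    by move=> s s00; apply: gPsi; rewrite invr_gt0.
  have F2 : \int[betaPsi]_k gaussn (e ^+ 2)^-1 k <= 2 * \int[beta]_k gaussn (e ^+ 2)^-1 k +
      D * e ^+ d * cc * e `^ p * W e.
    have := EPsi _ 0 si.
    have -> : \int[betaPsi]_k (cos (dotv 0 k) * gaussn (e ^+ 2)^-1 k) = \int[betaPsi]_k gaussn (e ^+ 2)^-1 k.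
      by apply: eq_Rintegral => k _; rewrite /dotv big1 ?cos0 ?mul1r// => i _; rewrite mxE mul0r.
    have -> : (fun u : 'rV[R]_d => gaussn (e ^+ 2)^-1^-1 (u - 0)) = gaussn (e ^+ 2).
      by apply/funext => u; rewrite subr0 invrK.
    move=> ->; apply: (le_trans (ler_wpM2l gm0 hPsi)); rewrite mulrDr; apply: lerD; first exact: hPhi.
    (* The factor [s = e^2] of the comparison is shared: [e^p] is the order to be proved, [e^q]
       completes the weight. *)
    have e2 : e ^+ 2 = e `^ p * e `^ q.
      rewrite -powRD; last by rewrite (gt_eqF e0) implybT.
      by rewrite /q addrC subrK powR_mulrn// ltW.
    rewrite gm -/alpha -/h -/cc [X in _ * (_ * X * _)]e2 /W -wE.
    move: (\int[alpha]_u _) => I; apply: le_of_eq; ring.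
  have ed0 : 0 < e ^- d by rewrite invr_gt0 exprn_gt0.
  apply: (le_trans (ler_wpM2l (ltW ed0) F1)); rewrite mulrCA; apply: ler_wpM2l => //.
  apply: (le_trans (ler_wpM2l (ltW ed0) F2)); apply: le_of_eq.
  have ep : e ^+ d != 0 by rewrite expf_neq0// gt_eqF.
  move: (e ^+ d) ep (\int[beta]_k _) (W e) (e `^ p) => E ep I w x; field; exact: ep.
(* [S] is given beforehand, so that in the case of [o] the constant [c] can be chosen after it. *)
have layers beta (c r1 : R) (S : R) : bartlett_spectral_measure P Phi beta -> 0 <= c -> 0 < r1 ->
    (forall r, 0 < r -> r < r1 -> `|r ^- d * fine (beta (eball r))| <= c * `|r `^ p|) ->
    (forall c r1 : R, 0 <= c -> 0 < r1 ->
      (forall r, 0 < r -> r < r1 -> fine (beta (eball r)) <= c * r `^ a) ->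
      exists K e0 : R, [/\ 0 <= K, 0 < e0 & forall e, 0 < e -> e < e0 ->
      \int[beta]_k gaussn (e ^+ 2)^-1 k <= (S * c + K * e) * e `^ a]) ->
    exists K e0 : R, [/\ 0 <= K, 0 < e0 & forall e, 0 < e -> e < e0 ->
      `|e ^- d * fine (betaPsi (eball e))| <= E2 * (2 * (S * c + K * e) + D * cc * W e) * `|e `^ p|].
  move=> Bb c0 r10 H L.
  have [|K [e0 [K0 e00 He]]] := L c r1 c0 r10.
    move=> r r0 rr; have rd : 0 < r ^+ d by rewrite exprn_gt0.
    have := le_trans (ler_norm _) (H r r0 rr).
    rewrite (ger0_norm (powR_ge0 _ _)) -(ed r r0) mulrCA ler_pM2l// invr_gt0//.
  exists K, (Num.min e0 1); split => //; first by rewrite lt_min e00 ltr01.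
  move=> e e_gt0; rewrite lt_min => /andP[ee0 e1].
  have b0 : 0 <= e ^- d * fine (betaPsi (eball e)).
    by apply: mulr_ge0; [rewrite invr_ge0 exprn_ge0// ltW|exact: fine_ge0].
  rewrite (ger0_norm b0) (ger0_norm (powR_ge0 _ _)).
  apply: (le_trans (main beta e Bb e_gt0 (ltW e1))); rewrite -[leRHS]mulrA; apply: ler_wpM2l => //.
  rewrite [leRHS]mulrDl; apply: lerD; last by apply: le_of_eq; ring.
  rewrite -[leRHS]mulrA; apply: ler_wpM2l => //; rewrite -(ed e e_gt0) [leRHS]mulrCA; apply: ler_wpM2l.
    by rewrite invr_ge0 exprn_ge0// ltW.
  exact: He.
have small (Q : R -> Prop) : (\forall r \near (0 : R)^'+, Q r) <-> exists2 r1, 0 < r1 & forall r, 0 < r -> r < r1 -> Q r.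
  split=> [[r1 /= r10 H]|[r1 r10 H]].
    by exists r1 => // r r0 rr; apply: H => //=; rewrite sub0r normrN gtr0_norm.
  exists r1 => //= r /=; rewrite sub0r normrN => rr r0; apply: H => //.
  by rewrite gtr0_norm in rr.
have lS beta : bartlett_spectral_measure P Phi beta -> exists S : R, 0 <= S /\ forall c r1 : R, 0 <= c -> 0 < r1 ->
      (forall r, 0 < r -> r < r1 -> fine (beta (eball r)) <= c * r `^ a) ->
      exists K e0 : R, [/\ 0 <= K, 0 < e0 & forall e, 0 < e -> e < e0 ->
      \int[beta]_k gaussn (e ^+ 2)^-1 k <= (S * c + K * e) * e `^ a].
  move=> Bb; apply: gaussian_mass_layers => //; first exact: (bartlett_locally_finite Bb).
  by move=> s s0; have [] := pairing_gaussn_le soPhi Bb s0.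
split.
- move=> [beta Bb /eqO_exP[k k0 /small[r1 r10 H]]]; exists betaPsi => //.
  have [S [S0 HS]] := lS beta Bb.
  have [K [e0 [K0 e00 He]]] := layers beta k r1 S Bb (ltW k0) r10 H HS.
  pose IW := (2 + (d.+2)`!%:R) * \int[alpha]_y (h y / (1 + enorm y `^ q)).
  (* For [e <= 1] the term [K * e] is at most [K] and the weighted integral at most [IW]; the
     constant used is [|T| + 1] because it must be positive. *)
  pose T := E2 * (2 * (S * k + K) + D * cc * IW).
  apply/eqO_exP; exists (`|T| + 1); first by rewrite ltr_wpDl.
  apply/small; exists (Num.min e0 1); first by rewrite lt_min e00 ltr01.
  move=> e e_gt0; rewrite lt_min => /andP[ee0 e1].
  apply: (le_trans (He e e_gt0 ee0)); apply: ler_wpM2r => //.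
  apply: (@le_trans _ _ T); last by rewrite (le_trans (ler_norm _))// lerDl.
  apply: ler_wpM2l => //; apply: lerD.
    apply: ler_wpM2l => //; rewrite lerD2l; rewrite ler_piMr// ltW//.
  apply: ler_wpM2l; first exact: mulr_ge0.
  exact: (weighted_le q0 qd h0 ih e_gt0 (ltW e1)).
- move=> p2 [beta Bb /eqoP Ho]; exists betaPsi => //; apply/eqoP => eps eps0.
  have [S [S0 HS]] := lS beta Bb.
  have q1 : 0 < q by rewrite subr_gt0.
  (* Chosen so that [2 * E2 * S * c <= eps / 3]; the summand 1 keeps the denominator positive when
     [S = 0]. The choice of [e3] below follows the same pattern with [K]. *)
  pose c := eps / (3 * (2 * E2 * S + 1)).
  have den : 0 < 3 * (2 * E2 * S + 1) by rewrite mulr_gt0// ltr_wpDl// !mulr_ge0.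
  have c0 : 0 < c by rewrite divr_gt0.
  have /small[r1 r10 H] := Ho c c0.
  have [K [e0 [K0 e00 He]]] := layers beta c r1 S Bb (ltW c0) r10 H HS.
  (* Here [p < 2] enters: for [q > 0] the weighted covariance integral tends to 0. *)
  have cw : E2 * (D * cc) * W e @[e --> 0^'+] --> (0 : R).
    rewrite [X in _ --> X](_ : 0 = E2 * (D * cc) * 0); last by rewrite mulr0.
    by apply: cvgM; [exact: cvg_cst|exact: (weighted_cvg0 q0 qd h0 ih q1)].
  have eps3 : 0 < eps / 3 by rewrite divr_gt0.
  have /cvgrPdist_lt/(_ _ eps3)/small[e2 e20 H2] := cw.
  pose e3 := eps / (3 * (2 * E2 * K + 1)).
  have den3 : 0 < 3 * (2 * E2 * K + 1) by rewrite mulr_gt0// ltr_wpDl// !mulr_ge0.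
  have e30 : 0 < e3 by rewrite divr_gt0.
  apply/small; exists (Num.min e0 (Num.min e2 e3)); first by rewrite !lt_min e00 e20.
  move=> e e_gt0; rewrite !lt_min => /and3P[ee0 ee2 ee3].
  apply: (le_trans (He e e_gt0 ee0)); apply: ler_wpM2r => //.
  have t1 : 2 * E2 * S * c <= eps / 3.
    rewrite /c mulrA ler_pdivrMr// mulrC [leRHS](_ : _ = eps * (2 * E2 * S + 1)); last by field.
    by apply: ler_wpM2l; [exact: ltW|rewrite lerDl].
  have t2 : 2 * E2 * K * e <= eps / 3.
    apply: (@le_trans _ _ (2 * E2 * K * e3)); first by apply: ler_wpM2l; [rewrite !mulr_ge0|exact: ltW].
    rewrite /e3 mulrA ler_pdivrMr// mulrC [leRHS](_ : _ = eps * (2 * E2 * K + 1)); last by field.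
    by apply: ler_wpM2l; [exact: ltW|rewrite lerDl].
  have t3 : E2 * (D * cc) * W e <= eps / 3.
    by have := H2 e e_gt0 ee2; rewrite sub0r normrN => /ltW; exact: le_trans (ler_norm _).
  rewrite (_ : E2 * _ = 2 * E2 * S * c + 2 * E2 * K * e + E2 * (D * cc) * W e); last by ring.
  by move: t1 t2 t3; lra.
Qed.
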